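(* Let $\Omega\subset\mathbf{R}^N$ be open, let $E,F$ be finite-dimensional real vector spaces, and let $\mathcal{A}u=\sum_{|\alpha|=1}A_\alpha\partial^\alpha u$, with $A_\alpha\in\mathrm{Hom}(E,F)$, be a first-order homogeneous linear constant-coefficient partial differential operator with principal symbol $\mathbb{A}^1(\xi)=\sum_{|\alpha|=1}A_\alpha\xi^\alpha$. Let $f:\Omega\to\mathbf{F}_{\mathcal{A}}$ be integrable, where $\mathbf{F}_{\mathcal{A}}$ is the essential range of $\mathcal{A}$. Then there exists a map $u\in SBV(\Omega;E)$ satisfying $$\mathcal{A}u \;=\; f\,\mathscr{L}_N\;+\;\mathbb{A}^1(\nu_u)[u]\,\mathscr{H}_{N-1}\llcorner J_u$$ and $$\int_\Omega(|u|+|\nabla u|)\,dx+\int_{J_u}|[u]|\,d\mathscr{H}_{N-1}\le C\int_\Omega|f|\,dx$$ for some constant $C$ that only depends on $\mathcal{A}$.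
   Context: $\mathscr{L}_N$ is $N$-dimensional Lebesgue measure and $\mathscr{H}_{N-1}$ is $(N-1)$-dimensional Hausdorff measure on $\mathbf{R}^N$; for a measure $\mu$ and a set $J$, $\mu\llcorner J$ denotes the restriction of $\mu$ to $J$. Derivatives are distributional. The finite-dimensional spaces carry fixed norms. Essential range: $\mathbf{F}_{\mathcal{A}}$ is the closure in $F$ of $\{\mathcal{A}u(x): x\in\Omega,\ u\in C_c^\infty(\mathbf{R}^N;E)\}$; it is a linear subspace and coincides with $\mathrm{span}\{\mathbb{A}^1(\xi)[e]:\xi\in\mathbf{R}^N,\ e\in E\}$. $BV(\Omega;E)$ is the space of integrable $u:\Omega\to E$ whose distributional gradient $Du$ is a finite $E\otimes\mathbf{R}^N$-valued Radon measure; $\nabla u\in L^1(\Omega;E\otimes\mathbf{R}^N)$ is the density of the absolutely continuous part of $Du$ with respect to $\mathscr{L}_N$. $J_u\subset\Omega$ is the jump set of $u$ (countably $\mathscr{H}_{N-1}$-rectifiable), with orienting unit normal $\nu_u$; $u^\pm$ are the one-sided Lebesgue limits of $u$ on $J_u$ with respect to $\nu_u$ and $[u]=u^+-u^-$. $SBV(\Omega;E)$ is the set of $u\in BV(\Omega;E)$ with $Du=\nabla u\,\mathscr{L}_N+[u]\otimes\nu_u\,\mathscr{H}_{N-1}\llcorner J_u$. *)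

(* Defs.v *)
From HB Require Import structures.
From mathcomp Require Import all_boot all_order all_algebra.
From mathcomp Require Import all_classical all_reals all_analysis.

Set Implicit Arguments.
Unset Strict Implicit.
Unset Printing Implicit Defensive.
Import Order.TTheory GRing.Theory Num.Theory.
Import numFieldNormedType.Exports.
Local Open Scope classical_set_scope.
Local Open Scope ring_scope.

#[short(type="normedVectType")]
HB.structure Definition NormedVector (R : numFieldType) :=
  {V of NormedModule R V & Vector R V}.


HB.instance Definition _ (R : realType) (m n : nat) :=
  NormedModule.on 'M[R]_(m, n).

Definition is_norm (R : realType) (V : lmodType R) (p : V -> R) : Prop :=
  [/\ forall v, p v = 0 -> v = 0,
      forall (a : R) v, p (a *: v) = `|a| * p v &
      forall v w, p (v + w) <= p v + p w].

Section cover_outer_measure.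
Local Open Scope ereal_scope.
Variables (R : realType) (T : pointedType).
Implicit Types (w : set T -> \bar R) (X : set T).

(* Caratheodory's construction from an arbitrary weight w on sets; weight +oo
   excludes a set from the covers. *)
Definition cover_outer w X : \bar R :=
  ereal_inf [set \sum_(k <oo) w (C k) |
             C in [set C : (set T)^nat | X `<=` \bigcup_k C k]].

(* All sets are measurable, so that mu_ext covers by arbitrary sets. *)
Definition discrete_copy : Type := T.
HB.instance Definition _ := Pointed.on discrete_copy.
HB.instance Definition _ := @isMeasurable.Build default_measure_display
  discrete_copy (@discrete_measurable T)
  (@discrete_measurable0 T) (@discrete_measurableC T) (@discrete_measurableU T).

Lemma cover_outer_mu_ext w :
  cover_outer w = mu_ext (w : set discrete_copy -> \bar R).
Proof.
apply/funext => X; rewrite /cover_outer /mu_ext; congr ereal_inf.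
by apply/seteqP; split => _ [C XC <-]; exists C => //; case: XC.
Qed.

Section facts.
Variable w : set T -> \bar R.
Hypotheses (w0 : w set0 = 0) (w_ge0 : forall X, 0 <= w X).

Lemma cover_outer0 : cover_outer w set0 = 0.
Proof. by rewrite cover_outer_mu_ext mu_ext0. Qed.

Lemma cover_outer_ge0 X : 0 <= cover_outer w X.
Proof. by rewrite cover_outer_mu_ext mu_ext_ge0. Qed.

Lemma le_cover_outer : {homo cover_outer w : A B / A `<=` B >-> A <= B}.
Proof. by move=> A B AB; rewrite cover_outer_mu_ext; exact: le_mu_ext. Qed.

Lemma cover_outer_sigma_subadditive : sigma_subadditive (cover_outer w).
Proof.
rewrite cover_outer_mu_ext.
exact: (@mu_ext_sigma_subadditive _ discrete_copy _ w w_ge0).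
Qed.
End facts.

End cover_outer_measure.

Section lebesgue_hausdorff.
Variable R : realType.

Definition box n (a b : 'rV[R]_n) : set 'rV[R]_n :=
  [set x | forall i, a 0 i <= x 0 i <= b 0 i].

(* The volume of A if A is a (possibly degenerate) closed box, 0 if A is empty
   and +oo otherwise. *)
Definition box_gauge n (A : set 'rV[R]_n) : \bar R :=
  if `[< A = set0 >] then 0%E else
  ereal_inf [set (\prod_i (ab.2 0 i - ab.1 0 i))%:E |
    ab in [set ab : 'rV[R]_n * 'rV[R]_n |
           (forall i, ab.1 0 i <= ab.2 0 i) /\ A = box ab.1 ab.2]].

Lemma box_gauge0 n : box_gauge (set0 : set 'rV[R]_n) = 0%E.
Proof. by rewrite /box_gauge; case: asboolP. Qed.

Lemma box_gauge_ge0 n (A : set 'rV[R]_n) : (0 <= box_gauge A)%E.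
Proof.
rewrite /box_gauge; case: asboolP => // _.
apply: le_ereal_inf_tmp => _ /= [[a b] /= [ab _] <-].
by rewrite lee_fin; apply: prodr_ge0 => i _; rewrite subr_ge0.
Qed.

Definition lebesgue_outer n : set 'rV[R]_n -> \bar R :=
  cover_outer (@box_gauge n).

HB.instance Definition _ n := isOuterMeasure.Build R 'rV[R]_n
  (@lebesgue_outer n)
  (cover_outer0 (@box_gauge0 n) (@box_gauge_ge0 n))
  (cover_outer_ge0 (@box_gauge_ge0 n))
  (@le_cover_outer _ _ (@box_gauge n))
  (cover_outer_sigma_subadditive (@box_gauge_ge0 n)).

Definition dot n (x y : 'rV[R]_n) : R := \sum_i x 0 i * y 0 i.

(* The canonical norm of 'rV[R]_n is the sup norm. *)
Definition enorm n (x : 'rV[R]_n) : R := Num.sqrt (dot x x).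

Definition ediam n (A : set 'rV[R]_n) : \bar R :=
  ereal_sup [set (enorm (x - y))%:E | x in A & y in A].

(* With this normalization, hausdorff_outer s on R^s is Lebesgue outer
   measure. *)
Definition unit_ball_volume s : R :=
  fine (@lebesgue_outer s [set x | enorm x < 1]).

Definition hausdorff_gauge n (s : nat) (delta : R) (A : set 'rV[R]_n) : \bar R :=
  if `[< A = set0 >] then 0%E else
  if (ediam A <= delta%:E)%E
  then (unit_ball_volume s * (fine (ediam A) / 2) ^+ s)%:E else +oo%E.

Lemma hausdorff_gauge0 n s delta :
  hausdorff_gauge s delta (set0 : set 'rV[R]_n) = 0%E.
Proof. by rewrite /hausdorff_gauge; case: asboolP. Qed.

Lemma hausdorff_gauge_ge0 n s delta (A : set 'rV[R]_n) :
  (0 <= hausdorff_gauge s delta A)%E.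
Proof.
rewrite /hausdorff_gauge; case: asboolP => // /eqP/set0P[x Ax].
case: ifPn => // _; rewrite lee_fin mulr_ge0//.
  exact/fine_ge0/outer_measure_ge0.
rewrite exprn_ge0// divr_ge0// fine_ge0//.
apply: (@le_trans _ _ (enorm (x - x))%:E); first by rewrite lee_fin sqrtr_ge0.
by apply: ereal_sup_ubound; exists x => //; exists x.
Qed.

Definition hausdorff_outer n (s : nat) (X : set 'rV[R]_n) : \bar R :=
  ereal_sup [set cover_outer (hausdorff_gauge s delta) X |
             delta in [set delta : R | 0 < delta]].

Lemma hausdorff_outer_ge0 n s (X : set 'rV[R]_n) : (0 <= hausdorff_outer s X)%E.
Proof.
apply: le_trans (cover_outer_ge0 (@hausdorff_gauge_ge0 n s 1) X) _.
by apply: ereal_sup_ubound; exists 1 => //=; exact: ltr01.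
Qed.

Lemma hausdorff_outer0 n s : hausdorff_outer s (set0 : set 'rV[R]_n) = 0%E.
Proof.
apply/eqP; rewrite eq_le hausdorff_outer_ge0 andbT.
apply: ge_ereal_sup => _ [delta _ <-]; rewrite cover_outer0//.
  exact: hausdorff_gauge0.
exact: hausdorff_gauge_ge0.
Qed.

Lemma le_hausdorff_outer n s :
  {homo @hausdorff_outer n s : A B / A `<=` B >-> (A <= B)%E}.
Proof.
move=> A B AB; apply: ge_ereal_sup => _ [delta d0 <-].
apply: le_trans (le_cover_outer _ AB) _.
by apply: ereal_sup_ubound; exists delta.
Qed.

Lemma hausdorff_outer_sigma_subadditive n s :
  sigma_subadditive (@hausdorff_outer n s).
Proof.
move=> F; apply: ge_ereal_sup => _ [delta d0 <-].
apply: le_trans (cover_outer_sigma_subadditive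
  (@hausdorff_gauge_ge0 n s delta) F) _.
apply: lee_nneseries => [i _ _|i _].
  exact: (cover_outer_ge0 (@hausdorff_gauge_ge0 n s delta)).
by apply: ereal_sup_ubound; exists delta.
Qed.

HB.instance Definition _ n s := isOuterMeasure.Build R 'rV[R]_n
  (@hausdorff_outer n s) (@hausdorff_outer0 n s) (@hausdorff_outer_ge0 n s)
  (@le_hausdorff_outer n s) (@hausdorff_outer_sigma_subadditive n s).

(* Measures on the Caratheodory sigma-algebras, which contain the Borel sets;
   for Lebesgue measure this is the sigma-algebra of Lebesgue-measurable
   sets. *)
Definition leb n :
    {measure set (caratheodory_type (@lebesgue_outer n)) -> \bar R} :=
  [the {outer_measure set 'rV[R]_n -> \bar R} of @lebesgue_outer n].

Definition hausdorff n s :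
    {measure set (caratheodory_type (@hausdorff_outer n s)) -> \bar R} :=
  [the {outer_measure set 'rV[R]_n -> \bar R} of @hausdorff_outer n s].

End lebesgue_hausdorff.

Section vector_integral.
Variables (R : realType) (V : vectType R).

(* Coordinatewise; in finite dimension this is Bochner integrability. *)
Definition vintegrable d (T : measurableType d)
    (mu : {measure set T -> \bar R}) (D : set T) (f : T -> V) : Prop :=
  forall i, mu.-integrable D (fun x => (coord (vbasis {:V}) i (f x))%:E).

Definition vintegral d (T : measurableType d)
    (mu : {measure set T -> \bar R}) (D : set T) (f : T -> V) : V :=
  \sum_i (\int[mu]_(x in D) coord (vbasis {:V}) i (f x)) *: (vbasis {:V})`_i.

(* Finite V-valued measures, given by their coordinates in vbasis {:V}; every
   finite Borel measure on an open subset of R^n is Radon. *)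
Definition vmeasure d (T : measurableType d) : Type :=
  'I_(\dim {:V}) -> {charge set T -> \bar R}.

Definition vmeasure_of d (T : measurableType d) (mu : vmeasure T) (A : set T) :
    V :=
  \sum_i fine (mu i A) *: (vbasis {:V})`_i.

End vector_integral.

Section charge_integral.
Variables (d : measure_display) (T : measurableType d) (R : realType).

(* The integral does not depend on the choice of the Hahn decomposition. *)
Definition charge_integral (nu : {charge set T -> \bar R}) (D : set T)
    (f : T -> R) : R :=
  let P := cid (Hahn_decomposition nu) in
  let N := cid (projT2 P) in
  \int[jordan_pos (projT2 N)]_(x in D) f x
  - \int[jordan_neg (projT2 N)]_(x in D) f x.

Definition vmeasure_integral (V : vectType R) (mu : vmeasure V T) (D : set T)
    (f : T -> R) : V :=
  \sum_i charge_integral (mu i) D f *: (vbasis {:V})`_i.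

End charge_integral.

Section operator.
Variables (R : realType) (n : nat).
Local Notation space := 'rV[R]_n.+1.

Definition partials (W : normedModType R) (s : seq 'I_n.+1) (f : space -> W) :
    space -> W :=
  foldr (fun i g => 'D_('e_i) g) f s.

(* Differentiability of every iterated partial derivative everywhere amounts to
   f being of class C^oo. *)
Definition smooth (W : normedModType R) (f : space -> W) : Prop :=
  forall s x, differentiable (partials s f) x.

Definition support (W : normedModType R) (f : space -> W) : set space :=
  closure [set x | f x != 0].

Definition Cc_infty (W : normedModType R) (f : space -> W) : Prop :=
  smooth f /\ compact (support f).

Definition test_function (Om : set space) (phi : space -> R) : Prop :=
  Cc_infty phi /\ support phi `<=` Om.

Variables (E F : normedVectType R).
(* A i is the coefficient of the partial derivative in the direction 'e_i. *)
Variable A : 'I_n.+1 -> 'Hom(E, F).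

Definition diff_op (u : space -> E) (x : space) : F :=
  \sum_i A i ('D_('e_i) u x).

Definition symbol (xi : space) (e : E) : F := \sum_i xi 0 i *: A i e.

Definition essential_range (Om : set space) : set F :=
  closure [set y | exists x (u : space -> E),
                     [/\ Om x, Cc_infty u & y = diff_op u x]].

Definition distr_op (Om : set space) (u : space -> E) (phi : space -> R) : F :=
  - vintegral (leb R n.+1) Om
      (fun x => \sum_i 'D_('e_i) phi x *: A i (u x)).

End operator.

Section jumps.
Variables (R : realType) (n : nat) (E : normedVectType R).
Local Notation space := 'rV[R]_n.+1.
Implicit Types (Om : set space) (u : space -> E) (x nu : space) (a : E).

Definition half_ball x nu (r : R) : set space :=
  [set y | enorm (y - x) < r /\ 0 < dot (y - x) nu].

Definition one_sided_limit u x nu a : Prop :=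
  ((leb R n.+1 (half_ball x nu r))^-1 *
   \int[leb R n.+1]_(y in half_ball x nu r) `|u y - a|%:E)%E
  @[r --> 0^'+] --> 0%E.

Definition jump_triple u x (t : E * E * space) : Prop :=
  let: (a, b, nu) := t in
  [/\ a <> b, enorm nu = 1,
      one_sided_limit u x nu a & one_sided_limit u x (- nu) b].

Definition jump_set Om u : set space :=
  [set x | Om x /\ exists t, jump_triple u x t].

(* At a jump point the triple (u^+, u^-, nu) is unique up to replacing it with
   (u^-, u^+, - nu). Below, the jump and the normal only occur in expressions
   that are invariant under this change, so an arbitrary orientation is
   chosen; Borel measurable orientations give the same values. *)
Definition jump_data u x : E * E * space := xget (0, 0, 0) (jump_triple u x).
Definition jump u x : E := (jump_data u x).1.1 - (jump_data u x).1.2.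
Definition normal u x : space := (jump_data u x).2.

End jumps.

Section bounded_variation.
Variables (R : realType) (n : nat) (E : normedVectType R).
Local Notation space := 'rV[R]_n.+1.
Local Notation borel := (g_sigma_algebraType (@open space)).
Implicit Types (Om : set space) (u : space -> E).

(* The tensor product of E and R^n.+1 is represented by n.+1-tuples in E: the
   i-th entry of a gradient is the i-th partial derivative. *)
Definition tensor : vectType R := {ffun 'I_n.+1 -> E}.

Definition tens (e : E) (xi : space) : tensor := [ffun i => xi 0 i *: e].

(* Only the values of Du on Borel subsets of Om matter. *)
Definition is_distr_gradient Om u (Du : vmeasure tensor borel) : Prop :=
  forall phi, test_function Om phi ->
  vmeasure_integral Du Om phi =
  - vintegral (leb R n.+1) Om (fun x => tens (u x) (\row_i 'D_('e_i) phi x)).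

Definition BV Om u : Prop :=
  vintegrable (leb R n.+1) Om u /\ exists Du, is_distr_gradient Om u Du.

(* Lebesgue decomposition: Du minus its absolutely continuous part is
   concentrated on the null set Z. *)
Definition is_ac_density Om (Du : vmeasure tensor borel) (g : space -> tensor) :
    Prop :=
  vintegrable (leb R n.+1) Om g /\
  exists Z : set borel, [/\ measurable Z, leb R n.+1 Z = 0%E &
    forall B : set borel, measurable B -> B `<=` Om `\` Z ->
      vmeasure_of Du B = vintegral (leb R n.+1) B g].

Definition nabla Om u : space -> tensor :=
  xget (cst 0) [set g | exists Du, is_distr_gradient Om u Du /\
                                   is_ac_density Om Du g].

Definition SBV Om u : Prop :=
  BV Om u /\
  exists Du, [/\ is_distr_gradient Om u Du,
    vintegrable (hausdorff R n.+1 n) (jump_set Om u)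
      (fun x => tens (jump u x) (normal u x)) &
    forall B : set borel, measurable B -> B `<=` Om ->
      vmeasure_of Du B =
      vintegral (leb R n.+1) B (nabla Om u) +
      vintegral (hausdorff R n.+1 n) (B `&` jump_set Om u)
        (fun x => tens (jump u x) (normal u x))].

End bounded_variation.

(* Main.v *)
From HB Require Import structures.
From mathcomp Require Import all_boot all_order all_algebra.
From mathcomp Require Import all_classical all_reals all_analysis.
From mathcomp Require Import measurable_realfun ring lra.
Require Import Defs.

(** The operator factors as A u = T (Du), where T is a linear map on the tensor
    product of E with R^N. The image of T is closed, being finite-dimensional, so
    it contains the essential range, and T has a linear right inverse on it
    (essential_range_lift). It is therefore enough to solve the problem for the
    full gradient: given an integrable tensor field g, find u such that the
    absolutely continuous part of Du is g and the jump part has mass at most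
    C |g|_1. Applying T gives the equation for A u, since T maps the tensor of a
    jump and a normal to the value of the symbol.

    By linearity g may be assumed to have a single nonzero coordinate, that is, g
    is a scalar function f in the direction of the i-th axis. The function f is
    approximated in mean by a step function over boxes whose mass does not exceed
    that of f by much (box_approximation). On a box with lower corner a, where the
    step function takes the value c, consider the ramp c (x_i - a_i), extended by
    0: its gradient is c e_i inside of the box, and it jumps on the faces. When the
    box is first cut into thin slabs orthogonal to e_i, the ramps are uniformly
    small, the jumps on the faces orthogonal to e_i have total mass |c| times the
    volume of the box, and the jumps on the other faces become negligible
    (thin_slabs). Repeating this on the remainder of f yields a series of ramps
    that converges uniformly and in mean, with summable jumps (ramp_sequence). Its
    sum is called a potential; the divergence theorem on boxes passes to the limit
    and shows that the potential has the required gradient (potential_divergence,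
    jump_potential_exists).

    It remains to recognize the singular part of the gradient as the one that the
    definition of SBV prescribes. All faces lie on countably many coordinate
    hyperplanes. By uniform convergence the potential has limits on both sides at
    every point that lies on hyperplanes of at most one direction (potential_above,
    potential_below), and the other points form a countable union of planes of
    codimension two, hence a null set for the (N - 1)-dimensional Hausdorff
    measure. Limits on the two sides of a hyperplane determine the jump triple,
    which is defined by averages over half balls (jump_triple_sides), so the jump
    set, the jump and the normal are known up to null sets (jump_set_gap). The
    absolutely continuous part is known as well, because test functions determine
    a charge on an open set (test_function_charge_unique, nabla_ae).

    Two facts about the measures themselves enter: Lebesgue measure satisfies
    Fubini's theorem, being the product measure on boxes, and the Hausdorff measure
    restricted to a coordinate hyperplane is the Lebesgue measure of the hyperplane
    (hausdorff_outer_ins). The latter turns the boundary terms of the divergence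
    theorem into integrals over jump sets. It combines the isodiametric
    inequality, which follows from the Brunn-Minkowski inequality for unions of
    boxes, with an iterated covering of boxes by inscribed balls
    (hausdorff_delta_improve). *)

Set Implicit Arguments.
Unset Strict Implicit.
Unset Printing Implicit Defensive.
Import Order.TTheory GRing.Theory Num.Theory.
Import numFieldNormedType.Exports.
Local Open Scope classical_set_scope.
Local Open Scope ring_scope.

(** * The Lebesgue outer measure of boxes *)

Lemma natSinv_lt (R : realType) (e : R) : 0 < e -> exists k, k.+1%:R^-1 < e.
Proof.
move=> e0; have [k _ h] := near_infty_natSinv_lt (PosNum e0).
by exists k; exact: (h k (leqnn k)).
Qed.

Section box_volume.
Context {R : realType}.

(** Induction on the dimension: each slice of the covered box is covered by the
    slices of the covering boxes, and the inequality between the volumes of the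
    slices is integrated over the last coordinate by monotone convergence. *)
Lemma box_volume_cover n (a b : nat -> R) (al be : nat -> nat -> R)
    (P : pred nat) :
  (forall i, a i <= b i) -> (forall k i, al k i <= be k i) ->
  (forall x : nat -> R, (forall i, (i < n)%N -> a i <= x i <= b i) ->
     exists2 k, P k & forall i, (i < n)%N -> al k i <= x i <= be k i) ->
  ((\prod_(i < n) (b i - a i))%:E <=
   \sum_(0 <= k <oo | P k) (\prod_(i < n) (be k i - al k i))%:E)%E.
Proof.
move=> ab albe; elim: n P => [|n IH] P cov.
  have [k Pk _] := cov a (fun i => ltac:(done)).
  rewrite big_ord0 (@nneseriesD1 _ _ k)//=; last first.
    by move=> i _; rewrite lee_fin big_ord0.
  by rewrite big_ord0 leeDl// nneseries_ge0// => i _ _; rewrite lee_fin big_ord0.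
pose v k := \prod_(i < n) (be k i - al k i).
have v0 k : 0 <= v k by apply: prodr_ge0 => i _; rewrite subr_ge0.
pose V := \prod_(i < n) (b i - a i).
have V0 : 0 <= V by apply: prodr_ge0 => i _; rewrite subr_ge0.
pose f (k : nat) (t : R) : \bar R :=
  if P k then (v k * \1_(`[al k n, be k n]) t)%:E else 0%E.
have f0 k t : (0 <= f k t)%E.
  by rewrite /f; case: ifP => // _; rewrite lee_fin mulr_ge0.
have mf k : measurable_fun setT (f k).
  rewrite /f; case: (P k) => //; apply/measurable_EFinP.
  by apply: measurable_funM => //; apply: measurable_indic.
have le1 t : ((V * \1_(`[a n, b n]) t)%:E <= \sum_(0 <= k <oo) f k t)%E.
  rewrite indicE; case: (boolP (t \in _)) => [|_]; last first.
    rewrite mulr0; apply: nneseries_ge0 => k _ _; exact: f0.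
  rewrite inE/= in_itv/= => tab; rewrite mulr1.
  apply: le_trans (IH (fun k => P k && (al k n <= t <= be k n)) _) _.
    move=> x xab.
    have [i|k Pk xk] := cov (fun i => if (i < n)%N then x i else t).
      by rewrite ltnS leq_eqVlt => /predU1P[->|lin]; rewrite ?ltnn// lin xab.
    exists k; first by rewrite Pk; have := xk n (ltnSn n); rewrite ltnn.
    by move=> i lin; have := xk i (ltnW lin); rewrite lin.
  rewrite eseries_mkcond; apply: lee_nneseries => k _.
    by move=> _; case: ifP => // _; exact: v0.
  rewrite /f; case: (P k) => //=; rewrite indicE mem_setE in_itv/=.
  by case: ifP => _; rewrite ?mulr1 ?mulr0.
have itvE (c d : R) (r : R) : 0 <= r -> c <= d ->
    (\int[lebesgue_measure]_t (r * \1_(`[c, d]) t)%:E = (r * (d - c))%:E)%E.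
  move=> r0 cd; under eq_integral do rewrite EFinM.
  rewrite ge0_integralZl//=; last first.
    by apply/measurable_EFinP; apply: measurable_indic.
  rewrite integral_indic//= setIT lebesgue_measure_itv/= lte_fin.
  case: ltP => [_|dc]; first by rewrite -EFinB -EFinM.
  by rewrite mule0 (_ : d - c = 0) ?mulr0//; lra.
rewrite big_ord_recr/= -/V -itvE//.
apply: (@le_trans _ _ (\int[lebesgue_measure]_t \sum_(0 <= k <oo) f k t)%E).
  apply: ge0_le_integral => //=.
  - by move=> x _; rewrite lee_fin mulr_ge0.
  - by apply/measurable_EFinP; apply: measurable_funM.
  - by apply: ge0_emeasurable_sum; move=> *; first [exact: f0 | exact: mf].
rewrite integral_nneseries// [leRHS]eseries_mkcond.
apply: lee_nneseries => k _; first by move=> _; apply: integral_ge0.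
rewrite /f; case: (P k); last by rewrite integral0.
by rewrite itvE// big_ord_recr.
Qed.

End box_volume.

Section cover_outer_facts.
Context {R : realType}.
Local Open Scope ereal_scope.

Lemma le_cover_outer_weight (T : pointedType) (w : set T -> \bar R) (X : set T) :
  w set0 = 0 -> (forall C, 0 <= w C) -> cover_outer w X <= w X.
Proof.
move=> w0 wge0; pose C k := if k is 0%N then X else set0.
apply: ereal_inf_lbound; exists C; first by move=> x Xx; exists 0%N.
rewrite (@nneseriesD1 _ _ 0%N)//= eseries0 ?adde0// => i _.
by case: i => //= i _; rewrite w0.
Qed.

(** Transports covers: an estimate of the outer measure of the sets Phi C by
    the weights of the sets C extends from the members of covers to all sets. *)
Lemma outer_le_cover_outer (T T' : pointedType) (w : set T -> \bar R)
    (mu : {outer_measure set T' -> \bar R}) (kappa : R) (Phi : set T -> set T')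
    (X : set T) (X' : set T') :
  (0 < kappa)%R -> (forall C, 0 <= w C) ->
  (forall C : (set T)^nat, X `<=` \bigcup_k C k ->
     X' `<=` \bigcup_k Phi (C k)) ->
  (forall C, mu (Phi C) <= kappa%:E * w C) ->
  mu X' <= kappa%:E * cover_outer w X.
Proof.
move=> k0 w0 cov muw; rewrite -lee_pdivrMl//.
apply: le_ereal_inf_tmp => _ [C XC <-]; rewrite lee_pdivrMl//.
rewrite -nneseriesZl//.
apply: (@le_trans _ _ (\sum_(0 <= k <oo) mu (Phi (C k)))).
  apply: le_trans (outer_measure_sigma_subadditive mu _).
  exact: le_outer_measure (cov _ XC).
by apply: lee_nneseries => // k _ _; exact: outer_measure_ge0.
Qed.

End cover_outer_facts.

Section lebesgue_outer_box.
Context {R : realType} {n : nat}.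
Implicit Types (a b v : 'rV[R]_n) (C X : set 'rV[R]_n).

Definition vol a b : R := \prod_i (b 0 i - a 0 i).

Lemma vol_ge0 a b : (forall i, a 0 i <= b 0 i) -> 0 <= vol a b.
Proof. by move=> ab; apply: prodr_ge0 => i _; rewrite subr_ge0. Qed.

Lemma box_inj a b (c d : 'rV[R]_n) : (forall i, a 0 i <= b 0 i) ->
  (forall i, c 0 i <= d 0 i) -> box a b = box c d -> a = c /\ b = d.
Proof.
move=> ab cd e.
have [ca bd] : (forall i, c 0 i <= a 0 i) /\ (forall i, b 0 i <= d 0 i).
  have : box c d a by rewrite -e => i; rewrite lexx ab.
  have : box c d b by rewrite -e => i; rewrite lexx ab.
  by move=> hb ha; split=> i; [case/andP: (ha i)|case/andP: (hb i)].
have [ac db] : (forall i, a 0 i <= c 0 i) /\ (forall i, d 0 i <= b 0 i).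
  have : box a b c by rewrite e => i; rewrite lexx cd.
  have : box a b d by rewrite e => i; rewrite lexx cd.
  by move=> hb ha; split=> i; [case/andP: (ha i)|case/andP: (hb i)].
split; apply/rowP => i; apply/eqP; rewrite eq_le.
- by rewrite ac ca.
- by rewrite db bd.
Qed.

Lemma box_gauge_box a b : (forall i, a 0 i <= b 0 i) ->
  box_gauge (box a b) = (vol a b)%:E.
Proof.
move=> ab; rewrite /box_gauge; case: asboolP => [e|_].
  have : box a b a by move=> i; rewrite lexx ab.
  by rewrite e.
rewrite (_ : [set _ | _ in _] = [set (vol a b)%:E]) ?ereal_inf1//.
apply/seteqP; split=> [_ /= [[c d] /= [cd e] <-]|_ -> /=].
  by have [-> ->] := box_inj ab cd e.
by exists (a, b).
Qed.

Lemma box_gauge_fin C : (box_gauge C < +oo)%E -> C <> set0 ->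
  exists ab : 'rV[R]_n * 'rV[R]_n,
    (forall i, ab.1 0 i <= ab.2 0 i) /\ C = box ab.1 ab.2.
Proof.
rewrite /box_gauge; case: asboolP => // _ + _; apply: contraPP => h.
rewrite (_ : [set _ | _ in _] = set0) ?ereal_inf0//.
by rewrite -subset0 => _ /= [ab abC _]; apply: h; exists ab.
Qed.

Lemma lebesgue_outer_box a b : (forall i, a 0 i <= b 0 i) ->
  lebesgue_outer (box a b) = (vol a b)%:E.
Proof.
move=> ab; apply/eqP; rewrite eq_le; apply/andP; split.
  rewrite -box_gauge_box//; apply: le_cover_outer_weight.
    exact: box_gauge0.
  exact: box_gauge_ge0.
apply: le_ereal_inf_tmp => _ [C abC <-].
have [[k Ck]|fin] := pselect (exists k, box_gauge (C k) = +oo%E).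
  rewrite (@nneseriesD1 _ _ k)//; last by move=> i _; exact: box_gauge_ge0.
  rewrite Ck addye ?leey// gt_eqF// (lt_le_trans ltNy0)//.
  by apply: nneseries_ge0 => i _ _; exact: box_gauge_ge0.
have ex k : exists cd : 'rV[R]_n * 'rV[R]_n, (forall i, cd.1 0 i <= cd.2 0 i) /\
    (C k <> set0 -> C k = box cd.1 cd.2).
  have [->|C0] := pselect (C k = set0); first by exists (0, 0).
  have [|cd [? ?]] := @box_gauge_fin (C k) _ C0; last by exists cd.
  by rewrite ltey; apply/eqP => h; apply: fin; exists k.
pose cd k := projT1 (cid (ex k)).
have cdle k : forall i, (cd k).1 0 i <= (cd k).2 0 i.
  by have [] := projT2 (cid (ex k)).
have cdE k : C k <> set0 -> C k = box (cd k).1 (cd k).2.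
  by have [] := projT2 (cid (ex k)).
pose fn (x : 'rV[R]_n) (i : nat) : R := oapp (x 0) 0 (insub i).
have fnE x (i : 'I_n) : fn x i = x 0 i by rewrite /fn valK.
have fnle (x y : 'rV[R]_n) : (forall i, x 0 i <= y 0 i) -> forall i, fn x i <= fn y i.
  by move=> xy i; rewrite /fn; case: insubP => /=.
pose P k := `[< C k <> set0 >].
have := @box_volume_cover R n (fn a) (fn b) (fun k => fn (cd k).1)
   (fun k => fn (cd k).2) P (fnle _ _ ab) (fun k => fnle _ _ (cdle k)).
have volE (x y : 'rV[R]_n) : \prod_(i < n) (fn y i - fn x i) = vol x y.
  by apply: eq_bigr => i _; rewrite !fnE.
rewrite volE => H; apply: le_trans (H _) _ => [x xab|].
  have [k _ Ckx] := abC (\row_i x i)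
    (fun i => ltac:(by rewrite mxE -!fnE xab)).
  have Ck0 : C k <> set0 by move=> e; rewrite e in Ckx.
  exists k; first exact/asboolP.
  move: Ckx; rewrite {1}cdE// => h i lin.
  by have := h (Ordinal lin); rewrite mxE -!fnE.
rewrite eseries_mkcond; apply: lee_nneseries => [k _ _|k _].
  by case: ifP => // _; rewrite volE lee_fin vol_ge0.
case: ifPn => [/asboolP Ck0|_]; last exact: box_gauge_ge0.
by rewrite volE cdE// box_gauge_box.
Qed.

End lebesgue_outer_box.

(** * Borel sets are Lebesgue measurable *)

Section halfspaces.
Context {R : realType} {n : nat}.
Implicit Types (a b v : 'rV[R]_n) (C X : set 'rV[R]_n).

Definition upd a (i : 'I_n) (c : R) : 'rV[R]_n :=
  \row_j (if j == i then c else a 0 j).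

(** Cutting a box along a coordinate hyperplane yields two boxes whose volumes
    add up; hence half-spaces are measurable. *)
Lemma box_gauge_split C i (c : R) :
  (box_gauge (C `&` [set x : 'rV[R]_n | (x 0 i <= c)%R]) +
   box_gauge (C `&` [set x : 'rV[R]_n | (c <= x 0 i)%R]) <= box_gauge C)%E.
Proof.
have [->|C0] := pselect (C = set0); first by rewrite !set0I box_gauge0 adde0.
have [->|fin] := eqVneq (box_gauge C) +oo%E; first by rewrite leey.
have [|[a b] /= [ab ->]] := @box_gauge_fin _ _ C _ C0; first by rewrite ltey.
have [ca|ac] := ltP c (a 0 i).
  rewrite (_ : _ `&` [set x : 'rV[R]_n | x 0 i <= c] = set0) ?box_gauge0 ?add0e; last first.
    rewrite -subset0 => x [/(_ i) /andP[h _] /= h'].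
    by move: ca; rewrite ltNge (le_trans h).
  rewrite (_ : _ `&` _ = box a b)//; apply: setIidl => x /(_ i) /andP[h _] /=.
  by rewrite (le_trans (ltW ca)).
have [bc|cb] := ltP (b 0 i) c.
  rewrite (_ : _ `&` [set x : 'rV[R]_n | c <= x 0 i] = set0) ?box_gauge0 ?adde0; last first.
    rewrite -subset0 => x [/(_ i) /andP[_ h] /= h'].
    by move: bc; rewrite ltNge (le_trans h').
  rewrite (_ : _ `&` _ = box a b)//; apply: setIidl => x /(_ i) /andP[_ h] /=.
  by rewrite (le_trans h)// ltW.
rewrite (_ : _ `&` [set x : 'rV[R]_n | x 0 i <= c] = box a (upd b i c)); last first.
  apply/seteqP; split=> x /= => [[xab xc] j|h].
    rewrite mxE; case: eqP => [->|_]; last exact: xab.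
    by have /andP[-> _] := xab i.
  split; last by have := h i; rewrite mxE eqxx => /andP[].
  move=> j; have := h j; rewrite mxE; case: eqP => [->|//] /andP[-> /=] h'.
  exact: le_trans cb.
rewrite (_ : _ `&` [set x : 'rV[R]_n | c <= x 0 i] = box (upd a i c) b); last first.
  apply/seteqP; split=> x /= => [[xab xc] j|h].
    rewrite mxE; case: eqP => [->|_]; last exact: xab.
    by have /andP[_ ->] := xab i; rewrite andbT.
  split; last by have := h i; rewrite mxE eqxx => /andP[].
  move=> j; have := h j; rewrite mxE; case: eqP => [->|//] /andP[h' -> /=].
  by rewrite andbT; exact: le_trans h'.
rewrite !box_gauge_box//; last 2 first.
- by move=> j; rewrite mxE; case: eqP => [->|].
- by move=> j; rewrite mxE; case: eqP => [->|].
rewrite -EFinD lee_fin /vol (bigD1 i)//= [X in _ + X <= _](bigD1 i)//=.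
rewrite [leRHS](bigD1 i)//= !mxE eqxx.
rewrite (eq_bigr (fun j => b 0 j - a 0 j)); last first.
  by move=> j /negPf ji; rewrite mxE ji.
rewrite [X in _ + _ * X](eq_bigr (fun j => b 0 j - a 0 j)); last first.
  by move=> j /negPf ji; rewrite mxE ji.
by rewrite -mulrDl addrC addrA subrK.
Qed.

Lemma lebesgue_outer_halfspace i (c : R) :
  (@lebesgue_outer R n).-caratheodory [set x : 'rV[R]_n | x 0 i <= c].
Proof.
apply: le_caratheodory_measurable => X; set H := [set x | _].
apply: le_ereal_inf_tmp => _ [C XC <-].
apply: (@le_trans _ _ (\sum_(0 <= k <oo) box_gauge (C k `&` H) +
    \sum_(0 <= k <oo) box_gauge (C k `&` [set x : 'rV[R]_n | (c <= x 0 i)%R]))%E).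
  apply: leeD; apply: ereal_inf_lbound.
    by exists (fun k => C k `&` H) => // x [/XC[k _ Ckx] Hx]; exists k.
  exists (fun k => C k `&` [set x : 'rV[R]_n | c <= x 0 i]) => // x [/XC[k _ Ckx] Hx].
  by exists k => //; split => //=; rewrite ltW// ltNge; exact/negP.
rewrite -nneseriesD; last 2 first.
- by move=> k _ _; exact: box_gauge_ge0.
- by move=> k _ _; exact: box_gauge_ge0.
apply: lee_nneseries => k _; last exact: box_gauge_split.
by move=> _; rewrite adde_ge0 ?box_gauge_ge0.
Qed.

(** Balls of the sup norm are boxes, so open sets are countable unions of finite
    intersections of half-spaces with rational data. *)
Lemma borel_halfspaces (S : set (set 'rV[R]_n)) : sigma_algebra setT S ->
  (forall i c, S [set x : 'rV[R]_n | x 0 i <= c]) -> <<s open >> `<=` S.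
Proof.
move=> [S0 SC SU] Sh; apply: smallest_sub; first by split.
have SCt X : S X -> S (~` X) by move=> /SC; rewrite setTD.
have SI (F : (set 'rV[R]_n)^nat) : (forall k, S (F k)) -> S (\bigcap_k F k).
  by move=> SF; rewrite -(setCK (\bigcap_k _)) setC_bigcap; apply/SCt/SU => k; exact: SCt.
have SI2 X Y : S X -> S Y -> S (X `&` Y).
  move=> SX SY; rewrite (_ : _ `&` _ = \bigcap_k (if k is 0%N then X else Y)).
    by apply: SI => -[].
  apply/seteqP; split=> [x [Xx Yx] [] //|x h]; split; [exact: (h 0%N)|exact: (h 1%N)].
have Slt i c : S [set x : 'rV[R]_n | x 0 i < c].
  rewrite (_ : [set _ | _] = \bigcup_k [set x : 'rV[R]_n | x 0 i <= c - k.+1%:R^-1]).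
    by apply: SU => k; exact: Sh.
  apply/seteqP; split=> x /= => [xc|[k _ /= h]].
    have [|k h] := @natSinv_lt R (c - x 0 i); first by rewrite subr_gt0.
    by exists k => //=; rewrite lerBrDl -lerBrDr ltW.
  by apply: le_lt_trans h _; rewrite ltrBlDr ltrDl invr_gt0.
have Sgt i c : S [set x : 'rV[R]_n | c < x 0 i].
  rewrite (_ : [set _ | _] = ~` [set x : 'rV[R]_n | x 0 i <= c]); first exact/SCt/Sh.
  by apply/seteqP; split=> x /=; rewrite ltNge => /negP.
have Sball (x : 'rV[R]_n) e : 0 < e -> S (ball x e).
  move=> e0.
  pose F (k : nat) : set 'rV[R]_n := if insub k is Some i then
    [set y | x 0 i - e < y 0 i] `&` [set y | y 0 i < x 0 i + e] else setT.
  rewrite (_ : ball x e = \bigcap_k F k).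
    apply: (SI F) => k; rewrite /F; case: insubP => [i _ _|_].
      by apply: SI2; [exact: Sgt|exact: Slt].
    by rewrite -setC0; exact: SCt.
  rewrite /F.
  apply/seteqP; split=> [y [_ xy] i _|y h]; last split=> // i j.
    case: insubP => // j _ _ /=; have := xy 0 j.
    by rewrite /ball/= ltr_distlC => /andP[].
  rewrite ord1; have := h j Logic.I; rewrite valK /ball/= ltr_distlC => -[/= -> ->//].
move=> U oU.
pose B (qk : 'rV[rat]_n * nat) : set 'rV[R]_n :=
  ball (map_mx (ratr : rat -> R) qk.1) qk.2.+1%:R^-1.
rewrite (_ : U = \bigcup_m (if unpickle m is Some qk then
   if `[< B qk `<=` U >] then B qk else set0 else set0)).
  apply: SU => m; case: unpickle => [qk|//]; case: ifP => _ //.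
  by apply: Sball; rewrite invr_gt0.
apply/seteqP; split=> [x Ux|x [m _]]; last first.
  by case: unpickle => // qk; case: asboolP => // h /h.
have /nbhs_ballP[e /= e0 xeU] : nbhs x U by exact: open_nbhs_nbhs.
have [|k ke] := @natSinv_lt R (e / 2); first by rewrite divr_gt0.
have k0 : 0 < k.+1%:R^-1 :> R by rewrite invr_gt0.
have /choice[q qx] i : exists q : rat, `|x 0 i - ratr q| < k.+1%:R^-1 :> R.
  have [|q] := @rat_in_itvoo R (x 0 i - k.+1%:R^-1) (x 0 i + k.+1%:R^-1).
    by rewrite ltrBlDr -addrA ltrDl addr_gt0.
  by rewrite in_itv/= => h; exists q; rewrite distrC ltr_distlC -?ltr_distlC distrC ltr_distlC.
exists (pickle (\row_i q i, k)) => //; rewrite pickleK.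
have BU : B (\row_i q i, k) `<=` U.
  move=> y [_ h]; apply: xeU; split=> // i j; rewrite ord1 /ball/=.
  have := h 0 j; have := qx j; rewrite /ball/= !mxE; move: ke.
  move: (_^-1) => t; rewrite !ltr_distl; lra.
rewrite asboolT//; split=> // i j.
by rewrite !mxE ord1 /ball/= distrC.
Qed.

Lemma borel_lebesgue (B : set 'rV[R]_n) : <<s open >> B ->
  (@lebesgue_outer R n).-caratheodory B.
Proof.
apply: borel_halfspaces; last exact: lebesgue_outer_halfspace.
split.
- exact: caratheodory_measurable_set0.
- by move=> A mA; rewrite setTD; exact: caratheodory_measurable_setC.
- by move=> F mF; exact: caratheodory_measurable_bigcup.
Qed.

End halfspaces.

(** * Affine maps and approximation by Borel sets *)

Section lebesgue_outer_affine.
Context {R : realType} {n : nat}.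
Implicit Types (a b v : 'rV[R]_n) (C X : set 'rV[R]_n).

Lemma image_box v (r : R) a b : 0 < r ->
  [set v + r *: x | x in box a b] = box (v + r *: a) (v + r *: b).
Proof.
move=> r0; apply/seteqP; split=> [_ [x xab <-] i|y h].
  by rewrite !mxE !lerD2l !ler_pM2l.
exists (r^-1 *: (y - v)); last first.
  by rewrite scalerA divff ?gt_eqF// scale1r addrC subrK.
move=> i; have := h i; rewrite !mxE.
by rewrite ler_pdivlMl// ler_pdivrMl// lerBrDl lerBlDl.
Qed.

Lemma vol_affine v (r : R) a b : vol (v + r *: a) (v + r *: b) = r ^+ n * vol a b.
Proof.
rewrite -[in r ^+ n](card_ord n) -prodr_const /vol -big_split/=.
by apply: eq_bigr => i _; rewrite !mxE; ring.
Qed.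

Let affine_le v (r : R) X : 0 < r ->
  (lebesgue_outer [set (v + r *: x)%R | x in X] <=
   (r ^+ n)%:E * lebesgue_outer X)%E.
Proof.
move=> r0.
pose Phi C := [set v + r *: x | x in C].
apply: (@outer_le_cover_outer _ _ _ (@box_gauge R n) (@lebesgue_outer R n) _ Phi).
- by rewrite exprn_gt0.
- exact: box_gauge_ge0.
- by move=> C XC _ [x /XC[k _ Ckx] <-]; exists k => //; exists x.
move=> C; have [->|C0] := pselect (C = set0).
  by rewrite /Phi image_set0 outer_measure0 box_gauge0 mule0.
have [->|fin] := eqVneq (box_gauge C) +oo%E.
  by rewrite mulry gtr0_sg ?exprn_gt0// mul1e leey.
have [|[a b] /= [ab ->]] := @box_gauge_fin _ _ C _ C0; first by rewrite ltey.
rewrite box_gauge_box// /Phi image_box// lebesgue_outer_box; last first.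
  by move=> i; rewrite !mxE lerD2l ler_pM2l.
by rewrite vol_affine EFinM.
Qed.

Lemma lebesgue_outer_affine v (r : R) X : 0 < r ->
  lebesgue_outer [set v + r *: x | x in X] = ((r ^+ n)%:E * lebesgue_outer X)%E.
Proof.
move=> r0; apply/eqP; rewrite eq_le affine_le//=.
rewrite -lee_pdivlMl ?exprn_gt0// -exprVn.
have {1}-> : X = [set - (r^-1 *: v) + r^-1 *: x | x in [set v + r *: x | x in X]].
  apply/seteqP; split=> [x Xx|_ [_ [x Xx <-] <-]].
    exists (v + r *: x); first by exists x.
    by rewrite scalerDr addKr scalerA mulVf ?gt_eqF// scale1r.
  by rewrite scalerDr addKr scalerA mulVf ?gt_eqF// scale1r.
by apply: affine_le; rewrite invr_gt0.
Qed.

End lebesgue_outer_affine.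

Section borel_approximation.
Context {R : realType} {n : nat}.
Implicit Types (a b v : 'rV[R]_n) (C X : set 'rV[R]_n).

Local Notation borel := (g_sigma_algebraType (@open 'rV[R]_n)).

Lemma measurable_gt_coord i (c : R) :
  measurable ([set x : 'rV[R]_n | c < x 0 i] : set borel).
Proof.
apply: sub_sigma_algebra.
have /continuousP := @coord_continuous R 1 n 0 i.
by move=> /(_ [set y | c < y]); apply; exact: open_gt.
Qed.

Lemma measurable_lt_coord i (c : R) :
  measurable ([set x : 'rV[R]_n | x 0 i < c] : set borel).
Proof.
apply: sub_sigma_algebra.
have /continuousP := @coord_continuous R 1 n 0 i.
by move=> /(_ [set y | y < c]); apply; exact: open_lt.
Qed.

Lemma measurable_ge_coord i (c : R) :
  measurable ([set x : 'rV[R]_n | c <= x 0 i] : set borel).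
Proof.
rewrite (_ : [set _ | _] = ~` [set x : 'rV[R]_n | x 0 i < c]).
  by apply: measurableC; exact: measurable_lt_coord.
by apply/seteqP; split=> x /=; rewrite leNgt => /negP.
Qed.

Lemma measurable_le_coord i (c : R) :
  measurable ([set x : 'rV[R]_n | x 0 i <= c] : set borel).
Proof.
rewrite (_ : [set _ | _] = ~` [set x : 'rV[R]_n | c < x 0 i]).
  by apply: measurableC; exact: measurable_gt_coord.
by apply/seteqP; split=> x /=; rewrite leNgt => /negP.
Qed.

Lemma measurable_box a b : measurable (box a b : set borel).
Proof.
rewrite (_ : box a b = \bigcap_(i in [set: 'I_n])
    ([set x : 'rV[R]_n | a 0 i <= x 0 i] `&` [set x | x 0 i <= b 0 i])).
  apply: (@fin_bigcap_measurable _ borel) => // i _.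
  by apply: measurableI; [exact: measurable_ge_coord|exact: measurable_le_coord].
apply/seteqP; split=> x h i; first by move=> _; have /andP[] := h i.
by have [/= -> ->] := h i Logic.I.
Qed.

(** A set of finite outer measure has covers consisting of boxes only, since a
    nonempty set that is not a box has infinite weight. *)
Lemma finite_cover X (e : R) : (lebesgue_outer X < +oo)%E -> 0 < e ->
  exists ab : nat -> 'rV[R]_n * 'rV[R]_n,
  exists P : pred nat,
  [/\ forall k i, (ab k).1 0 i <= (ab k).2 0 i,
      X `<=` \bigcup_(k in P) box (ab k).1 (ab k).2 &
      (\sum_(0 <= k <oo | P k) (vol (ab k).1 (ab k).2)%:E <=
        lebesgue_outer X + e%:E)%E].
Proof.
move=> Xoo e0.
have Xfin : lebesgue_outer X \is a fin_num.
  by rewrite ge0_fin_numE// outer_measure_ge0.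
have [_ [C XC <-] le] := @lb_ereal_inf_adherent _ _ _ e0 Xfin.
have [[k Ck]|fin] := pselect (exists k, box_gauge (C k) = +oo%E).
  have : (\sum_(0 <= k <oo) box_gauge (C k) < +oo)%E.
    by rewrite (lt_trans le)// -/(lebesgue_outer X) lte_add_pinfty// ltry.
  rewrite (@nneseriesD1 _ _ k)//; last by move=> i _; exact: box_gauge_ge0.
  rewrite Ck addye// gt_eqF// (lt_le_trans ltNy0)//.
  by apply: nneseries_ge0 => i _ _; exact: box_gauge_ge0.
have /choice[ab abP] k : exists cd : 'rV[R]_n * 'rV[R]_n,
    (forall i, cd.1 0 i <= cd.2 0 i) /\
    (C k <> set0 -> C k = box cd.1 cd.2).
  have [->|C0] := pselect (C k = set0); first by exists (0, 0).
  have [|cd [? ?]] := @box_gauge_fin _ _ (C k) _ C0; last by exists cd.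
  by rewrite ltey; apply/eqP => h; apply: fin; exists k.
exists ab, (fun k => `[< C k <> set0 >]); split.
- by move=> k i; have [] := abP k.
- move=> x /XC[k _ Ckx]; have Ck0 : C k <> set0 by move=> h; rewrite h in Ckx.
  exists k; first exact/asboolP.
  by have [_ <-] := abP k.
- apply: le_trans (ltW le); rewrite eseries_mkcond.
  apply: lee_nneseries => [k _ _|k _].
    by case: ifP => // _; rewrite lee_fin vol_ge0//; have [] := abP k.
  case: ifPn => [/asboolP Ck0|_]; last exact: box_gauge_ge0.
  by have [h1 /(_ Ck0) ->] := abP k; rewrite box_gauge_box.
Qed.

Lemma borel_hull X : (lebesgue_outer X < +oo)%E ->
  exists B : set borel,
    [/\ measurable B, X `<=` B & lebesgue_outer B = lebesgue_outer X].
Proof.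
move=> Xoo.
have Xfin : lebesgue_outer X \is a fin_num.
  by rewrite ge0_fin_numE// outer_measure_ge0.
have /choice[U UP] k : exists U : set borel, [/\ measurable U, X `<=` U &
    (lebesgue_outer U <= lebesgue_outer X + (k.+1%:R^-1)%:E)%E].
  have [|ab [P [abl XU abE]]] := @finite_cover X k.+1%:R^-1 Xoo.
    by rewrite invr_gt0.
  exists (\bigcup_(k in P) box (ab k).1 (ab k).2); split => //.
    by apply: bigcup_measurable => j _; exact: measurable_box.
  apply: le_trans abE.
  pose C j := if P j then box (ab j).1 (ab j).2 else set0.
  rewrite (_ : \bigcup_(k in _) _ = \bigcup_k C k); last first.
    apply/seteqP; split=> [x [j Pj h]|x [j _]]; first by exists j => //; rewrite /C Pj.
    by rewrite /C; case: ifP => // Pj h; exists j.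
  apply: le_trans (outer_measure_sigma_subadditive _ C) _.
  rewrite [leRHS]eseries_mkcond; apply: lee_nneseries => j _.
    by move=> _; exact: outer_measure_ge0.
  rewrite /C; case: ifP => _; last by rewrite outer_measure0.
  by rewrite -[leLHS]/(lebesgue_outer _) lebesgue_outer_box.
exists (\bigcap_k U k); split.
- by apply: bigcapT_measurable => k; have [] := UP k.
- by move=> x Xx k _; have [_ h _] := UP k; exact: h.
apply/eqP; rewrite eq_le; apply/andP; split; last first.
  by apply: le_outer_measure => x Xx k _; have [_ h _] := UP k; exact: h.
apply/lee_addgt0Pr => e e0; have [k ke] := natSinv_lt e0.
have [_ _ h] := UP k; apply: le_trans (le_trans h _).
  by apply: le_outer_measure; exact: bigcap_inf.
by rewrite leeD2l// lee_fin ltW.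
Qed.

(** In each cube [-k, k]^n the complement of A has a Borel hull of the same finite
    measure, whose complement is a Borel subset of A. *)
Lemma borel_kernel (A : set 'rV[R]_n) : (@lebesgue_outer R n).-caratheodory A ->
  exists B : set borel,
    [/\ measurable B, B `<=` A & lebesgue_outer (A `\` B) = 0%E].
Proof.
move=> mA.
pose Q k : set 'rV[R]_n := box (const_mx (- k%:R)) (const_mx k%:R).
have Qoo k : (lebesgue_outer (Q k) < +oo)%E.
  rewrite lebesgue_outer_box ?ltry// => i; rewrite !mxE.
  by rewrite (@le_trans _ _ 0)// oppr_le0.
have QT : \bigcup_k Q k = setT.
  rewrite -subTset => x _.
  have /choice[m mP] i : exists k : nat, `|x 0 i| <= k%:R.
    by exists (Num.truncn `|x 0 i|).+1; rewrite ltW// truncnS_gt.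
  exists (\sum_i m i)%N => // i; rewrite !mxE -ler_norml (le_trans (mP i))//.
  by rewrite ler_nat (bigD1 i)//= leq_addr.
have mQ k : (@lebesgue_outer R n).-caratheodory (Q k).
  by apply: borel_lebesgue; exact: measurable_box.
have /choice[G GP] k : exists G : set borel, [/\ measurable G, Q k `\` A `<=` G &
    lebesgue_outer G = lebesgue_outer (Q k `\` A)].
  apply: borel_hull; apply: le_lt_trans (Qoo k).
  by apply: le_outer_measure; exact: subDsetl.
exists (\bigcup_k (Q k `\` G k)); split.
- apply: bigcupT_measurable => k; have [mG _ _] := GP k.
  by apply: measurableD => //; exact: measurable_box.
- move=> x [k _ [Qx nGx]]; apply: contrapT => nAx.
  by have [_ h _] := GP k; apply: nGx; exact: h.
have sub : A `\` \bigcup_k (Q k `\` G k) `<=` \bigcup_k (G k `\` (Q k `\` A)).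
  move=> x [Ax nx]; have [k _ Qx] : (\bigcup_k Q k) x by rewrite QT.
  exists k => //; split; last by move=> [].
  by apply: contrapT => nGx; apply: nx; exists k.
have nul k : lebesgue_outer (G k `\` (Q k `\` A)) = 0%E.
  have [mG QG GE] := GP k.
  have mD : (@lebesgue_outer R n).-caratheodory (Q k `\` A).
    exact: caratheodory_measurable_setD.
  have := mD (G k); rewrite (setIidr QG) GE.
  have : lebesgue_outer (Q k `\` A) \is a fin_num.
    rewrite ge0_fin_numE ?outer_measure_ge0//.
    apply: le_lt_trans (Qoo k).
    by apply: le_outer_measure; exact: subDsetl.
  rewrite setDE; move: (lebesgue_outer (G k `&` _)) => y.
  case: (lebesgue_outer _) => //= r _; case: y => //= y [] e; congr EFin.
  by apply: (addrI r); rewrite addr0 -e.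
apply/eqP; rewrite eq_le outer_measure_ge0 andbT.
apply: le_trans (le_outer_measure _ _ _ sub) _.
apply: le_trans (outer_measure_sigma_subadditive _ _) _.
by rewrite eseries0// => k _ _; exact: nul.
Qed.

End borel_approximation.

(** * Euclidean norm and null sets *)

Section euclidean_norm.
Context {R : realType} {n : nat}.
Implicit Types x y : 'rV[R]_n.

Lemma dotC x y : dot x y = dot y x.
Proof. by apply: eq_bigr => i _; rewrite mulrC. Qed.

Lemma dotDl x y (z : 'rV[R]_n) : dot (x + y) z = dot x z + dot y z.
Proof. by rewrite -big_split/=; apply: eq_bigr => i _; rewrite mxE mulrDl. Qed.

Lemma dotZl (r : R) x y : dot (r *: x) y = r * dot x y.
Proof. by rewrite mulr_sumr; apply: eq_bigr => i _; rewrite mxE mulrA. Qed.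

Lemma dotNl x y : dot (- x) y = - dot x y.
Proof. by rewrite -scaleN1r dotZl mulN1r. Qed.

Lemma dotDr x y (z : 'rV[R]_n) : dot z (x + y) = dot z x + dot z y.
Proof. by rewrite dotC dotDl !(dotC z). Qed.

Lemma dotZr (r : R) x y : dot x (r *: y) = r * dot x y.
Proof. by rewrite dotC dotZl dotC. Qed.

Lemma dotNr x y : dot x (- y) = - dot x y.
Proof. by rewrite dotC dotNl dotC. Qed.

Lemma dot_ge0 x : 0 <= dot x x.
Proof. by apply: sumr_ge0 => i _; rewrite -expr2 sqr_ge0. Qed.

Lemma sqr_enorm x : enorm x ^+ 2 = dot x x.
Proof. by rewrite sqr_sqrtr// dot_ge0. Qed.

Lemma enorm_ge0 x : 0 <= enorm x.
Proof. exact: sqrtr_ge0. Qed.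

Lemma dot_sqr_le x y : dot x y ^+ 2 <= dot x x * dot y y.
Proof.
have [y0|yn0] := eqVneq (dot y y) 0.
  have -> : dot x y = 0; last by rewrite expr0n/= mulr_ge0// dot_ge0.
  apply: big1 => i _; suff -> : y 0 i = 0 by rewrite mulr0.
  have /eqP := y0; rewrite psumr_eq0 => [|j _]; last by rewrite -expr2 sqr_ge0.
  by move=> /allP/(_ i); rewrite mem_index_enum -expr2 sqrf_eq0 => /(_ isT)/eqP.
have y0 : 0 < dot y y by rewrite lt_neqAle eq_sym yn0 dot_ge0.
have := dot_ge0 (dot y y *: x - dot x y *: y).
rewrite dotDl !dotDr !dotNl !dotNr !dotZl !dotZr (dotC y x) => h.
suff : 0 <= dot y y * (dot x x * dot y y - dot x y ^+ 2).
  by rewrite pmulr_rge0// subr_ge0.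
by move: h; congr (0 <= _); ring.
Qed.

Lemma dot_le x y : dot x y <= enorm x * enorm y.
Proof.
apply: le_trans (ler_norm _) _.
rewrite -ler_sqr ?nnegrE ?mulr_ge0 ?enorm_ge0//.
by rewrite real_normK ?num_real// exprMn !sqr_enorm dot_sqr_le.
Qed.

Lemma enormD x y : enorm (x + y) <= enorm x + enorm y.
Proof.
rewrite -ler_sqr ?nnegrE ?addr_ge0 ?enorm_ge0// sqr_enorm dotDl !dotDr.
rewrite sqrrD !sqr_enorm (dotC y x).
have := dot_le x y; lra.
Qed.

Lemma enormZ (r : R) x : enorm (r *: x) = `|r| * enorm x.
Proof. by rewrite /enorm dotZl dotZr mulrA -expr2 sqrtrM ?sqr_ge0// sqrtr_sqr. Qed.

Lemma enormN x : enorm (- x) = enorm x.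
Proof. by rewrite /enorm dotNl dotNr opprK. Qed.

Lemma enorm_dist x y : enorm (x - y) = enorm (y - x).
Proof. by rewrite -enormN opprB. Qed.

Lemma coord_le_enorm x i : `|x 0 i| <= enorm x.
Proof.
rewrite -sqrtr_sqr /enorm ler_sqrt ?dot_ge0// /dot (bigD1 i)//= expr2 lerDl.
by apply: sumr_ge0 => j _; rewrite -expr2 sqr_ge0.
Qed.

Lemma enorm_le_sum x : enorm x <= \sum_i `|x 0 i|.
Proof.
have s0 : 0 <= \sum_i `|x 0 i| by apply: sumr_ge0.
rewrite -ler_sqr ?nnegrE ?enorm_ge0// sqr_enorm expr2 mulr_suml.
apply: ler_sum => i _; rewrite -expr2 -real_normK ?num_real// expr2.
by rewrite ler_wpM2l// (bigD1 i)//= lerDl sumr_ge0.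
Qed.

Lemma enorm_le_bound x (c : R) : (forall i, `|x 0 i| <= c) -> enorm x <= n%:R * c.
Proof.
move=> xc; apply: le_trans (enorm_le_sum x) _.
apply: le_trans (_ : \sum_(i < n) c <= _); first by apply: ler_sum => i _.
by rewrite sumr_const card_ord -[leLHS]mulr_natl.
Qed.

End euclidean_norm.

Section null_sets.
Context {R : realType}.

Lemma outer_null_bigcup (T : Type) (mu : {outer_measure set T -> \bar R})
    (F : (set T)^nat) :
  (forall k, mu (F k) = 0%E) -> mu (\bigcup_k F k) = 0%E.
Proof.
move=> F0; apply/eqP; rewrite eq_le outer_measure_ge0 andbT.
apply: le_trans (outer_measure_sigma_subadditive _ _) _.
by rewrite eseries0// => k _ _; exact: F0.
Qed.

Lemma outer_null_sub (T : Type) (mu : {outer_measure set T -> \bar R})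
    (A B : set T) : A `<=` B -> mu B = 0%E -> mu A = 0%E.
Proof.
move=> AB B0; apply/eqP; rewrite eq_le outer_measure_ge0 andbT -B0.
exact: le_outer_measure.
Qed.

Lemma outer_null_setU (T : Type) (mu : {outer_measure set T -> \bar R})
    (A B : set T) : mu A = 0%E -> mu B = 0%E -> mu (A `|` B) = 0%E.
Proof.
move=> A0 B0; apply/eqP; rewrite eq_le outer_measure_ge0 andbT.
by apply: le_trans (outer_measureU2 _ _ _) _; rewrite A0 B0 adde0.
Qed.

Lemma outer_null_countable (T : Type) (mu : {outer_measure set T -> \bar R})
    (I : countType) (F : I -> set T) :
  (forall k, mu (F k) = 0%E) -> mu (\bigcup_k F k) = 0%E.
Proof.
move=> F0; pose G m := if unpickle m is Some i then F i else set0.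
apply: (@outer_null_sub _ _ _ (\bigcup_m G m)).
  by move=> x [i _ Fx]; exists (pickle i) => //; rewrite /G pickleK.
apply: outer_null_bigcup => m; rewrite /G; case: unpickle => //.
Qed.

Lemma lebesgue_outer_hyperplane n (i : 'I_n) (c : R) :
  lebesgue_outer [set x : 'rV[R]_n | x 0 i = c] = 0%E.
Proof.
pose Q k := box (upd (const_mx (- k%:R)) i c) (upd (const_mx k%:R) i c).
apply: (@outer_null_sub _ (@lebesgue_outer R n) _ (\bigcup_k Q k)).
  move=> x /= xc; have /choice[m mP] j : exists k : nat, `|x 0 j| <= k%:R.
    by exists (Num.truncn `|x 0 j|).+1; rewrite ltW// truncnS_gt.
  exists (\sum_j m j)%N => // j; rewrite !mxE; case: eqP => [->|_].
    by rewrite xc lexx.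
  rewrite -ler_norml (le_trans (mP j))//.
  by rewrite ler_nat (bigD1 j)//= leq_addr.
apply: (@outer_null_bigcup _ (@lebesgue_outer R n)) => k.
rewrite -[LHS]/(lebesgue_outer _) lebesgue_outer_box.
  by rewrite /vol (bigD1 i)//= !mxE eqxx subrr mul0r.
move=> j; rewrite !mxE; case: eqP => // _.
by rewrite (@le_trans _ _ 0)// oppr_le0.
Qed.

Lemma outer_measure_seq (T : Type) (mu : {outer_measure set T -> \bar R})
    (I : eqType) (r : seq I) (F : I -> set T) (X : set T) :
  X `<=` \bigcup_(i in [set i | i \in r]) F i ->
  (mu X <= \sum_(i <- r) mu (F i))%E.
Proof.
elim: r X => [|i r IH] X XF.
  by rewrite big_nil (@outer_null_sub _ mu X set0)// => x /XF[].
rewrite big_cons; apply: (@le_trans _ _ (mu (F i) + mu (X `\` F i))%E).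
  apply: le_trans (outer_measureU2 _ _ _); apply: le_outer_measure => x Xx.
  by have [Fx|nFx] := pselect (F i x); [left|right].
apply: leeD2l; apply: IH => x [/XF[j /= ]].
by rewrite inE => /predU1P[->//|jr Fj] _; exists j.
Qed.

End null_sets.

(** * The Brunn-Minkowski inequality *)

Section brunn_minkowski.
Context {R : realType} {n : nat}.
Local Notation space := 'rV[R]_n.
Local Notation boxes := (seq (space * space)).
Implicit Types (q : space * space) (s t : boxes).

Definition obox (a b : space) : set space := [set x | forall i, a 0 i < x 0 i < b 0 i].

Lemma obox_sub (a b : space) : obox a b `<=` box a b.
Proof. by move=> x h i; have /andP[/ltW -> /ltW ->] := h i. Qed.

Lemma lebesgue_outer_obox (a b : space) : (forall i, a 0 i <= b 0 i) ->
  lebesgue_outer (obox a b) = (vol a b)%:E.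
Proof.
move=> ab; apply/eqP; rewrite eq_le -lebesgue_outer_box//.
rewrite le_outer_measure; last exact: obox_sub.
pose F (i : 'I_n) : set space := [set x | x 0 i = a 0 i] `|` [set x | x 0 i = b 0 i].
have F0 : lebesgue_outer (\bigcup_i F i) = 0%E.
  apply: (@outer_null_countable _ _ (@lebesgue_outer R n)) => i.
  by apply: outer_null_setU; exact: lebesgue_outer_hyperplane.
rewrite /= -[leRHS]adde0 -F0.
apply: le_trans (outer_measureU2 _ _ _); apply: le_outer_measure => x xab.
have [h|/existsNP[i]] := pselect (forall i, a 0 i < x 0 i < b 0 i); first by left.
move=> h; right; exists i => //; have /andP[xa xb] := xab i; apply: contrapT => nF.
apply: h; rewrite !lt_neqAle xa xb !andbT.
apply/andP; split; apply/eqP => e; apply: nF; [by left|by right].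
Qed.

Definition nondegenerate q := [forall i, q.1 0 i < q.2 0 i].
Definition separated q q' :=
  [exists i, (q.2 0 i <= q'.1 0 i) || (q'.2 0 i <= q.1 0 i)].
Definition volume s : R := \sum_(q <- s) vol q.1 q.2.
Definition interior s : set space :=
  [set x | exists2 q, q \in s & obox q.1 q.2 x].

Lemma vol_gt0 q : nondegenerate q -> 0 < vol q.1 q.2.
Proof. by move=> /forallP h; apply: prodr_gt0 => i _; rewrite subr_gt0. Qed.

Lemma volume_ge0 s : all nondegenerate s -> 0 <= volume s.
Proof.
move=> /allP h; rewrite /volume big_seq; apply: sumr_ge0 => q qs.
exact/ltW/vol_gt0/h.
Qed.

Lemma volume_gt0 s : all nondegenerate s -> s != [::] -> 0 < volume s.
Proof.
case: s => // q s /= /andP[q0 s0] _.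
by rewrite /volume big_cons ltr_wpDr ?vol_gt0// volume_ge0.
Qed.

Definition cutl i (c : R) q := (q.1, upd q.2 i (Num.min (q.2 0 i) c)).
Definition cutr i (c : R) q := (upd q.1 i (Num.max (q.1 0 i) c), q.2).
Definition clipl i c s := [seq q <- map (cutl i c) s | nondegenerate q].
Definition clipr i c s := [seq q <- map (cutr i c) s | nondegenerate q].

Definition face_vol i q : R := \prod_(j | j != i) (q.2 0 j - q.1 0 j).
(** The volume of the part of the boxes of s on the left of the hyperplane x_i
    = c, as a continuous function of c. *)
Definition left_volume i s (c : R) : R := \sum_(q <- s)
  face_vol i q * (Num.max (q.1 0 i) (Num.min (q.2 0 i) c) - q.1 0 i).

Lemma volumel i c s : all nondegenerate s -> volume (clipl i c s) = left_volume i s c.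
Proof.
move=> s0; rewrite /volume /clipl big_filter big_map /left_volume.
rewrite [LHS]big_mkcond/= !big_seq; apply: eq_bigr => q /(allP s0) /forallP q0.
have volE : vol q.1 (upd q.2 i (Num.min (q.2 0 i) c)) =
    face_vol i q * (Num.min (q.2 0 i) c - q.1 0 i).
  rewrite /vol (bigD1 i)//= mulrC mxE eqxx; congr (_ * _).
  by apply: eq_bigr => j /negPf ji; rewrite mxE ji.
have [h|h] := ltP (q.1 0 i) (Num.min (q.2 0 i) c).
  rewrite ifT; first by rewrite volE.
  by apply/forallP => j /=; rewrite mxE; case: eqP => [->|].
rewrite ifF; first by rewrite subrr mulr0.
apply/negP => /forallP /(_ i) /=; rewrite mxE eqxx => h'.
by move: h; rewrite leNgt h'.
Qed.

Lemma volumer i c s : all nondegenerate s ->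
  volume (clipr i c s) = volume s - left_volume i s c.
Proof.
move=> s0; rewrite /volume /clipr big_filter big_map /left_volume -sumrB.
rewrite [LHS]big_mkcond/= !big_seq; apply: eq_bigr => q /(allP s0) /forallP q0.
have volE : vol (upd q.1 i (Num.max (q.1 0 i) c)) q.2 =
    face_vol i q * (q.2 0 i - Num.max (q.1 0 i) c).
  rewrite /vol (bigD1 i)//= mulrC mxE eqxx; congr (_ * _).
  by apply: eq_bigr => j /negPf ji; rewrite mxE ji.
have -> : vol q.1 q.2 = face_vol i q * (q.2 0 i - q.1 0 i).
  by rewrite /vol (bigD1 i)//= mulrC.
have qi := q0 i.
have [h|h] := ltP (Num.max (q.1 0 i) c) (q.2 0 i).
  rewrite ifT.
    rewrite volE -mulrBr; congr (_ * _); move: h; rewrite gt_max => /andP[_ h].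
    by rewrite (min_idPr (ltW h)); lra.
  by apply/forallP => j /=; rewrite mxE; case: eqP => [->|].
rewrite ifF.
  rewrite -mulrBr; move: h; rewrite le_max leNgt qi/= => h.
  by rewrite (min_idPl h) (max_idPr (ltW qi)) subrr mulr0.
apply/negP => /forallP /(_ i) /=; rewrite mxE eqxx => h'.
by move: h; rewrite leNgt h'.
Qed.

Lemma left_volume_continuous i s : continuous (left_volume i s).
Proof.
rewrite /left_volume; elim: s => [|q s IH] x.
  under eq_fun do rewrite big_nil; exact: cvg_cst.
under eq_fun do rewrite big_cons.
apply: cvgD; last exact: IH.
apply: cvgMr; apply: cvgB; last exact: cvg_cst.
apply: (@continuous_max R R (fun=> q.1 0 i) (fun c => Num.min (q.2 0 i) c)).
  exact: cvg_cst.
apply: (@continuous_min R R (fun=> q.2 0 i) (fun c => c)); first exact: cvg_cst.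
exact: cvg_id.
Qed.

Lemma clipl_interior i c s x : interior (clipl i c s) x -> interior s x /\ x 0 i < c.
Proof.
move=> [q]; rewrite mem_filter => /andP[_ /mapP[q' q's ->]] /= h.
split.
  exists q' => // j; have := h j; rewrite !mxE; case: eqP => [->|//] /andP[-> /=].
  by rewrite lt_min => /andP[].
by have := h i; rewrite !mxE eqxx lt_min => /and3P[].
Qed.

Lemma clipr_interior i c s x : interior (clipr i c s) x -> interior s x /\ c < x 0 i.
Proof.
move=> [q]; rewrite mem_filter => /andP[_ /mapP[q' q's ->]] /= h.
split.
  exists q' => // j; have := h j; rewrite !mxE; case: eqP => [->|//] /andP[+ ->].
  by rewrite gt_max => /andP[->].
by have := h i; rewrite !mxE eqxx gt_max => /andP[/andP[]].
Qed.

Lemma clipl_separated i c s : pairwise separated s -> pairwise separated (clipl i c s).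
Proof.
move=> h; apply: pairwise_filter; rewrite pairwise_map; apply: sub_pairwise h.
move=> q q' /existsP[j qj]; apply/existsP; exists j; rewrite /= !mxE.
by case: eqP => // ji; rewrite -ji !ge_min; case/orP: qj => ->; rewrite ?orbT.
Qed.

Lemma clipr_separated i c s : pairwise separated s -> pairwise separated (clipr i c s).
Proof.
move=> h; apply: pairwise_filter; rewrite pairwise_map; apply: sub_pairwise h.
move=> q q' /existsP[j qj]; apply/existsP; exists j; rewrite /= !mxE.
by case: eqP => // ji; rewrite -ji !le_max; case/orP: qj => ->; rewrite ?orbT.
Qed.

Lemma clipl_size i c s : (size (clipl i c s) <= size s)%N.
Proof. by rewrite size_filter (leq_trans (count_size _ _))// size_map. Qed.

Lemma clipr_size i c s : (size (clipr i c s) <= size s)%N.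
Proof. by rewrite size_filter (leq_trans (count_size _ _))// size_map. Qed.

Lemma clipl_ltn i c s q : q \in s -> c <= q.1 0 i -> (size (clipl i c s) < size s)%N.
Proof.
move=> qs cq; rewrite size_filter -[X in (_ < X)%N](size_map (cutl i c)).
rewrite ltn_neqAle count_size andbT -all_count.
apply/negP => /allP /(_ _ (map_f _ qs)) /forallP /(_ i); rewrite /= mxE eqxx.
by rewrite lt_min (ltNge _ c) cq andbF.
Qed.

Lemma clipr_ltn i c s q : q \in s -> q.2 0 i <= c -> (size (clipr i c s) < size s)%N.
Proof.
move=> qs cq; rewrite size_filter -[X in (_ < X)%N](size_map (cutr i c)).
rewrite ltn_neqAle count_size andbT -all_count.
apply/negP => /allP /(_ _ (map_f _ qs)) /forallP /(_ i); rewrite /= mxE eqxx.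
by rewrite gt_max (ltNge c) cq andbF.
Qed.

Lemma clipl_neq0 i c s q : all nondegenerate s -> q \in s -> q.2 0 i <= c ->
  clipl i c s != [::].
Proof.
move=> s0 qs qc; apply/eqP => e; have : q \in clipl i c s; last by rewrite e.
rewrite mem_filter (allP s0 _ qs)/=; apply/mapP; exists q => //.
rewrite /cutl (min_idPl qc) [LHS]surjective_pairing; congr pair.
by apply/rowP => j; rewrite mxE; case: eqP => [->|].
Qed.

Lemma clipr_neq0 i c s q : all nondegenerate s -> q \in s -> c <= q.1 0 i ->
  clipr i c s != [::].
Proof.
move=> s0 qs qc; apply/eqP => e; have : q \in clipr i c s; last by rewrite e.
rewrite mem_filter (allP s0 _ qs)/=; apply/mapP; exists q => //.
rewrite /cutr (max_idPl qc) [LHS]surjective_pairing; congr pair.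
by apply/rowP => j; rewrite mxE; case: eqP => [->|].
Qed.

(** The intermediate value theorem provides a hyperplane that cuts off a
    prescribed volume. *)
Lemma left_volume_onto i s (v : R) : all nondegenerate s ->
  0 <= v <= volume s -> exists c, left_volume i s c = v.
Proof.
move=> s0 /andP[v0 vs].
pose lo := - \sum_(q <- s) `|q.1 0 i|; pose hi := \sum_(q <- s) `|q.2 0 i|.
have ltlo q : q \in s -> lo <= q.1 0 i.
  move=> qs; rewrite lerNl /lo (big_rem _ qs)/=.
  rewrite (le_trans (_ : _ <= `|q.1 0 i|))// ?lerDl ?sumr_ge0//.
  by rewrite -normrN ler_norm.
have lthi q : q \in s -> q.2 0 i <= hi.
  move=> qs; rewrite /hi (big_rem _ qs)/=.
  by rewrite (le_trans (ler_norm _))// lerDl sumr_ge0.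
have elo : left_volume i s lo = 0.
  rewrite /left_volume big_seq big1// => q qs.
  have /forallP/(_ i) q0 := allP s0 _ qs; have l := ltlo q qs.
  by rewrite (min_idPr (le_trans l (ltW q0))) (max_idPl l) subrr mulr0.
have ehi : left_volume i s hi = volume s.
  rewrite /left_volume /volume !big_seq; apply: eq_bigr => q qs.
  have /forallP/(_ i) q0 := allP s0 _ qs; have l := lthi q qs.
  by rewrite (min_idPl l) (max_idPr (ltW q0)) /vol (bigD1 i)//= mulrC.
have lohi : lo <= hi.
  by rewrite (@le_trans _ _ 0)// ?oppr_le0 sumr_ge0.
have [||c _ <-] := @IVT _ (left_volume i s) _ _ v lohi; last by exists c.
  exact/continuous_subspaceT/left_volume_continuous.
by rewrite elo ehi ge_min v0 le_max vs orbT.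
Qed.

(** For two boxes the set of midpoints contains the box with the averaged
    sides, whose length is at least their geometric mean, side by side. *)
Let brunn_minkowski_box q q' (C : set space) : nondegenerate q -> nondegenerate q' ->
  (forall x y, obox q.1 q.2 x -> obox q'.1 q'.2 y -> C (2^-1 *: (x + y))) ->
  ((Num.sqrt (vol q.1 q.2 * vol q'.1 q'.2))%:E <= lebesgue_outer C)%E.
Proof.
move=> /forallP q0 /forallP q'0 sub.
pose a := 2^-1 *: (q.1 + q'.1); pose b := 2^-1 *: (q.2 + q'.2).
have ab i : a 0 i <= b 0 i.
  by have := q0 i; have := q'0 i; rewrite !mxE; lra.
apply: (@le_trans _ _ (lebesgue_outer (obox a b))); last first.
  apply: le_outer_measure => z zab.
  pose th i := (z 0 i - a 0 i) / (b 0 i - a 0 i).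
  have ab' i : 0 < b 0 i - a 0 i by have := q0 i; have := q'0 i; rewrite !mxE; lra.
  have th01 i : 0 < th i < 1.
    have /andP[h1 h2] := zab i.
    apply/andP; split; first by rewrite divr_gt0// subr_gt0.
    by rewrite /th ltr_pdivrMr// mul1r ltrD2r.
  rewrite (_ : z = 2^-1 *: ((\row_i (q.1 0 i + th i * (q.2 0 i - q.1 0 i))) +
                            (\row_i (q'.1 0 i + th i * (q'.2 0 i - q'.1 0 i))))).
    have bd (u v t : R) : u < v -> 0 < t < 1 -> u < u + t * (v - u) < v.
      move=> uv /andP[t0 t1]; rewrite ltrDl mulr_gt0 ?subr_gt0//=.
      suff : t * (v - u) < 1 * (v - u) by lra.
      by rewrite ltr_pM2r ?subr_gt0.
    by apply: sub => i; rewrite mxE bd.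
  apply/rowP => i; rewrite !mxE.
  have -> : z 0 i = a 0 i + th i * (b 0 i - a 0 i).
    by rewrite divfK ?gt_eqF// addrC subrK.
  by rewrite !mxE; field.
rewrite lebesgue_outer_obox// lee_fin -[leRHS]ger0_norm ?vol_ge0//.
rewrite -sqrtr_sqr ler_sqrt ?sqr_ge0// expr2 /vol -!big_split/=.
apply: ler_prod => i _; rewrite !mxE.
have h := q0 i; have h' := q'0 i.
set u := q.2 0 i in h *; set v := q.1 0 i in h *.
set u' := q'.2 0 i in h' *; set v' := q'.1 0 i in h' *.
apply/andP; split; first by apply: mulr_ge0; lra.
rewrite -subr_ge0 (_ : _ - _ = (2^-1 * ((u - v) - (u' - v'))) ^+ 2) ?sqr_ge0//.
by field.
Qed.

(** A hyperplane separating two boxes of s cuts s into two lists with fewer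
    boxes; a parallel hyperplane cuts t in the same proportion. The midpoints
    of left parts and of right parts lie on different sides of the middle
    hyperplane, so that the inequalities for the two halves add up. *)
Let brunn_minkowski_step m :
  (forall s t (C : set space), (size s + size t <= m)%N ->
    all nondegenerate s -> all nondegenerate t ->
    pairwise separated s -> pairwise separated t -> s != [::] -> t != [::] ->
    (forall x y, interior s x -> interior t y -> C (2^-1 *: (x + y))) ->
    ((Num.sqrt (volume s * volume t))%:E <= lebesgue_outer C)%E) ->
  forall s t (C : set space), (size s + size t <= m.+1)%N -> (1 < size s)%N ->
    all nondegenerate s -> all nondegenerate t ->
    pairwise separated s -> pairwise separated t -> s != [::] -> t != [::] ->
    (forall x y, interior s x -> interior t y -> C (2^-1 *: (x + y))) ->
    ((Num.sqrt (volume s * volume t))%:E <= lebesgue_outer C)%E.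
Proof.
move=> IH s t C szm sz1 s0 t0 ss st sn tn sub.
have [i [c [q [q' [qs q's qc cq']]]]] : exists i c q q',
    [/\ q \in s, q' \in s, q.2 0 i <= c & c <= q'.1 0 i].
  case: s sz1 ss {szm s0 sn sub} => [//|q [//|q' s]] _ /= /andP[/andP[+ _] _].
  move=> /existsP[i /orP[h|h]].
    by exists i, (q'.1 0 i), q, q'; rewrite !inE !eqxx orbT.
  by exists i, (q.1 0 i), q', q; rewrite !inE !eqxx orbT.
set sl := clipl i c s; set sr := clipr i c s.
have sl0 : all nondegenerate sl by exact: filter_all.
have sr0 : all nondegenerate sr by exact: filter_all.
have vl : 0 < volume sl by apply: volume_gt0 => //; exact: clipl_neq0 qs qc.
have vr : 0 < volume sr by apply: volume_gt0 => //; exact: clipr_neq0 q's cq'.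
have vs : volume s = volume sl + volume sr.
  by rewrite volumer// volumel// addrC subrK.
have vs0 : 0 < volume s by rewrite vs addr_gt0.
have vt0 := volume_gt0 t0 tn.
pose la := volume sl / volume s; pose lb := volume sr / volume s.
have la0 : 0 < la by rewrite divr_gt0.
have lb0 : 0 < lb by rewrite divr_gt0.
have lab : la + lb = 1 by rewrite -mulrDl -vs divff// gt_eqF.
have [|c' ec'] := @left_volume_onto i t (la * volume t) t0.
  rewrite mulr_ge0 ?(ltW la0) ?(ltW vt0)//= -[leRHS]mul1r ler_pM2r//; lra.
set tl := clipl i c' t; set tr := clipr i c' t.
have tl0 : all nondegenerate tl by exact: filter_all.
have tr0 : all nondegenerate tr by exact: filter_all.
have vtl : volume tl = la * volume t by rewrite volumel.
have vtr : volume tr = lb * volume t.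
  by rewrite volumer// ec' -{1}[volume t]mul1r -mulrBl -lab; congr (_ * _); lra.
have neq0 r (v : R) : 0 < v -> volume r = v -> r != [::].
  by move=> v0; apply: contraPN => /eqP ->; rewrite /volume big_nil => h; rewrite -h ltxx in v0.
pose H := [set x : space | x 0 i <= 2^-1 * (c + c')].
rewrite [leRHS](@lebesgue_outer_halfspace R n i (2^-1 * (c + c')) C).
have sq (u v w : R) : 0 <= u -> 0 <= v -> 0 <= w ->
    Num.sqrt (u * v * (u * w)) = u * Num.sqrt (v * w).
  move=> u0 v0 w0; rewrite (_ : u * v * (u * w) = u ^+ 2 * (v * w)); last by ring.
  by rewrite sqrtrM ?sqr_ge0// sqrtr_sqr ger0_norm.
have vlE : volume sl = la * volume s by rewrite divfK// gt_eqF.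
have vrE : volume sr = lb * volume s by rewrite divfK// gt_eqF.
have -> : Num.sqrt (volume s * volume t) =
    Num.sqrt (volume sl * volume tl) + Num.sqrt (volume sr * volume tr).
  by rewrite vlE vrE vtl vtr !sq ?ltW// -mulrDl lab mul1r.
have szl : (size sl < size s)%N by exact: clipl_ltn q's cq'.
have szr : (size sr < size s)%N by exact: clipr_ltn qs qc.
have sztl : (size tl <= size t)%N by exact: clipl_size.
have sztr : (size tr <= size t)%N by exact: clipr_size.
rewrite EFinD; apply: leeD; apply: IH => //.
- by rewrite -ltnS (leq_trans _ szm)// -addSn leq_add.
- exact: clipl_separated.
- exact: clipl_separated.
- exact: neq0 vl _.
- by apply: neq0 vtl; rewrite mulr_gt0.
- move=> x y /clipl_interior[xs xc] /clipl_interior[yt yc]; split; first exact: sub.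
  by rewrite /= !mxE; lra.
- by rewrite -ltnS (leq_trans _ szm)// -addSn leq_add.
- exact: clipr_separated.
- exact: clipr_separated.
- exact: neq0 vr _.
- by apply: neq0 vtr; rewrite mulr_gt0.
- move=> x y /clipr_interior[xs xc] /clipr_interior[yt yc]; split; first exact: sub.
  by rewrite /= !mxE => h; lra.
Qed.

(** The multiplicative form of the inequality, by the Hadwiger-Ohmann induction on
    the number of boxes. *)
Lemma brunn_minkowski s t (C : set space) :
  all nondegenerate s -> all nondegenerate t ->
  pairwise separated s -> pairwise separated t -> s != [::] -> t != [::] ->
  (forall x y, interior s x -> interior t y -> C (2^-1 *: (x + y))) ->
  ((Num.sqrt (volume s * volume t))%:E <= lebesgue_outer C)%E.
Proof.
have [m szm] : exists m, (size s + size t <= m)%N by exists (size s + size t)%N.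
elim: m s t C szm => [|m IH] s t C szm s0 t0 ss st sn tn sub.
  by move: szm sn; rewrite leqn0 addn_eq0 => /andP[/eqP/size0nil -> _].
have [sz1|sz1] := ltnP 1 (size s); first exact: brunn_minkowski_step IH _ _ _ _ _ _ _ _ _ _ _ _.
have [tz1|tz1] := ltnP 1 (size t).
  rewrite mulrC; apply: brunn_minkowski_step IH _ _ _ _ _ _ _ _ _ _ _ _ => //.
    by rewrite addnC.
  by move=> x y ht hs; rewrite addrC; exact: sub.
case: s t sz1 tz1 s0 t0 sn tn sub {szm ss st IH} => [//|q [|//]] [//|q' [|//]] _ _.
move=> /andP[q0 _] /andP[q'0 _] _ _ sub.
rewrite /volume !big_cons !big_nil !addr0; apply: brunn_minkowski_box => //.
move=> x y qx q'y; apply: sub; [by exists q; rewrite ?inE|by exists q'; rewrite ?inE].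
Qed.

End brunn_minkowski.

(** * The isodiametric inequality *)

Section isodiametric.
Context {R : realType} {n : nat}.
Local Notation space := 'rV[R]_n.

Lemma enorm_ball_affine (r : R) : 0 < r ->
  [set x : space | enorm x < r] = [set 0 + r *: x | x in [set x : space | enorm x < 1]].
Proof.
move=> r0; apply/seteqP; split=> [x /= xr|_ [x /= x1 <-]].
  exists (r^-1 *: x); last by rewrite add0r scalerA divff ?gt_eqF// scale1r.
  by rewrite /= enormZ gtr0_norm ?invr_gt0// ltr_pdivrMl// mulr1.
by rewrite add0r enormZ gtr0_norm// -[ltRHS]mulr1 ltr_pM2l.
Qed.

Lemma unit_ball_fin_num : lebesgue_outer [set x : space | enorm x < 1] \is a fin_num.
Proof.
rewrite ge0_fin_numE ?outer_measure_ge0//.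
apply: (@le_lt_trans _ _ (lebesgue_outer (box (const_mx (-1)) (const_mx 1 : space)))).
  apply: le_outer_measure => x /= x1 i; rewrite !mxE -ler_norml.
  exact: le_trans (coord_le_enorm _ _) (ltW x1).
by rewrite lebesgue_outer_box ?ltry// => i; rewrite !mxE; lra.
Qed.

Lemma lebesgue_outer_ball (r : R) : 0 < r ->
  lebesgue_outer [set x : space | enorm x < r] = (unit_ball_volume R n * r ^+ n)%:E.
Proof.
move=> r0; rewrite enorm_ball_affine// lebesgue_outer_affine//.
by rewrite mulrC EFinM fineK// unit_ball_fin_num.
Qed.

Lemma unit_ball_volume_ge0 : 0 <= unit_ball_volume R n.
Proof. exact/fine_ge0/outer_measure_ge0. Qed.

(** The cells of the grid of mesh M / m on [-M, M]^n. *)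
Let mesh (M : R) (m : nat) (z : {ffun 'I_n -> 'I_m.*2}) : space * space :=
  (\row_i (- M + M / m%:R * (z i)%:R), \row_i (- M + M / m%:R * (z i).+1%:R)).

Let mesh_cover (M : R) m (x : space) : 0 < M -> (0 < m)%N ->
  (forall i, `|x 0 i| < M) -> exists z : {ffun 'I_n -> 'I_m.*2}, box (mesh M z).1 (mesh M z).2 x.
Proof.
move=> M0 m0 xM; have h0 : 0 < M / m%:R by rewrite divr_gt0// ltr0n.
have /choice[z zP] i : exists k : 'I_m.*2,
    - M + M / m%:R * k%:R <= x 0 i <= - M + M / m%:R * k.+1%:R.
  have := xM i; rewrite ltr_norml => /andP[x1 x2].
  pose y := (x 0 i + M) / (M / m%:R).
  have y0 : 0 <= y by rewrite divr_ge0 ?ltW//; lra.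
  have /andP[h1 h2] := truncn_itv y0.
  have km : (Num.truncn y < m.*2)%N.
    rewrite -(ltr_nat R); apply: le_lt_trans h1 _.
    rewrite /y ltr_pdivrMr// -addnn natrD.
    rewrite (_ : (m%:R + m%:R) * _ = 2 * M); first by lra.
    by field; rewrite pnatr_eq0 -lt0n.
  exists (Ordinal km) => /=.
  have -> : x 0 i = - M + M / m%:R * y.
    by rewrite mulrC divfK ?gt_eqF// addrC addrK.
  by rewrite !lerD2l !ler_pM2l// h1 ltW.
by exists (finfun z) => i; rewrite !mxE ffunE zP.
Qed.

(** The midpoints of A and -A lie in the ball of diameter diam A, so the
    Brunn-Minkowski inequality bounds the volume of A by the volume of this ball;
    A is first replaced with the cubes of a fine grid that meet A. *)
Lemma isodiametric_fine (A : set space) (d : R) (M e : R) : 0 < e -> 0 < M -> 0 <= d ->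
  (forall x, A x -> forall i, `|x 0 i| < M) ->
  (forall x y, A x -> A y -> enorm (x - y) <= d) ->
  (lebesgue_outer A <= (unit_ball_volume R n * (d / 2 + e) ^+ n)%:E)%E.
Proof.
move=> e0 M0 d0 AM Ad.
have [->|/eqP/set0P[x0 Ax0]] := pselect (A = set0).
  by rewrite outer_measure0 lee_fin mulr_ge0 ?unit_ball_volume_ge0// exprn_ge0//; lra.
have [m me] : exists m : nat, n%:R * (M / m.+1%:R) < e.
  have [|m h] := @natSinv_lt R (e / (n.+1%:R * M)); first by rewrite divr_gt0// mulr_gt0.
  exists m; apply: le_lt_trans (_ : n.+1%:R * M * m.+1%:R^-1 < _).
    rewrite mulrA ler_wpM2r ?invr_ge0// ler_wpM2r ?(ltW M0)//.
    by rewrite ler_nat.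
  by rewrite mulrC -ltr_pdivlMr ?mulr_gt0// .
set h := M / m.+1%:R in me *.
have h0 : 0 < h by rewrite divr_gt0.
pose meets (z : {ffun 'I_n -> 'I_m.+1.*2}) := `[< exists2 x, A x & box (mesh M z).1 (mesh M z).2 x >].
pose zs := [seq z <- enum {ffun 'I_n -> 'I_m.+1.*2} | meets z].
pose s := [seq mesh M z | z <- zs].
pose t := map (fun q : space * space => (- q.2, - q.1)) s.
have widthE (z : {ffun 'I_n -> 'I_m.+1.*2}) i : (mesh M z).2 0 i = (mesh M z).1 0 i + h.
  by rewrite !mxE -/h -natr1; ring.
have s0 : all (@nondegenerate _ _) s.
  apply/allP => _ /mapP[z _ ->]; apply/forallP => i.
  by rewrite widthE ltrDl.
have t0 : all (@nondegenerate _ _) t.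
  apply/allP => _ /mapP[q /(allP s0)/forallP q0 ->]; apply/forallP => i.
  by rewrite !mxE ltrN2.
have ss : pairwise (@separated _ _) s.
  rewrite pairwise_map; apply: pairwise_filter.
  apply: (@sub_pairwise _ (fun z z' => z != z')); last first.
    by rewrite -uniq_pairwise enum_uniq.
  move=> z z' zz'; apply/existsP.
  have [i zi] : exists i, z i != z' i.
    apply/existsP; apply: contraNT zz'; rewrite negb_exists => /forallP e1.
    by apply/eqP/ffunP => i; apply/eqP; have := e1 i; rewrite negbK.
  exists i; rewrite !mxE !lerD2l !ler_pM2l// !ler_nat.
  by have := zi; rewrite -(inj_eq val_inj) neq_ltn.
have st : pairwise (@separated _ _) t.
  rewrite pairwise_map; apply: sub_pairwise ss => q q' /existsP[i qi].
  apply/existsP; exists i; rewrite /= !mxE !lerN2.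
  by case/orP: qi => ->; rewrite ?orbT.
have [z0 z0P] := @mesh_cover M m.+1 x0 M0 isT (AM _ Ax0).
have z0s : mesh M z0 \in s.
  apply: map_f; rewrite mem_filter mem_enum andbT; apply/asboolP.
  by exists x0.
have sn : s != [::] by apply: contraTneq z0s => ->.
have tn : t != [::] by rewrite /t; case: (s) sn.
have volt : volume t = volume s.
  rewrite /volume big_map; apply: eq_bigr => q _.
  by apply: eq_bigr => i _; rewrite !mxE opprK addrC.
have As : (lebesgue_outer A <= (volume s)%:E)%E.
  apply: (@le_trans _ _ (\sum_(q <- s) lebesgue_outer (box q.1 q.2))%E).
    apply: (@outer_measure_seq R _ (@lebesgue_outer R n)) => x Ax.
    have [z zP] := @mesh_cover M m.+1 x M0 isT (AM _ Ax).
    exists (mesh M z) => //=; apply: map_f; rewrite mem_filter mem_enum andbT.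
    by apply/asboolP; exists x.
  rewrite /volume -sumEFin big_seq [leRHS]big_seq; apply: lee_sum => q qs.
  rewrite lebesgue_outer_box// => i.
  by have /forallP/(_ i)/ltW := allP s0 _ qs.
apply: le_trans As _.
have -> : volume s = Num.sqrt (volume s * volume t).
  by rewrite volt -expr2 sqrtr_sqr ger0_norm// volume_ge0.
have de : 0 < d / 2 + e by lra.
rewrite -lebesgue_outer_ball//.
apply: brunn_minkowski => //= x y [q qs xq] [q' + yq'].
move=> /mapP[q'' q''s q'E].
have ex q1 : q1 \in s -> exists2 x, A x & forall y, obox q1.1 q1.2 y -> enorm (y - x) < e.
  move=> /mapP[z]; rewrite mem_filter => /andP[/asboolP[x1 Ax1 x1z] _] ->.
  exists x1 => // y1 y1z; apply: le_lt_trans me.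
  apply: enorm_le_bound => i; have /andP[a1 a2] := y1z i; have /andP[a3 a4] := x1z i.
  rewrite !mxE ler_norml; move: a2 a4; rewrite !widthE; lra.
have [a Aa xa] := ex _ qs; have [b Ab yb] := ex _ q''s.
have h1 := xa _ xq.
have h2 : enorm (y + b) < e.
  rewrite -enormN opprD; apply: yb => i; have := yq' i; rewrite q'E /= !mxE; lra.
rewrite enormZ gtr0_norm ?invr_gt0// (_ : x + y = (x - a) + ((a - b) + (y + b))).
  have h3 := enormD (x - a) ((a - b) + (y + b)); have h4 := enormD (a - b) (y + b).
  have h5 := Ad _ _ Aa Ab.
  have h6 : enorm (x - a + (a - b + (y + b))) < d + 2 * e by lra.
  lra.
by rewrite addrA -!addrA (addrCA (- b)) addNr addr0 !addrA subrK.
Qed.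

Theorem isodiametric (A : set space) (d : R) : 0 <= d ->
  (forall x y, A x -> A y -> enorm (x - y) <= d) ->
  (lebesgue_outer A <= (unit_ball_volume R n * (d / 2) ^+ n)%:E)%E.
Proof.
move=> d0 Ad.
have [->|/eqP/set0P[x0 Ax0]] := pselect (A = set0).
  by rewrite outer_measure0 lee_fin mulr_ge0 ?unit_ball_volume_ge0// exprn_ge0//; lra.
pose M := enorm x0 + d + 1.
have M0 : 0 < M by have := enorm_ge0 x0; rewrite /M; lra.
have AM x : A x -> forall i, `|x 0 i| < M.
  move=> Ax i; apply: le_lt_trans (coord_le_enorm _ _) _.
  rewrite -(subrK x0 x); apply: le_lt_trans (enormD _ _) _.
  by have := Ad _ _ Ax Ax0; rewrite /M; lra.
have fineA e : 0 < e -> (lebesgue_outer A <= (unit_ball_volume R n * (d / 2 + e) ^+ n)%:E)%E.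
  by move=> e0; apply: (isodiametric_fine e0 M0 d0 AM Ad).
have Afin : lebesgue_outer A \is a fin_num.
  rewrite ge0_fin_numE ?outer_measure_ge0//.
  by apply: le_lt_trans (fineA 1 ltr01) _; rewrite ltry.
move: fineA; rewrite -(fineK Afin) => fineA; rewrite lee_fin leNgt; apply/negP => lt.
have cont : (unit_ball_volume R n * (d / 2 + e) ^+ n) @[e --> 0^'+] -->
    unit_ball_volume R n * (d / 2) ^+ n.
  apply: cvg_at_right_filter.
  have c1 : d / 2 + e @[e --> (0 : R)] --> d / 2 + 0.
    by apply: cvgD; [exact: cvg_cst|exact: cvg_id].
  have := @continuous_comp _ _ _ (fun e => d / 2 + e) (fun x => x ^+ n) (0 : R) c1.
  rewrite addr0 => /(_ (@exprn_continuous _ _ _)) c2.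
  have c3 : (d / 2 + z) ^+ n @[z --> (0 : R)] --> (d / 2 + 0) ^+ n := c2.
  by rewrite addr0 in c3; exact: cvgMr.
have [e [e0 /= he]] : exists e, 0 < e /\
    unit_ball_volume R n * (d / 2 + e) ^+ n < fine (lebesgue_outer A).
  near (0:R)^'+ => e; exists e; split; first by near: e; exact: nbhs_right_gt.
  by near: e; apply: (cvgr_lt _ cont).
by have := fineA e e0; rewrite lee_fin leNgt he.
Unshelve. all: by end_near. Qed.

End isodiametric.

(** * Hausdorff measure on hyperplanes *)

Section coordinate_insertion.
Context {R : realType} {n : nat}.
Implicit Types (x : 'rV[R]_n.+1) (y z : 'rV[R]_n) (i : 'I_n.+1) (t : R).

Definition ins i t y : 'rV[R]_n.+1 := \row_j oapp (y 0) t (unlift i j).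
Definition del i x : 'rV[R]_n := \row_j x 0 (lift i j).

Lemma ins_pivot i t y : ins i t y 0 i = t.
Proof. by rewrite mxE unlift_none. Qed.

Lemma ins_lift i t y j : ins i t y 0 (lift i j) = y 0 j.
Proof. by rewrite mxE liftK. Qed.

Lemma insK i t : cancel (ins i t) (del i).
Proof. by move=> y; apply/rowP => j; rewrite mxE ins_lift. Qed.

Lemma delK i x : ins i (x 0 i) (del i x) = x.
Proof.
apply/rowP => j; case: (unliftP i j) => [k ->|->]; last by rewrite ins_pivot.
by rewrite ins_lift mxE.
Qed.

Lemma dot_lift i x x' : dot x x' = x 0 i * x' 0 i + dot (del i x) (del i x').
Proof.
rewrite /dot (bigD1_ord i)//=; congr (_ + _).
by apply: eq_bigr => j _; rewrite !mxE.
Qed.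

Lemma delB i x x' : del i (x - x') = del i x - del i x'.
Proof. by apply/rowP => j; rewrite !mxE. Qed.

Lemma enorm_ins i t y z : enorm (ins i t y - ins i t z) = enorm (y - z).
Proof.
by rewrite /enorm (dot_lift i) delB !insK !mxE !unlift_none subrr mul0r add0r.
Qed.

End coordinate_insertion.

Section hausdorff_premeasure.
Context {R : realType} {n : nat} (s : nat) (delta : R).
Local Notation space := 'rV[R]_n.
Implicit Types (A C : set space).

Definition hausdorff_delta : set space -> \bar R := cover_outer (hausdorff_gauge s delta).

HB.instance Definition _ := isOuterMeasure.Build R space hausdorff_delta
  (cover_outer0 (@hausdorff_gauge0 R n s delta) (@hausdorff_gauge_ge0 R n s delta))
  (cover_outer_ge0 (@hausdorff_gauge_ge0 R n s delta))
  (@le_cover_outer _ _ (@hausdorff_gauge R n s delta))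
  (cover_outer_sigma_subadditive (@hausdorff_gauge_ge0 R n s delta)).

Lemma hausdorff_delta_gauge A : (hausdorff_delta A <= hausdorff_gauge s delta A)%E.
Proof.
apply: le_cover_outer_weight; first exact: hausdorff_gauge0.
exact: hausdorff_gauge_ge0.
Qed.

Lemma ediam_ge0 A : A <> set0 -> (0 <= ediam A)%E.
Proof.
move=> /eqP/set0P[x Ax]; apply: (@le_trans _ _ (enorm (x - x))%:E).
  by rewrite lee_fin sqrtr_ge0.
by apply: ereal_sup_ubound; exists x => //; exists x.
Qed.

Lemma ediam_leP A (d : R) : (ediam A <= d%:E)%E <->
  (forall x y, A x -> A y -> enorm (x - y) <= d).
Proof.
split=> [h x y Ax Ay|h].
  rewrite -lee_fin; apply: le_trans h.
  by apply: ereal_sup_ubound; exists x => //; exists y.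
by apply: ge_ereal_sup => _ [x Ax [y Ay <-]]; rewrite lee_fin h.
Qed.

Lemma ediam_fin A (d : R) : A <> set0 -> (ediam A <= d%:E)%E ->
  (fine (ediam A))%:E = ediam A.
Proof.
move=> A0 Ad; rewrite fineK// ge0_fin_numE ?ediam_ge0//.
by rewrite (le_lt_trans Ad)// ltry.
Qed.

Lemma hausdorff_gauge_le A (d : R) : A <> set0 -> (ediam A <= d%:E)%E -> d <= delta ->
  (hausdorff_gauge s delta A <= (unit_ball_volume R s * (d / 2) ^+ s)%:E)%E.
Proof.
move=> A0 Ad dd; rewrite /hausdorff_gauge; case: asboolP => // _.
rewrite ifT; last by rewrite (le_trans Ad)// lee_fin.
have := Ad; rewrite -(ediam_fin A0 Ad) lee_fin => Ad'.
rewrite lee_fin ler_wpM2l//; first exact/fine_ge0/outer_measure_ge0.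
have h : 0 <= fine (ediam A) by apply: fine_ge0; exact: ediam_ge0.
by rewrite lerXn2r// ?nnegrE; lra.
Qed.

Lemma hausdorff_gauge_fin A : A <> set0 -> (hausdorff_gauge s delta A < +oo)%E ->
  (ediam A <= delta%:E)%E.
Proof.
by move=> A0; rewrite /hausdorff_gauge; case: asboolP => // _; case: ifP.
Qed.

Lemma le_hausdorff_gauge A C : A `<=` C ->
  (hausdorff_gauge s delta A <= hausdorff_gauge s delta C)%E.
Proof.
move=> AC; have [->|A0] := pselect (A = set0).
  by rewrite hausdorff_gauge0 hausdorff_gauge_ge0.
have C0 : C <> set0 by move=> C0; apply: A0; rewrite -subset0 -C0.
have [->|] := eqVneq (hausdorff_gauge s delta C) +oo%E; first by rewrite leey.
rewrite -ltey => /(hausdorff_gauge_fin C0) Cd.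
have AleC : (ediam A <= ediam C)%E.
  apply: ge_ereal_sup => _ [x Ax [y Ay <-]]; apply: ereal_sup_ubound.
  by exists x; [exact: AC|exists y => //; exact: AC].
apply: (@le_trans _ _ (unit_ball_volume R s * (fine (ediam C) / 2) ^+ s)%:E).
  apply: hausdorff_gauge_le => //; first by rewrite (ediam_fin C0 Cd).
  by rewrite -lee_fin (ediam_fin C0 Cd).
by rewrite /hausdorff_gauge; case: asboolP => // _; rewrite Cd.
Qed.

End hausdorff_premeasure.

Section hausdorff_le_lebesgue.
Context {R : realType} {n : nat}.
Local Notation space := 'rV[R]_n.
Implicit Types (a b : space).

(** The sides of the box are comparable, which bounds its diameter in terms of
    its volume. *)
Definition fat_box (s : R) a b :=
  forall i, s / 2 <= b 0 i - a 0 i <= s.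

Lemma halve_box i a b : let c := (a 0 i + b 0 i) / 2 in a 0 i <= b 0 i ->
  box a b `<=` box a (upd b i c) `|` box (upd a i c) b.
Proof.
move=> c ab x xab; have [xc|cx] := leP (x 0 i) c.
  left=> j; rewrite mxE; case: eqP => [->|_]; last exact: xab.
  by have /andP[-> _] := xab i.
right=> j; rewrite mxE; case: eqP => [->|_]; last exact: xab.
by have /andP[_ ->] := xab i; rewrite ltW.
Qed.

Lemma vol_halve i a b : let c := (a 0 i + b 0 i) / 2 in
  vol a b = vol a (upd b i c) + vol (upd a i c) b.
Proof.
move=> c; rewrite /vol [RHS](congr2 +%R (bigD1 i isT) (bigD1 i isT))/=.
rewrite (bigD1 i)//= !mxE eqxx.
rewrite [in X in _ = _ * X + _](eq_bigr (fun j => b 0 j - a 0 j)); last first.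
  by move=> j /negPf ji; rewrite mxE ji.
rewrite [in X in _ = _ + _ * X](eq_bigr (fun j => b 0 j - a 0 j)); last first.
  by move=> j /negPf ji; rewrite mxE ji.
by rewrite -mulrDl; congr (_ * _); rewrite /c; lra.
Qed.

(** Induction on the number of halvings of sides: a side longer than s is cut
    into halves of length at least s / 2. *)
Lemma fat_box_partition (h : {outer_measure set space -> \bar R}) (kappa s : R) :
  0 < s ->
  (forall a b, fat_box s a b -> (h (box a b) <= (kappa * vol a b)%:E)%E) ->
  forall a b, (forall i, s / 2 <= b 0 i - a 0 i) ->
  (h (box a b) <= (kappa * vol a b)%:E)%E.
Proof.
move=> s0 fat.
suff H M : forall (e : 'I_n -> nat) a b, (\sum_i e i <= M)%N ->
    (forall i, s / 2 <= b 0 i - a 0 i <= 2 ^+ e i * s) ->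
    (h (box a b) <= (kappa * vol a b)%:E)%E.
  move=> a b ab.
  have /choice[e eP] i : exists k : nat, b 0 i - a 0 i <= 2 ^+ k * s.
    exists (Num.truncn `|(b 0 i - a 0 i) / s|).+1.
    rewrite -ler_pdivrMr//; apply: le_trans (ler_norm _) _.
    apply: le_trans (ltW (truncnS_gt _)) _.
    by rewrite -natrX ler_nat ltnW// ltn_expl.
  by apply: (H _ e a b (leqnn _)) => i; rewrite ab eP.
elim: M => [|M IH] e a b eM ab.
  apply: fat => i; have := ab i.
  by have := eM; rewrite leqn0 sum_nat_eq0 => /forallP/(_ i)/eqP ->; rewrite mul1r.
have [fab|/existsNP[i nfab]] := pselect (forall i, b 0 i - a 0 i <= s).
  by apply: fat => i; have /andP[h1 _] := ab i; rewrite h1 fab.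
have /andP[ab1 ab2] := ab i.
have {}nfab : s < b 0 i - a 0 i by rewrite ltNge; exact/negP.
have e0 : (0 < e i)%N.
  by rewrite lt0n; apply/eqP => e0; move: ab2; rewrite e0 mul1r leNgt nfab.
pose e' j := if j == i then (e i).-1 else e j.
have e'M : (\sum_j e' j <= M)%N.
  rewrite -ltnS (leq_trans _ eM)// [ltnRHS](bigD1 i)//= (bigD1 i)//= /e' eqxx.
  rewrite -addSn prednK//; apply/eq_leq; congr (_ + _)%N.
  by apply: eq_bigr => j /negPf ->.
have e2 : 2 ^+ e i = 2 * 2 ^+ (e i).-1 :> R by rewrite -exprS prednK.
have ab3 : b 0 i - a 0 i <= 2 * (2 ^+ (e i).-1 * s) by rewrite mulrA -e2.
apply: le_trans (le_outer_measure _ _ _ (@halve_box i a b _)) _; first by lra.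
apply: le_trans (outer_measureU2 _ _ _) _.
rewrite (vol_halve i) mulrDr EFinD; apply: leeD; apply: (IH e') => //.
- move=> j; rewrite mxE /e'; case: eqP => [->|_]; last exact: ab.
  by apply/andP; split; lra.
- move=> j; rewrite mxE /e'; case: eqP => [->|_]; last exact: ab.
  by apply/andP; split; lra.
Qed.

Lemma cvg_prodr (I T : Type) (r : seq I) (F : set_system T) {FF : Filter F}
    (f : I -> T -> R) (l : I -> R) : (forall i, f i x @[x --> F] --> l i) ->
  \prod_(i <- r) f i x @[x --> F] --> \prod_(i <- r) l i.
Proof.
move=> fl; elim: r => [|i r IH].
  by rewrite big_nil; under eq_fun do rewrite big_nil; exact: cvg_cst.
rewrite big_cons; under eq_fun do rewrite big_cons.
exact: cvgM.
Qed.

(** A bound on fat boxes of small diameter extends to all sets: boxes can be cut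
    into fat boxes, and Lebesgue outer measure is an infimum over box covers. *)
Lemma outer_le_lebesgue (h : {outer_measure set space -> \bar R}) (kappa eta : R) :
  0 < kappa -> 0 < eta ->
  (forall s a b, 0 < s -> s <= eta -> fat_box s a b ->
     (h (box a b) <= (kappa * vol a b)%:E)%E) ->
  forall X, (h X <= kappa%:E * lebesgue_outer X)%E.
Proof.
move=> k0 eta0 fat X.
have nondeg a b : (forall i, a 0 i < b 0 i) -> (h (box a b) <= (kappa * vol a b)%:E)%E.
  move=> ab.
  have /choice[m mP] i : exists k : nat, k.+1%:R^-1 < b 0 i - a 0 i.
    by apply: natSinv_lt; rewrite subr_gt0.
  have [k ke] := natSinv_lt eta0.
  pose s : R := (k + \sum_i m i).+1%:R^-1.
  have s0 : 0 < s by rewrite invr_gt0.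
  apply: (fat_box_partition s0) => [c d|i].
    apply: fat => //; apply: le_trans (ltW ke).
    by rewrite lef_pV2 ?posrE// ler_nat ltnS leq_addr.
  have : s <= (m i).+1%:R^-1.
    rewrite lef_pV2 ?posrE// ler_nat ltnS (leq_trans _ (leq_addl _ _))//.
    by rewrite (bigD1 i)//= leq_addr.
  by have := mP i; move: (_^-1) => u; lra.
apply: (@outer_le_cover_outer R _ _ (@box_gauge R n) h kappa id) => //.
  exact: box_gauge_ge0.
move=> C; have [->|C0] := pselect (C = set0).
  by rewrite outer_measure0 box_gauge0 mule0.
have [->|fin] := eqVneq (box_gauge C) +oo%E.
  by rewrite mulry gtr0_sg// mul1e leey.
have [|[a b] /= [ab ->]] := @box_gauge_fin _ _ C _ C0; first by rewrite ltey.
rewrite box_gauge_box// -EFinM.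
have bound e : 0 < e -> (h (box a b) <= (kappa * vol a (b + const_mx e))%:E)%E.
  move=> e0; apply: le_trans (nondeg _ _ _); last first.
    by move=> i; rewrite !mxE; have := ab i; lra.
  apply: le_outer_measure => x xab i; have /andP[-> /=] := xab i.
  by rewrite !mxE; lra.
have hfin : h (box a b) \is a fin_num.
  rewrite ge0_fin_numE ?outer_measure_ge0//.
  by apply: le_lt_trans (bound 1 ltr01) _; rewrite ltry.
move: bound; rewrite -(fineK hfin) => bound; rewrite lee_fin leNgt; apply/negP => lt.
have cont : kappa * vol a (b + const_mx e) @[e --> 0^'+] --> kappa * vol a b.
  apply: cvg_at_right_filter; apply: cvgMr.
  have -> : vol a b = \prod_i (b 0 i + 0 - a 0 i).
    by apply: eq_bigr => i _; rewrite addr0.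
  rewrite /vol; under eq_fun do under eq_bigr do rewrite !mxE.
  apply: cvg_prodr => i; apply: cvgB; last exact: cvg_cst.
  by apply: cvgD; [exact: cvg_cst|exact: cvg_id].
have [e [e0 he]] : exists e, 0 < e /\
    kappa * vol a (b + const_mx e) < fine (h (box a b)).
  near (0:R)^'+ => e; exists e; split; first by near: e; exact: nbhs_right_gt.
  by near: e; apply: (cvgr_lt _ cont).
by have := bound e e0; rewrite lee_fin leNgt he.
Unshelve. all: by end_near. Qed.

Lemma unit_ball_volume_gt0 : 0 < unit_ball_volume R n.
Proof.
pose r : R := n.+1%:R^-1.
have r0 : 0 < r by rewrite invr_gt0.
rewrite /unit_ball_volume -lte_fin fineK ?unit_ball_fin_num//.
apply: (@lt_le_trans _ _ (lebesgue_outer (box (const_mx (- r)) (const_mx r : space)))).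
  rewrite lebesgue_outer_box; last by move=> i; rewrite !mxE; lra.
  by rewrite lte_fin; apply: prodr_gt0 => i _; rewrite !mxE; lra.
apply: le_outer_measure => x xr /=.
apply: (@le_lt_trans _ _ (n%:R * r)).
  by apply: enorm_le_bound => i; have := xr i; rewrite !mxE -ler_norml.
by rewrite ltr_pdivrMr// mul1r ltr_nat.
Qed.

Lemma lebesgue_outer_ball_at (c : space) (r : R) : 0 < r ->
  lebesgue_outer [set x | enorm (x - c) < r] = (unit_ball_volume R n * r ^+ n)%:E.
Proof.
move=> r0; rewrite -lebesgue_outer_ball//.
rewrite (_ : [set x | _] = [set c + 1 *: x | x in [set x : space | enorm x < r]]).
  by rewrite lebesgue_outer_affine// expr1n mul1e.
apply/seteqP; split=> [x /= xr|_ [x /= xr <-]]; last by rewrite scale1r addrC addKr.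
by exists (x - c) => //; rewrite scale1r addrC subrK.
Qed.

Lemma enorm_continuous (c : space) : continuous (fun x : space => enorm (x - c)).
Proof.
move=> x; have FF : Filter (nbhs (x : ('rV[R]_n : topologicalType))).
  exact: nbhs_filter.
apply/(@cvgrPdist_lt _ _ _ _ FF) => e e0.
near=> y; apply: (@le_lt_trans _ _ (enorm (x - y))).
  rewrite ler_distl; apply/andP; split.
    have := enormD (y - x) (x - c); rewrite addrA subrK (enorm_dist y x); lra.
  by have := enormD (x - y) (y - c); rewrite addrA subrK addrC; lra.
have xy : ball (x : 'rV[R]_n) (e / n.+1%:R) y.
  by near: y; apply: nbhsx_ballx; rewrite divr_gt0.
apply: (@le_lt_trans _ _ (n%:R * (e / n.+1%:R))).
  by apply: enorm_le_bound => i; rewrite !mxE; have [_ /(_ 0 i)/ltW] := xy.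
by rewrite mulrA ltr_pdivrMr// mulrC ltr_pM2l// ltr_nat.
Unshelve. all: by end_near. Qed.

Lemma borel_ball (c : space) (r : R) : <<s open >> [set x : space | enorm (x - c) < r].
Proof.
apply: sub_sigma_algebra.
by have /continuousP/(_ [set y | y < r]) := @enorm_continuous c; apply; exact: open_lt.
Qed.

Section delta.
Variable delta : R.
Hypothesis delta0 : 0 < delta.
Let eta : R := delta / n.+1%:R.
Let eta0 : 0 < eta. Proof. by rewrite divr_gt0. Qed.
Let h : {outer_measure set space -> \bar R} := hausdorff_delta n delta.
Let omega := unit_ball_volume R n.

Let box_neq0 a b : (forall i, a 0 i <= b 0 i) -> box a b <> set0.
Proof. by move=> ab e; have : box a b a; [move=> i; rewrite lexx ab|rewrite e]. Qed.

(** The crude bound from which the improvements start: a fat box covers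
    itself. *)
Lemma hausdorff_delta_fat_box s a b : 0 < s -> s <= eta -> fat_box s a b ->
  (h (box a b) <= ((1 + omega * n%:R ^+ n) * vol a b)%:E)%E.
Proof.
move=> s0 se fab.
have ab i : a 0 i <= b 0 i by have /andP[] := fab i; lra.
have diam : (ediam (box a b) <= (n%:R * s)%:E)%E.
  apply/ediam_leP => x y xab yab; apply: enorm_le_bound => i; rewrite !mxE.
  have /andP[? ?] := xab i; have /andP[? ?] := yab i; have /andP[_ ?] := fab i.
  by rewrite ler_norml; lra.
have nse : n%:R * s <= delta.
  apply: (@le_trans _ _ (n.+1%:R * eta)); last first.
    by rewrite /eta mulrC divfK// pnatr_eq0.
  by apply: ler_pM => //; [exact: ltW|rewrite ler_nat].
apply: le_trans (hausdorff_delta_gauge _ _ _) _.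
apply: le_trans (hausdorff_gauge_le n (box_neq0 ab) diam nse) _.
have volab : (s / 2) ^+ n <= vol a b.
  rewrite -[in _ ^+ n](card_ord n) -prodr_const; apply: ler_prod => i _.
  by have /andP[-> _] := fab i; rewrite divr_ge0// ltW.
rewrite lee_fin -/omega -mulrA exprMn mulrA.
have w0 : 0 <= omega * n%:R ^+ n.
  by rewrite mulr_ge0 ?exprn_ge0//; exact: unit_ball_volume_ge0.
apply: (@le_trans _ _ (omega * n%:R ^+ n * vol a b)); first by rewrite ler_wpM2l.
by rewrite mulrDl mul1r lerDr vol_ge0.
Qed.

Let theta : R := Num.min (omega / 4 ^+ n) 2^-1.

(** Covering the ball inscribed in a fat box by itself improves a bound
    h <= kappa * Lebesgue. *)
Lemma hausdorff_delta_improve kappa : 1 <= kappa ->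
  (forall X, (h X <= kappa%:E * lebesgue_outer X)%E) ->
  forall X, (h X <= (theta + kappa * (1 - theta))%:E * lebesgue_outer X)%E.
Proof.
move=> k1 hk.
have th0 : 0 < theta.
  by rewrite /theta lt_min invr_gt0 ltr0n andbT divr_gt0// ?unit_ball_volume_gt0// exprn_gt0.
have th1 : theta <= 2^-1 by rewrite /theta ge_min lexx orbT.
apply: (@outer_le_lebesgue h _ eta) => //; first by nra.
move=> s a b s0 se fab.
have ab i : a 0 i <= b 0 i by have /andP[] := fab i; lra.
pose c : space := 2^-1 *: (a + b); pose r := s / 4.
have r0 : 0 < r by rewrite divr_gt0.
pose B := [set x | enorm (x - c) < r].
have BP : B `<=` box a b.
  move=> x /= xB i; have /andP[fab1 _] := fab i.
  have := le_lt_trans (coord_le_enorm _ i) xB.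
  by rewrite !mxE ltr_norml /r => /andP[h1 h2]; apply/andP; split; lra.
have Bc : B c by rewrite /B/= subrr /enorm /dot big1 ?sqrtr0// => i _; rewrite mxE mul0r.
have LB : lebesgue_outer B = (omega * r ^+ n)%:E by exact: lebesgue_outer_ball_at.
have hB : (h B <= lebesgue_outer B)%E.
  apply: le_trans (hausdorff_delta_gauge _ _ _) _; rewrite LB.
  rewrite (_ : r = (2 * r) / 2); last by rewrite mulrC mulKf.
  apply: hausdorff_gauge_le.
  - by move=> B0; rewrite B0 in Bc.
  - apply/ediam_leP => x y; rewrite /B/= => xB yB.
    rewrite (_ : x - y = (x - c) + (c - y)).
      by have := enormD (x - c) (c - y); rewrite (enorm_dist c y); lra.
    by rewrite addrA subrK.
  - rewrite /r; apply: le_trans (_ : s <= _); first by lra.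
    apply: le_trans se _; rewrite /eta ler_pdivrMr//.
    by rewrite -[X in X <= _]mulr1 ler_wpM2l ?(ltW delta0)// ler1n.
have LP : lebesgue_outer (box a b) = (vol a b)%:E by exact: lebesgue_outer_box.
have := @borel_lebesgue R n B (borel_ball _ _) (box a b).
rewrite (setIidr BP) LB LP => splitP.
have diffE : lebesgue_outer (box a b `&` ~` B) = (vol a b - omega * r ^+ n)%:E.
  move: splitP; case: (lebesgue_outer (box a b `&` ~` B)) => // v.
  by rewrite -EFinD => -[->]; congr EFin; lra.
have volle : theta * vol a b <= omega * r ^+ n.
  apply: (@le_trans _ _ (omega / 4 ^+ n * s ^+ n)); last first.
    by rewrite /r exprMn exprVn mulrA mulrAC.
  apply: ler_pM; rewrite ?vol_ge0 ?(ltW th0)//; first by rewrite ge_min lexx.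
  rewrite -[in s ^+ n](card_ord n) -prodr_const; apply: ler_prod => i _.
  by have /andP[_ ->] := fab i; rewrite subr_ge0 ab.
apply: (@le_trans _ _ (h B + h (box a b `&` ~` B))%E).
  apply: le_trans (outer_measureU2 _ _ _); apply: le_outer_measure => x xab.
  by have [|] := pselect (B x); [left|right].
apply: (@le_trans _ _ (lebesgue_outer B + kappa%:E * lebesgue_outer (box a b `&` ~` B))%E).
  exact: leeD.
rewrite LB diffE -EFinM -EFinD lee_fin.
by have := vol_ge0 ab; nra.
Qed.

(** Iterating the improvement drives the constant to its fixed point 1; the
    bound for the premeasures does not depend on the scale delta. *)
Lemma hausdorff_delta_le X : (h X <= lebesgue_outer X)%E.
Proof.
have th0 : 0 < theta.
  by rewrite /theta lt_min invr_gt0 ltr0n andbT divr_gt0// ?unit_ball_volume_gt0// exprn_gt0.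
have th1 : theta <= 2^-1 by rewrite /theta ge_min lexx orbT.
pose e := omega * n%:R ^+ n.
have e0 : 0 <= e by rewrite mulr_ge0 ?exprn_ge0//; exact: unit_ball_volume_ge0.
have H k : forall Y, (h Y <= (1 + (1 - theta) ^+ k * e)%:E * lebesgue_outer Y)%E.
  elim: k => [|k IH] Y.
    rewrite mul1r; apply: (@outer_le_lebesgue h _ eta) => //; first by lra.
    exact: hausdorff_delta_fat_box.
  have -> : 1 + (1 - theta) ^+ k.+1 * e =
      theta + (1 + (1 - theta) ^+ k * e) * (1 - theta) by rewrite exprS; ring.
  apply: hausdorff_delta_improve IH Y; rewrite lerDl mulr_ge0// exprn_ge0//; lra.
have [->|Xfin] := eqVneq (lebesgue_outer X) +oo%E; first by rewrite leey.
have {}Xfin : lebesgue_outer X \is a fin_num.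
  by rewrite ge0_fin_numE ?outer_measure_ge0// ltey.
rewrite -(fineK Xfin) -[X in (_ <= X)%E]mul1e -EFinM.
have cv : ((1 + (1 - theta) ^+ k * e) * fine (lebesgue_outer X))%:E @[k --> \oo] -->
    (1 * fine (lebesgue_outer X))%:E.
  apply: cvg_EFin; first by near=> k.
  apply: cvgMl; rewrite -[X in _ --> X]addr0; apply: cvgD; first exact: cvg_cst.
  rewrite -(mul0r e); apply: cvgMl; apply: cvg_expr.
  by rewrite ger0_norm; lra.
apply: (cvge_ge _ cv); near=> k.
by apply: le_trans (H k X) _; rewrite EFinM fineK.
Unshelve. all: by end_near. Qed.

End delta.

End hausdorff_le_lebesgue.

Section hausdorff_lebesgue.
Context {R : realType} {n : nat}.
Implicit Types (i : 'I_n.+1) (t : R) (Y : set 'rV[R]_n).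

(** One inequality is the isodiametric inequality for the slices of the covering
    sets; the other one transports covers along the isometric insertion of a
    coordinate and compares the Hausdorff premeasures with Lebesgue measure. *)
Lemma hausdorff_outer_ins i t Y :
  hausdorff_outer n [set ins i t y | y in Y] = lebesgue_outer Y.
Proof.
apply/eqP; rewrite eq_le; apply/andP; split.
  apply: ge_ereal_sup => _ [delta /= d0 <-].
  apply: le_trans (hausdorff_delta_le d0 Y).
  rewrite -[leRHS]mul1e.
  pose Phi (C : set 'rV[R]_n) := [set ins i t y | y in C].
  apply: (@outer_le_cover_outer R _ _ (@hausdorff_gauge R n n delta)
    (@hausdorff_delta R n.+1 n delta) 1 Phi) => //.
  - by move=> C; exact: hausdorff_gauge_ge0.
  - by move=> C YC _ [y /YC[k _ Cky] <-]; exists k => //; exists y.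
  move=> C; rewrite mul1e; have [->|C0] := pselect (C = set0).
    by rewrite /Phi image_set0 outer_measure0 hausdorff_gauge0.
  have [->|] := eqVneq (hausdorff_gauge n delta C) +oo%E; first by rewrite leey.
  rewrite -ltey => /(hausdorff_gauge_fin C0) Cd.
  have P0 : Phi C <> set0.
    by move/eqP/set0P : C0 => [y Cy]; apply/eqP/set0P; exists (ins i t y); exists y.
  have Pd : (ediam (Phi C) <= (fine (ediam C))%:E)%E.
    apply/ediam_leP => _ _ [y Cy <-] [z Cz <-]; rewrite enorm_ins.
    by rewrite -lee_fin (ediam_fin C0 Cd); apply: ereal_sup_ubound; exists y => //; exists z.
  apply: le_trans (hausdorff_delta_gauge _ _ _) _.
  apply: le_trans (hausdorff_gauge_le n P0 Pd _) _.
    by rewrite -lee_fin (ediam_fin C0 Cd).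
  by rewrite [leRHS]/hausdorff_gauge; case: asboolP => // _; rewrite Cd.
apply: (@le_trans _ _ (@hausdorff_delta R n.+1 n 1 [set ins i t y | y in Y])); last first.
  by apply: ereal_sup_ubound; exists 1 => //=.
rewrite -[leRHS]mul1e.
pose Phi (C : set 'rV[R]_n.+1) := [set y | C (ins i t y)].
apply: (@outer_le_cover_outer R _ _ (@hausdorff_gauge R n.+1 n 1)
  (@lebesgue_outer R n) 1 Phi) => //.
- by move=> C; exact: hausdorff_gauge_ge0.
- by move=> C YC y Yy; have [|k _ Ck] := YC (ins i t y); [exists y|exists k].
move=> C; rewrite mul1e; have [->|C0] := pselect (C = set0).
  by rewrite /Phi outer_measure0 hausdorff_gauge0.
have [->|] := eqVneq (hausdorff_gauge n 1 C) +oo%E; first by rewrite leey.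
rewrite -ltey => /(hausdorff_gauge_fin C0) Cd.
rewrite [leRHS]/hausdorff_gauge; case: asboolP => // _; rewrite Cd.
apply: isodiametric; first by apply: fine_ge0; exact: ediam_ge0.
move=> y z Cy Cz; rewrite -(enorm_ins i t) -lee_fin (ediam_fin C0 Cd).
by apply: ereal_sup_ubound; exists (ins i t y) => //; exists (ins i t z).
Qed.

(** The intersection of two hyperplanes is a Lebesgue null set of one of
    them. *)
Lemma hausdorff_outer_ridge i l t (u : R) : i != l ->
  hausdorff_outer n [set x : 'rV[R]_n.+1 | x 0 i = t /\ x 0 l = u] = 0%E.
Proof.
move=> il; have [j lE _] := unlift_some il.
rewrite (_ : [set x | _] = [set ins i t y | y in [set y : 'rV[R]_n | y 0 j = u]]).
  by rewrite hausdorff_outer_ins lebesgue_outer_hyperplane.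
apply/seteqP; split=> [x /= [xi xl]|_ [y /= yj <-]] /=.
  by exists (del i x); rewrite ?mxE -?lE// -xi delK.
by rewrite ins_pivot lE ins_lift.
Qed.

End hausdorff_lebesgue.

(** * Borel sets are Hausdorff measurable *)

Section hausdorff_borel.
Context {R : realType} {m : nat} (s : nat).
Local Notation space := 'rV[R]_m.
Implicit Types (X A B : set space) (i : 'I_m) (c : R).
Local Open Scope ereal_scope.

(** Covers by sets of diameter less than c' - c split into covers of A and of
    B. *)
Lemma hausdorff_outer_separated i (c c' : R) A B : (c < c')%R ->
  (forall x, A x -> (x 0 i <= c)%R) -> (forall x, B x -> (c' <= x 0 i)%R) ->
  hausdorff_outer s A + hausdorff_outer s B <= hausdorff_outer s (A `|` B).
Proof.
move=> cc' Ac Bc.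
have [->|Mfin] := eqVneq (hausdorff_outer s (A `|` B)) +oo; first by rewrite leey.
have fin X : X `<=` A `|` B -> hausdorff_outer s X \is a fin_num.
  move=> XAB; rewrite ge0_fin_numE ?outer_measure_ge0//.
  apply: (@le_lt_trans _ _ (hausdorff_outer s (A `|` B))); last by rewrite ltey.
  exact: le_outer_measure.
have Bfin := fin B (@subsetUr _ _ _).
rewrite -leeBrDr//; apply: ge_ereal_sup => _ [d1 /= d10 <-].
rewrite leeBrDr//.
have [A1|A1] := eqVneq (cover_outer (hausdorff_gauge s d1) A) +oo.
  have := fin A (@subsetUl _ _ _).
  rewrite ge0_fin_numE ?outer_measure_ge0// ltNge => /negP[].
  by rewrite -A1; apply: ereal_sup_ubound; exists d1.
have A1fin : cover_outer (hausdorff_gauge s d1) A \is a fin_num.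
  rewrite ge0_fin_numE; first by rewrite ltey.
  exact: (cover_outer_ge0 (@hausdorff_gauge_ge0 R m s d1)).
rewrite addeC -leeBrDr//; apply: ge_ereal_sup => _ [d2 /= d20 <-].
rewrite leeBrDr//.
pose d : R := Num.min (Num.min d1 d2) ((c' - c) / 2)%R.
have d0 : (0 < d)%R by rewrite !lt_min d10 d20 divr_gt0// subr_gt0.
have dmono e X : (d <= e)%R -> cover_outer (hausdorff_gauge s e) X <=
    cover_outer (hausdorff_gauge s d) X.
  move=> de; rewrite -[leRHS]mul1e.
  apply: (@outer_le_cover_outer R _ _ (@hausdorff_gauge R m s d)
    (@hausdorff_delta R m s e) 1 id) => //.
    by move=> C; exact: hausdorff_gauge_ge0.
  move=> C; rewrite mul1e; apply: le_trans (hausdorff_delta_gauge _ _ _) _.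
  have [->|C0] := pselect (C = set0); first by rewrite !hausdorff_gauge0.
  rewrite /hausdorff_gauge; case: asboolP => // _.
  case: (boolP (_ <= d%:E)) => [Cd|_]; last by rewrite leey.
  by rewrite (le_trans Cd)// lee_fin.
apply: (@le_trans _ _ (cover_outer (hausdorff_gauge s d) (A `|` B))); last first.
  by apply: ereal_sup_ubound; exists d.
apply: (@le_trans _ _ (cover_outer (hausdorff_gauge s d) B +
    cover_outer (hausdorff_gauge s d) A)).
  by apply: leeD; apply: dmono; rewrite !ge_min lexx ?orbT.
apply: le_ereal_inf_tmp => _ [C ABC <-].
apply: (@le_trans _ _ (\sum_(0 <= k <oo) hausdorff_gauge s d (C k `&` B) +
    \sum_(0 <= k <oo) hausdorff_gauge s d (C k `&` A))).
  apply: leeD; apply: ereal_inf_lbound.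
    by exists (fun k => C k `&` B) => // x Bx; have [|k _ Ck] := ABC x; [right|exists k].
  by exists (fun k => C k `&` A) => // x Ax; have [|k _ Ck] := ABC x; [left|exists k].
rewrite -nneseriesD; last 2 first.
- by move=> k _ _; exact: hausdorff_gauge_ge0.
- by move=> k _ _; exact: hausdorff_gauge_ge0.
apply: lee_nneseries => k _; first by move=> _; rewrite adde_ge0 ?hausdorff_gauge_ge0.
have [->|fink] := eqVneq (hausdorff_gauge s d (C k)) +oo; first by rewrite leey.
have [/eqP/set0P[x [Cx Ax]]|CA] := pselect (C k `&` A <> set0); last first.
  move/contrapT : CA => ->; rewrite hausdorff_gauge0 adde0.
  by apply: le_hausdorff_gauge; exact: subIsetl.
rewrite (_ : C k `&` B = set0) ?hausdorff_gauge0 ?add0e.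
  by apply: le_hausdorff_gauge; exact: subIsetl.
rewrite -subset0 => y [Cy By] /=.
have C0 : C k <> set0 by move=> C0; rewrite C0 in Cx.
have /ediam_leP/(_ _ _ Cy Cx) : ediam (C k) <= d%:E.
  by apply: (hausdorff_gauge_fin C0); rewrite ltey; exact: fink.
have := coord_le_enorm (y - x) i; rewrite !mxE.
have := Ac _ Ax; have := Bc _ By.
have : (d <= (c' - c) / 2)%R by rewrite ge_min lexx orbT.
have := ler_norm (y 0 i - x 0 i)%R; lra.
Qed.

(** The part of X above the hyperplane x_i = c is cut into layers, non-consecutive
    layers being at a positive distance of each other. *)
Let layer X i c k := X `&` [set x : space |
  (c + k.+2%:R^-1 <= x 0 i)%R /\ (x 0 i < c + k.+1%:R^-1)%R].

Let layer_sum X i c p (r : nat) :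
  \sum_(0 <= k < p) hausdorff_outer s (layer X i c (k.*2 + r)%N) <=
  hausdorff_outer s (X `&` [set x : space | (c + (p.*2 + r)%:R^-1 <= x 0 i)%R]).
Proof.
elim: p => [|p IH]; first by rewrite big_geq// outer_measure_ge0.
rewrite big_nat_recr//= addeC.
have layersub : layer X i c (p.*2 + r) `<=`
    X `&` [set x : space | (c + (p.+1.*2 + r)%:R^-1 <= x 0 i)%R].
  by move=> x [Xx [xc _]]; split => //=; rewrite doubleS !addSn.
case: p => [|p] in IH layersub *.
  rewrite big_geq// adde0; exact: le_outer_measure.
apply: le_trans (leeD2l _ IH) _.
apply: le_trans (@hausdorff_outer_separated i (c + (p.+1.*2 + r).+1%:R^-1)
  (c + (p.+1.*2 + r)%:R^-1) _ _ _ _ _) _.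
- by rewrite ltrD2l ltf_pV2 ?posrE ?ltr_nat// ltr0n.
- by move=> x [_ [_ /ltW]].
- by move=> x [_].
apply: le_outer_measure => x [/layersub//|[Xx /= xc]]; split => //=.
apply: le_trans xc; rewrite lerD2l lef_pV2 ?posrE ?ltr0n// ler_nat.
by rewrite leq_add2r leq_double.
Qed.

Let sum_double (f : nat -> \bar R) p :
  \sum_(0 <= k < p.*2) f k =
  \sum_(0 <= k < p) f (k.*2 + 0)%N + \sum_(0 <= k < p) f (k.*2 + 1)%N.
Proof.
elim: p => [|p IH]; first by rewrite !big_geq// adde0.
by rewrite doubleS !big_nat_recr//= IH addn0 addn1 -addeA addeACA addeA.
Qed.

(** Caratheodory's criterion for half-spaces: the layers of X near the boundary
    of the half-space have summable measures, so they can be removed. *)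
Lemma hausdorff_outer_halfspace i c :
  (@hausdorff_outer R m s).-caratheodory [set x : space | (x 0 i <= c)%R].
Proof.
apply: le_caratheodory_measurable => X; set D := [set x : space | _].
change (hausdorff_outer s (X `&` D) + hausdorff_outer s (X `&` ~` D) <=
  hausdorff_outer s X).
have [->|Xfin] := eqVneq (hausdorff_outer s X) +oo; first by rewrite leey.
have XleX Y : Y `<=` X -> hausdorff_outer s Y <= hausdorff_outer s X.
  exact: le_outer_measure.
have {}Xfin : hausdorff_outer s X \is a fin_num.
  by rewrite ge0_fin_numE ?outer_measure_ge0// ltey.
pose f k := hausdorff_outer s (layer X i c k).
have f0 k : 0 <= f k by exact: outer_measure_ge0.
have fsum : \sum_(0 <= k <oo) f k < +oo.
  apply: (@le_lt_trans _ _ (hausdorff_outer s X + hausdorff_outer s X)).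
    apply: lime_le; first by apply: is_cvg_nneseries.
    near=> p; apply: (@le_trans _ _ (\sum_(0 <= k < p.*2) f k)).
      rewrite [leRHS](@big_cat_nat _ _ _ p)//=; last by rewrite -addnn leq_addr.
      by rewrite leeDl// sume_ge0.
    rewrite sum_double; apply: leeD; apply: (le_trans (layer_sum _ _ _ _ _)).
      exact: XleX (@subIsetl _ _ _).
    exact: XleX (@subIsetl _ _ _).
  by rewrite lte_add_pinfty// ltey_eq Xfin.
have tail := nneseries_tail_cvg fsum (fun k _ => f0 k).
have cv : hausdorff_outer s X + \sum_(p <= k <oo) f k @[p --> \oo] -->
    hausdorff_outer s X + 0.
  apply: cvgeD tail; last exact: cvg_cst.
  by rewrite fin_num_adde_defr.
rewrite adde0 in cv; apply: (cvge_ge _ cv); near=> p.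
apply: (@le_trans _ _ (hausdorff_outer s (X `&` D) +
  (hausdorff_outer s (X `&` [set x : space | (c + p.+1%:R^-1 <= x 0 i)%R]) +
   \sum_(p <= k <oo) f k))).
  apply: leeD2l.
  apply: (@le_trans _ _ (hausdorff_outer s
     (X `&` [set x : space | (c + p.+1%:R^-1 <= x 0 i)%R]) +
     hausdorff_outer s (\bigcup_k layer X i c (k + p)))).
    apply: le_trans (outer_measureU2 _ _ _); apply: le_outer_measure.
    move=> x [Xx /negP]; rewrite -ltNge => xc.
    have [xp|xp] := leP (c + p.+1%:R^-1)%R (x 0%R i); first by left.
    right; have t0 : (0 < x 0%R i - c)%R by rewrite subr_gt0.
    have ex : exists k, (k.+2%:R^-1 <= x 0%R i - c)%R.
      have [k kt] := natSinv_lt t0; exists k; apply: le_trans (ltW kt).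
      by rewrite lef_pV2 ?posrE ?ltr0n// ler_nat.
    case: (ex_minnP ex) => k kt kmin.
    have pk : (p <= k)%N.
      have : (k.+2%:R^-1 < p.+1%:R^-1 :> R)%R by apply: le_lt_trans kt _; rewrite ltrBlDl.
      by rewrite ltf_pV2 ?posrE// ltr_nat !ltnS.
    exists (k - p)%N => //; rewrite subnK//; split => //; split; first by rewrite -lerBrDl.
    rewrite -ltrBlDl.
    case: k => [|k] in kt kmin pk *.
      apply: (@lt_le_trans _ _ (p.+1%:R^-1)%R); first by rewrite ltrBlDl.
      by rewrite lef_pV2 ?posrE// ler_nat.
    by rewrite ltNge; apply/negP => /kmin; rewrite ltnn.
  apply: leeD2l; apply: le_trans (outer_measure_sigma_subadditive _ _) _.
  by rewrite -nneseries_addn.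
rewrite addeA leeD2r//.
apply: le_trans (@hausdorff_outer_separated i c (c + p.+1%:R^-1) _ _ _ _ _) _.
- by rewrite ltrDl invr_gt0.
- by move=> x [].
- by move=> x [].
by apply: XleX => x [] [].
Unshelve. all: by end_near. Qed.

Lemma borel_hausdorff (B : set space) : <<s open >> B ->
  (@hausdorff_outer R m s).-caratheodory B.
Proof.
apply: borel_halfspaces; last exact: hausdorff_outer_halfspace.
split.
- exact: caratheodory_measurable_set0.
- by move=> A mA; rewrite setTD; exact: caratheodory_measurable_setC.
- by move=> F mF; exact: caratheodory_measurable_bigcup.
Qed.

End hausdorff_borel.

(** * Measures with densities and charges *)

Section density_measure.
Local Open Scope ereal_scope.
Context d1 d2 (T1 : measurableType d1) (T2 : measurableType d2) (R : realType).
Variables (p : T1 -> T2) (mp : measurable_fun setT p).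
Variable mu : {measure set T1 -> \bar R}.
Variables (h : T1 -> R) (ih : mu.-integrable setT (EFin \o h)).

Local Notation hp := (EFin \o (h^\+)%R).

(** The image under p of the positive part of the measure of density h; the
    function h itself serves as argument so that h and - h give the positive and
    negative part of one charge. *)
Definition density of measurable_fun setT p & mu.-integrable setT (EFin \o h) :=
  fun B : set T2 => \int[mu]_(x in p @^-1` B) hp x.

Let mhp : measurable_fun setT hp.
Proof.
by apply/measurable_EFinP/measurable_funrpos/measurable_EFinP; case/integrableP: ih.
Qed.

Let hp0 x : 0 <= hp x. Proof. by rewrite lee_fin funrpos_ge0. Qed.

Let mpre B : measurable B -> measurable (p @^-1` B).
Proof. by move=> mB; rewrite -(setTI (_ @^-1` _)); exact: mp. Qed.

Local Notation nu := (density mp ih).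

Let nu0 : nu set0 = 0.
Proof. by rewrite /density preimage_set0 integral_set0. Qed.

Let nu_ge0 B : 0 <= nu B.
Proof. by apply: integral_ge0 => x _; exact: hp0. Qed.

Let nu_sigma_additive : semi_sigma_additive nu.
Proof.
move=> F mF tF mUF; rewrite /density preimage_bigcup.
rewrite ge0_integral_bigcup//.
- by apply: is_cvg_ereal_nneg_natsum_cond => n _ _; exact: integral_ge0.
- by move=> k; exact: mpre.
- exact: measurable_funTS.
- apply/trivIsetP => i j _ _ ij; rewrite -preimage_setI.
  by have /trivIsetP/(_ i j Logic.I Logic.I ij) -> := tF; rewrite preimage_set0.
Qed.

HB.instance Definition _ := isMeasure.Build _ _ _ nu nu0 nu_ge0 nu_sigma_additive.

Let nu_fin : fin_num_fun nu.
Proof.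
move=> B mB; rewrite ge0_fin_numE//.
have : mu.-integrable (p @^-1` B) hp.
  apply: (@integrableS _ _ _ mu setT) => //; first exact: mpre.
  exact: integrable_funrpos.
by case/integrableP => _; under eq_integral do rewrite gee0_abs//.
Qed.

HB.instance Definition _ := @Measure_isFinite.Build _ _ _ nu nu_fin.

Import HBNNSimple.

Lemma ge0_integral_density (f : T2 -> \bar R) :
  measurable_fun setT f -> (forall y, 0 <= f y) ->
  \int[nu]_y f y = \int[mu]_x (f (p x) * hp x).
Proof.
move=> mf f0; pose g := nnsfun_approx measurableT mf.
have gf y : (g n y)%:E @[n --> \oo] --> f y by exact: cvg_nnsfun_approx.
have mgp n : measurable_fun setT (fun x => (g n (p x))%:E).
  by apply/measurable_EFinP; apply: measurableT_comp.
have -> : \int[nu]_y f y = limn (fun n => \int[nu]_y (g n y)%:E).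
  rewrite -monotone_convergence//.
  - by apply: eq_integral => y _; apply/esym/cvg_lim.
  - by move=> n; apply/measurable_EFinP.
  - by move=> n y _; rewrite lee_fin.
  - by move=> y _ m n mn; rewrite lee_fin; exact/lefP/nd_nnsfun_approx.
have -> : \int[mu]_x (f (p x) * hp x) =
    limn (fun n => \int[mu]_x ((g n (p x))%:E * hp x)).
  rewrite -monotone_convergence//.
  - apply: eq_integral => x _; apply/esym/cvg_lim => //.
    by apply: cvgeZr => //; exact: gf.
  - by move=> n; apply: emeasurable_funM.
  - by move=> n x _; rewrite mule_ge0// lee_fin.
  - by move=> x _ m n mn; rewrite lee_wpmul2r// lee_fin; exact/lefP/nd_nnsfun_approx.
congr (limn _); apply/funext => n.
have mA k : measurable (g n @^-1` [set k]) by [].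
transitivity (\sum_(k \in range (g n)) \int[nu]_y (k * \1_(g n @^-1` [set k]) y)%:E).
  under eq_integral do rewrite fimfunE -fsumEFin//.
  rewrite ge0_integral_fsum//.
  - by move=> k; apply/measurable_EFinP; exact: measurable_funM.
  - by move=> k y _; exact: nnfun_muleindic_ge0.
transitivity (\int[mu]_x (\sum_(k \in range (g n))
    (k * \1_(g n @^-1` [set k]) (p x))%:E * hp x)); last first.
  apply: eq_integral => x _; rewrite -ge0_mule_fsuml.
    by rewrite fsumEFin// -fimfunE.
  by move=> k; exact: nnfun_muleindic_ge0.
have mi k : measurable_fun setT (\1_(g n @^-1` [set k]) : T2 -> R).
  exact: measurable_indic.
have mind k : measurable_fun setT (fun x => (k * \1_(g n @^-1` [set k]) (p x))%:E).
  apply/measurable_EFinP; apply: measurable_funM => //.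
  exact: (measurableT_comp (mi k) mp).
rewrite ge0_integral_fsum//; last 2 first.
- by move=> k; exact: emeasurable_funM.
- by move=> k x _; rewrite mule_ge0//; exact: nnfun_muleindic_ge0.
apply: eq_fsbigr => k _; rewrite integralZl_indic_nnsfun// integral_indic// setIT.
have [k0|k0] := ltP k 0%R.
  rewrite preimage_nnfun0// measure0 mule0 integral0_eq// => x _.
  by rewrite indicE in_set0 mulr0 mul0e.
under [RHS]eq_integral do rewrite EFinM -muleA.
rewrite ge0_integralZl//; last 2 first.
- apply: emeasurable_funM => //; apply/measurable_EFinP.
  exact: (measurableT_comp (mi k) mp).
- by move=> x _; rewrite mule_ge0.
congr (_ * _); rewrite /= /density integral_mkcond; apply: eq_integral => x _.
rewrite patchE indicE.
have -> : (p x \in g n @^-1` [set k]) = (x \in p @^-1` (g n @^-1` [set k])) by [].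
by case: ifP => _; rewrite ?mul1e ?mul0e.
Qed.

Lemma Rintegral_density (f : T2 -> R) (M : R) :
  measurable_fun setT f -> (forall y, (`|f y| <= M)%R) ->
  (\int[nu]_y f y = \int[mu]_x (f (p x) * h^\+ x))%R.
Proof.
move=> mf fM.
have M0 : (0 <= M)%R by apply: le_trans (fM (p point)).
have f1_ge0 y : (0 <= f y + M)%R by have := fM y; rewrite ler_norml; lra.
have mf1 : measurable_fun setT (fun y => (f y + M)%R) by exact: measurable_funD.
have inu (g : T2 -> R) (c : R) : measurable_fun setT g -> (forall y, (`|g y| <= c)%R) ->
    nu.-integrable setT (EFin \o g).
  move=> mg gc; apply: measurable_bounded_integrable => //.
    by rewrite ltey_eq fin_num_measure.
  by exists c; split; [exact: num_real|move=> x cx y _ /=; rewrite (le_trans (gc y))// ltW].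
have imu (g : T2 -> R) (c : R) : measurable_fun setT g -> (forall y, (`|g y| <= c)%R) ->
    mu.-integrable setT (EFin \o (fun x => (g (p x) * h^\+ x)%R)).
  move=> mg gc; apply: (@le_integrable _ _ _ mu setT measurableT _
      (fun x => (c%:E * hp x))).
  - apply/measurable_EFinP; apply: measurable_funM; first exact: measurableT_comp.
    exact/measurable_EFinP.
  - move=> x _; change ((`|g (p x) * h^\+ x|%R)%:E <= (`|c * h^\+ x|%R)%:E).
    by rewrite lee_fin !normrM ler_wpM2r// (le_trans (gc _))// ler_norm.
  - by apply: integrableZl => //; exact: integrable_funrpos.
have f2M y : (`|f y + M| <= M + M)%R by rewrite ger0_norm// lerD2r (le_trans _ (fM y))// ler_norm.
have cM (y : T2) : (`|M| <= M)%R by rewrite ger0_norm.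
have -> : (\int[nu]_y f y = \int[nu]_y ((f y + M) - M))%R.
  by apply: eq_Rintegral => y _; rewrite addrK.
rewrite RintegralB//; last 2 first.
- exact: inu mf1 f2M.
- by apply: (inu (cst M) M).
have -> : (\int[mu]_x (f (p x) * h^\+ x) =
    \int[mu]_x ((f (p x) + M) * h^\+ x - M * h^\+ x))%R.
  by apply: eq_Rintegral => x _; rewrite mulrDl addrK.
rewrite RintegralB//; last 2 first.
- exact: (imu _ _ mf1 f2M).
- by apply: (imu (cst M) M).
congr (_ - _)%R; rewrite /Rintegral; congr fine.
- rewrite (ge0_integral_density (f := fun y => (f y + M)%:E))//.
  by apply/measurable_EFinP.
- rewrite (ge0_integral_density (f := fun y => M%:E))//.
Qed.

End density_measure.

Section charge_integral_facts.
Context d (T : measurableType d) (R : realType).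
Implicit Types (m : {finite_measure set T -> \bar R}).

Lemma bounded_integrable m (f : T -> R) (M : R) :
  measurable_fun setT f -> (forall y, `|f y| <= M) -> m.-integrable setT (EFin \o f).
Proof.
move=> mf fM; apply: measurable_bounded_integrable => //.
  by rewrite ltey_eq fin_num_measure.
by exists M; split; [exact: num_real|move=> x Mx y _ /=; rewrite (le_trans (fM y))// ltW].
Qed.

(** The integral against a charge is determined by any representation of the
    charge as a difference of finite measures. *)
Lemma charge_integralE (nu : {charge set T -> \bar R}) m1 m2 (f : T -> R) (M : R) :
  (forall B, measurable B -> nu B = (m1 B - m2 B)%E) ->
  measurable_fun setT f -> (forall y, `|f y| <= M) ->
  charge_integral nu setT f = \int[m1]_y f y - \int[m2]_y f y.
Proof.
move=> nuE mf fM; rewrite /charge_integral.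
set P := cid _; set N := cid _.
pose jp : {finite_measure set T -> \bar R} := jordan_pos (projT2 N).
pose jn : {finite_measure set T -> \bar R} := jordan_neg (projT2 N).
rewrite -/jp -/jn.
have swapE (a b c e : \bar R) : a \is a fin_num -> b \is a fin_num ->
    c \is a fin_num -> e \is a fin_num -> (a - b = c - e -> c + b = a + e)%E.
  move: a b c e => [a| |] [b| |] [c| |] [e| |]// _ _ _ _.
  by rewrite -!EFinB => -[] E; rewrite -!EFinD; congr EFin; lra.
have addE B : measurable B -> measure_add jp m2 B = measure_add m1 jn B.
  move=> mB; rewrite !measure_addE.
  have : nu B = (jp B - jn B)%E.
    by rewrite (jordan_decomp (projT2 N) mB) /cadd/= cscaleN1.
  rewrite nuE//; apply: swapE; exact: fin_num_measure.
have := @eq_measure_integral _ _ _ setT (measure_add jp m2) (measure_add m1 jn)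
  (EFin \o f) (fun A mA _ => esym (addE A mA)).
have ib m := bounded_integrable m mf fM.
rewrite !integral_measure_add ?ib//.
rewrite /Rintegral => E.
have fin m : (\int[m]_y (f y)%:E)%E \is a fin_num.
  exact: (integrable_fin_num measurableT (ib m)).
have swapF (a b c e : \bar R) : a \is a fin_num -> b \is a fin_num ->
    c \is a fin_num -> e \is a fin_num -> (a + b = c + e)%E ->
    fine c - fine b = fine a - fine e.
  move: a b c e => [a| |] [b| |] [c| |] [e| |]// _ _ _ _.
  by rewrite -!EFinD => -[] /= ?; lra.
exact: (swapF _ _ _ _ (fin m1) (fin jn) (fin jp) (fin m2) E).
Qed.

End charge_integral_facts.

(** * Fubini's theorem for Lebesgue measure *)

Section borel_lebesgue_measure.
Context {R : realType} {n : nat}.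
Local Notation space := 'rV[R]_n.
Local Notation borel := (g_sigma_algebraType (@open space)).
Local Open Scope ereal_scope.

(** On the Borel sets, Lebesgue measure is a sigma-finite measure to which the
    construction of product measures applies. *)
Definition leb_borel : set borel -> \bar R := @lebesgue_outer R n.

Let leb_borel0 : leb_borel set0 = 0. Proof. exact: outer_measure0. Qed.

Let leb_borel_ge0 B : 0 <= leb_borel B. Proof. exact: outer_measure_ge0. Qed.

Let leb_borel_sigma_additive : semi_sigma_additive leb_borel.
Proof.
move=> F mF tF mUF; apply: (@measure_semi_sigma_additive _ _ _ (leb R n) F) => //.
  by move=> k; apply: borel_lebesgue; exact: mF.
exact: borel_lebesgue.
Qed.

HB.instance Definition _ := isMeasure.Build _ borel R leb_borel
  leb_borel0 leb_borel_ge0 leb_borel_sigma_additive.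

Definition cube (k : nat) : set space := box (const_mx (- k%:R)%R) (const_mx k%:R%R).

Lemma bigcup_cube : \bigcup_k cube k = setT.
Proof.
rewrite -subTset => x _.
have /choice[m mP] i : exists k : nat, (`|x 0%R i| <= k%:R)%R.
  by exists (Num.truncn `|x 0%R i|).+1; rewrite ltW// truncnS_gt.
exists (\sum_i m i)%N => // i; rewrite !mxE -ler_norml (le_trans (mP i))//.
by rewrite ler_nat (bigD1 i)//= leq_addr.
Qed.

Lemma lebesgue_outer_cube k : lebesgue_outer (cube k) < +oo.
Proof.
rewrite lebesgue_outer_box ?ltry// => i; rewrite !mxE.
by rewrite (@le_trans _ _ 0%R)// oppr_le0.
Qed.

Let leb_borel_sigma_finite : sigma_finite setT leb_borel.
Proof.
exists cube; first by rewrite bigcup_cube.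
by move=> k; split; [exact: measurable_box|exact: lebesgue_outer_cube].
Qed.

HB.instance Definition _ := @Measure_isSigmaFinite.Build _ borel R leb_borel
  leb_borel_sigma_finite.

Lemma measurable_lebesgue (B : set borel) : measurable B ->
  measurable (B : set (caratheodory_type (@lebesgue_outer R n))).
Proof. exact: borel_lebesgue. Qed.

Lemma measurable_hausdorff s (B : set borel) : measurable B ->
  measurable (B : set (caratheodory_type (@hausdorff_outer R n s))).
Proof. exact: borel_hausdorff. Qed.

Lemma measurable_fun_lebesgue d (T : measurableType d) (f : space -> T) :
  measurable_fun (setT : set borel) f ->
  measurable_fun (setT : set (caratheodory_type (@lebesgue_outer R n))) f.
Proof. by move=> mf _ Y mY; rewrite setTI; apply: borel_lebesgue; have := mf measurableT Y mY; rewrite setTI. Qed.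

Lemma measurable_fun_hausdorff s d (T : measurableType d) (f : space -> T) :
  measurable_fun (setT : set borel) f ->
  measurable_fun (setT : set (caratheodory_type (@hausdorff_outer R n s))) f.
Proof. by move=> mf _ Y mY; rewrite setTI; apply: borel_hausdorff; have := mf measurableT Y mY; rewrite setTI. Qed.

Lemma continuous_measurable (f : space -> R) : continuous f ->
  measurable_fun (setT : set borel) f.
Proof.
move=> cf; apply: (measurability _ (RGenOInfty.measurableE R)) => //.
move=> /= _ [_ [a ->]] <-; apply: measurableI => //; rewrite preimage_itvoy.
apply: sub_sigma_algebra.
by have /continuousP/(_ [set y | (a < y)%R]) := cf; apply; exact: open_gt.
Qed.

Let ge0_integral_leb_borel (f : space -> \bar R) :
  measurable_fun (setT : set borel) f -> (forall x, 0 <= f x) ->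
  \int[leb R n]_x f x = \int[leb_borel]_x f x.
Proof.
move=> mf f0.
have mid : measurable_fun (setT : set (caratheodory_type (@lebesgue_outer R n)))
    (id : _ -> borel).
  by move=> _ Y mY; rewrite setTI; exact: measurable_lebesgue.
have := @ge0_integral_pushforward _ _ _ _ R _ mid (leb R n) setT f measurableT mf
  (fun x _ => f0 x).
rewrite preimage_setT => ->; exact: eq_measure_integral.
Qed.

Lemma integral_leb_borel (f : space -> \bar R) :
  measurable_fun (setT : set borel) f ->
  \int[leb R n]_x f x = \int[leb_borel]_x f x.
Proof.
move=> mf; rewrite integralE [RHS]integralE; congr (_ - _).
- by apply: ge0_integral_leb_borel => //; exact: measurable_funepos.
- by apply: ge0_integral_leb_borel => //; exact: measurable_funeneg.
Qed.

Lemma borel_boxes : (@measurable _ borel) =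
  <<s [set box ab.1 ab.2 | ab in [set: space * space]] >>.
Proof.
apply/seteqP; split; last first.
  apply: smallest_sub; first exact: sigma_algebra_measurable.
  by move=> _ [ab _ <-]; exact: measurable_box.
apply: borel_halfspaces; first exact: smallest_sigma_algebra.
move=> i c; have [S0 SC SU] := smallest_sigma_algebra setT
  [set box ab.1 ab.2 | ab in [set: space * space]].
rewrite (_ : [set x | _] = \bigcup_k box (const_mx (- k%:R)%R) (upd (const_mx k%:R%R) i c)).
  apply: SU => k; apply: sub_sigma_algebra.
  by exists (const_mx (- k%:R)%R, upd (const_mx k%:R%R) i c).
apply/seteqP; split=> x /= => [xc|[k _ /(_ i)]]; last by rewrite !mxE eqxx => /andP[].
have [k _ xk] : (\bigcup_k cube k) x by rewrite bigcup_cube.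
exists k => // j; have := xk j; rewrite !mxE; case: eqP => [->|//].
by move=> /andP[-> _].
Qed.

Lemma boxes_setI_closed : setI_closed [set box ab.1 ab.2 | ab in [set: space * space]].
Proof.
move=> _ _ [[a b] _ <-] [[c d] _ <-].
exists ((\row_i Num.max (a 0 i) (c 0 i))%R, (\row_i Num.min (b 0 i) (d 0 i))%R) => //=.
apply/seteqP; split=> [x h|x [h1 h2] i].
  split=> i; have := h i; rewrite !mxE ge_max le_min; first by move=> /andP[/andP[-> _] /andP[]].
  by move=> /andP[/andP[_ ->] /andP[]].
rewrite !mxE ge_max le_min; have /andP[-> ->] := h1 i.
by have /andP[-> ->] := h2 i.
Qed.

End borel_lebesgue_measure.
Arguments leb_borel : clear implicits.

Section lebesgue_product.
Context {R : realType} {n : nat}.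
Local Notation space := 'rV[R]_n.+1.
Local Notation borel m := (g_sigma_algebraType (@open 'rV[R]_m)).
Local Open Scope ereal_scope.
Variable i : 'I_n.+1.

Definition ins_pair (ty : measurableTypeR R * borel n) : borel n.+1 := ins i ty.1 ty.2.

Lemma measurable_ins_pair : measurable_fun setT ins_pair.
Proof.
move=> _; suff H : (@measurable _ (borel n.+1)) `<=` [set B | measurable (ins_pair @^-1` B)].
  by move=> B /H; rewrite setTI.
apply: borel_halfspaces.
  split=> [|B mB|F mF] /=.
  - by rewrite preimage_set0.
  - by rewrite setTD preimage_setC; exact: measurableC.
  - by rewrite preimage_bigcup; exact: bigcupT_measurable.
move=> j c /=; case: (unliftP i j) => [k ->|->].
  rewrite (_ : _ @^-1` _ = setT `*` [set y : 'rV[R]_n | (y 0 k <= c)%R]).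
    by apply: measurableX => //; exact: measurable_le_coord.
  by apply/seteqP; split=> -[t y] /=; rewrite /ins_pair ins_lift//; case.
rewrite (_ : _ @^-1` _ = [set t | (t <= c)%R] `*` setT).
  by apply: measurableX => //; rewrite -set_itvNyc; exact: measurable_itv.
by apply/seteqP; split=> -[t y] /=; rewrite /ins_pair ins_pivot//; case.
Qed.

Definition leb_product : set (borel n.+1) -> \bar R := fun B =>
  ((@lebesgue_measure R) \x (leb_borel R n)) (ins_pair @^-1` B).

Let mpre B : measurable B -> measurable (ins_pair @^-1` B).
Proof. by move=> mB; rewrite -(setTI (_ @^-1` _)); exact: measurable_ins_pair. Qed.

Let leb_product0 : leb_product set0 = 0.
Proof. by rewrite /leb_product preimage_set0 measure0. Qed.

Let leb_product_ge0 B : 0 <= leb_product B. Proof. exact: measure_ge0. Qed.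

Let leb_product_sigma_additive : semi_sigma_additive leb_product.
Proof.
move=> F mF tF mUF; rewrite /leb_product preimage_bigcup.
apply: measure_semi_sigma_additive => [k||].
- exact: mpre.
- apply/trivIsetP => j k _ _ jk; rewrite -preimage_setI.
  by have /trivIsetP/(_ j k Logic.I Logic.I jk) -> := tF; rewrite preimage_set0.
- by rewrite -preimage_bigcup; exact: mpre.
Qed.

HB.instance Definition _ := isMeasure.Build _ (borel n.+1) R leb_product
  leb_product0 leb_product_ge0 leb_product_sigma_additive.

Lemma ins_pair_box a b : ins_pair @^-1` box a b =
  `[a 0%R i, b 0%R i]%classic `*` box (del i a) (del i b).
Proof.
apply/seteqP; split=> -[t y] /=; rewrite /ins_pair/=.
  move=> h; split; first by have := h i; rewrite in_itv/= ins_pivot.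
  by move=> j; have := h (lift i j); rewrite ins_lift !mxE.
rewrite in_itv/= => -[ht hy] j; case: (unliftP i j) => [k ->|->].
  by have := hy k; rewrite ins_lift !mxE.
by rewrite ins_pivot.
Qed.

Lemma vol_del (a b : space) : vol a b = ((b 0%R i - a 0%R i) * vol (del i a) (del i b))%R.
Proof.
rewrite /vol (bigD1_ord i)//=; congr (_ * _)%R.
by apply: eq_bigr => j _; rewrite !mxE.
Qed.

(** Both sides agree on boxes, which form a generating pi-system. *)
Lemma leb_borel_product B : measurable B -> leb_borel R n.+1 B = leb_product B.
Proof.
apply: (@measure_unique _ R (borel n.+1) _ (@cube R n.+1) (@borel_boxes R n.+1)
  (@boxes_setI_closed R n.+1) _ _ (leb_borel R n.+1) leb_product).
- by move=> k; eexists (_, _) => //.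
- exact: bigcup_cube.
- move=> _ [[a b] _ <-] /=; rewrite /leb_product ins_pair_box.
  rewrite product_measure1E//; last exact: measurable_box.
  change (lebesgue_outer (box a b) = (@lebesgue_measure R) `[a 0%R i, b 0%R i]%classic *
    lebesgue_outer (box (del i a) (del i b))).
  have [ab|] := pselect (forall j, (a 0%R j <= b 0%R j)%R).
    rewrite lebesgue_measure_itv/= lte_fin !lebesgue_outer_box//; last first.
      by move=> j; rewrite !mxE.
    rewrite (vol_del a b); case: ltP => [_|ba]; first by rewrite -EFinB -EFinM.
    by rewrite mul0e (_ : (_ - _ = 0)%R) ?mul0r//; have := ab i; lra.
  move=> /existsNP[j /negP]; rewrite -ltNge => ba.
  have -> : box a b = set0.
    rewrite -subset0 => x /(_ j) /andP[h1 h2].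
    by move: ba; rewrite ltNge (le_trans h1 h2).
  rewrite outer_measure0; case: (unliftP i j) => [k jk|ji].
    have -> : box (del i a) (del i b) = set0.
      rewrite -subset0 => x /(_ k); rewrite !mxE -jk => /andP[h1 h2].
      by move: ba; rewrite ltNge (le_trans h1 h2).
    by rewrite outer_measure0 mule0.
  by rewrite lebesgue_measure_itv/= lte_fin -ji ltNge (ltW ba)/= mul0e.
- exact: lebesgue_outer_cube.
Qed.

Lemma integral_leb_product (f : space -> \bar R) :
  (leb_borel R n.+1).-integrable setT f ->
  \int[leb_borel R n.+1]_x f x =
  \int[leb_borel R n]_y \int[lebesgue_measure]_t f (ins i t y).
Proof.
move=> intf; have mf : measurable_fun (setT : set (borel n.+1)) f.
  by case/integrableP : intf.
have intfins : ((@lebesgue_measure R) \x (leb_borel R n)).-integrable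
    (ins_pair @^-1` setT) (f \o ins_pair).
  apply/integrableP; split.
    by rewrite preimage_setT; apply: measurableT_comp => //; exact: measurable_ins_pair.
  case/integrableP : intf => _; apply: le_lt_trans; rewrite le_eqVlt; apply/orP; left; apply/eqP.
  have mabs : measurable_fun (setT : set (borel n.+1)) (abse \o f).
    exact: measurableT_comp.
  have := @ge0_integral_pushforward _ _ _ _ R _ measurable_ins_pair
    (lebesgue_measure \x (leb_borel R n)) setT (abse \o f) measurableT mabs
    (fun x _ => abse_ge0 (f x)).
  move=> <-.
  apply: eq_measure_integral => [|? A mA _]; first exact: measurable_ins_pair.
  exact/esym/leb_borel_product.
have := @integral_pushforward _ _ _ _ R _ measurable_ins_pair
  (lebesgue_measure \x (leb_borel R n)) setT f mf intfins measurableT.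
rewrite preimage_setT in intfins *.
rewrite -(integral21_prod_meas1 intfins) => <-.
apply: eq_measure_integral => [|? A mA _]; first exact: measurable_ins_pair.
exact: leb_borel_product.
Qed.

End lebesgue_product.

(** * The divergence theorem on boxes *)

Section divergence_on_boxes.
Context {R : realType} {n : nat}.
Local Notation space := 'rV[R]_n.+1.
Local Notation borel m := (g_sigma_algebraType (@open 'rV[R]_m)).
Implicit Types (a b x : space) (l : 'I_n.+1).

Lemma ins_continuousl l (y : 'rV[R]_n) : continuous (fun t : R => ins l t y).
Proof.
move=> t A /nbhs_ballP[e /= e0 eA]; apply/nbhs_ballP; exists e => // t' tt'.
apply: eA; split=> // i j; rewrite ord1; case: (unliftP l j) => [k ->|->].
  by rewrite !ins_lift; exact: ballxx.
by rewrite !ins_pivot.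
Qed.

Lemma ins_continuousr l (t : R) : continuous (ins l t : 'rV[R]_n -> space).
Proof.
move=> y A /nbhs_ballP[e /= e0 eA]; apply/nbhs_ballP; exists e => // y' [_ yy'].
apply: eA; split=> // i j; rewrite ord1; case: (unliftP l j) => [k ->|->].
  by rewrite !ins_lift; exact: yy'.
by rewrite !ins_pivot; exact: ballxx.
Qed.

Lemma compact_box a b : compact (box a b).
Proof.
rewrite (_ : box a b = [set x | forall i, `[a 0 i, b 0 i]%classic (x ord0 i)]).
  apply: (@rV_compact R n.+1 (fun i => `[a 0 i, b 0 i]%classic)) => i.
  exact: segment_compact.
by apply/seteqP; split=> x h i; have := h i; rewrite /= in_itv.
Qed.

Lemma continuous_box_bounded (f : space -> R) a b : continuous f ->
  exists2 M, 0 <= M & forall x, box a b x -> `|f x| <= M.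
Proof.
move=> cf.
have /compact_bounded[M [_ MP]] : compact [set f x | x in box a b].
  by apply: continuous_compact; [exact: continuous_subspaceT|exact: compact_box].
exists (`|M| + 1); first by rewrite addr_ge0.
move=> x xab; apply: (MP (`|M| + 1)); last by exists x.
by rewrite (le_lt_trans (ler_norm _))// ltrDl.
Qed.

Lemma integrable_box (f : space -> R) a b : continuous f ->
  (forall i, a 0 i <= b 0 i) ->
  (leb_borel R n.+1).-integrable setT (EFin \o (f \* \1_(box a b))).
Proof.
move=> cf ab; have [M M0 fM] := continuous_box_bounded a b cf.
have mQ : measurable (box a b : set (borel n.+1)) by exact: measurable_box.
apply/integrableP; split.
  apply/measurable_EFinP; apply: measurable_funM; first exact: continuous_measurable.
  exact: measurable_indic.
apply: (@le_lt_trans _ _ (\int[leb_borel R n.+1]_x (M%:E * (\1_(box a b) x)%:E))%E).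
  apply: ge0_le_integral => //=.
  - apply/measurable_EFinP; apply: measurableT_comp => //; apply: measurable_funM.
      exact: continuous_measurable.
    exact: measurable_indic.
  - by apply: measurable_funeM; apply/measurable_EFinP; exact: measurable_indic.
  - move=> x _; rewrite lee_fin normrM indicE; case: (boolP (x \in _)) => xab.
      by rewrite normr1 !mulr1 fM// -inE.
    by rewrite normr0 !mulr0.
rewrite ge0_integralZl//=; last by apply/measurable_EFinP; exact: measurable_indic.
rewrite integral_indic// setIT.
change (M%:E * lebesgue_outer (box a b) < +oo)%E.
by rewrite lebesgue_outer_box// -EFinM ltry.
Qed.

Lemma derive_ins (psi : space -> R) l (y : 'rV[R]_n) (t : R) :
  derivable psi (ins l t y) 'e_l ->
  derivable (fun t => psi (ins l t y)) t 1 /\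
  derive1 (fun t => psi (ins l t y)) t = 'D_('e_l) psi (ins l t y).
Proof.
have insE (h : R) : ins l (h + t) y = h *: 'e_l + ins l t y.
  apply/rowP => j; case: (unliftP l j) => [k ->|->].
    by rewrite ins_lift !mxE liftK eqxx/= eq_sym (negPf (neq_lift _ _)) mulr0 add0r.
  by rewrite ins_pivot !mxE unlift_none !eqxx mulr1.
have E : (fun h : R => h^-1 *: (((fun t => psi (ins l t y)) \o shift t) (h *: 1) -
      psi (ins l t y))) =
    (fun h => h^-1 *: ((psi \o shift (ins l t y)) (h *: 'e_l) - psi (ins l t y))).
  apply/funext => h /=; rewrite -insE.
  by congr (h^-1 *: (psi (ins l (_ + t) y) - _)); exact: mulr1.
by move=> d; split; [rewrite /derivable E|rewrite derive1E /derive E].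
Qed.

Let integral_derive_segment (psi : space -> R) l (y : 'rV[R]_n) (u v : R) : u <= v ->
  (forall x, derivable psi x 'e_l) -> continuous ('D_('e_l) psi) -> continuous psi ->
  (\int[lebesgue_measure]_(t in `[u, v]) ('D_('e_l) psi (ins l t y))%:E =
   (psi (ins l v y) - psi (ins l u y))%:E)%E.
Proof.
move=> uv dpsi cD cpsi.
have cins := @ins_continuousl l y.
have cF (f : space -> R) : continuous f -> continuous (fun t => f (ins l t y)).
  by move=> cf t; apply: (@continuous_comp _ _ _ (fun t => ins l t y) f); [exact: cins|exact: cf].
move: uv; rewrite le_eqVlt => /predU1P[->|uv].
  by rewrite set_itv1 subrr (integral_set1).
rewrite (@continuous_FTC2 R (fun t => 'D_('e_l) psi (ins l t y)) (fun t => psi (ins l t y)) u v)//.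
- by apply: continuous_subspaceT; exact: (cF ('D_('e_l) psi) cD).
- split.
  + by move=> t _; have [] := derive_ins (dpsi (ins l t y)).
  + by apply: cvg_at_right_filter; exact: cF.
  + by apply: cvg_at_left_filter; exact: cF.
- by move=> t _; have [_ ->] := derive_ins (dpsi (ins l t y)).
Qed.

(** Fubini's theorem in the direction l and the fundamental theorem of calculus
    on the fibres. *)
Lemma divergence_box (psi : space -> R) l a b : (forall i, a 0 i <= b 0 i) ->
  (forall x, derivable psi x 'e_l) -> continuous ('D_('e_l) psi) -> continuous psi ->
  (\int[leb R n.+1]_x ('D_('e_l) psi x * \1_(box a b) x)%:E =
   \int[leb R n]_y ((psi (ins l (b 0%R l) y) - psi (ins l (a 0%R l) y)) *
                    \1_(box (del l a) (del l b)) y)%:E)%E.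
Proof.
move=> ab dpsi cD cpsi.
have iD := integrable_box cD ab.
have mD : measurable_fun (setT : set (borel n.+1))
    (EFin \o ('D_('e_l) psi \* \1_(box a b))) by case/integrableP : iD.
have cins (t : R) := @ins_continuousr l t.
have mpsi (t : R) : measurable_fun (setT : set (borel n)) (fun y => psi (ins l t y)).
  apply: continuous_measurable => y.
  by apply: (@continuous_comp _ _ _ (fun y => ins l t y) psi); [exact: cins|exact: cpsi].
rewrite (integral_leb_borel mD) (integral_leb_product l iD).
rewrite (integral_leb_borel (f := fun y => _)); last first.
  apply/measurable_EFinP; apply: measurable_funM.
    exact: measurable_funB.
  by apply: measurable_indic; exact: measurable_box.
apply: eq_integral => y _.
under eq_integral do rewrite /= EFinM.
have indE t : \1_(box a b) (ins l t y) =
    \1_(`[a 0%R l, b 0%R l]%classic) t * \1_(box (del l a) (del l b)) y :> R.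
  rewrite !indicE -natrM mulnb; congr (nat_of_bool _)%:R.
  have := congr1 (fun A => (t, y) \in A) (ins_pair_box l a b).
  by rewrite in_setX.
rewrite [in RHS]EFinM indicE; case: (boolP (y \in _)) => yab; last first.
  rewrite mule0 integral0_eq// => t _.
  rewrite (_ : \1_(box a b) (ins l t y) = 0 :> R) ?mule0//.
  by rewrite [LHS]indE [X in _ * X]indicE (negPf yab) mulr0.
rewrite mule1 -(integral_derive_segment y (ab l) dpsi cD cpsi).
rewrite [RHS]integral_mkcond; apply: eq_integral => t _.
rewrite (_ : \1_(box a b) (ins l t y) = \1_(`[a 0%R l, b 0%R l]%classic) t :> R); last first.
  by rewrite [LHS]indE [X in _ * X]indicE yab mulr1.
rewrite patchE indicE.
by case: ifP => _; rewrite ?mule1 ?mule0.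
Qed.

End divergence_on_boxes.

Section hausdorff_on_hyperplanes.
Context {R : realType} {n : nat} (l : 'I_n.+1) (t : R).
Local Notation space := 'rV[R]_n.+1.
Local Notation borel m := (g_sigma_algebraType (@open 'rV[R]_m)).
Local Notation hausT := (caratheodory_type (@hausdorff_outer R n.+1 n)).
Local Notation lebT := (caratheodory_type (@lebesgue_outer R n)).
Local Open Scope ereal_scope.

(** Since the insertion of a coordinate transports the outer measures, a set that
    splits every subset of the hyperplane additively has a preimage that splits
    every subset of R^n additively. *)
Lemma measurable_ins : measurable_fun (setT : set lebT) (ins l t : lebT -> hausT).
Proof.
move=> _ X mX; rewrite setTI.
change ((@lebesgue_outer R n).-caratheodory (ins l t @^-1` X)) => Z.
have := mX [set ins l t y | y in Z].
have im Y : hausdorff_outer n [set ins l t y | y in Y] = lebesgue_outer Y.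
  exact: hausdorff_outer_ins.
change (hausdorff_outer n [set ins l t y | y in Z] =
  hausdorff_outer n ([set ins l t y | y in Z] `&` X) +
  hausdorff_outer n ([set ins l t y | y in Z] `&` ~` X) ->
  lebesgue_outer Z = lebesgue_outer (Z `&` (ins l t @^-1` X)) +
  lebesgue_outer (Z `&` ~` (ins l t @^-1` X))).
rewrite -(im Z) -(im (Z `&` _)) -(im (Z `&` ~` _)) => ->.
congr (_ + _)%E; congr (hausdorff_outer _ _).
- apply/seteqP; split=> [_ [[y Zy <-] Xy]|_ [y [Zy Xy] <-]].
    by exists y.
  by split => //; exists y.
- apply/seteqP; split=> [_ [[y Zy <-] Xy]|_ [y [Zy Xy] <-]].
    by exists y.
  by split => //; exists y.
Qed.

Let hyper : set space := [set x | x 0%R l = t].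

Lemma measurable_hyperplane : measurable (hyper : set (borel n.+1)).
Proof.
rewrite (_ : hyper = [set x : space | (x 0%R l <= t)%R] `&` [set x | (t <= x 0%R l)%R]).
  by apply: measurableI; [exact: measurable_le_coord|exact: measurable_ge_coord].
apply/seteqP; split=> x /=; first by rewrite /hyper/= => ->; rewrite lexx.
by move=> [h1 h2]; apply/eqP; rewrite eq_le h1.
Qed.

Lemma ge0_integral_hyperplane (f : space -> \bar R) :
  measurable_fun (setT : set hausT) f -> (forall x, 0 <= f x) ->
  \int[hausdorff R n.+1 n]_(x in hyper) f x = \int[leb R n]_y f (ins l t y).
Proof.
move=> mf f0.
have mh : measurable (hyper : set hausT).
  by apply: measurable_hausdorff; exact: measurable_hyperplane.
have := @ge0_integral_pushforward _ _ _ _ R _ measurable_ins (leb R n) hyper f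
  mh (measurable_funTS mf) (fun x _ => f0 x).
have -> : ins l t @^-1` hyper = setT.
  by rewrite -subTset => y _; rewrite /hyper/= ins_pivot.
move=> <-; apply: eq_measure_integral => [|? X mX Xh]; first exact: measurable_ins.
change (hausdorff_outer n X = lebesgue_outer (ins l t @^-1` X)).
rewrite -(hausdorff_outer_ins l t); congr (hausdorff_outer _ _).
apply/seteqP; split=> [x Xx|_ [y Xy <-]] //.
exists (del l x); last by rewrite -(Xh x Xx) delK.
by rewrite /= -(Xh x Xx) delK.
Qed.

End hausdorff_on_hyperplanes.

(** * Smooth bump functions *)

Section smooth_bumps.
Context {R : realType}.

(** The functions t^-k exp (- 1 / t) for t > 0, extended by 0; all the
    derivatives of the smooth function exp (- 1 / t) are combinations of
    them. *)
Definition flat (k : nat) (t : R) : R :=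
  if 0 < t then t^-1 ^+ k * expR (- t^-1) else 0.

Lemma flat_ge0 k t : 0 <= flat k t.
Proof.
rewrite /flat; case: ifP => // t0.
by rewrite mulr_ge0 ?expR_ge0// exprn_ge0// invr_ge0 ltW.
Qed.

Lemma flat0_le1 t : flat 0 t <= 1.
Proof.
rewrite /flat; case: ifP => // t0; rewrite expr0 mul1r.
by rewrite -[leRHS]expR0 ler_expR oppr_le0 invr_ge0 ltW.
Qed.

Lemma flat0_gt0 t : (0 < flat 0 t) = (0 < t).
Proof.
by rewrite /flat; case: ifP => t0; rewrite ?ltxx// expr0 mul1r expR_gt0.
Qed.

(** The quadratic bound gives the differentiability at 0. *)
Lemma flat_sqr k t : `|flat k t| <= (k.+2)`!%:R * t ^+ 2.
Proof.
rewrite ger0_norm ?flat_ge0// /flat; case: ifPn => t0; last first.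
  by rewrite mulr_ge0 ?ler0n// sqr_ge0.
have s0 : 0 < t^-1 by rewrite invr_gt0.
have := expR_ge1Dxn k.+1 (ltW s0).
rewrite expRN => H.
have f0 : 0 < ((k.+2)`!%:R : R) by rewrite ltr0n fact_gt0.
have tk : t ^+ k.+2 * t^-1 ^+ k.+2 = 1 by rewrite -exprMn divff ?expr1n// gt_eqF.
have {}H : t^-1 ^+ k.+2 <= (k.+2)`!%:R * expR t^-1.
  by rewrite mulrC -ler_pdivrMr//; apply: le_trans H; rewrite lerDr.
rewrite ler_pdivrMr ?expR_gt0// mulrAC.
apply: (@le_trans _ _ (t ^+ 2 * t^-1 ^+ k.+2)).
  by rewrite -(addn2 k) exprD mulrCA -exprMn divff ?expr1n ?mulr1// gt_eqF.
by rewrite mulrC ler_wpM2r// sqr_ge0.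
Qed.

Lemma is_derive_flat k t :
  is_derive (t : R) (1 : R) (flat k : R -> R) (flat k.+2 t - k%:R * flat k.+1 t).
Proof.
have [t0|t0|t0] := ltgtP 0 t; last first.
- rewrite -{}t0; have F j : flat j 0 = 0 by rewrite /flat ltxx.
  rewrite !F mulr0 subrr; set c : R := (k.+2)`!%:R.
  have H : h^-1 *: ((flat k \o shift 0) (h *: 1) - flat k 0) @[h --> 0^'] --> (0 : R).
    apply/cvgrPdist_le => e e0.
    have c0 : 0 < c by rewrite ltr0n fact_gt0.
    have N := @dnbhs0_le R R^o _ (divr_gt0 e0 c0).
    near=> h.
    rewrite sub0r normrN F subr0 /= /shift /= addr0.
    have -> : h *: (1 : R) = h by exact: mulr1.
    have h0 : h != 0 by near: h; exact: nbhs_dnbhs_neq.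
    change (`|h^-1 * flat k h| <= e).
    rewrite normrM normfV mulrC ler_pdivrMr ?normr_gt0//.
    apply: (le_trans (flat_sqr _ _)).
    rewrite -/c -[h ^+ 2]ger0_norm ?sqr_ge0// normrX expr2 mulrA ler_wpM2r//.
    rewrite mulrC -ler_pdivlMr//.
    by near: h.
  apply: DeriveDef; first by rewrite /derivable; apply/cvg_ex; exists 0.
  exact: (cvg_lim _ H).
- have F j : flat j t = 0 by rewrite /flat ltNge (ltW t0).
  rewrite !F mulr0 subrr.
  have h0 : is_derive (t : R^o) (1 : R^o) (cst 0 : R^o -> R^o) 0 by exact: is_derive_cst.
  apply: near_eq_is_derive h0.
  near=> s; rewrite /flat/= ltNge ltW//=; near: s; exact: lt_nbhsl.
- have N : \forall s \near (t : R^o),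
      ((fun s : R => s^-1) ^+ k * (expR \o (fun s : R => - s^-1))) s = flat k s.
    by near=> s; rewrite /flat ifT ?fctE//; near: s; exact: lt_nbhsr.
  have dV : is_derive t 1 (fun s : R => s^-1) (- (t^-1 ^+ 2)).
    have := @is_deriveV R id t 1 1; rewrite gt_eqF//= => /(_ isT (is_derive_id _ _)).
    by rewrite exprVn scaleNr scaler1 -exprVn; apply.
  have dN := is_deriveN dV.
  have dE := @is_derive1_comp _ expR (fun s : R => - s^-1) t _ _ (is_derive_expR (- t^-1)) dN.
  have dX := is_deriveX k dV.
  have := near_eq_is_derive N (is_deriveM dX dE).
  rewrite /flat t0; move=> [d v]; apply: (DeriveDef d).
  rewrite {d}v /=.
  rewrite !fctE; move: (t^-1) => s; move: (expR (- s)) => e.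
  rewrite !opprK /GRing.scale/=.
  case: (k) => [|m]; first by rewrite !expr0; ring.
  by rewrite !exprS /=; ring.
Unshelve. all: by end_near. Qed.

Context {n : nat}.
Local Notation space := 'rV[R]_n.+1.

(** The algebra generated by the functions flat k of affine functions of one
    coordinate. It is closed under partial derivatives, so that its members are
    smooth. *)
Inductive flat_algebra : (space -> R) -> Prop :=
| flat_cst c : flat_algebra (cst c)
| flat_coord k i (s a : R) : flat_algebra (fun x => flat k (s * x 0 i + a))
| flat_add f g : flat_algebra f -> flat_algebra g -> flat_algebra (f + g)
| flat_mul f g : flat_algebra f -> flat_algebra g -> flat_algebra (f * g).

Let affine_is_diff i (s a : R) (x : space) :
  differentiable (fun y : space => s * y 0 i + a) x /\
  forall l, 'D_('e_l) (fun y : space => s * y 0 i + a) x = s * (i == l)%:R.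
Proof.
have d1 : differentiable (fun y : space => y 0 i : R) x by exact: differentiable_coord.
have d2 : differentiable (fun y : space => s * y 0 i : R) x by exact: differentiableZ.
have d : differentiable (fun y : space => s * y 0 i + a) x by exact: differentiableD.
split=> // l.
apply: (lim_near_cst (@norm_hausdorff _ _)).
near=> h; rewrite /= !mxE /= ?eqxx/=.
have h0 : h != 0 by near: h; exact: nbhs_dnbhs_neq.
rewrite /GRing.scale/= (_ : _ - _ = h * (s * (i == l)%:R)); last by ring.
by rewrite mulrA mulVf// mul1r.
Unshelve. all: by end_near. Qed.

Lemma flat_algebra_derive f : flat_algebra f ->
  (forall x, differentiable f x) /\ forall l, flat_algebra ('D_('e_l) f).
Proof.
have df (k : nat) (t : R) : differentiable (flat k) t.
  by apply/derivable1_diffP; have [] := is_derive_flat k t.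
elim=> {f} [c|k i s a|f g _ [df1 af] _ [dg1 ag]|f g Af [df1 af] Ag [dg1 ag]].
- split=> [x|l]; first exact: differentiable_cst.
  rewrite (_ : 'D_('e_l) _ = cst 0); first exact: flat_cst.
  by apply/funext => x; rewrite derive_cst.
- split=> [x|l].
    apply: (@differentiable_comp _ _ _ _ (fun y : space => s * y 0 i + a)) => //.
    by have [] := affine_is_diff i s a x.
  rewrite (_ : 'D_('e_l) _ = cst (s * (i == l)%:R) *
    ((fun x => flat k.+2 (s * x 0 i + a)) + cst (- k%:R) *
     (fun x => flat k.+1 (s * x 0 i + a)))).
    apply: flat_mul; first exact: flat_cst.
    apply: flat_add; first exact: flat_coord.
    by apply: flat_mul; [exact: flat_cst|exact: flat_coord].
  apply/funext => x; have [da Da] := affine_is_diff i s a x.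
  rewrite deriveE; last exact: (@differentiable_comp _ _ _ _ (fun y : space => s * y 0 i + a)).
  rewrite (@diff_comp _ _ _ _ (fun y : space => s * y 0 i + a) (flat k))//=.
  rewrite -(deriveE 'e_l da) Da diff1E// derive1E.
  have h := is_derive_flat k (s * x 0 i + a); rewrite (@derive_val _ _ _ _ _ _ _ h).
  by rewrite !fctE /= /cst /GRing.scale/=; ring.
- split=> [x|l]; first exact: differentiableD.
  rewrite (_ : 'D_('e_l) _ = 'D_('e_l) f + 'D_('e_l) g).
    exact: flat_add.
  by apply/funext => x; rewrite deriveD//; exact: diff_derivable.
- split=> [x|l]; first exact: differentiableM.
  rewrite (_ : 'D_('e_l) _ = f * 'D_('e_l) g + g * 'D_('e_l) f).
    by apply: flat_add; apply: flat_mul.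
  by apply/funext => x; rewrite deriveM//; exact: diff_derivable.
Qed.

Lemma flat_algebra_smooth f : flat_algebra f -> smooth f.
Proof.
move=> Af s x; have : flat_algebra (partials s f).
  by elim: s => [|i s IH] //=; have [_] := flat_algebra_derive IH; apply.
by move=> /flat_algebra_derive[].
Qed.

Definition bump (a b x : space) : R :=
  \prod_i (flat 0 (x 0 i - a 0 i) * flat 0 (b 0 i - x 0 i)).

Lemma bump_ge0 a b x : 0 <= bump a b x.
Proof. by apply: prodr_ge0 => i _; rewrite mulr_ge0// flat_ge0. Qed.

Lemma bump_le1 a b x : bump a b x <= 1.
Proof.
apply: prodr_ile1 => i _; rewrite mulr_ge0 ?flat_ge0//=.
by rewrite mulr_ile1 ?flat_ge0 ?flat0_le1.
Qed.

Lemma bump_gt0 a b x : (0 < bump a b x) <-> obox a b x.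
Proof.
split=> [|xab].
  rewrite lt_neqAle eq_sym => /andP[/prodf_neq0 h _] i.
  have := h i isT; rewrite mulf_eq0 negb_or => /andP[h1 h2].
  have pos t : flat 0 t != 0 -> 0 < t by rewrite -flat0_gt0 lt0r flat_ge0 andbT.
  by rewrite -(subr_gt0 (a 0 i)) -(subr_gt0 (x 0 i)) !pos.
by apply: prodr_gt0 => i _; have /andP[h1 h2] := xab i; rewrite mulr_gt0// flat0_gt0 subr_gt0.
Qed.

Lemma flat_algebra_bump a b : flat_algebra (bump a b).
Proof.
rewrite /bump; elim: (index_enum _) => [|i r IH].
  under eq_fun do rewrite big_nil; exact: flat_cst.
under eq_fun do rewrite big_cons.
apply: (@flat_mul (fun x => _) (fun x => _) _ IH).
apply: (@flat_mul (fun x => flat 0 (x 0 i - a 0 i)) (fun x => flat 0 (b 0 i - x 0 i))).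
  by under eq_fun do rewrite -[x in flat _ (x - _)]mul1r; exact: flat_coord.
by under eq_fun do rewrite addrC -mulN1r; exact: flat_coord.
Qed.

(** Raising 1 - bump a b to large powers produces test functions that increase
    to the indicator function of the open box. *)
Definition plateau a b k x : R := 1 - (1 - bump a b x) ^+ k.

Lemma plateau_eq0 a b k x : ~ box a b x -> plateau a b k x = 0.
Proof.
move=> xab; suff b0 : bump a b x = 0 by rewrite /plateau b0 subr0 expr1n subrr.
apply/eqP/negPn/negP => h; apply/xab/obox_sub/bump_gt0.
by rewrite lt_neqAle bump_ge0 andbT eq_sym.
Qed.

Lemma plateau_test a b k Om : box a b `<=` Om -> test_function Om (plateau a b k).
Proof.
move=> abOm.
have sub : support (plateau a b k) `<=` box a b.
  have cB : closed (box a b).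
    by apply: compact_closed; [exact: norm_hausdorff|exact: compact_box].
  move/closure_id : cB => ->; apply: closure_subset => x /= xk.
  by apply: contrapT => /(plateau_eq0 k) h; rewrite h eqxx in xk.
split; last exact: subset_trans abOm.
split.
  apply: flat_algebra_smooth.
  have bm : flat_algebra (fun x => 1 - bump a b x).
    apply: (@flat_add (cst 1) (fun x => - bump a b x)); first exact: flat_cst.
    under eq_fun do rewrite -mulN1r.
    by apply: (@flat_mul (cst (-1))); [exact: flat_cst|exact: flat_algebra_bump].
  apply: (@flat_add (cst 1) (fun x => - _)); first exact: flat_cst.
  under eq_fun do rewrite -mulN1r.
  apply: (@flat_mul (cst (-1))); first exact: flat_cst.
  elim: k {sub} => [|k IH]; first by under eq_fun do rewrite expr0; exact: flat_cst.
  by under eq_fun do rewrite exprS; apply: flat_mul.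
apply: subclosed_compact sub; [exact: closed_closure|exact: compact_box].
Qed.

Lemma plateau_bound a b k x : 0 <= plateau a b k x <= 1.
Proof.
have h0 := bump_ge0 a b x; have h1 := bump_le1 a b x.
rewrite /plateau subr_ge0 gerBl exprn_ge0 ?subr_ge0// andbT exprn_ile1 ?subr_ge0//.
by rewrite gerBl.
Qed.

Lemma plateau_cvg a b x : plateau a b k x @[k --> \oo] --> (\1_(obox a b) x : R).
Proof.
rewrite indicE; have [|xab] := boolP (x \in _).
  rewrite inE => /bump_gt0 h; rewrite -[in X in _ --> X](subr0 1).
  apply: cvgB; first exact: cvg_cst.
  by apply: cvg_expr; rewrite ger0_norm ?subr_ge0 ?bump_le1// gtrBl.
rewrite (_ : plateau a b ^~ x = cst 0); first exact: cvg_cst.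
apply/funext => k; suff b0 : bump a b x = 0 by rewrite /plateau b0 subr0 expr1n subrr.
apply/eqP; move: xab; apply: contraNT => h; rewrite inE; apply/bump_gt0.
by rewrite lt_neqAle bump_ge0 andbT eq_sym.
Qed.

End smooth_bumps.

(** * Test functions determine charges *)

Section finite_measure_add.
Context d (T : measurableType d) (R : realType).
Variables m1 m2 : {finite_measure set T -> \bar R}.

Definition finite_add : set T -> \bar R := measure_add m1 m2.

HB.instance Definition _ := Measure.on finite_add.

Let finite_add_fin : fin_num_fun finite_add.
Proof. by move=> B mB; rewrite /finite_add measure_addE fin_numD !fin_num_measure. Qed.

HB.instance Definition _ := @Measure_isFinite.Build _ T R finite_add finite_add_fin.

Lemma Rintegral_finite_add (f : T -> R) M : measurable_fun setT f ->
  (forall x, `|f x| <= M) ->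
  \int[finite_add]_x f x = \int[m1]_x f x + \int[m2]_x f x.
Proof.
move=> mf fM; have ib m := @bounded_integrable _ _ _ m f M mf fM.
rewrite /finite_add /Rintegral integral_measure_add ?ib//.
exact: (fineD (integrable_fin_num measurableT (ib m1)) (integrable_fin_num measurableT (ib m2))).
Qed.

End finite_measure_add.

Section uniqueness.
Context {R : realType} {n : nat}.
Local Notation space := 'rV[R]_n.+1.
Local Notation borel := (g_sigma_algebraType (@open space)).
Implicit Types (a b x : space) (Om : set space).

Lemma measurable_obox a b : measurable (obox a b : set borel).
Proof.
rewrite (_ : obox a b = \bigcap_(i in [set: 'I_n.+1])
    ([set x : space | a 0 i < x 0 i] `&` [set x | x 0 i < b 0 i])).
  apply: fin_bigcap_measurable => // i _; apply: measurableI.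
    exact: measurable_gt_coord.
  exact: measurable_lt_coord.
apply/seteqP; split=> [x h i _|x h i]; first by have /andP[] := h i.
by have [-> ->] := h i Logic.I.
Qed.

Let shrunk (ab : space * space) (k : nat) : space * space :=
  (\row_i (ab.1 0 i - k.+1%:R^-1), \row_i (ab.2 0 i + k.+1%:R^-1)).

Lemma borel_oboxes : (@measurable _ borel) =
  <<s [set obox ab.1 ab.2 | ab in [set: space * space]] >>.
Proof.
apply/seteqP; split; last first.
  apply: smallest_sub; first exact: sigma_algebra_measurable.
  by move=> _ [ab _ <-]; exact: measurable_obox.
rewrite borel_boxes; apply: smallest_sub; first exact: smallest_sigma_algebra.
have S : sigma_algebra setT <<s [set obox ab.1 ab.2 | ab in [set: space * space]] >>.
  exact: smallest_sigma_algebra.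
move=> _ [[a b] _ <-].
rewrite (_ : box _ _ = \bigcap_k obox (shrunk (a, b) k).1 (shrunk (a, b) k).2).
  rewrite -[X in _ X]setCK setC_bigcap -setTD.
  have [S0 SC SU] := S; apply: (SC); apply: SU => k; rewrite -setTD; apply: (SC).
  by apply: sub_sigma_algebra; exists (shrunk (a, b) k).
apply/seteqP; split=> x /= h.
  move=> k _ i; have /andP[h1 h2] := h i; rewrite !mxE /=.
  have k0 : (0 : R) < k.+1%:R^-1 by rewrite invr_gt0.
  by rewrite ltrBlDr (le_lt_trans h1) ?ltrDl// (le_lt_trans h2) ?ltrDl.
move=> i; apply/andP; split; apply/ler_addgt0Pr => e e0;
  have [k ke] := natSinv_lt e0; have /andP[] := h k Logic.I i; rewrite !mxE/= => h1 h2.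
  by rewrite (le_trans (ltW _) (_ : x 0 i + k.+1%:R^-1 <= _))// ?lerD2l ?(ltW ke)// -ltrBlDr.
by rewrite (le_trans (ltW h2))// lerD2l ltW.
Qed.

(** Boxes with arbitrarily small rational perturbations of the corners are enough
    to exhaust an open set. *)
Lemma open_bigcup_obox Om : open Om -> exists ab : nat -> space * space,
  (forall k, box (ab k).1 (ab k).2 `<=` Om) /\
  Om = \bigcup_k obox (ab k).1 (ab k).2.
Proof.
move=> oOm.
pose T := ('rV[rat]_n.+1 * 'rV[rat]_n.+1)%type.
pose I (q : T) : space * space := (map_mx ratr q.1, map_mx ratr q.2).
pose E : space * space := (const_mx 1, const_mx 0).
pose ab (k : nat) : space * space := if unpickle k is Some q then
  if `[< box (I q).1 (I q).2 `<=` Om >] then I q else E else E.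
have E0 : box E.1 E.2 = set0.
  by rewrite -subset0 => x /(_ ord0); rewrite !mxE => /andP[h1 h2]; have := le_trans h1 h2; rewrite ler10.
have abOm k : box (ab k).1 (ab k).2 `<=` Om.
  rewrite /ab; case: (unpickle k) => [q|]; last by rewrite E0.
  by case: asboolP => // _; rewrite E0.
exists ab; split => //; apply/seteqP; split=> [x Omx|x [k _ /obox_sub /abOm]//].
move/open_nbhs_nbhs: (conj oOm Omx) => /= H.
have /nbhs_ballP[e /= e0 eOm] : nbhs x Om by apply: open_nbhs_nbhs.
have ex i : exists q : rat * rat, x 0 i - e < ratr q.1 < x 0 i /\ x 0 i < ratr q.2 < x 0 i + e.
  have l1 : x 0 i - e < x 0 i by rewrite ltrBlDr ltrDl.
  have l2 : x 0 i < x 0 i + e by rewrite ltrDl.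
  have [q1 q1P] := rat_in_itvoo l1; have [q2 q2P] := rat_in_itvoo l2.
  by exists (q1, q2); rewrite !in_itv/= in q1P q2P *.
have [q qP] := choice ex.
pose Q : T := (\row_i (q i).1, \row_i (q i).2).
exists (pickle Q) => //; rewrite /ab pickleK; case: asboolP => [_ i|[]].
  by rewrite !mxE; have [/andP[_ ->] /andP[-> _]] := qP i.
move=> y yQ; apply: eOm; split=> // j i; rewrite ord1 /ball/= ltr_distlC.
have := yQ i; rewrite !mxE; have [/andP[h1 _] /andP[_ h2]] := qP i => /andP[h3 h4].
by rewrite (lt_le_trans h1 h3) (le_lt_trans h4 h2).
Qed.

(** Dominated convergence along the plateau functions. *)
Let Rint_plateau (m : {finite_measure set borel -> \bar R}) a b :
  (fun k => \int[m]_x plateau a b k x)%R @ \oo --> fine (m (obox a b)).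
Proof.
have mp k : measurable_fun (setT : set borel) (plateau a b k).
  apply: continuous_measurable => x; apply: differentiable_continuous.
  have [[sm _] _] := plateau_test k (@subset_refl _ (box a b)).
  exact: (sm [::]).
have -> : fine (m (obox a b)) = \int[m]_x (\1_(obox a b) x).
  rewrite /Rintegral integral_indic//; last exact: measurable_obox.
  by rewrite setIT.
have [|||||] := @dominated_convergence _ borel R m setT measurableT
  (fun k x => (plateau a b k x)%:E) (fun x => (\1_(obox a b) x)%:E) (cst 1%E).
- by move=> k; apply/measurable_EFinP.
- by apply/measurable_EFinP; apply: measurable_indic; exact: measurable_obox.
- by apply: aeW => x _; apply/cvg_EFin; [exact: nearW|exact: plateau_cvg].
- by apply: (@bounded_integrable _ borel R m (cst 1) 1) => // y; rewrite normr1.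
- apply: aeW => x k _; have /andP[p0 p1] := plateau_bound a b k x.
  by rewrite abse_EFin lee_fin ger0_norm.
move=> i1 _ h; apply: fine_cvg; move: h; rewrite fineK//.
exact: (integrable_fin_num measurableT i1).
Qed.

(** The plateau functions determine the measures on the open boxes with closure
    in Om, which are stable under intersection and exhaust Om. *)
Lemma test_function_measure_unique Om (m1 m2 : {finite_measure set borel -> \bar R}) :
  open Om ->
  (forall phi, test_function Om phi -> \int[m1]_x phi x = \int[m2]_x phi x) ->
  forall B : set borel, measurable B -> B `<=` Om -> m1 B = m2 B.
Proof.
move=> oOm H.
have HQ a b : box a b `<=` Om -> m1 (obox a b) = m2 (obox a b).
  move=> abOm; rewrite -[LHS]fineK ?fin_num_measure//; last exact: measurable_obox.
  rewrite -[RHS]fineK ?fin_num_measure//; last exact: measurable_obox.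
  congr EFin; have h1 := @Rint_plateau m1 a b.
  have : (fun k => \int[m1]_x plateau a b k x)%R @ \oo --> fine (m2 (obox a b)).
    by under eq_fun do rewrite (H _ (plateau_test _ abOm)); exact: Rint_plateau.
  by move=> h2; apply: (cvg_unique _ h1 h2).
have HB a b B : box a b `<=` Om -> measurable (B : set borel) -> B `<=` obox a b ->
    m1 B = m2 B.
  move=> abOm mB Bab; have mQ := measurable_obox a b.
  have : mrestr m1 mQ B = mrestr m2 mQ B.
    apply: (@measure_unique _ R borel _ (fun k : nat => obox (- const_mx k%:R) (const_mx k%:R)) borel_oboxes).
    - move=> _ _ [[c d] _ <-] [[c' d'] _ <-].
      exists ((\row_i Num.max (c 0 i) (c' 0 i))%R, (\row_i Num.min (d 0 i) (d' 0 i))%R) => //=.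
      apply/seteqP; split=> [x h|x [h1 h2] i].
        split=> i; have := h i; rewrite !mxE gt_max lt_min; first by move=> /andP[/andP[-> _] /andP[]].
        by move=> /andP[/andP[_ ->] /andP[]].
      rewrite !mxE gt_max lt_min; have /andP[-> ->] := h1 i.
      by have /andP[-> ->] := h2 i.
    - by move=> k; exists (- const_mx k%:R, const_mx k%:R).
    - rewrite -subTset => x _; have [k _ xk] : (\bigcup_k cube k) x by rewrite bigcup_cube.
      exists k.+1 => // i; have := xk i; rewrite !mxE => /andP[h1 h2].
      by rewrite (lt_le_trans _ h1) ?(le_lt_trans h2)// ?ltrN2 ltr_nat.
    - move=> _ [[c d] _ <-]; change (m1 (obox c d `&` obox a b) = m2 (obox c d `&` obox a b)).
      rewrite (_ : obox c d `&` _ = obox (\row_i Num.max (c 0 i) (a 0 i))%R (\row_i Num.min (d 0 i) (b 0 i))%R).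
        apply: HQ; apply: subset_trans abOm => x h i; have := h i.
        by rewrite !mxE ge_max le_min => /andP[/andP[_ ->] /andP[]].
      apply/seteqP; split=> [x [h1 h2] i|x h].
        rewrite !mxE gt_max lt_min; have /andP[-> ->] := h1 i.
        by have /andP[-> ->] := h2 i.
      split=> i; have := h i; rewrite !mxE gt_max lt_min; first by move=> /andP[/andP[-> _] /andP[]].
      by move=> /andP[/andP[_ ->] /andP[]].
    - move=> k; change (m1 (obox (- const_mx k%:R) (const_mx k%:R) `&` obox a b) < +oo)%E.
      rewrite ltey_eq fin_num_measure//; apply: measurableI => //.
      exact: measurable_obox.
    - exact: mB.
  by rewrite /mrestr (setIidl Bab).
move=> B mB BOm; have [ab [abOm OmE]] := open_bigcup_obox oOm.
pose F k := obox (ab k).1 (ab k).2.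
have BE : B = \bigcup_k (B `&` seqDU F k).
  by rewrite -setI_bigcupr -seqDU_bigcup_eq /F -OmE (setIidl BOm).
have mF k : measurable (F k : set borel) by exact: measurable_obox.
have mG k : measurable (B `&` seqDU F k : set borel).
  apply: measurableI => //; apply: measurableD => //; exact: bigsetU_measurable.
have tG : trivIset setT (fun k => B `&` seqDU F k).
  by apply: trivIset_setIl; exact: trivIset_seqDU.
rewrite {1 2}BE !measure_bigcup//=; apply: eq_eseriesr => k _.
apply: (HB _ _ _ (abOm k)) => //; apply: (@subset_trans _ (seqDU F k)); [exact: subIsetr|exact: subset_seqDU].
Qed.

Lemma charge_integral_setT Om (nu : {charge set borel -> \bar R}) phi : open Om ->
  (forall x, ~ Om x -> phi x = 0) ->
  charge_integral nu Om phi = charge_integral nu setT phi.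
Proof.
move=> oOm H; rewrite /charge_integral; set P := cid _; set N := cid _.
by congr (_ - _); rewrite Rintegral_mkcond; apply: eq_Rintegral => x _;
  rewrite patchE; case: ifPn => // /negP xOm; rewrite H// => Ox; apply: xOm; rewrite inE.
Qed.

Lemma test_function_eq0 Om (phi : space -> R) x : test_function Om phi -> ~ Om x -> phi x = 0.
Proof.
move=> [_ sOm] xOm; apply/eqP/negPn/negP => h; apply/xOm/sOm.
exact: subset_closure.
Qed.

Lemma test_function_differentiable Om (phi : space -> R) s x :
  test_function Om phi -> differentiable (partials s phi) x.
Proof. by case=> -[]. Qed.

Lemma test_function_continuous Om (phi : space -> R) s :
  test_function Om phi -> continuous (partials s phi).
Proof.
by move=> tphi x; apply: differentiable_continuous; exact: test_function_differentiable tphi.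
Qed.

Lemma partials_eq0 (phi : space -> R) s x : ~ support phi x -> partials s phi x = 0.
Proof.
move=> xS; have U : open (~` support phi) by apply: closed_openC; exact: closed_closure.
elim: s x xS => [|i s IH] x xS /=.
  by apply/eqP/negPn/negP => h; apply: xS; exact: subset_closure.
have N : \near x, cst 0 x = partials s phi x.
  have : nbhs x (~` support phi) by apply: open_nbhs_nbhs.
  by apply: filterS => y yS; rewrite IH.
exact: (@derive_val _ _ _ _ _ _ _ (near_eq_is_derive N (is_derive_cst 0 x 'e_i))).
Qed.

Lemma test_function_bounded Om (phi : space -> R) s : test_function Om phi ->
  exists2 M, 0 <= M & forall x, `|partials s phi x| <= M.
Proof.
move=> tphi; have [[_ cS] _] := tphi.
have /compact_bounded[M [_ MP]] : compact [set partials s phi x | x in support phi].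
  apply: continuous_compact => //; apply: continuous_subspaceT.
  exact: test_function_continuous tphi.
exists (`|M| + 1); first by rewrite addr_ge0.
move=> x; have [xS|/partials_eq0 ->] := pselect (support phi x); last by rewrite normr0 addr_ge0.
apply: (MP (`|M| + 1)); last by exists x.
by rewrite (le_lt_trans (ler_norm _))// ltrDl.
Qed.

(** The equality of the integrals is one of integrals against the finite
    measures nu1^+ + nu2^- and nu2^+ + nu1^-. *)
Lemma test_function_charge_unique Om (nu1 nu2 : {charge set borel -> \bar R}) :
  open Om ->
  (forall phi, test_function Om phi -> charge_integral nu1 Om phi = charge_integral nu2 Om phi) ->
  forall B : set borel, measurable B -> B `<=` Om -> nu1 B = nu2 B.
Proof.
move=> oOm H B mB BOm.
have [P1 hP1] := Hahn_decomposition nu1; have [N1 h1] := hP1.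
have [P2 hP2] := Hahn_decomposition nu2; have [N2 h2] := hP2.
pose p1 : {finite_measure set borel -> \bar R} := jordan_pos h1.
pose q1 : {finite_measure set borel -> \bar R} := jordan_neg h1.
pose p2 : {finite_measure set borel -> \bar R} := jordan_pos h2.
pose q2 : {finite_measure set borel -> \bar R} := jordan_neg h2.
have d1 C : measurable C -> nu1 C = (p1 C - q1 C)%E.
  by move=> mC; rewrite (jordan_decomp h1 mC) /cadd/= cscaleN1.
have d2 C : measurable C -> nu2 C = (p2 C - q2 C)%E.
  by move=> mC; rewrite (jordan_decomp h2 mC) /cadd/= cscaleN1.
have : finite_add p1 q2 B = finite_add p2 q1 B.
  apply: (@test_function_measure_unique Om (finite_add p1 q2) (finite_add p2 q1)) => //.
  move=> phi tphi; have [M M0 phiM] := test_function_bounded [::] tphi.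
  have mphi : measurable_fun (setT : set borel) phi.
    by apply: continuous_measurable; exact: (test_function_continuous (s := [::]) tphi).
  have := H phi tphi.
  rewrite !(charge_integral_setT _ oOm) => [|x|x]; [|exact: test_function_eq0 tphi..].
  rewrite (charge_integralE d1 mphi phiM) (charge_integralE d2 mphi phiM).
  rewrite !(Rintegral_finite_add _ _ mphi phiM).
  by move=> ?; lra.
change (measure_add p1 q2 B = measure_add p2 q1 B -> nu1 B = nu2 B).
rewrite !measure_addE d1// d2// => E.
have swap (a b c e : \bar R) : a \is a fin_num -> b \is a fin_num ->
    c \is a fin_num -> e \is a fin_num -> (a + e = c + b -> a - b = c - e)%E.
  move: a b c e => [a| |] [b| |] [c| |] [e| |]// _ _ _ _.
  by rewrite -!EFinB -!EFinD => -[] ?; congr EFin; lra.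
exact: (swap _ _ _ _ (fin_num_measure p1 B mB) (fin_num_measure q1 B mB)
  (fin_num_measure p2 B mB) (fin_num_measure q2 B mB) E).
Qed.

End uniqueness.

(** * One-sided limits and jump triples *)

Section monotone_integral.
Context d (T : measurableType d) (R : realType) (mu : {measure set T -> \bar R}).
Local Open Scope ereal_scope.

(** The integral of a nonnegative function is a supremum over the simple
    functions below it, so that it is monotone on arbitrary functions. *)
Lemma ge0_subset_le_integral (D1 D2 : set T) (f1 f2 : T -> \bar R) :
  D1 `<=` D2 -> (forall x, D1 x -> 0 <= f1 x) -> (forall x, D2 x -> 0 <= f2 x) ->
  (forall x, D1 x -> f1 x <= f2 x) ->
  \int[mu]_(x in D1) f1 x <= \int[mu]_(x in D2) f2 x.
Proof.
move=> D12 f10 f20 f12; rewrite integral_mkcond [leRHS]integral_mkcond.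
have p1 x : 0 <= (f1 \_ D1) x.
  by rewrite patchE; case: ifPn => //; rewrite inE; exact: f10.
have p2 x : 0 <= (f2 \_ D2) x.
  by rewrite patchE; case: ifPn => //; rewrite inE; exact: f20.
rewrite !ge0_integralTE//; apply: le_ereal_sup => _ [h hf <-]; exists h => // x.
apply: le_trans (hf x) _; rewrite !patchE; case: ifPn => [|xD1]; last by have := p2 x; rewrite patchE.
by rewrite inE => D1x; rewrite ifT ?f12// inE; exact: D12.
Qed.

End monotone_integral.

Section one_sided_limits.
Context {R : realType} {n : nat} {E : normedVectType R}.
Local Notation space := 'rV[R]_n.+1.
Local Notation borel := (g_sigma_algebraType (@open space)).
Implicit Types (u : space -> E) (x z d nu : space) (p q a b : E).

(** Uniform limits on half balls, from which the limits in the mean are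
    deduced. *)
Definition side_limit u x d p := forall e : R, 0 < e -> exists2 r : R, 0 < r &
  forall y, half_ball x d r y -> `|u y - p| <= e.

Lemma measurable_half_ball x d r : measurable (half_ball x d r : set borel).
Proof.
rewrite (_ : half_ball x d r = [set y : space | enorm (y - x) < r] `&`
    (fun y : space => dot (y - x) d) @^-1` `]0, +oo[%classic).
  apply: measurableI; first exact: borel_ball.
  rewrite -[X in measurable X]setTI.
  have : measurable_fun (setT : set borel) (fun y : space => dot (y - x) d).
    rewrite /dot; apply: measurable_sum => i; apply: measurable_funM => //.
    under eq_fun do rewrite !mxE.
    apply: measurable_funB => //; apply: continuous_measurable; exact: coord_continuous.
  by apply => //; exact: measurable_itv.
by apply/seteqP; split=> y /=; rewrite in_itv/= andbT.
Qed.

Lemma half_ball_le_ball x d r : 0 < r ->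
  (leb R n.+1 (half_ball x d r) <= ((2 * r) ^+ n.+1)%:E)%E.
Proof.
move=> r0; apply: (@le_trans _ _ (lebesgue_outer (box (x - const_mx r) (x + const_mx r)))).
  apply: le_outer_measure => y [yr _] i; rewrite !mxE -ler_distlC.
  by apply/ltW/(le_lt_trans _ yr); rewrite -enorm_dist; have := coord_le_enorm (x - y) i; rewrite !mxE.
rewrite lebesgue_outer_box; last by move=> i; rewrite !mxE; lra.
rewrite lee_fin /vol (eq_bigr (fun=> 2 * r)); last by move=> i _; rewrite !mxE; lra.
by rewrite prodr_const card_ord.
Qed.

(** By scaling, the box is r times a fixed one, a small box around z on which the
    strict inequalities satisfied by z persist. *)
Lemma half_ball_box x nu d z : enorm nu = 1 -> enorm d = 1 -> enorm z < 1 ->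
  0 < dot z nu -> 0 < dot z d ->
  exists2 e : R, 0 < e & forall r, 0 < r -> exists C : set space,
  [/\ C `<=` half_ball x nu r, C `<=` half_ball x d r, measurable (C : set borel) &
      leb R n.+1 C = ((2 * (e * r)) ^+ n.+1)%:E].
Proof.
move=> nu1 d1 z1 znu zd; pose m := Num.min (1 - enorm z) (Num.min (dot z nu) (dot z d)).
have m0 : 0 < m by rewrite !lt_min subr_gt0 z1 znu zd.
pose e := m / 2 / n.+1%:R.
have e0 : 0 < e by rewrite !divr_gt0// ltr0n.
exists e => // r r0.
pose c := x + r *: z; pose C := box (c - const_mx (e * r)) (c + const_mx (e * r)).
have er0 : 0 < e * r by rewrite mulr_gt0.
have key y : C y -> exists2 w, y - x = r *: w & enorm (w - z) < m.
  move=> Cy; exists (r^-1 *: (y - x)); first by rewrite scalerA divff ?gt_eqF// scale1r.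
  have -> : r^-1 *: (y - x) - z = r^-1 *: (y - c).
    by rewrite /c opprD addrA [RHS]scalerBr scalerA mulVf ?gt_eqF// scale1r.
  rewrite enormZ gtr0_norm ?invr_gt0// mulrC ltr_pdivrMr//.
  apply: (@le_lt_trans _ _ (n.+1%:R * (e * r))).
    apply: enorm_le_bound => i; have := Cy i; rewrite !mxE => h.
    by rewrite ler_distl; move: h => /andP[h1 h2]; lra.
  rewrite mulrA ltr_pM2r// /e mulrC divfK ?pnatr_eq0//.
  by rewrite ltr_pdivrMr//; lra.
have half f : enorm f = 1 -> m <= dot z f -> C `<=` half_ball x f r.
  move=> f1 mf y /key[w yw wz]; rewrite /half_ball/= yw; split.
    rewrite enormZ gtr0_norm// -[ltRHS]mulr1 ltr_pM2l//.
    apply: (@le_lt_trans _ _ (enorm (w - z) + enorm z)); first by rewrite -{1}(subrK z w) enormD.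
    have : m <= 1 - enorm z by rewrite ge_min lexx.
    by lra.
  rewrite dotZl mulr_gt0//; have := dot_le (z - w) f; rewrite f1 mulr1 enorm_dist.
  by rewrite dotDl dotNl => ?; lra.
exists C; split.
- by apply: half => //; rewrite !ge_min lexx orbT.
- by apply: half => //; rewrite !ge_min lexx !orbT.
- exact: measurable_box.
- change (lebesgue_outer C = ((2 * (e * r)) ^+ n.+1)%:E).
  rewrite lebesgue_outer_box; last by move=> i; rewrite !mxE; lra.
  rewrite /vol (eq_bigr (fun=> 2 * (e * r))); last by move=> i _; rewrite !mxE; lra.
  by rewrite prodr_const card_ord.
Qed.

Lemma half_ball_gt0 x d r : enorm d = 1 -> 0 < r -> (0 < leb R n.+1 (half_ball x d r))%E.
Proof.
move=> d1 r0; have dd : dot d d = 1 by rewrite -sqr_enorm d1 expr1n.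
have [|||e e0 /(_ r r0) [C [Cd _ _ CE]]] := @half_ball_box x d d (2^-1 *: d) d1 d1.
- by rewrite enormZ d1 ger0_norm ?invr_ge0//; lra.
- by rewrite dotZl dd; lra.
- by rewrite dotZl dd; lra.
apply: (@lt_le_trans _ _ (leb R n.+1 C)); first by rewrite CE lte_fin exprn_gt0// !mulr_gt0.
exact: le_outer_measure.
Qed.

Lemma half_ball_fin x d r : 0 < r -> (leb R n.+1 (half_ball x d r)) \is a fin_num.
Proof.
move=> r0; rewrite ge0_fin_numE ?measure_ge0//.
by apply: le_lt_trans (half_ball_le_ball x d r0) _; rewrite ltry.
Qed.

Let cvg0_le (f : R -> \bar R) : (forall r, 0 < r -> (0 <= f r)%E) ->
  f r @[r --> 0^'+] --> 0%E <->
  forall e, 0 < e -> \forall r \near 0^'+, (f r <= e%:E)%E.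
Proof.
move=> f0; have F0 : \forall r \near (0 : R)^'+, (0 <= f r)%E.
  by near=> r; apply: f0; near: r; exact: nbhs_right_gt.
split=> [/fine_cvgP[ffin /cvgrPdist_le H] e e0|H].
  near=> r; have fr : f r \is a fin_num by near: r.
  have : `|0 - (fine \o f) r| <= e by near: r; exact: H.
  by rewrite sub0r normrN /= => h; rewrite -(fineK fr) lee_fin (le_trans (ler_norm _)).
apply/fine_cvgP; split.
  have := H 1 ltr01; apply: filterS2 F0 => r r0 r1.
  by rewrite ge0_fin_numE// (le_lt_trans r1)// ltry.
apply/cvgrPdist_le => e e0; have := H e e0; apply: filterS2 F0 => r r0 re.
rewrite sub0r normrN /= ger0_norm ?fine_ge0// -lee_fin fineK//.
by rewrite ge0_fin_numE// (le_lt_trans re)// ltry.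
Unshelve. all: by end_near. Qed.

Let average_ge0 u x d p r : (0 <= (leb R n.+1 (half_ball x d r))^-1 *
   \int[leb R n.+1]_(y in half_ball x d r) `|u y - p|%:E)%E.
Proof.
by apply: mule_ge0; [rewrite inve_ge0 measure_ge0|apply: integral_ge0 => y _; rewrite lee_fin].
Qed.

Lemma one_sided_limitP u x d p : one_sided_limit u x d p <->
  forall e : R, 0 < e -> \forall r \near 0^'+,
    ((leb R n.+1 (half_ball x d r))^-1 *
     \int[leb R n.+1]_(y in half_ball x d r) `|u y - p|%:E <= e%:E)%E.
Proof. by apply: cvg0_le => r _; exact: average_ge0. Qed.

(** The average over a half ball is at most the supremum over it. *)
Lemma side_one_sided_limit u x d p : enorm d = 1 -> side_limit u x d p ->
  one_sided_limit u x d p.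
Proof.
move=> d1 up; apply/one_sided_limitP => e e0; have [r0 r00 ur] := up e e0.
near=> r.
have rp : 0 < r by near: r; exact: nbhs_right_gt.
have rr0 : r < r0 by near: r; exact: nbhs_right_lt.
have mH : measurable (half_ball x d r : set (caratheodory_type (@lebesgue_outer R n.+1))).
  by apply: borel_lebesgue; exact: measurable_half_ball.
have mp := half_ball_gt0 x d1 rp; have mf := half_ball_fin x d rp.
have I : (\int[leb R n.+1]_(y in half_ball x d r) `|u y - p|%:E <=
    e%:E * leb R n.+1 (half_ball x d r))%E.
  rewrite -integral_cst//; apply: ge0_subset_le_integral => // y [yr yd]; rewrite lee_fin//.
    exact: ltW.
  by apply: ur; split => //; exact: lt_trans rr0.
move: mp mf I; set m := leb _ _ _; case: m => [m| |]// mp _ I.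
rewrite lte_fin in mp; rewrite inver gt_eqF//.
apply: le_trans (lee_wpmul2l _ I) _; first by rewrite lee_fin invr_ge0 ltW.
by rewrite -!EFinM lee_fin mulrCA mulVf ?mulr1// gt_eqF.
Unshelve. all: by end_near. Qed.

(** The box common to both half balls occupies a fixed fraction of them. If a
    differed from p then u would be far from a on this box, and the averages
    could not tend to 0. *)
Lemma one_sided_limit_unique u x nu d z a p : enorm nu = 1 -> enorm d = 1 ->
  0 < dot z nu -> 0 < dot z d -> one_sided_limit u x nu a -> side_limit u x d p -> a = p.
Proof.
move=> nu1 d1 znu zd /one_sided_limitP ua up; apply/eqP/negPn/negP => ap.
have D0 : 0 < `|a - p| by rewrite normr_gt0 subr_eq0.
pose s := (2 * (enorm z + 1))^-1.
have s0 : 0 < s by rewrite invr_gt0 mulr_gt0// ltr_wpDl// enorm_ge0.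
have [|||] := @half_ball_box x nu d (s *: z) nu1 d1.
- rewrite enormZ gtr0_norm// /s mulrC ltr_pdivrMr ?mul1r; last by rewrite mulr_gt0// ltr_wpDl// enorm_ge0.
  by have := enorm_ge0 z; lra.
- by rewrite dotZl mulr_gt0.
- by rewrite dotZl mulr_gt0.
move=> e e0 boxes; pose D := `|a - p|; rewrite -/D in D0.
have [r0 r00 ur] := up (D / 2) (divr_gt0 D0 (ltr0Sn _ _)).
have c0 : 0 < D / 4 * e ^+ n.+1 by rewrite mulr_gt0 ?exprn_gt0// divr_gt0.
have {}ua := ua _ c0.
suff : \forall r \near (0 : R)^'+, False by move=> /(@filter_ex _ _ _) [].
near=> r.
have rp : 0 < r by near: r; exact: nbhs_right_gt.
have rr0 : r < r0 by near: r; exact: nbhs_right_lt.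
have : ((leb R n.+1 (half_ball x nu r))^-1 * \int[leb R n.+1]_(y in half_ball x nu r) `|u y - a|%:E
    <= (D / 4 * e ^+ n.+1)%:E)%E by near: r.
have [C [Cnu Cd mC CE]] := boxes r rp.
have I : ((D / 2)%:E * leb R n.+1 C <= \int[leb R n.+1]_(y in half_ball x nu r) `|u y - a|%:E)%E.
  rewrite -integral_cst//; last exact: borel_lebesgue.
  apply: ge0_subset_le_integral => // y Cy; rewrite lee_fin//; first by rewrite ltW// divr_gt0.
  have [yr yd] := Cd _ Cy.
  have uy : `|u y - p| <= D / 2 by apply: ur; split => //; exact: lt_trans rr0.
  have : D <= `|u y - a| + `|u y - p|.
    by rewrite /D -(subrKA (u y)) (le_trans (ler_normD _ _))// (distrC a).
  by lra.
have := half_ball_le_ball x nu rp; have := half_ball_gt0 x nu1 rp.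
have := half_ball_fin x nu rp; move: I; rewrite {}CE.
set m := leb _ _ _; case: m => [m| |]// I _ mp mr; rewrite lte_fin in mp; rewrite lee_fin in mr.
rewrite inver gt_eqF// => K.
have {K}I := le_trans (lee_wpmul2l (_ : 0 <= m^-1%:E)%E I) K.
have : (0 <= m^-1%:E)%E by rewrite lee_fin invr_ge0 ltW.
move=> /I; rewrite -!EFinM lee_fin mulrC ler_pdivrMr// => K.
have {K} := le_trans K (ler_wpM2l (ltW c0) mr).
rewrite !exprMn; set P := _ ^+ _ in c0 *; set Q := 2 ^+ _; set T := r ^+ _.
have PP : 0 < P by rewrite exprn_gt0.
have QQ : 0 < Q by rewrite exprn_gt0.
have TT : 0 < T by rewrite exprn_gt0.
have -> : D / 2 * (Q * (P * T)) = 2 * (D / 4 * P * (Q * T)) by field.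
have : 0 < D / 4 * P * (Q * T) by rewrite !mulr_gt0.
by move: (_ * _) => w; lra.
Unshelve. all: by end_near. Qed.

Lemma enorm_e l : enorm ('e_l : space) = 1.
Proof.
rewrite /enorm /dot (bigD1 l)//= big1 => [|i il]; last by rewrite mxE (negPf il) andbF mul0r.
by rewrite !mxE !eqxx mulr1 addr0 sqrtr1.
Qed.

(** The sum of two non-opposite unit vectors points into both half-spaces. *)
Let unit_dot_gt nu d : enorm nu = 1 -> enorm d = 1 -> nu <> - d ->
  0 < dot (nu + d) nu /\ 0 < dot (nu + d) d.
Proof.
move=> nu1 d1 nd.
have dn : dot nu nu = 1 by rewrite -sqr_enorm nu1 expr1n.
have dd : dot d d = 1 by rewrite -sqr_enorm d1 expr1n.
have dC := dotC d nu.
have : 0 < dot (nu + d) (nu + d).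
  rewrite -sqr_enorm exprn_gt0// lt_neqAle enorm_ge0 andbT; apply/negP => /eqP h; apply: nd.
  apply/eqP; rewrite -addr_eq0; apply/eqP/rowP => i; rewrite [RHS]mxE; apply/eqP.
  by rewrite -normr_le0 h; exact: coord_le_enorm.
by rewrite !dotDl !dotDr dn dd dC; lra.
Qed.

(** Where u has limits p and q on the two sides of a hyperplane, averages over
    half balls of any other direction mix the two values, so that the jump
    triple is the expected one up to orientation. *)
Lemma jump_triple_sides u x d p q : enorm d = 1 ->
  side_limit u x d p -> side_limit u x (- d) q ->
  (p = q -> forall t, ~ jump_triple u x t) /\
  (p <> q -> jump_triple u x (p, q, d) /\
     (jump_data u x = (p, q, d) \/ jump_data u x = (q, p, - d))).
Proof.
move=> d1 up uq; have nd1 : enorm (- d) = 1 by rewrite enormN.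
have H a b nu : jump_triple u x (a, b, nu) ->
    (nu <> - d -> a = p /\ b = q) /\ (nu <> d -> a = q /\ b = p).
  move=> [_ nu1 ua ub]; have nn1 : enorm (- nu) = 1 by rewrite enormN.
  split=> nud.
    have [h1 h2] := unit_dot_gt nu1 d1 nud.
    have nnd : - nu <> - - d by move=> /oppr_inj.
    have [h3 h4] := unit_dot_gt nn1 nd1 nnd.
    by split; [exact: (one_sided_limit_unique nu1 d1 h1 h2 ua up)|exact: (one_sided_limit_unique nn1 nd1 h3 h4 ub uq)].
  have nud' : nu <> - - d by rewrite opprK.
  have [h1 h2] := unit_dot_gt nu1 nd1 nud'.
  have nnd : - nu <> - d by move=> /oppr_inj.
  have [h3 h4] := unit_dot_gt nn1 d1 nnd.
  by split; [exact: (one_sided_limit_unique nu1 nd1 h1 h2 ua uq)|exact: (one_sided_limit_unique nn1 d1 h3 h4 ub up)].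
have dnd : d <> - d.
  move=> nd; have : enorm (d *+ 2) = 0.
    by rewrite mulr2n {2}nd subrr -(scale0r d) enormZ normr0 mul0r.
  by rewrite -scaler_nat enormZ d1 mulr1 normr_nat => /eqP; rewrite pnatr_eq0.
split=> [pq [[a b] nu] t|pq].
  have [ab nu1 _ _] := t; have [h1 h2] := H _ _ _ t.
  have [nd|/h2[aq bp]] := pselect (nu = d); last by apply: ab; rewrite aq bp.
  by case: h1 => [nd'|ap bq]; [apply: dnd; rewrite -nd' nd|apply: ab; rewrite ap bq].
have T : jump_triple u x (p, q, d) by split => //; exact: side_one_sided_limit.
split => //; rewrite /jump_data; case: xgetP => [[[a b] nu] _ t|/(_ (p, q, d))//].
have [h1 h2] := H _ _ _ t.
have [nd|nd] := pselect (nu = d).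
  by left; rewrite nd; case: h1 => [nd'|-> ->//]; apply: dnd; rewrite -nd' nd.
have [nd'|nd'] := pselect (nu = - d); first by right; have [-> ->] := h2 nd; rewrite nd'.
by have [ap _] := h1 nd'; have [aq _] := h2 nd; case: pq; rewrite -ap.
Qed.

End one_sided_limits.

(** * Approximation by step functions over boxes *)

Section mean_norm.
Context d (T : measurableType d) (R : realType) (mu : {measure set T -> \bar R}).
Implicit Types f g h : T -> R.

Lemma integral_normD_le f g h : measurable_fun setT f -> measurable_fun setT g ->
  (forall x, `|h x| <= `|f x| + `|g x|) ->
  (\int[mu]_x `|h x|%:E <= \int[mu]_x `|f x|%:E + \int[mu]_x `|g x|%:E)%E.
Proof.
move=> mf mg H; rewrite -ge0_integralD//; last 2 first.
- by apply/measurable_EFinP; exact: measurableT_comp.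
- by apply/measurable_EFinP; exact: measurableT_comp.
by apply: ge0_subset_le_integral => // x _; rewrite ?lee_fin// -EFinD lee_fin.
Qed.

Lemma integral_normZ c f : measurable_fun setT f ->
  (\int[mu]_x `|c * f x|%:E = `|c|%:E * \int[mu]_x `|f x|%:E)%E.
Proof.
move=> mf; under eq_integral do rewrite normrM EFinM.
by rewrite ge0_integralZl//; apply/measurable_EFinP; exact: measurableT_comp.
Qed.

End mean_norm.

Section step_approximation.
Context d (T : measurableType d) (R : realType) (mu : {measure set T -> \bar R}).
Variables (I : Type) (cell : I -> set T) (w : I -> R).
Implicit Types (s : seq (R * I)) (f g : T -> R).

Definition step_fun s x : R := \sum_(q <- s) q.1 * \1_(cell q.2) x.
Definition step_mass s : R := \sum_(q <- s) `|q.1| * w q.2.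

Hypothesis mcell : forall i, measurable (cell i).

Lemma measurable_step_fun s : measurable_fun setT (step_fun s).
Proof.
by rewrite /step_fun; apply: measurable_sum => q; apply: measurable_funM => //;
  exact: measurable_indic.
Qed.

(** The masses are controlled together with the distance in the mean, since
    cancellations between overlapping cells would otherwise be unbounded. *)
Definition approximable f (M : R) := measurable_fun setT f /\
  forall e, 0 < e -> exists s,
    (\int[mu]_x `|f x - step_fun s x|%:E <= e%:E)%E /\ step_mass s <= M + e.

Let approximable0 : approximable (cst 0) 0.
Proof.
split=> // e e0; exists [::]; split.
  rewrite integral0_eq ?lee_fin ?ltW// => x _.
  by rewrite /step_fun big_nil subr0 normr0.
by rewrite /step_mass big_nil add0r ltW.
Qed.

Let approximableD f g M M' : approximable f M -> approximable g M' ->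
  approximable (fun x => f x + g x) (M + M').
Proof.
move=> [mf Hf] [mg Hg]; split; first exact: measurable_funD.
move=> e e0; have e2 : 0 < e / 2 by rewrite divr_gt0.
have [s [fs ms]] := Hf _ e2; have [t [gt mt]] := Hg _ e2.
exists (s ++ t); split.
- rewrite [in leRHS](splitr e) EFinD; apply: le_trans (leeD fs gt).
  apply: integral_normD_le.
  + by apply: measurable_funB => //; exact: measurable_step_fun.
  + by apply: measurable_funB => //; exact: measurable_step_fun.
  + move=> x; rewrite /step_fun big_cat/=; apply: le_trans (ler_normD _ _).
    by rewrite opprD addrACA.
- by rewrite /step_mass big_cat/= -!/(step_mass _); lra.
Qed.

Let approximableZ c f M : approximable f M -> approximable (fun x => c * f x) (`|c| * M).
Proof.
move=> [mf Hf]; split; first exact: measurable_funM.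
move=> e e0; have c1 : 0 < `|c| + 1 by rewrite ltr_wpDl.
have ce : `|c| * (e / (`|c| + 1)) <= e.
  by rewrite mulrA ler_pdivrMr// mulrC ler_wpM2l ?ltW// ltrDl.
have [s [fs ms]] := Hf _ (divr_gt0 e0 c1).
exists [seq (c * q.1, q.2) | q <- s]; split.
- have E x : c * f x - step_fun [seq (c * q.1, q.2) | q <- s] x = c * (f x - step_fun s x).
    rewrite mulrBr /step_fun big_map mulr_sumr; congr (_ - _).
    by apply: eq_bigr => q _ /=; rewrite mulrA.
  under eq_integral do rewrite E.
  rewrite (integral_normZ _ _ (f := fun x => f x - step_fun s x)); last first.
    by apply: measurable_funB => //; exact: measurable_step_fun.
  apply: le_trans (lee_wpmul2l _ fs) _; first by rewrite lee_fin.
  by rewrite -EFinM lee_fin.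
- have -> : step_mass [seq (c * q.1, q.2) | q <- s] = `|c| * step_mass s.
    by rewrite /step_mass big_map mulr_sumr; apply: eq_bigr => q _ /=; rewrite normrM mulrA.
  by apply: le_trans (ler_wpM2l (normr_ge0 c) ms) _; rewrite mulrDr lerD2l.
Qed.

Let approximable_sum (J : eqType) (r : seq J) (f : J -> T -> R) (M : J -> R) :
  (forall i, i \in r -> approximable (f i) (M i)) ->
  approximable (fun x => \sum_(i <- r) f i x) (\sum_(i <- r) M i).
Proof.
elim: r => [|i r IH] H.
  by under eq_fun do rewrite big_nil; rewrite big_nil; exact: approximable0.
under eq_fun do rewrite big_cons; rewrite big_cons; apply: approximableD.
  by apply: H; rewrite mem_head.
by apply: IH => j jr; apply: H; rewrite inE jr orbT.
Qed.

Hypothesis wE : forall i, mu (cell i) = (w i)%:E.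

Hypothesis cell_cover : forall X, measurable X -> (mu X < +oo)%E -> forall e, 0 < e ->
  exists (c : nat -> I) (P : pred nat),
    {ae mu, forall x, X x -> exists2 k, P k & cell (c k) x} /\
    (\sum_(0 <= k <oo | P k) (w (c k))%:E <= mu X + e%:E)%E.

(** The sum of the indicator functions of a cover is at least that of X, so its
    distance in mean to the latter is the excess of volume, which is small even
    though the cells overlap. *)
Let approximable_indic X : measurable X -> (mu X < +oo)%E ->
  approximable (\1_X) (fine (mu X)).
Proof.
move=> mX Xoo; split; first exact: measurable_indic.
move=> e' e'0; pose e := e' / 3; have e0 : 0 < e by rewrite divr_gt0.
have Xfin : mu X \is a fin_num by rewrite ge0_fin_numE ?measure_ge0.
have [c [P [Xc cX]]] := cell_cover mX Xoo e0.
pose h k (x : T) : R := if P k then \1_(cell (c k)) x else 0.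
have h0 k x : 0 <= h k x by rewrite /h; case: ifP.
have mh k : measurable_fun setT (h k).
  by rewrite /h; case: (P k) => //; exact: measurable_indic.
have mEh k : measurable_fun setT (fun x => (h k x)%:E) by exact/measurable_EFinP.
pose v k : \bar R := if P k then (w (c k))%:E else 0%E.
have ih k : (\int[mu]_x (h k x)%:E = v k)%E.
  rewrite /h /v; case: (P k); last by rewrite integral0.
  by rewrite integral_indic// setIT wE.
have v0 k : (0 <= v k)%E by rewrite -ih; apply: integral_ge0 => x _; rewrite lee_fin.
have S : (\sum_(0 <= k <oo) v k <= mu X + e%:E)%E.
  by apply: le_trans cX; rewrite [in leRHS]eseries_mkcond.
pose H x : \bar R := (\sum_(0 <= k <oo) (h k x)%:E)%E.
have mH : measurable_fun setT H.
  by apply: ge0_emeasurable_sum => // k x _ _; rewrite lee_fin.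
have H0 x : (0 <= H x)%E by apply: nneseries_ge0 => k _ _; rewrite lee_fin.
have IH : (\int[mu]_x H x = \sum_(0 <= k <oo) v k)%E.
  rewrite integral_nneseries//; last by move=> k x _; rewrite lee_fin.
  by apply: eq_eseriesr => k _; exact: ih.
have pH K x : (\sum_(0 <= k < K) (h k x)%:E <= H x)%E.
  by apply: nneseries_lim_ge => k _ _; rewrite lee_fin.
have XH : {ae mu, forall x, ((\1_X x)%:E <= H x)%E}.
  apply: filterS Xc => x Xcx; rewrite indicE; case: (boolP (x \in X)) => [|_]; last exact: H0.
  rewrite inE => /Xcx[k Pk xk]; apply: le_trans (pH k.+1 x).
  rewrite big_nat_recr//= -[leLHS]add0e leeD//.
    by rewrite sume_ge0// => j _; rewrite lee_fin.
  by rewrite /h Pk indicE mem_set.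
pose g K x := \sum_(0 <= k < K) h k x.
have mg K : measurable_fun setT (g K) by exact: measurable_sum.
have Sg K : (\int[mu]_x (g K x)%:E = \sum_(0 <= k < K) v k)%E.
  under eq_integral do rewrite /g -sumEFin.
  rewrite ge0_integral_sum//; last by move=> k x _; rewrite lee_fin.
  by apply: eq_bigr => k _; exact: ih.
have g0 K x : 0 <= g K x by apply: sumr_ge0 => k _; exact: h0.
have mXi : measurable_fun setT (\1_X : T -> R) by exact: measurable_indic.
(* |s - t| + s + t is twice the maximum of s and t *)
have key K : (\int[mu]_x `|\1_X x - g K x|%:E + (mu X + \sum_(0 <= k < K) v k) <=
    (mu X + e%:E) + (mu X + e%:E))%E.
  apply: (@le_trans _ _ (\int[mu]_x (H x + H x))%E); last first.
    by rewrite ge0_integralD// IH leeD.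
  rewrite -Sg (_ : mu X = \int[mu]_x (\1_X x)%:E)%E; last by rewrite integral_indic// setIT.
  have mEg : measurable_fun setT (fun x => (g K x)%:E) by exact/measurable_EFinP.
  have mEX : measurable_fun setT (fun x => (\1_X x : R)%:E) by exact/measurable_EFinP.
  have mEd : measurable_fun setT (fun x => `|\1_X x - g K x|%:E).
    by apply/measurable_EFinP; apply: measurableT_comp => //; exact: measurable_funB.
  have mED : measurable_fun setT (fun x => (\1_X x)%:E + (g K x)%:E)%E by exact: emeasurable_funD.
  have X0 x : setT x -> (0 <= (\1_X x : R)%:E)%E by rewrite lee_fin.
  have gE0 x : setT x -> (0 <= (g K x)%:E)%E by rewrite lee_fin.
  have d0 x : setT x -> (0 <= `|\1_X x - g K x|%:E)%E by rewrite lee_fin.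
  have D0 x : setT x -> (0 <= (\1_X x)%:E + (g K x)%:E)%E by move=> _; rewrite adde_ge0 ?X0 ?gE0.
  rewrite -(ge0_integralD mu measurableT X0 mEX gE0 mEg) -(ge0_integralD mu measurableT d0 mEd D0 mED).
  apply: ae_ge0_le_integral => //.
  - by move=> x Tx; rewrite adde_ge0 ?d0 ?D0.
  - exact: emeasurable_funD.
  - by move=> x _; exact: adde_ge0.
  - exact: emeasurable_funD.
  - apply: filterS XH => x Xx _; have := pH K x; rewrite sumEFin -/(g K x).
    move: Xx (H0 x); case: (H x) => [r| |] //=; last by move=> *; rewrite leey.
    rewrite -!EFinD !lee_fin => r1 r0 r2.
    by have [|] := ler0P (\1_X x - g K x); lra.
have [K KS] : exists K, (mu X - e%:E <= \sum_(0 <= k < K) v k)%E.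
  have XS : (mu X <= \sum_(0 <= k <oo) v k)%E.
    rewrite -IH -[X in (mu X)](setIT X) -(integral_indic mu measurableT mX).
    apply: ae_ge0_le_integral => //.
    - by apply/measurable_EFinP.
    - by apply: filterS XH => x + _.
  have [r vr] : exists r, (\sum_(0 <= k <oo) v k)%E = r%:E.
    exists (fine (\sum_(0 <= k <oo) v k)%E); rewrite fineK// ge0_fin_numE; last exact: nneseries_ge0.
    by apply: le_lt_trans S _; rewrite -(fineK Xfin) -EFinD ltry.
  have : (fun K => \sum_(0 <= k < K) v k)%E @ \oo --> r%:E.
    by rewrite -vr; apply: is_cvg_nneseries.
  move=> /fine_cvgP[vfin /cvgrPdist_le /(_ _ e0)] /(filterI vfin)[K _ /(_ K (leqnn K))[Kfin]].
  move=> /= rK; exists K; rewrite -(fineK Kfin) -(fineK Xfin) -EFinB lee_fin.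
  move: XS; rewrite vr -(fineK Xfin) lee_fin; move: rK; rewrite ler_norml.
  by move=> /andP[]; lra.
exists [seq (1, c k) | k <- [seq k <- index_iota 0 K | P k]].
have -> : step_fun [seq (1, c k) | k <- [seq k <- index_iota 0 K | P k]] = g K.
  apply/funext => x; rewrite /step_fun big_map big_filter big_mkcond/=.
  by apply: eq_bigr => k _; rewrite /h mul1r.
have -> : step_mass [seq (1, c k) | k <- [seq k <- index_iota 0 K | P k]] =
    fine (\sum_(0 <= k < K) v k)%E.
  rewrite /step_mass big_map big_filter big_mkcond/=.
  rewrite (eq_bigr (fun k => (if P k then w (c k) else 0)%:E)); last first.
    by move=> k _; rewrite /v; case: ifP.
  by rewrite sumEFin; apply: eq_bigr => k _; rewrite normr1 mul1r.
have VS : (\sum_(0 <= k < K) v k <= mu X + e%:E)%E.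
  by apply: le_trans S; exact: nneseries_lim_ge.
have Vfin : (\sum_(0 <= k < K) v k)%E \is a fin_num.
  rewrite ge0_fin_numE; last exact: sume_ge0.
  by apply: le_lt_trans VS _; rewrite -(fineK Xfin) -EFinD ltry.
have := key K; have I0 : (0 <= \int[mu]_x `|\1_X x - g K x|%:E)%E.
  by apply: integral_ge0 => x _; rewrite lee_fin.
move: KS VS I0; rewrite -(fineK Vfin) -(fineK Xfin).
move: (fine _) (fine (\sum_(_ <= _ < _) _)%E) (\int[mu]_x _)%E => a b [t| |]//.
  rewrite -!EFinD -?EFinB !lee_fin /= => h1 h2 h3 h4.
  by rewrite /e in h1 h2 h4; split; lra.
Qed.

Import HBSimple.

Let approximable_sfun (g : {sfun T >-> R}) : mu.-integrable setT (EFin \o g) ->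
  approximable g (fine (\int[mu]_x `|g x|%:E)).
Proof.
move=> ig; pose r : seq R := [seq y <- finmap.enum_fset (fset_set (range g)) | y != 0].
have ur : uniq r by rewrite filter_uniq// finmap.fset_uniq.
have rP x : (g x \in r) = (g x != 0).
  by rewrite mem_filter in_fset_set// andb_idr// => _; rewrite inE; exists x.
have mX y : measurable (g @^-1` [set y]) by [].
have gE x : g x = \sum_(y <- r) y * \1_(g @^-1` [set y]) x.
  have z y : y != g x -> \1_(g @^-1` [set y]) x = 0 :> R.
    by move=> yx; rewrite indicE memNset// => /= xy; rewrite -xy eqxx in yx.
  have [gx|gx] := boolP (g x \in r).
    rewrite (bigD1_seq (g x))//= indicE mem_set// mulr1 big1 ?addr0// => y /z ->.
    by rewrite mulr0.
  rewrite big_seq big1; first by move: gx; rewrite rP negbK => /eqP.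
  by move=> y yr; rewrite z ?mulr0//; apply: contraNneq gx => <-.
have gN x : `|g x| = \sum_(y <- r) `|y| * \1_(g @^-1` [set y]) x.
  have z y : y != g x -> \1_(g @^-1` [set y]) x = 0 :> R.
    by move=> yx; rewrite indicE memNset// => /= xy; rewrite -xy eqxx in yx.
  have [gx|gx] := boolP (g x \in r).
    rewrite (bigD1_seq (g x))//= indicE mem_set// mulr1 big1 ?addr0// => y /z ->.
    by rewrite mulr0.
  rewrite big_seq big1; first by move: gx; rewrite rP negbK => /eqP ->; rewrite normr0.
  by move=> y yr; rewrite z ?mulr0//; apply: contraNneq gx => <-.
have IE : (\int[mu]_x `|g x|%:E = \sum_(y <- r) `|y|%:E * mu (g @^-1` [set y]))%E.
  under eq_integral do rewrite gN -sumEFin.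
  rewrite ge0_integral_sum//; last first.
    by move=> y; apply/measurable_EFinP; apply: measurable_funM => //; exact: measurable_indic.
  apply: eq_bigr => y _; under eq_integral do rewrite EFinM.
  rewrite ge0_integralZl//; last by apply/measurable_EFinP; exact: measurable_indic.
  by rewrite integral_indic// setIT.
have Ifin : (\int[mu]_x `|g x|%:E < +oo)%E by case/integrableP : ig.
have Xfin y : y \in r -> (mu (g @^-1` [set y]) < +oo)%E.
  move=> yr; have y0 : 0 < `|y| by move: yr; rewrite mem_filter normr_gt0 => /andP[].
  have : (`|y|%:E * mu (g @^-1` [set y]) < +oo)%E.
    apply: le_lt_trans Ifin; rewrite IE (bigD1_seq y)//= leeDl//.
    by apply: sume_ge0 => z _; rewrite mule_ge0.
  have := measure_ge0 mu (g @^-1` [set y]); case: (mu _) => [m| |]//=.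
    by move=> *; rewrite ltry.
  by rewrite mulry gtr0_sg// mul1e.
rewrite (_ : fine _ = \sum_(y <- r) `|y| * fine (mu (g @^-1` [set y]))).
  rewrite [X in approximable X _](_ : _ = (fun x => \sum_(y <- r) y * \1_(g @^-1` [set y]) x)).
    apply: (@approximable_sum R r (fun y x => y * \1_(g @^-1` [set y]) x)
      (fun y => `|y| * fine (mu (g @^-1` [set y])))) => y yr.
    by apply: approximableZ; apply: approximable_indic => //; exact: Xfin.
  by apply/funext => x; exact: gE.
rewrite IE big_seq [in RHS]big_seq -[RHS]/(fine (_%:E)) -sumEFin; congr fine.
apply: eq_bigr => y yr; rewrite EFinM fineK// ge0_fin_numE//; exact: Xfin.
Qed.

(** Approximation of integrable functions by step functions over a family of
    cells follows from that of sets of finite measure, without loss of mass. *)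
Lemma step_approximation f : mu.-integrable setT (EFin \o f) -> forall e, 0 < e ->
  exists s, (\int[mu]_x `|f x - step_fun s x|%:E <= e%:E)%E /\
    ((step_mass s)%:E <= \int[mu]_x `|f x|%:E + e%:E)%E.
Proof.
move=> intf e e0; have [g [ig _ fg]] := approximation_sfun_integrable measurableT intf.
have mf : measurable_fun setT f by apply/measurable_EFinP; case/integrableP : intf.
have e3 : 0 < e / 3 by rewrite divr_gt0.
have : \forall k \near \oo, (\int[mu]_x `|f x - g k x|%:E <= (e / 3)%:E)%E.
  move/fine_cvgP : fg => [ffin /cvgrPdist_le /(_ _ e3)]; apply: filterS2 ffin => k kf.
  rewrite sub0r normrN /= ger0_norm ?fine_ge0//; last exact: integral_ge0.
  by rewrite -lee_fin fineK.
move=> [k _ /(_ k (leqnn k))] fgk.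
have mg : measurable_fun setT (g k) by [].
have [_ /(_ _ e3)[s [gs ms]]] := approximable_sfun (ig k).
have Ifin : (\int[mu]_x `|g k x|%:E)%E \is a fin_num.
  rewrite ge0_fin_numE; first by case/integrableP : (ig k).
  by apply: integral_ge0 => x _; rewrite lee_fin.
exists s; split.
  apply: (@le_trans _ _ ((e / 3)%:E + (e / 3)%:E)%E); last by rewrite -EFinD lee_fin; lra.
  apply: le_trans (leeD fgk gs); apply: integral_normD_le.
  - exact: measurable_funB.
  - by apply: measurable_funB => //; exact: measurable_step_fun.
  - by move=> x; rewrite -(subrKA (g k x)) ler_normD.
apply: (@le_trans _ _ (\int[mu]_x `|g k x|%:E + (e / 3)%:E)%E).
  by rewrite -(fineK Ifin) -EFinD lee_fin.
apply: (@le_trans _ _ ((\int[mu]_x `|f x|%:E + (e / 3)%:E) + (e / 3)%:E)%E); last first.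
  by rewrite -addeA leeD2l// -EFinD lee_fin; lra.
rewrite leeD2r//; apply: (@le_trans _ _ (\int[mu]_x `|f x|%:E + \int[mu]_x `|f x - g k x|%:E)%E).
  apply: integral_normD_le => //; first exact: measurable_funB.
  by move=> x; rewrite -[X in `|X|](subKr (f x)) (le_trans (ler_normB _ _))// opprB.
by rewrite leeD2l.
Qed.

End step_approximation.

Lemma outer_null_measurable (R : realType) (T : pointedType)
    (mu : {outer_measure set T -> \bar R}) (A : set T) : mu A = 0%E ->
  measurable (A : set (caratheodory_type mu)).
Proof.
move=> A0; apply: le_caratheodory_measurable => X.
rewrite (outer_null_sub (@subIsetr _ X A) A0) add0e.
by apply: le_outer_measure; exact: subIsetl.
Qed.

Section box_approximation.
Context {R : realType} {n : nat}.
Local Notation space := 'rV[R]_n.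
Local Notation lebT := (caratheodory_type (@lebesgue_outer R n)).
Local Notation mu := (leb R n).
Implicit Types (a b x : space).

Definition hbox a b : set space := [set x | forall i, a 0 i < x 0 i <= b 0 i].

Lemma hbox_sub a b : hbox a b `<=` box a b.
Proof. by move=> x h i; have /andP[/ltW -> ->] := h i. Qed.

Lemma measurable_hbox a b : measurable (hbox a b : set (g_sigma_algebraType (@open space))).
Proof.
rewrite (_ : hbox a b = \bigcap_(i in [set: 'I_n])
    ([set x : space | a 0 i < x 0 i] `&` [set x | x 0 i <= b 0 i])).
  apply: fin_bigcap_measurable => // i _; apply: measurableI.
    exact: measurable_gt_coord.
  exact: measurable_le_coord.
apply/seteqP; split=> [x h i _|x h i]; first by have /andP[] := h i.
by have [-> ->] := h i Logic.I.
Qed.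

Lemma box_hbox_ae a b : {ae mu, forall x, \1_(box a b) x = \1_(hbox a b) x :> R}.
Proof.
pose N := \bigcup_(i in [set: 'I_n]) [set x : space | x 0 i = a 0 i].
have N0 : lebesgue_outer N = 0%E.
  apply: (@outer_null_sub _ _ _ _ (\bigcup_(k : nat)
      (if insub k is Some i then [set x : space | x 0 i = a 0 i] else set0))).
    by move=> x [i _ xi]; exists (i : nat) => //; rewrite valK.
  apply: outer_null_bigcup => k; case: insub => [i|]; last exact: outer_measure0.
  exact: lebesgue_outer_hyperplane.
exists N; split.
- exact: outer_null_measurable.
- exact: N0.
move=> x /= xab; apply: contrapT => xN; apply: xab.
rewrite !indicE; congr (nat_of_bool _)%:R; apply/idP/idP; rewrite !inE; last exact: hbox_sub.
move=> h i; have /andP[h1 ->] := h i; rewrite andbT lt_neqAle h1 andbT.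
by apply/eqP => e; apply: xN; exists i.
Qed.

Definition corners := {ab : space * space | forall i, ab.1 0 i <= ab.2 0 i}.
Definition cvol (q : corners) := vol (sval q).1 (sval q).2.

Lemma lebesgue_outer_hbox (q : corners) :
  mu (hbox (sval q).1 (sval q).2) = (cvol q)%:E.
Proof.
case: q => -[a b] /= ab; rewrite /cvol/=.
have mh : measurable (hbox a b : set lebT) by apply: borel_lebesgue; exact: measurable_hbox.
have mb : measurable (box a b : set lebT) by apply: borel_lebesgue; exact: measurable_box.
rewrite -(lebesgue_outer_box ab); change (mu (hbox a b) = mu (box a b)).
rewrite -[in LHS](setIT (hbox a b)) -[in RHS](setIT (box a b)).
rewrite -(integral_indic mu measurableT mh) -(integral_indic mu measurableT mb).
have mi (B : set lebT) : measurable B -> measurable_fun setT (fun x : lebT => (\1_B x : R)%:E).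
  by move=> mB; apply/measurable_EFinP; exact: measurable_indic.
apply: (ae_eq_integral _ _ measurableT (mi _ mh) (mi _ mb)).
by apply: (@filterS _ (almost_everywhere mu) _ _ _ _ (box_hbox_ae a b)) => x E _; rewrite /= E.
Qed.

(** The covers by boxes that define Lebesgue outer measure are covers by cells,
    up to the boundaries of the boxes, which are null sets. *)
Lemma box_approximation (f : space -> R) : mu.-integrable setT (EFin \o f) ->
  forall e, 0 < e -> exists s : seq (R * corners),
    (\int[mu]_x `|f x - \sum_(q <- s) q.1 * \1_(hbox (sval q.2).1 (sval q.2).2) x|%:E <= e%:E)%E /\
    ((\sum_(q <- s) `|q.1| * cvol q.2)%:E <= \int[mu]_x `|f x|%:E + e%:E)%E.
Proof.
apply: (@step_approximation _ lebT R mu corners (fun q => hbox (sval q).1 (sval q).2) cvol).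
- by move=> q; apply: borel_lebesgue; exact: measurable_hbox.
- exact: lebesgue_outer_hbox.
move=> X mX Xoo e e0; have [ab [P [ab1 Xab abX]]] := finite_cover Xoo e0.
exists (fun k => exist _ (ab k) (ab1 k)), P; split => //=.
have := ae_foralln (fun k => box_hbox_ae (ab k).1 (ab k).2).
apply: filterS => x H /Xab[k Pk xk]; exists k => //.
by have := H k; rewrite !indicE mem_set//; case: (boolP (x \in hbox _ _)) => [|_ /eqP]; rewrite ?inE//= oner_eq0.
Qed.

End box_approximation.

(** * Convergence in mean *)

Section mean_convergence.
Context d (T : measurableType d) (R : realType) (mu : {measure set T -> \bar R}).
Implicit Types f g phi : T -> R.

Lemma integrable_boundedM f phi (M : R) : mu.-integrable setT (EFin \o f) ->
  measurable_fun setT phi -> (forall x, `|phi x| <= M) ->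
  mu.-integrable setT (EFin \o (fun x => phi x * f x)).
Proof.
move=> intf mphi phiM; have M0 : 0 <= M by apply: le_trans (phiM point).
have mf : measurable_fun setT f by apply/measurable_EFinP; case/integrableP : intf.
apply: (@le_integrable _ _ _ mu setT measurableT _ (fun x => M%:E * (f x)%:E)%E).
- by apply/measurable_EFinP; exact: measurable_funM.
- by move=> x _ /=; rewrite lee_fin !normrM (ger0_norm M0) ler_wpM2r.
- exact: integrableZl.
Qed.

Lemma mean_pairing_le f g phi (M e : R) : mu.-integrable setT (EFin \o f) ->
  mu.-integrable setT (EFin \o g) -> measurable_fun setT phi ->
  (forall x, `|phi x| <= M) -> (\int[mu]_x `|f x - g x|%:E <= e%:E)%E ->
  `|\int[mu]_x (phi x * f x) - \int[mu]_x (phi x * g x)| <= M * e.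
Proof.
move=> intf intg mphi phiM fge.
have M0 : 0 <= M by apply: le_trans (phiM point).
have mf : measurable_fun setT f by apply/measurable_EFinP; case/integrableP : intf.
have mg : measurable_fun setT g by apply/measurable_EFinP; case/integrableP : intg.
have intp h : mu.-integrable setT (EFin \o h) ->
    mu.-integrable setT (EFin \o (fun x => phi x * h x)).
  by move=> ih; exact: integrable_boundedM ih mphi phiM.
rewrite -RintegralB//; [|exact: intp..].
have mD : measurable_fun setT (fun x => f x - g x) by exact: measurable_funB.
have intD : mu.-integrable setT (EFin \o (fun x => f x - g x)).
  by have := integrableB measurableT intf intg; apply: eq_integrable => // x _.
have -> : \int[mu]_x (phi x * f x - phi x * g x) = \int[mu]_x (phi x * (f x - g x)).
  by apply: eq_Rintegral => x _; rewrite mulrBr.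
apply: le_trans (le_normr_Rintegral _ _) _ => //; first exact: intp.
have I : (\int[mu]_x `|phi x * (f x - g x)|%:E <= (M * e)%:E)%E.
  apply: (@le_trans _ _ (\int[mu]_x (M%:E * `|f x - g x|%:E))%E).
    apply: ge0_subset_le_integral => // x _; rewrite ?mule_ge0 ?lee_fin//.
    by rewrite normrM ler_wpM2r.
  rewrite ge0_integralZl//; last by apply/measurable_EFinP; exact: measurableT_comp.
  by rewrite EFinM lee_wpmul2l.
have If : (\int[mu]_x `|phi x * (f x - g x)|%:E)%E \is a fin_num.
  rewrite ge0_fin_numE; first exact: le_lt_trans I (ltry _).
  by apply: integral_ge0 => x _; rewrite lee_fin.
by rewrite -lee_fin; apply: le_trans I; rewrite /Rintegral fineK.
Qed.

(** A remainder is at most the sum of the absolute values of the remaining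
    terms, which is integrated term by term. *)
Lemma mean_series (h : nat -> T -> R) (s : T -> R) (K : R) : 0 <= K ->
  (forall j, measurable_fun setT (h j)) ->
  (forall x, (fun J => \sum_(0 <= j < J) h j x) @ \oo --> s x) ->
  (forall j, (\int[mu]_x `|h j x|%:E <= (K * 2^-1 ^+ j)%:E)%E) ->
  measurable_fun setT s /\
  forall J, (\int[mu]_x `|s x - \sum_(0 <= j < J) h j x|%:E <= (2 * K * 2^-1 ^+ J)%:E)%E.
Proof.
move=> K0 mh hs hK; split.
  apply: (@measurable_fun_cvg _ _ _ _ (fun J x => \sum_(0 <= j < J) h j x)) => //.
  by move=> J; exact: measurable_sum.
move=> J; apply: (@le_trans _ _ (\int[mu]_x (\sum_(0 <= j <oo) `|h (J + j)%N x|%:E))%E).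
  apply: ge0_subset_le_integral => // x _.
    by apply: nneseries_ge0 => j _ _; rewrite lee_fin.
  have := @nneseries_ge0 R (fun j => `|h (J + j)%N x|%:E) predT 0.
  set S : \bar R := (\sum_(0 <= j <oo) _)%E => S0.
  have {}S0 : (0 <= S)%E by apply: S0 => j _ _; rewrite lee_fin.
  have SE : S = (\sum_(0 <= j <oo) `|h (J + j)%N x|%:E)%E by [].
  clearbody S; case: S S0 SE => [r| |]// _ ES; last by rewrite leey.
  rewrite lee_fin.
  have H : (fun J' => `|\sum_(0 <= j < J') h j x - \sum_(0 <= j < J) h j x|) @ \oo -->
      `|s x - \sum_(0 <= j < J) h j x|.
    by apply: cvg_norm; apply: cvgB => //; exact: cvg_cst.
  apply: (cvgr_to_le H); exists J => // J' /= JJ'.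
  have -> : \sum_(0 <= j < J') h j x - \sum_(0 <= j < J) h j x =
      \sum_(0 <= j < J' - J) h (J + j)%N x.
    rewrite (big_cat_nat (n := J))//= addrAC subrr add0r -{1}[J]add0n big_addn.
    by apply: eq_bigr => j _; rewrite addnC.
  apply: le_trans (ler_norm_sum _ _ _) _; rewrite -lee_fin ES -sumEFin.
  by apply: nneseries_lim_ge => j _ _; rewrite lee_fin.
rewrite integral_nneseries//; last first.
  by move=> j; apply/measurable_EFinP; exact: measurableT_comp.
apply: (@le_trans _ _ (\sum_(0 <= j <oo) ((2 * K * 2^-1 ^+ J) / (2 ^ j.+1)%:R)%:E)%E).
  apply: lee_nneseries => [j _ _|j _]; first by apply: integral_ge0 => x _; rewrite lee_fin.
  apply: le_trans (hK _) _; rewrite lee_fin natrX exprD exprS invfM exprVn.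
  rewrite le_eqVlt; apply/orP; left; apply/eqP; rewrite exprVn.
  by move: (2 ^- J) (2 ^- j) => y z; field.
by apply: epsilon_trick0; rewrite !mulr_ge0// exprn_ge0.
Qed.

End mean_convergence.

(** * Ramps over thin slabs *)

Section slabs.
Context {R : realType} {n : nat}.
Local Notation space := 'rV[R]_n.+1.
Local Notation cells := (seq (R * corners (R := R) (n := n.+1))).
Implicit Types (a b x : space) (q : corners (R := R) (n := n.+1)) (t : cells) (i l : 'I_n.+1).

Definition lo q : space := (sval q).1.
Definition hi q : space := (sval q).2.

Lemma lo_hi q i : lo q 0 i <= hi q 0 i. Proof. exact: (svalP q i). Qed.

Definition step t x : R := \sum_(p <- t) p.1 * \1_(hbox (lo p.2) (hi p.2)) x.

(** Its derivative in the direction i is the step function up to jumps on the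
    faces of the cells. *)
Definition ramp i t x : R :=
  \sum_(p <- t) p.1 * ((x 0 i - lo p.2 0 i) * \1_(hbox (lo p.2) (hi p.2)) x).

Definition face l q : R := \prod_(j | j != l) (hi q 0 j - lo q 0 j).

(** Bounds the mass of the jumps of the ramp: its height times the area of the
    upper face orthogonal to i is the volume of the cell, and each other face is
    counted with the full height. *)
Definition ramp_jump i t : R := \sum_(p <- t) `|p.1| *
  (cvol p.2 + \sum_(l | l != i) 2 * ((hi p.2 0 i - lo p.2 0 i) * face l p.2)).

Lemma face_ge0 l q : 0 <= face l q.
Proof. by apply: prodr_ge0 => j _; rewrite subr_ge0 lo_hi. Qed.

Lemma cvol_face i q : cvol q = (hi q 0 i - lo q 0 i) * face i q.
Proof. by rewrite /cvol /vol (bigD1 i). Qed.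

Lemma cvol_ge0 q : 0 <= cvol q.
Proof. by rewrite (cvol_face ord0) mulr_ge0 ?face_ge0// subr_ge0 lo_hi. Qed.

Definition thickness i q k : R := (hi q 0 i - lo q 0 i) / k.+1%:R.

Lemma thickness_ge0 i q k : 0 <= thickness i q k.
Proof. by rewrite divr_ge0// subr_ge0 lo_hi. Qed.

Let height i q k (p : nat) : R := lo q 0 i + p%:R * thickness i q k.

Let height_nd i q k p p' : (p <= p')%N -> height i q k p <= height i q k p'.
Proof. by move=> pp'; rewrite lerD2l ler_wpM2r ?thickness_ge0// ler_nat. Qed.

Let heightE i q k : height i q k k.+1 = hi q 0 i.
Proof. by rewrite /height /thickness mulrC divfK ?pnatr_eq0// addrC subrK. Qed.

Definition slab i q k (p : nat) : space * space :=
  (upd (lo q) i (height i q k p), upd (hi q) i (height i q k p.+1)).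

Let slab_le i q k p j : (slab i q k p).1 0 j <= (slab i q k p).2 0 j.
Proof. by rewrite !mxE; case: eqP => _; [exact: height_nd|exact: lo_hi]. Qed.

(** The ramp restarts from 0 on each slab, so that its height is divided by the
    number of slabs. *)
Definition slabs i c q k : cells :=
  [seq (c, exist _ (slab i q k p) (slab_le i q k p)) | p <- index_iota 0 k.+1].

Let hbox_slab i q k p x : \1_(hbox (slab i q k p).1 (slab i q k p).2) x =
  (\1_(hbox (lo q) (hi q)) x * ((x 0 i <= height i q k p.+1)%R%:R -
                              (x 0 i <= height i q k p)%R%:R) : R) \/ (k < p)%N.
Proof.
have [|pk] := leqP p k; [left|by right].
have h1 : height i q k p.+1 <= hi q 0 i by rewrite -(heightE i q k); exact: height_nd.
have h2 : lo q 0 i <= height i q k p.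
  by rewrite lerDl mulr_ge0 ?thickness_ge0.
have h3 := height_nd i q k (leqnSn p).
rewrite !indicE; case: (boolP (x \in hbox (slab i q k p).1 _)) => [|].
  rewrite inE => /= h; have := h i; rewrite !mxE eqxx => /andP[h4 h5].
  rewrite mem_set; first by rewrite h5 leNgt h4/= mul1r subr0.
  move=> j /=; have := h j; rewrite !mxE; case: eqP => [-> _|//].
  by rewrite (le_lt_trans h2 h4) (le_trans h5 h1).
move=> /negP; rewrite inE => h; case: (boolP (x \in hbox (lo q) (hi q))) => [|_]; last by rewrite mul0r.
rewrite inE => hx; rewrite mul1r; case: (leP (x 0 i) (height i q k p)) => h4.
  by rewrite (le_trans h4 h3) subrr.
case: leP => h5; last by rewrite subrr.
exfalso; apply: h => j /=; rewrite !mxE; case: eqP => [->|_]; first by rewrite h4 h5.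
exact: hx.
Qed.

Let hbox_slabE i q k p x : (p < k.+1)%N ->
  \1_(hbox (slab i q k p).1 (slab i q k p).2) x =
  \1_(hbox (lo q) (hi q)) x * ((x 0 i <= height i q k p.+1)%R%:R -
                              (x 0 i <= height i q k p)%R%:R) :> R.
Proof. by move=> pk; case: (hbox_slab i q k p x) => //; rewrite ltnNge -ltnS pk. Qed.

Let sum_slab i q k x :
  \sum_(0 <= p < k.+1) \1_(hbox (slab i q k p).1 (slab i q k p).2) x =
  \1_(hbox (lo q) (hi q)) x :> R.
Proof.
rewrite (eq_big_nat _ _ (F2 := fun p => \1_(hbox (lo q) (hi q)) x *
  ((x 0 i <= height i q k p.+1)%R%:R - (x 0 i <= height i q k p)%R%:R))); last first.
  by move=> p /andP[_ pk]; exact: hbox_slabE.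
rewrite -mulr_sumr telescope_sumr// heightE /height mul0r addr0 indicE.
case: (boolP (x \in _)) => [|_]; last by rewrite mul0r.
by rewrite inE => /(_ i)/andP[h1 h2]; rewrite h2 leNgt h1 subr0 mulr1.
Qed.

Lemma step_slabs i c q k x : step (slabs i c q k) x = c * \1_(hbox (lo q) (hi q)) x.
Proof. by rewrite /step /slabs big_map -mulr_sumr -(sum_slab i q k). Qed.

Lemma ramp_slabs_le i c q k x :
  `|ramp i (slabs i c q k) x| <= `|c| * thickness i q k * \1_(hbox (lo q) (hi q)) x.
Proof.
rewrite /ramp /slabs big_map -(sum_slab i q k) mulr_sumr.
apply: le_trans (ler_norm_sum _ _ _) _; apply: ler_sum => p _ /=.
rewrite !normrM -mulrA ler_wpM2l// [X in _ * X]ger0_norm ?indicE//.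
case: (boolP (x \in _)) => [|_]; last by rewrite !mulr0.
rewrite inE => /= /(_ i); rewrite /lo/= !mxE eqxx !mulr1 => /andP[h1 h2].
rewrite ger0_norm; last by rewrite subr_ge0 ltW.
by rewrite lerBlDr (le_trans h2)// /height -natr1 mulrDl mul1r addrA addrC.
Qed.

Let slab_height i q k p : k.+1%:R * (height i q k p.+1 - height i q k p) =
  hi q 0 i - lo q 0 i.
Proof.
have -> : height i q k p.+1 - height i q k p = thickness i q k.
  by rewrite /height -natr1; ring.
by rewrite /thickness mulrC divfK// pnatr_eq0.
Qed.

Let face_slab i q k p (p_lt : (p < k.+1)%N) l : l != i ->
  k.+1%:R * face l (exist _ (slab i q k p) (slab_le i q k p)) = face l q.
Proof.
move=> li; rewrite /face (bigD1 i) 1?eq_sym//= [RHS](bigD1 i) 1?eq_sym//= mulrA; congr (_ * _).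
  by rewrite -(slab_height i q k p) /lo/hi/= !mxE eqxx.
by apply: eq_bigr => j /andP[_ ji]; rewrite /lo/hi/= !mxE (negPf ji).
Qed.

Let cvol_slab i q k p : k.+1%:R * cvol (exist _ (slab i q k p) (slab_le i q k p)) = cvol q.
Proof.
rewrite !(cvol_face i) mulrA; congr (_ * _).
  by rewrite -(slab_height i q k p) /lo/hi/= !mxE eqxx.
by apply: eq_bigr => j ji; rewrite /lo/hi/= !mxE (negPf ji).
Qed.

Lemma ramp_jump_slabs i c q k : ramp_jump i (slabs i c q k) =
  `|c| * (cvol q + thickness i q k * \sum_(l | l != i) 2 * face l q).
Proof.
have k0 : k.+1%:R != 0 :> R by rewrite pnatr_eq0.
pose Q p := exist (fun ab : space * space => forall i, ab.1 0 i <= ab.2 0 i)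
  (slab i q k p) (slab_le i q k p).
have -> : ramp_jump i (slabs i c q k) = `|c| * \sum_(0 <= p < k.+1)
    (cvol (Q p) + \sum_(l | l != i) 2 * ((hi (Q p) 0 i - lo (Q p) 0 i) * face l (Q p))).
  by rewrite /ramp_jump /slabs big_map mulr_sumr; apply: eq_bigr.
congr (_ * _).
rewrite (eq_big_nat _ _ (F2 := fun=> k.+1%:R^-1 *
   (cvol q + thickness i q k * \sum_(l | l != i) 2 * face l q))); last first.
  move=> p /andP[_ pk]; rewrite mulrDr; congr (_ + _).
    by rewrite -(cvol_slab i q k p) mulrA mulVf ?mul1r.
  rewrite mulrCA mulr_sumr [RHS]mulr_sumr; apply: eq_bigr => l li.
  rewrite -[face l q](face_slab q pk li) -/(Q p).
  have -> : hi (Q p) 0 i - lo (Q p) 0 i = thickness i q k.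
    by rewrite /lo/hi/= !mxE eqxx /height -natr1; ring.
  by rewrite [2 * (k.+1%:R * _)]mulrCA mulKf// mulrCA.
by rewrite sumr_const_nat subn0 -[LHS]mulr_natl mulVKf.
Qed.

Lemma step_cat t t' x : step (t ++ t') x = step t x + step t' x.
Proof. by rewrite /step big_cat. Qed.

Lemma ramp_cat i t t' x : ramp i (t ++ t') x = ramp i t x + ramp i t' x.
Proof. by rewrite /ramp big_cat. Qed.

Lemma ramp_jump_cat i t t' : ramp_jump i (t ++ t') = ramp_jump i t + ramp_jump i t'.
Proof. by rewrite /ramp_jump big_cat. Qed.

Local Notation borel := (g_sigma_algebraType (@open space)).

Lemma measurable_coord i : measurable_fun (setT : set borel) (fun x : space => x 0 i).
Proof. by apply: continuous_measurable; exact: coord_continuous. Qed.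

Lemma measurable_step t : measurable_fun (setT : set borel) (step t).
Proof.
rewrite /step; apply: measurable_sum => p; apply: measurable_funM => //.
by apply: measurable_indic; exact: measurable_hbox.
Qed.

Lemma measurable_ramp i t : measurable_fun (setT : set borel) (ramp i t).
Proof.
rewrite /ramp; apply: measurable_sum => p; apply: measurable_funM => //.
apply: measurable_funM; last by apply: measurable_indic; exact: measurable_hbox.
by apply: measurable_funB => //; exact: measurable_coord.
Qed.

(** Cutting a cell into thin slabs orthogonal to the direction i makes the ramp
    uniformly small, in the sup norm and in mean; the faces orthogonal to i then
    carry a jump of mass equal to that of the slope, and the other faces a
    negligible one. *)
Lemma thin_slabs i c q e : 0 < e -> exists t,
  [/\ forall x, step t x = c * \1_(hbox (lo q) (hi q)) x,
      forall x, `|ramp i t x| <= e,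
      (\int[leb R n.+1]_x `|ramp i t x|%:E <= e%:E)%E &
      ramp_jump i t <= `|c| * cvol q + e].
Proof.
move=> e0; pose S := \sum_(l | l != i) 2 * face l q.
have S0 : 0 <= S by apply: sumr_ge0 => l _; rewrite mulr_ge0 ?face_ge0.
have v0 := cvol_ge0 q; have L0 : 0 <= hi q 0 i - lo q 0 i by rewrite subr_ge0 lo_hi.
pose K := `|c| * (hi q 0 i - lo q 0 i) * (1 + cvol q + S).
have K0 : 0 <= K by rewrite !mulr_ge0// !addr_ge0.
have [k ke] := natSinv_lt (divr_gt0 e0 (ltr_wpDl K0 ltr01)).
have H : `|c| * thickness i q k * (1 + cvol q + S) <= e.
  have -> : `|c| * thickness i q k * (1 + cvol q + S) = K * k.+1%:R^-1.
    by rewrite /K /thickness; move: (k.+1%:R^-1) => w; ring.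
  apply: le_trans (ler_wpM2l K0 (ltW ke)) _.
  by rewrite mulrA ler_pdivrMr ?ltr_wpDl// mulrDr mulr1 mulrC lerDl ltW.
have ct0 : 0 <= `|c| * thickness i q k by rewrite mulr_ge0 ?thickness_ge0.
have ind1 x : \1_(hbox (lo q) (hi q)) x <= 1 :> R by rewrite indicE lern1; case: (_ \in _).
have ct : `|c| * thickness i q k <= e.
  apply: le_trans H; rewrite ler_peMr// -addrA lerDl addr_ge0//.
exists (slabs i c q k); split.
- exact: step_slabs.
- move=> x; apply: le_trans (ramp_slabs_le _ _ _ _ _) _; apply: le_trans ct.
  by rewrite ler_piMr.
- apply: (@le_trans _ _ (\int[leb R n.+1]_x ((`|c| * thickness i q k)%:E *
      (\1_(hbox (lo q) (hi q)) x)%:E))%E).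
    apply: ge0_subset_le_integral => // x _; rewrite ?mule_ge0 ?lee_fin//.
    exact: ramp_slabs_le.
  rewrite ge0_integralZl//; last first.
    apply/measurable_EFinP/measurable_indic; apply: borel_lebesgue; exact: measurable_hbox.
  rewrite integral_indic//; last by apply: borel_lebesgue; exact: measurable_hbox.
  rewrite setIT lebesgue_outer_hbox -EFinM lee_fin; apply: le_trans H.
  by rewrite ler_wpM2l//; lra.
- rewrite ramp_jump_slabs -/S mulrDr lerD2l mulrA; apply: le_trans H.
  by rewrite ler_wpM2l//; lra.
Qed.

(** The boxes of a step function approximating f are cut into thin slabs, which
    leaves the step function unchanged while the jumps of the ramps keep the mass
    of f up to a small error. *)
Lemma ramp_approximation i (f : space -> R) : (leb R n.+1).-integrable setT (EFin \o f) ->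
  forall e, 0 < e -> exists t,
  [/\ (\int[leb R n.+1]_x `|f x - step t x|%:E <= e%:E)%E,
      forall x, `|ramp i t x| <= e,
      (\int[leb R n.+1]_x `|ramp i t x|%:E <= e%:E)%E &
      ((ramp_jump i t)%:E <= \int[leb R n.+1]_x `|f x|%:E + e%:E)%E].
Proof.
move=> intf e e0; have e2 : 0 < e / 2 by rewrite divr_gt0.
have [s [fs ms]] := box_approximation intf e2.
suff H : forall e, 0 < e -> exists t,
  [/\ forall x, step t x = step s x, forall x, `|ramp i t x| <= e,
      (\int[leb R n.+1]_x `|ramp i t x|%:E <= e%:E)%E &
      ramp_jump i t <= \sum_(q <- s) `|q.1| * cvol q.2 + e].
  have [t [tE t1 t2 t3]] := H _ e2; exists t; split.
  - by under eq_integral do rewrite tE; apply: le_trans fs _; rewrite lee_fin; lra.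
  - by move=> x; apply: le_trans (t1 x) _; lra.
  - by apply: le_trans t2 _; rewrite lee_fin; lra.
  - apply: le_trans (_ : _ <= (\sum_(q <- s) `|q.1| * cvol q.2)%:E + (e / 2)%:E)%E _.
      by rewrite -EFinD lee_fin.
    by apply: le_trans (leeD2r _ ms) _; rewrite -addeA -EFinD leeD2l// lee_fin; lra.
elim: s {fs ms} => [|[c q] s IH] {e0 e2}e e0.
  exists [::]; split.
  - by [].
  - by move=> x; rewrite /ramp big_nil normr0 ltW.
  - rewrite integral0_eq ?lee_fin ?ltW// => x _.
    by rewrite /ramp big_nil normr0.
  - by rewrite /ramp_jump !big_nil add0r ltW.
have e2 : 0 < e / 2 by rewrite divr_gt0.
have [t [t1 t2 t3 t4]] := IH _ e2; have [r [r1 r2 r3 r4]] := thin_slabs i c q e2.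
exists (r ++ t); split.
- by move=> x; rewrite step_cat r1 t1 [RHS]/step big_cons.
- by move=> x; rewrite ramp_cat (le_trans (ler_normD _ _))// (splitr e) lerD.
- rewrite [in leRHS](splitr e) EFinD; apply: le_trans (leeD r3 t3).
  apply: integral_normD_le.
  + by apply: measurable_fun_lebesgue; exact: measurable_ramp.
  + by apply: measurable_fun_lebesgue; exact: measurable_ramp.
  + by move=> x; rewrite ramp_cat ler_normD.
- by rewrite ramp_jump_cat big_cons /=; lra.
Qed.

End slabs.

(** * Jumps of ramps *)

Section positive_combination.
Context d (T : measurableType d) (R : realType) (mu : {measure set T -> \bar R}).

Lemma ge0_integral_combination (a b : R) (f g : T -> R) : 0 <= a -> 0 <= b ->
  measurable_fun setT f -> measurable_fun setT g ->
  (forall x, 0 <= f x) -> (forall x, 0 <= g x) ->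
  (\int[mu]_x (a * f x + b * g x)%:E =
   a%:E * \int[mu]_x (f x)%:E + b%:E * \int[mu]_x (g x)%:E)%E.
Proof.
move=> a0 b0 mf mg f0 g0.
have mEf : measurable_fun setT (EFin \o f) by exact/measurable_EFinP.
have mEg : measurable_fun setT (EFin \o g) by exact/measurable_EFinP.
under eq_integral do rewrite EFinD !EFinM.
rewrite ge0_integralD//; last 4 first.
- by move=> x _; rewrite mule_ge0 ?lee_fin.
- exact: measurable_funeM.
- by move=> x _; rewrite mule_ge0 ?lee_fin.
- exact: measurable_funeM.
by rewrite !ge0_integralZl// => x _; rewrite lee_fin.
Qed.

End positive_combination.

Section face_integrals.
Context {R : realType} {n : nat} (l : 'I_n.+1).
Local Notation space := 'rV[R]_n.+1.
Local Notation borel := (g_sigma_algebraType (@open space)).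
Local Notation hausT := (caratheodory_type (@hausdorff_outer R n.+1 n)).
Local Notation H := (hausdorff R n.+1 n).

Let hyper t : set space := [set x | x 0 l = t].

Lemma integral_hyperplane t (f : space -> \bar R) : measurable_fun (setT : set hausT) f ->
  (\int[H]_(x in hyper t) f x = \int[leb R n]_y f (ins l t y))%E.
Proof.
move=> mf; rewrite integralE [RHS]integralE.
congr (_ - _)%E.
- apply: etrans (ge0_integral_hyperplane l t (measurable_funepos mf) (funepos_ge0 f)) _.
  by apply: eq_integral => y _; rewrite !funeposE.
- apply: etrans (ge0_integral_hyperplane l t (measurable_funeneg mf) (funeneg_ge0 f)) _.
  by apply: eq_integral => y _; rewrite !funenegE.
Qed.

Lemma integral_face t (f : space -> R) : measurable_fun (setT : set borel) f ->
  (\int[H]_x ((x 0 l == t)%:R * f x)%:E = \int[leb R n]_y (f (ins l t y))%:E)%E.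
Proof.
move=> mf; have mf' : measurable_fun (setT : set hausT) (EFin \o f).
  by apply/measurable_EFinP/measurable_fun_hausdorff.
rewrite -[RHS](integral_hyperplane t mf') [RHS]integral_mkcond.
apply: eq_integral => x _.
have [xt|xt] := eqVneq (x 0 l) t; first by rewrite patchE mem_set// mul1r.
by rewrite patchE memNset ?mul0r//; exact/eqP.
Qed.

Lemma measurable_face t : measurable_fun (setT : set borel) (fun x : space => (x 0 l == t)%:R : R).
Proof.
rewrite (_ : (fun x => _) = \1_(hyper t)).
  by apply: measurable_indic; exact: measurable_hyperplane.
apply/funext => x; rewrite indicE; congr (nat_of_bool _)%:R.
by apply/eqP/idP; rewrite inE.
Qed.

Lemma measurable_del : measurable_fun (setT : set borel)
  (del l : borel -> g_sigma_algebraType (@open 'rV[R]_n)).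
Proof.
move=> _; suff K : (@measurable _ (g_sigma_algebraType (@open 'rV[R]_n))) `<=`
    [set B | measurable (del l @^-1` B : set borel)].
  by move=> B /K; rewrite setTI.
apply: borel_halfspaces.
  split=> [|B mB|F mF] /=.
  - by rewrite preimage_set0.
  - by rewrite setTD preimage_setC; exact: measurableC.
  - by rewrite preimage_bigcup; exact: bigcupT_measurable.
move=> j c /=; rewrite (_ : _ @^-1` _ = [set x : space | x 0 (lift l j) <= c]).
  exact: measurable_le_coord.
by apply/seteqP; split=> x /=; rewrite !mxE.
Qed.

End face_integrals.

Section ramp_gaps.
Context {R : realType} {n : nat}.
Local Notation space := 'rV[R]_n.+1.
Local Notation borel := (g_sigma_algebraType (@open space)).
Local Notation corners m := (corners (R := R) (n := m)).
Local Notation cells := (seq (R * corners n.+1)).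
Local Notation H := (hausdorff R n.+1 n).
Implicit Types (x : space) (q : corners n.+1) (t : cells) (i l : 'I_n.+1).

Let section_le l q j : (del l (lo q)) 0 j <= (del l (hi q)) 0 j.
Proof. by rewrite !mxE lo_hi. Qed.

Definition cell_section l q : corners n := exist _ (del l (lo q), del l (hi q)) (section_le l q).

Let sec l q (y : 'rV[R]_n) : R := \1_(hbox (del l (lo q)) (del l (hi q))) y.

Lemma cvol_section l q : cvol (cell_section l q) = face l q.
Proof.
rewrite /cvol /vol /face [RHS]big_mkcond [RHS](bigD1_ord l)//= eqxx mul1r.
by apply: eq_bigr => j _; rewrite !mxE eq_sym neq_lift.
Qed.

(** The difference of the limits of the ramp from above and from below in the
    direction l, at the points none of whose other coordinates is that of a
    corner of the cell. *)
Definition gap1 i l q x : R := (x 0 i - lo q 0 i) *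
  (((x 0 l == lo q 0 l)%:R - (x 0 l == hi q 0 l)%:R) * sec l q (del l x)).
Definition gap i l t x : R := \sum_(p <- t) p.1 * gap1 i l p.2 x.

Let msec l q : measurable_fun (setT : set borel) (fun x => sec l q (del l x)).
Proof.
have m1 : measurable_fun (setT : set (g_sigma_algebraType (@open 'rV[R]_n))) (sec l q).
  by apply: measurable_indic; exact: measurable_hbox.
exact: (measurableT_comp m1 (measurable_del l)).
Qed.

Let msec' l q : measurable_fun (setT : set (g_sigma_algebraType (@open 'rV[R]_n))) (sec l q).
Proof. by apply: measurable_indic; exact: measurable_hbox. Qed.

Lemma measurable_gap1 i l q : measurable_fun (setT : set borel) (gap1 i l q).
Proof.
have m1 : measurable_fun (setT : set borel) (fun x : space => x 0 i - lo q 0 i).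
  by apply: measurable_funB => //; exact: measurable_coord.
have m2 := measurable_funB (measurable_face l (lo q 0 l)) (measurable_face l (hi q 0 l)).
exact: (measurable_funM m1 (measurable_funM m2 (msec l q))).
Qed.

Lemma measurable_gap i l t : measurable_fun (setT : set borel) (gap i l t).
Proof.
by apply: measurable_sum => p; apply: measurable_funM => //; exact: measurable_gap1.
Qed.

Let gap1_le i l q x : `|gap1 i l q x| <= (hi q 0 i - lo q 0 i) *
  ((x 0 l == hi q 0 l)%:R * sec l q (del l x)) +
  (l != i)%:R * (hi q 0 i - lo q 0 i) * ((x 0 l == lo q 0 l)%:R * sec l q (del l x)).
Proof.
have L0 : 0 <= hi q 0 i - lo q 0 i by rewrite subr_ge0 lo_hi.
rewrite /gap1 /sec indicE; case: (boolP (del l x \in _)) => [|_]; last by rewrite !mulr0 normr0 addr0.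
rewrite inE !mulr1 => xs; have [->|li] := eqVneq l i.
  rewrite mul0r mul0r addr0; case: (eqVneq (x 0 i) (lo q 0 i)) => [->|_].
    by rewrite subrr mul0r normr0 mulr_ge0.
  case: eqP => [->|_]; last by rewrite subrr !mulr0 normr0.
  by rewrite sub0r mulrN1 mulr1 normrN ger0_norm.
have wL : `|x 0 i - lo q 0 i| <= hi q 0 i - lo q 0 i.
  have [j ij] : exists j, i = lift l j by case: (unliftP l i) li => [j ->|->]; [exists j|rewrite eqxx].
  have := xs j; rewrite !mxE -ij => /andP[h1 h2].
  by rewrite ger0_norm ?lerB// subr_ge0 ltW.
rewrite normrM mul1r -mulrDr; apply: ler_pM => //.
by rewrite [leRHS]addrC (le_trans (ler_normB _ _))// !ger0_norm.
Qed.

Lemma integral_section l q c :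
  (\int[H]_x ((x 0 l == c)%:R * sec l q (del l x))%:E = (face l q)%:E)%E.
Proof.
rewrite integral_face//; under eq_integral do rewrite insK.
rewrite integral_indic//; last by apply: borel_lebesgue; exact: measurable_hbox.
by rewrite setIT -cvol_section -(lebesgue_outer_hbox (cell_section l q)).
Qed.

Let gap_bound i l q : R := (hi q 0 i - lo q 0 i) * face l q * (1 + (l != i)%:R).

(** On the lower face orthogonal to i the ramp vanishes, so that this face does
    not contribute to the jump. *)
Lemma integral_gap1 i l q : (\int[H]_x `|gap1 i l q x|%:E <= (gap_bound i l q)%:E)%E.
Proof.
have L0 : 0 <= hi q 0 i - lo q 0 i by rewrite subr_ge0 lo_hi.
pose f c x : R := (x 0 l == c)%:R * sec l q (del l x).
have f0 c x : 0 <= f c x by rewrite mulr_ge0// /sec indicE.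
have mf c : measurable_fun (setT : set (caratheodory_type (@hausdorff_outer R n.+1 n))) (f c).
  apply: measurable_fun_hausdorff; exact: (measurable_funM (measurable_face l c) (msec l q)).
have a0 : 0 <= (l != i)%:R * (hi q 0 i - lo q 0 i) by rewrite mulr_ge0.
apply: (@le_trans _ _ (\int[H]_x ((hi q 0%R i - lo q 0%R i) * f (hi q 0%R l) x +
   ((l != i)%:R * (hi q 0%R i - lo q 0%R i)) * f (lo q 0%R l) x)%R%:E)%E).
  apply: ge0_subset_le_integral => // x _; rewrite lee_fin; last exact: gap1_le.
  by rewrite addr_ge0// mulr_ge0.
rewrite (ge0_integral_combination _ L0 a0 (mf _) (mf _))//.
by rewrite !integral_section -!EFinM -EFinD lee_fin /gap_bound le_eqVlt; apply/orP; left; apply/eqP; ring.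
Qed.

Lemma integral_gap i t :
  (\sum_l \int[H]_x `|gap i l t x|%:E <= (ramp_jump i t)%:E)%E.
Proof.
apply: (@le_trans _ _ (\sum_l (\sum_(p <- t) `|p.1| * gap_bound i l p.2)%:E)%E).
  apply: lee_sum => l _; elim: t => [|p t IH].
    rewrite big_nil integral0_eq// => x _; by rewrite /gap big_nil normr0.
  rewrite big_cons EFinD; apply: (@le_trans _ _
    (\int[H]_x `|p.1 * gap1 i l p.2 x|%:E + \int[H]_x `|gap i l t x|%:E)%E).
    apply: integral_normD_le.
    - by apply: measurable_fun_hausdorff; apply: measurable_funM => //; exact: measurable_gap1.
    - by apply: measurable_fun_hausdorff; exact: measurable_gap.
    - by move=> x; rewrite /gap big_cons ler_normD.
  apply: leeD => //; rewrite integral_normZ; last first.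
    by apply: measurable_fun_hausdorff; exact: measurable_gap1.
  by rewrite EFinM lee_wpmul2l// integral_gap1.
rewrite sumEFin lee_fin exchange_big/=; apply: ler_sum => p _.
rewrite -[leLHS]mulr_sumr; apply: ler_wpM2l => //; rewrite (bigD1 i)//= /gap_bound eqxx addr0 mulr1 -cvol_face lerD2l.
by apply: ler_sum => l li; rewrite li [leRHS]mulrC.
Qed.

End ramp_gaps.

(** * Distributional derivatives of ramps *)

Section pairing.
Context d (T : measurableType d) (R : realType) (mu : {measure set T -> \bar R}).

Lemma integrable_combination (I : Type) (t : seq I) (c : I -> R) (f : I -> T -> R) :
  (forall p, mu.-integrable setT (EFin \o f p)) ->
  mu.-integrable setT (EFin \o (fun x => \sum_(p <- t) c p * f p x)).
Proof.
move=> intf; elim: t => [|p t IH].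
  rewrite (_ : EFin \o _ = cst 0%E); first exact: integrable0.
  by apply/funext => x /=; rewrite big_nil.
rewrite (_ : EFin \o _ = (fun x => (c p)%:E * (f p x)%:E)%E \+
    (EFin \o (fun x => \sum_(p <- t) c p * f p x))).
  apply: integrableD => //; exact: (integrableZl measurableT (c p) (intf p)).
by apply/funext => x /=; rewrite big_cons.
Qed.

Lemma Rintegral_pairing (I : Type) (t : seq I) (c : I -> R) (f : I -> T -> R)
    (phi : T -> R) (M : R) :
  (forall p, mu.-integrable setT (EFin \o f p)) -> measurable_fun setT phi ->
  (forall x, `|phi x| <= M) ->
  \int[mu]_x (phi x * \sum_(p <- t) c p * f p x) =
  \sum_(p <- t) c p * \int[mu]_x (phi x * f p x).
Proof.
move=> intf mphi phiM.
have intp p : mu.-integrable setT (EFin \o (fun x => phi x * f p x)).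
  exact: integrable_boundedM (intf p) mphi phiM.
elim: t => [|p t IH].
  rewrite big_nil; under eq_Rintegral do rewrite big_nil mulr0.
  by rewrite Rintegral_cst// mul0r.
rewrite big_cons -IH.
have -> : \int[mu]_x (phi x * \sum_(p <- p :: t) c p * f p x) =
    \int[mu]_x (c p * (phi x * f p x) + phi x * \sum_(p <- t) c p * f p x).
  by apply: eq_Rintegral => x _; rewrite big_cons mulrDr mulrCA.
rewrite RintegralD//.
- by rewrite RintegralZl.
- exact: (integrableZl measurableT (c p) (intp p)).
- by apply: integrable_boundedM mphi phiM; exact: integrable_combination.
Qed.

End pairing.

Section box_boundary.
Context {R : realType} {m : nat}.
Local Notation borel := (g_sigma_algebraType (@open 'rV[R]_m)).

Lemma integral_box_hbox (f : 'rV[R]_m -> R) a b : measurable_fun (setT : set borel) f ->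
  (\int[leb R m]_x (f x * \1_(box a b) x)%:E = \int[leb R m]_x (f x * \1_(hbox a b) x)%:E)%E.
Proof.
move=> mf.
have m1 (B : set borel) : measurable B ->
    measurable_fun (setT : set (caratheodory_type (@lebesgue_outer R m)))
      (fun x => (f x * \1_B x)%:E).
  move=> mB; apply: measurable_fun_lebesgue; apply/measurable_EFinP.
  by apply: (measurable_funM mf); exact: measurable_indic.
apply: (ae_eq_integral _ _ measurableT (m1 _ (measurable_box _ _)) (m1 _ (measurable_hbox _ _))).
by apply: (@filterS _ (almost_everywhere (leb R m)) _ _ _ _ (box_hbox_ae a b)) => x E _; rewrite /= E.
Qed.

End box_boundary.

Section ramp_integrability.
Context {R : realType} {n : nat}.
Local Notation space := 'rV[R]_n.+1.
Local Notation borel := (g_sigma_algebraType (@open space)).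
Local Notation corners m := (corners (R := R) (n := m)).
Local Notation cells := (seq (R * corners n.+1)).
Local Notation H := (hausdorff R n.+1 n).
Local Notation L := (leb R n.+1).
Implicit Types (x : space) (q : corners n.+1) (t : cells) (i l : 'I_n.+1).

Lemma integrable_indic_hbox q : L.-integrable setT (EFin \o (\1_(hbox (lo q) (hi q)) : space -> R)).
Proof.
have mh : measurable_fun (setT : set (caratheodory_type (@lebesgue_outer R n.+1)))
    (\1_(hbox (lo q) (hi q)) : space -> R).
  by apply: measurable_fun_lebesgue; apply: measurable_indic; exact: measurable_hbox.
apply/integrableP; split; first exact/measurable_EFinP.
under eq_integral do rewrite /= ger0_norm ?indicE//.
rewrite integral_indic//; last by apply: borel_lebesgue; exact: measurable_hbox.
by rewrite setIT lebesgue_outer_hbox ltry.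
Qed.

Definition ramp1 i q x : R := (x 0 i - lo q 0 i) * \1_(hbox (lo q) (hi q)) x.

Lemma measurable_ramp1 i q : measurable_fun (setT : set borel) (ramp1 i q).
Proof.
have m1 : measurable_fun (setT : set borel) (fun x : space => x 0 i - lo q 0 i).
  by apply: measurable_funB => //; exact: measurable_coord.
apply: (measurable_funM m1); apply: measurable_indic; exact: measurable_hbox.
Qed.

Lemma integrable_ramp1 i q : L.-integrable setT (EFin \o ramp1 i q).
Proof.
have L0 : 0 <= hi q 0 i - lo q 0 i by rewrite subr_ge0 lo_hi.
apply: (@le_integrable _ _ _ L setT measurableT _
  (fun x => (hi q 0%R i - lo q 0%R i)%:E * (\1_(hbox (lo q) (hi q)) x)%:E)%E).
- by apply/measurable_EFinP; apply: measurable_fun_lebesgue; exact: measurable_ramp1.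
- move=> x _; rewrite /= lee_fin !normrM (ger0_norm L0) indicE.
  case: (boolP (x \in _)) => [|_]; last by rewrite normr0 !mulr0.
  rewrite inE normr1 !mulr1 => /(_ i)/andP[h1 h2].
  by rewrite ger0_norm ?lerB// subr_ge0 ltW.
- by apply: integrableZl => //; exact: integrable_indic_hbox.
Qed.

Lemma integrable_gap1 i l q : H.-integrable setT (EFin \o gap1 i l q).
Proof.
apply/integrableP; split.
  by apply/measurable_EFinP; apply: measurable_fun_hausdorff; exact: measurable_gap1.
by apply: le_lt_trans (integral_gap1 i l q) _; rewrite ltry.
Qed.

End ramp_integrability.

Section ramp_divergence.
Context {R : realType} {n : nat}.
Local Notation space := 'rV[R]_n.+1.
Local Notation borel := (g_sigma_algebraType (@open space)).
Local Notation corners m := (corners (R := R) (n := m)).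
Local Notation cells := (seq (R * corners n.+1)).
Local Notation H := (hausdorff R n.+1 n).
Local Notation L := (leb R n.+1).
Implicit Types (x : space) (q : corners n.+1) (t : cells) (i l : 'I_n.+1).
Variables (Om : set space) (phi : space -> R).
Hypothesis tphi : test_function Om phi.

Let cphi : continuous phi. Proof. exact: (test_function_continuous (s := [::]) tphi). Qed.

Let cdphi l : continuous ('D_('e_l) phi).
Proof. exact: (test_function_continuous (s := [:: l]) tphi). Qed.

Let dphi x : differentiable phi x.
Proof. exact: (@test_function_differentiable _ _ Om phi [::] x tphi). Qed.

Let psi i q x : R := (x 0 i - lo q 0 i) * phi x.

Let daff i q x : differentiable (fun y : space => y 0 i - lo q 0 i) x.
Proof. by apply: differentiableB; [exact: differentiable_coord|exact: differentiable_cst]. Qed.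

Let Daff i q l x : 'D_('e_l) (fun y : space => y 0 i - lo q 0 i) x = (i == l)%:R.
Proof.
apply: (lim_near_cst (@norm_hausdorff _ _)).
near=> h; rewrite /= !mxE /= ?eqxx/=.
have h0 : h != 0 by near: h; exact: nbhs_dnbhs_neq.
rewrite /GRing.scale/= (_ : _ - _ = h * (i == l)%:R); last by ring.
by rewrite mulrA mulVf// mul1r.
Unshelve. all: by end_near. Qed.

Let psiE i q l : 'D_('e_l) (psi i q) =
  fun x => (i == l)%:R * phi x + (x 0 i - lo q 0 i) * 'D_('e_l) phi x.
Proof.
apply/funext => x; rewrite /psi.
have -> : (fun x : space => (x 0 i - lo q 0 i) * phi x) =
  (fun x : space => x 0 i - lo q 0 i) * phi by [].
rewrite deriveM; [|by apply: diff_derivable..].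
by rewrite Daff /GRing.scale/=; ring.
Qed.

Let caff i q : continuous (fun x : space => x 0 i - lo q 0 i).
Proof. by move=> x; apply: differentiable_continuous; exact: daff. Qed.

Let cpsi i q : continuous (psi i q).
Proof. by move=> x; exact: (cvgM (@caff i q x) (@cphi x)). Qed.

Let bphi : exists2 M, 0 <= M & forall x, `|phi x| <= M.
Proof. exact: (test_function_bounded [::] tphi). Qed.

Let mphi : measurable_fun (setT : set borel) phi.
Proof. exact: continuous_measurable. Qed.

Let fpsi i l q (c : R) x : R := (x 0 l == c)%:R * (psi i q x * \1_(hbox (del l (lo q)) (del l (hi q))) (del l x)).

Let mpsi i l q : measurable_fun (setT : set borel)
  (fun x => psi i q x * \1_(hbox (del l (lo q)) (del l (hi q))) (del l x)).
Proof.
apply: measurable_funM; first by apply: continuous_measurable; exact: cpsi.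
have m1 : measurable_fun (setT : set (g_sigma_algebraType (@open 'rV[R]_n)))
    (\1_(hbox (del l (lo q)) (del l (hi q))) : 'rV[R]_n -> R).
  by apply: measurable_indic; exact: measurable_hbox.
exact: (measurableT_comp m1 (measurable_del l)).
Qed.

Let integrable_fpsi i l q c : H.-integrable setT (EFin \o fpsi i l q c).
Proof.
have [M M0 phiM] := bphi.
have L0 : 0 <= hi q 0 i - lo q 0 i by rewrite subr_ge0 lo_hi.
pose K := (hi q 0 i - lo q 0 i + `|c - lo q 0 i|) * M.
have K0 : 0 <= K by rewrite mulr_ge0// addr_ge0.
pose g x : R := (x 0 l == c)%:R * \1_(hbox (del l (lo q)) (del l (hi q))) (del l x).
have mg : measurable_fun (setT : set (caratheodory_type (@hausdorff_outer R n.+1 n))) g.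
  have m1 : measurable_fun (setT : set (g_sigma_algebraType (@open 'rV[R]_n)))
      (\1_(hbox (del l (lo q)) (del l (hi q))) : 'rV[R]_n -> R).
    by apply: measurable_indic; exact: measurable_hbox.
  apply: measurable_fun_hausdorff.
  exact: (measurable_funM (measurable_face l c) (measurableT_comp m1 (measurable_del l))).
have g0 x : 0 <= g x by rewrite mulr_ge0// indicE.
have ig : H.-integrable setT (EFin \o g).
  apply/integrableP; split; first exact/measurable_EFinP.
  under eq_integral do rewrite /= ger0_norm//.
  by rewrite integral_section ltry.
apply: (@le_integrable _ _ _ H setT measurableT _ (fun x => K%:E * (g x)%:E)%E).
- apply/measurable_EFinP; apply: measurable_fun_hausdorff.
  exact: (measurable_funM (measurable_face l c) (mpsi i l q)).
- move=> x _; change ((`|fpsi i l q c x|)%:E <= (`|K * g x|)%:E)%E.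
  rewrite lee_fin /fpsi /psi /g indicE; case: eqP => [xc|_]; last by rewrite !mul0r mulr0 normr0.
  case: (boolP (_ \in _)) => [|_]; last by rewrite !mulr0 normr0.
  rewrite inE !mul1r !mulr1 (ger0_norm K0) normrM => xs; rewrite /K; apply: ler_pM => //.
  case: (unliftP l i) => [j ij|il]; last by rewrite il xc lerDr -il.
  have := xs j; rewrite !mxE -ij => /andP[h1 h2].
  rewrite [X in X <= _]ger0_norm; last by rewrite subr_ge0 ltW.
  by have := normr_ge0 (c - lo q 0 i); lra.
- exact: integrableZl.
Qed.

Let face_fpsi i l q c : \int[H]_x fpsi i l q c x =
  \int[leb R n]_y (psi i q (ins l c y) * \1_(hbox (del l (lo q)) (del l (hi q))) y).
Proof.
rewrite /Rintegral /fpsi (integral_face _ _ (mpsi i l q)); congr fine.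
by apply: eq_integral => y _; rewrite insK.
Qed.

Let mpsi_ins i l q c : measurable_fun (setT : set (g_sigma_algebraType (@open 'rV[R]_n)))
  (fun y => psi i q (ins l c y)).
Proof.
apply: continuous_measurable => y.
apply: (@continuous_comp _ _ _ (fun y => ins l c y) (psi i q)); [exact: ins_continuousr|exact: cpsi].
Qed.

Let integrable_section i l q c : (leb R n).-integrable setT (EFin \o
  (fun y => psi i q (ins l c y) * \1_(hbox (del l (lo q)) (del l (hi q))) y)).
Proof.
have m1 : measurable_fun (setT : set (g_sigma_algebraType (@open 'rV[R]_n)))
    (\1_(hbox (del l (lo q)) (del l (hi q))) : 'rV[R]_n -> R).
  by apply: measurable_indic; exact: measurable_hbox.
apply/integrableP; split.
  apply/measurable_EFinP; apply: measurable_fun_lebesgue.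
  exact: (measurable_funM (mpsi_ins i l q c) m1).
have /integrableP[_] := integrable_fpsi i l q c; apply: le_lt_trans.
have := integral_face l c (f := fun x => `|psi i q x * \1_(hbox (del l (lo q)) (del l (hi q))) (del l x)|).
move=> /(_ (measurableT_comp (@normr_measurable _ setT) (mpsi i l q))) E.
rewrite le_eqVlt; apply/orP; left; apply/eqP; apply: etrans (etrans (esym E) _).
  by apply: eq_integral => y _; rewrite insK.
by apply: eq_integral => x _; rewrite /fpsi /= [in RHS]normrM (ger0_norm (ler0n R _)).
Qed.

(** The divergence theorem on the cell for the product of the test function
    with the affine function x_i - a_i; the boundary terms are the integrals of
    the gap over the two faces orthogonal to l. *)
Let ramp1_divergence i l q :
  \int[L]_x ('D_('e_l) phi x * ramp1 i q x) =
  - ((i == l)%:R * \int[L]_x (phi x * \1_(hbox (lo q) (hi q)) x) +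
     \int[H]_x (phi x * gap1 i l q x)).
Proof.
have [M M0 phiM] := bphi; have [M' M'0 dphiM] := test_function_bounded [:: l] tphi.
have mdphi : measurable_fun (setT : set borel) ('D_('e_l) phi) by exact: continuous_measurable.
have lh j : lo q 0 j <= hi q 0 j by exact: lo_hi.
have cdpsi : continuous ('D_('e_l) (psi i q)).
  rewrite psiE => x.
  exact: (cvgD (cvgM (@cvg_cst _ _ _ _ _) (@cphi x)) (cvgM (@caff i q x) (@cdphi l x))).
have dpsi x : derivable (psi i q) x 'e_l.
  by apply: diff_derivable; apply: differentiableM.
have := divergence_box lh dpsi cdpsi (@cpsi i q).
rewrite (integral_box_hbox (lo q) (hi q) (continuous_measurable cdpsi)).
rewrite (integral_box_hbox (del l (lo q)) (del l (hi q))
  (measurable_funB (mpsi_ins i l q (hi q 0 l)) (mpsi_ins i l q (lo q 0 l)))).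
move=> /(congr1 fine); rewrite -/(Rintegral _ _ _) -/(Rintegral _ _ _).
have -> : \int[L]_x ('D_('e_l) (psi i q) x * \1_(hbox (lo q) (hi q)) x) =
    \int[L]_x ((i == l)%:R * (phi x * \1_(hbox (lo q) (hi q)) x) + 'D_('e_l) phi x * ramp1 i q x).
    apply: eq_Rintegral => x _; have E := congr1 (fun f => f x) (psiE i q l).
  apply: etrans (congr1 (fun y => y * \1_(hbox (lo q) (hi q)) x) E) _.
  by rewrite /ramp1; ring.
have I1 := @integrable_boundedM _ _ R L _ phi M (integrable_indic_hbox q)
  (measurable_fun_lebesgue mphi) phiM.
have I2 := @integrable_boundedM _ _ R L _ ('D_('e_l) phi) M' (integrable_ramp1 i q)
  (measurable_fun_lebesgue mdphi) dphiM.
have I3 := @integrable_boundedM _ _ R L _ (cst (i == l)%:R) `|(i == l)%:R| I1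
  (measurable_cst _) (fun=> lexx _).
rewrite RintegralD//.
rewrite RintegralZl//.
under [X in _ = X -> _]eq_Rintegral do rewrite mulrBl.
rewrite RintegralB//; [|exact: integrable_section..].
rewrite -!face_fpsi.
have -> : \int[H]_x (phi x * gap1 i l q x) =
    \int[H]_x fpsi i l q (lo q 0 l) x - \int[H]_x fpsi i l q (hi q 0 l) x.
  rewrite -RintegralB//; [|exact: integrable_fpsi..].
  by apply: eq_Rintegral => x _; rewrite /gap1 /fpsi /psi; ring.
by move=> ?; lra.
Qed.

(** Integration by parts on each cell, summed over the cells: the terms on the
    right are the absolutely continuous part and the jump part of the partial
    derivative of the ramp in the direction l. *)
Lemma ramp_divergence i l t :
  \int[L]_x ('D_('e_l) phi x * ramp i t x) =
  - ((i == l)%:R * \int[L]_x (phi x * step t x) + \int[H]_x (phi x * gap i l t x)).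
Proof.
have [M M0 phiM] := bphi; have [M' M'0 dphiM] := test_function_bounded [:: l] tphi.
have mdphi : measurable_fun (setT : set borel) ('D_('e_l) phi) by exact: continuous_measurable.
have E1 := @Rintegral_pairing _ _ R L _ t (fun p => p.1) (fun p => ramp1 i p.2)
  ('D_('e_l) phi) M' (fun p => integrable_ramp1 i p.2) (measurable_fun_lebesgue mdphi) dphiM.
have E2 := @Rintegral_pairing _ _ R L _ t (fun p => p.1)
  (fun p => \1_(hbox (lo p.2) (hi p.2))) phi M
  (fun p => integrable_indic_hbox p.2) (measurable_fun_lebesgue mphi) phiM.
have E3 := @Rintegral_pairing _ _ R H _ t (fun p => p.1) (fun p => gap1 i l p.2) phi M
  (fun p => integrable_gap1 i l p.2) (measurable_fun_hausdorff mphi) phiM.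
rewrite /ramp /step /gap [LHS]E1 [X in _ * X]E2 [X in _ + X]E3.
rewrite mulr_sumr -big_split -sumrN; apply: eq_bigr => p _ /=.
by rewrite ramp1_divergence; ring.
Qed.

End ramp_divergence.

(** * Series of ramps *)

Section mean_of_family.
Context d (T : measurableType d) (R : realType) (mu : {measure set T -> \bar R}).

Lemma mean_ge0 (g : T -> R) : (0 <= \int[mu]_x `|g x|%:E)%E.
Proof. by apply: integral_ge0 => x _; rewrite lee_fin. Qed.

Lemma le_sum_mean (I : finType) (g : I -> T -> R) (l : I) :
  (\int[mu]_x `|g l x|%:E <= \sum_k \int[mu]_x `|g k x|%:E)%E.
Proof. by rewrite (bigD1 l)//= leeDl// sume_ge0// => k _; exact: mean_ge0. Qed.

End mean_of_family.

Section ramp_sequences.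
Context {R : realType} {n : nat}.
Local Notation space := 'rV[R]_n.+1.
Local Notation borel := (g_sigma_algebraType (@open space)).
Local Notation cells := (seq (R * corners (R := R) (n := n.+1))).
Local Notation L := (leb R n.+1).
Local Notation H := (hausdorff R n.+1 n).
Implicit Types (x : space) (i l : 'I_n.+1).

Fixpoint join (t : nat -> cells) J : cells := if J is J'.+1 then join t J' ++ t J' else [::].

Lemma ramp_join i t J x : ramp i (join t J) x = \sum_(0 <= j < J) ramp i (t j) x.
Proof.
elim: J => [|J IH]; first by rewrite big_nil /ramp big_nil.
by rewrite big_nat_recr//= ramp_cat IH.
Qed.

Lemma gap_join i l t J x : gap i l (join t J) x = \sum_(0 <= j < J) gap i l (t j) x.
Proof.
elim: J => [|J IH]; first by rewrite big_nil /gap big_nil.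
by rewrite big_nat_recr//= /gap big_cat/= -/(gap _ _ _ _) IH.
Qed.

(** Iterating the approximation on the remainders exhausts f, with errors that
    decrease geometrically both in mean and uniformly. *)
Lemma ramp_sequence i (f : space -> R) : L.-integrable setT (EFin \o f) ->
  exists t : nat -> cells, let F := fine (\int[L]_x `|f x|%:E)%E in
  [/\ forall J, (\int[L]_x `|f x - step (join t J) x|%:E <= (F * 2^-1 ^+ J)%:E)%E,
      forall j x, `|ramp i (t j) x| <= 2^-1 ^+ j,
      forall j, (\int[L]_x `|ramp i (t j) x|%:E <= (F * 2^-1 ^+ j)%:E)%E &
      forall j, ramp_jump i (t j) <= 2 * F * 2^-1 ^+ j].
Proof.
move=> intf; set F := fine _.
have mf : measurable_fun (setT : set (caratheodory_type (@lebesgue_outer R n.+1))) f.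
  by apply/measurable_EFinP; case/integrableP : intf.
have Ffin : (\int[L]_x `|f x|%:E)%E \is a fin_num.
  rewrite ge0_fin_numE; first by case/integrableP : intf.
  by apply: integral_ge0 => x _; rewrite lee_fin.
have FE : (\int[L]_x `|f x|%:E = F%:E)%E by rewrite fineK.
have F0 : 0 <= F by apply: fine_ge0; apply: integral_ge0 => x _; rewrite lee_fin.
have p0 j : 0 < 2^-1 ^+ j :> R by rewrite exprn_gt0.
have pS j : 2^-1 ^+ j.+1 = 2^-1 ^+ j / 2 :> R by rewrite exprS mulrC.
move: F0; rewrite le_eqVlt => /predU1P[F0|F0].
  exists (fun=> [::]); rewrite -F0.
  have J0 J : join (fun=> [::]) J = [::] by elim: J => //= J ->.
  split.
  - move=> J; rewrite J0 mul0r; apply: (@le_trans _ _ (\int[L]_x `|f x|%:E)%E); last by rewrite FE -F0.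
    by apply: ge0_subset_le_integral => // x _; rewrite lee_fin// /step big_nil subr0.
  - by move=> j x; rewrite /ramp big_nil normr0 ltW.
  - move=> j; rewrite mul0r integral0_eq// => x _.
    by rewrite /ramp big_nil normr0.
  - by move=> j; rewrite /ramp_jump big_nil mulr0 mul0r.
pose e j : R := 2^-1 ^+ j.+1 * Num.min 1 F.
have e0 j : 0 < e j by rewrite mulr_gt0// lt_min ltr01 F0.
have eF j : e j <= F * 2^-1 ^+ j.+1 by rewrite /e mulrC ler_wpM2r ?ge_min ?lexx ?orbT// ltW.
have e1 j : e j <= 2^-1 ^+ j.
  rewrite /e pS; apply: (@le_trans _ _ (2^-1 ^+ j / 2 * 1)).
    by rewrite ler_wpM2l ?ge_min ?lexx// divr_ge0// ltW.
  by have := p0 j; lra.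
pose P (p : nat * cells) := (\int[L]_x `|f x - step p.2 x|%:E <= (F * 2^-1 ^+ p.1)%:E)%E.
pose good (j : nat) (t : cells) := [/\ forall x, `|ramp i t x| <= 2^-1 ^+ j,
  (\int[L]_x `|ramp i t x|%:E <= (F * 2^-1 ^+ j)%:E)%E & ramp_jump i t <= 2 * F * 2^-1 ^+ j].
have mstep t : measurable_fun setT (step t : caratheodory_type (@lebesgue_outer R n.+1) -> R).
  by apply: measurable_fun_lebesgue; exact: measurable_step.
have /choice[pick pickP] (p : nat * cells) : exists t, P p -> good p.1 t /\ P (p.1.+1, p.2 ++ t).
  have [Pp|] := pselect (P p); last by exists [::].
  have mg : measurable_fun setT (fun x : caratheodory_type (@lebesgue_outer R n.+1) => f x - step p.2 x).
    exact: measurable_funB.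
  have ig : L.-integrable setT (EFin \o (fun x => f x - step p.2 x)).
    apply/integrableP; split; first exact/measurable_EFinP.
    exact: le_lt_trans Pp (ltry _).
  have [t [t1 t2 t3 t4]] := ramp_approximation i ig (e0 p.1).
  exists t => _; split; last first.
    change (\int[L]_x `|f x - step (p.2 ++ t) x|%:E <= (F * 2^-1 ^+ p.1.+1)%:E)%E.
    under eq_integral do rewrite step_cat opprD addrA.
    by apply: le_trans t1 _; rewrite lee_fin.
  have h1 := e1 p.1; have h2 := eF p.1.
  have h3 : F * 2^-1 ^+ p.1.+1 <= F * 2^-1 ^+ p.1.
    by rewrite pS mulrA; have := mulr_gt0 F0 (p0 p.1); lra.
  split.
  - by move=> x; apply: le_trans (t2 x) h1.
  - by apply: le_trans t3 _; rewrite lee_fin; lra.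
  - rewrite -lee_fin; apply: le_trans t4 _; apply: le_trans (leeD2r _ Pp) _.
    by rewrite -EFinD lee_fin; lra.
pose fix T J : cells := if J is J'.+1 then T J' ++ pick (J', T J') else [::].
pose t j := pick (j, T j).
have TE J : join t J = T J by elim: J => //= J ->.
have PT J : P (J, T J).
  elim: J => [|J IH]; last by have [] := pickP (J, T J) IH.
  change (\int[L]_x `|f x - step [::] x|%:E <= (F * 2^-1 ^+ 0)%:E)%E.
  rewrite expr0 mulr1 -FE; apply: ge0_subset_le_integral => // x _; rewrite lee_fin//.
  by rewrite /step big_nil subr0.
have G j : good j (t j) by have [] := pickP (j, T j) (PT j).
exists t; split.
- by move=> J; rewrite TE; exact: PT.
- by move=> j; have [] := G j.
- by move=> j; have [] := G j.
- by move=> j; have [] := G j.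
Qed.

End ramp_sequences.

Section geometric_series.
Context {R : realType}.

Lemma geometric_domination (h : nat -> R) (K : R) : 0 <= K ->
  (forall j, `|h j| <= K * 2^-1 ^+ j) ->
  cvgn (fun J => \sum_(0 <= j < J) h j) /\
  forall J, `|limn (fun J => \sum_(0 <= j < J) h j) - \sum_(0 <= j < J) h j| <= 2 * K * 2^-1 ^+ J.
Proof.
move=> K0 hK; have pS j : 2^-1 ^+ j.+1 = 2^-1 ^+ j / 2 :> R by rewrite exprS mulrC.
have cv : cvgn (fun J => \sum_(0 <= j < J) h j).
  apply: (@normed_cvg R _ h); apply: (@series_le_cvg R _ (geometric K 2^-1)).
  - by move=> j /=.
  - by move=> j; rewrite /geometric/= mulr_ge0// exprn_ge0.
  - by move=> j; exact: hK.
  - by apply: is_cvg_geometric_series; rewrite ger0_norm ?invr_ge0// invf_lt1// ltr1n.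
split=> // J.
have tail m : `|\sum_(0 <= j < m + J) h j - \sum_(0 <= j < J) h j| <=
    2 * K * (2^-1 ^+ J - 2^-1 ^+ (m + J)).
  elim: m => [|m IH]; first by rewrite add0n !subrr normr0 mulr0.
  rewrite addSn big_nat_recr//= addrAC; apply: le_trans (ler_normD _ _) _.
  by have := hK (m + J)%N; rewrite pS; lra.
have C : (fun J' => `|\sum_(0 <= j < J') h j - \sum_(0 <= j < J) h j|) @ \oo -->
    `|limn (fun J => \sum_(0 <= j < J) h j) - \sum_(0 <= j < J) h j|.
  by apply: cvg_norm; apply: cvgB => //; exact: cvg_cst.
apply: (cvgr_to_le C); exists J => // J' /= JJ'.
have := tail (J' - J)%N; rewrite subnK// => /le_trans; apply.
rewrite mulrBr gerBl !mulr_ge0// exprn_ge0//.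
Qed.

End geometric_series.

(** * One-sided limits of ramps *)

Section grids.
Context {R : realType} {n : nat}.
Local Notation space := 'rV[R]_n.+1.
Local Notation borel := (g_sigma_algebraType (@open space)).
Local Notation corners := (corners (R := R) (n := n.+1)).
Local Notation cells := (seq (R * corners)).
Local Notation H := (hausdorff R n.+1 n).
Implicit Types (x y : space) (i l : 'I_n.+1) (q : corners) (t : cells).

(* The grid is formed by the hyperplanes on which the l-th coordinate is one of
   the values c l m; its ridge consists of the points where hyperplanes of two
   different directions meet. *)
Variable c : 'I_n.+1 -> nat -> R.

Let crossing (p : ('I_n.+1 * nat) * ('I_n.+1 * nat)) : set space :=
  if p.1.1 == p.2.1 then set0 else
  [set x | x 0 p.1.1 = c p.1.1 p.1.2 /\ x 0 p.2.1 = c p.2.1 p.2.2].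

Definition ridge : set space := \bigcup_p crossing p.

Let bigcup_countable (I : countType) (F : I -> set space) :
  \bigcup_(i in [set: I]) F i = \bigcup_(k : nat) (if unpickle k is Some i then F i else set0).
Proof.
apply/seteqP; split=> x [k _]; first by move=> Fx; exists (pickle k) => //; rewrite pickleK.
by case: unpickle => [i Fi|//]; exists i.
Qed.

Lemma measurable_ridge : measurable (ridge : set borel).
Proof.
rewrite /ridge (bigcup_countable crossing); apply: bigcupT_measurable => k; case: unpickle => [p|//].
have [pq|/negPf pq] := boolP (p.1.1 == p.2.1).
  by rewrite (_ : crossing p = set0); [exact: measurable0|rewrite /crossing pq].
rewrite (_ : crossing p = [set x : space | x 0 p.1.1 = c p.1.1 p.1.2] `&`
    [set x | x 0 p.2.1 = c p.2.1 p.2.2]); last by rewrite /crossing pq.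
by apply: measurableI; exact: measurable_hyperplane.
Qed.

(** The ridge is a countable union of planes of codimension two. *)
Lemma hausdorff_ridge : H ridge = 0%E.
Proof.
rewrite /ridge (bigcup_countable crossing); apply: outer_null_bigcup => k.
case: unpickle => [p|]; last exact: outer_measure0.
rewrite /crossing; have [_|pq] := eqVneq p.1.1 p.2.1; first exact: outer_measure0.
exact: hausdorff_outer_ridge.
Qed.

Definition on_grid q := forall l, (exists m, c l m = lo q 0 l) /\ (exists m, c l m = hi q 0 l).

Definition off_grid l x := forall j m, j != l -> x 0 j != c j m.

Lemma off_ridge x : ~ ridge x -> exists l, off_grid l x.
Proof.
move=> xr; have [[l [m xl]]|h] := pselect (exists l m, x 0 l = c l m).
  exists l => j m' jl; apply/eqP => xj; apply: xr.
  by exists ((j, m'), (l, m)) => //; rewrite /crossing/= (negPf jl).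
by exists ord0 => j m _; apply/eqP => xj; apply: h; exists j, m.
Qed.

Lemma gap1_off i l q x : on_grid q -> (forall m, x 0 l != c l m) -> gap1 i l q x = 0.
Proof.
move=> gq xl; have [[m1 E1] [m2 E2]] := gq l.
have := xl m1; have := xl m2; rewrite E1 E2 => /negPf h1 /negPf h2.
by rewrite /gap1 h1 h2 subrr mul0r mulr0.
Qed.

Let nbhsF x : Filter (nbhs x).
Proof. exact: (nbhs_filter (x : ('rV[R]_n.+1 : topologicalType))). Qed.

Let coord_cmp x j (s : R) : x 0 j != s ->
  nbhs x [set y : space | ((s < y 0 j) = (s < x 0 j)) /\ ((y 0 j <= s) = (x 0 j <= s))].
Proof.
move=> xs; apply/nbhs_ballP; exists `|x 0 j - s|; first by rewrite /= normr_gt0 subr_eq0.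
move=> y [_ /(_ 0 j)]; rewrite /ball/= => h.
move: h; have [h|h|h] := ltgtP (x 0 j) s; last by rewrite h eqxx in xs.
  rewrite [ltRHS]ltr0_norm ?subr_lt0// distrC => /(le_lt_trans (ler_norm _)) h'.
  have ys : y 0 j < s by lra.
  by rewrite ltNge (ltW ys).
rewrite [ltRHS]gtr0_norm ?subr_gt0// => /(le_lt_trans (ler_norm _)) h'.
have ys : s < y 0 j by lra.
by rewrite leNgt ys.
Qed.

Lemma indic_hbox_del l (a b : space) y : \1_(hbox a b) y =
  (a 0 l < y 0 l <= b 0 l)%R%:R * \1_(hbox (del l a) (del l b)) (del l y) :> R.
Proof.
rewrite !indicE -natrM mulnb; congr (nat_of_bool _)%:R.
apply/idP/andP => [|[h1]]; rewrite !inE => h.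
  split; first exact: h.
  by move=> j; rewrite !mxE; exact: h.
move=> j; case: (unliftP l j) => [k ->|->//].
by have := h k; rewrite !mxE.
Qed.

Let near_section l q x : on_grid q -> off_grid l x ->
  nbhs x [set y : space | \1_(hbox (del l (lo q)) (del l (hi q))) (del l y) =
    \1_(hbox (del l (lo q)) (del l (hi q))) (del l x) :> R].
Proof.
move=> gq xl.
have N : nbhs x [set y : space | forall k : 'I_n,
    ((lo q 0 (lift l k) < y 0 (lift l k)) = (lo q 0 (lift l k) < x 0 (lift l k))) /\
    ((y 0 (lift l k) <= hi q 0 (lift l k)) = (x 0 (lift l k) <= hi q 0 (lift l k)))].
  apply: (@filter_forall _ _ _ _ (nbhsF x)) => k; have [[m1 E1] [m2 E2]] := gq (lift l k).
  have kl : lift l k != l by rewrite eq_sym neq_lift.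
  have := xl _ m1 kl; have := xl _ m2 kl; rewrite E1 E2.
  move=> /coord_cmp h1 /coord_cmp; apply: filterS2 h1 => y [_ h] [h' _].
  by rewrite h h'.
apply: filterS N => y yk; rewrite !indicE; congr (nat_of_bool _)%:R.
by apply/idP/idP; rewrite !inE => h k; have := h k; rewrite !mxE; have [-> ->] := yk k.
Qed.

Definition above l x : set space := [set y | x 0 l < y 0 l].
Definition below l x : set space := [set y | y 0 l < x 0 l].

Let cvg_ramp1_side (A : set space) i l q x (I : R) : on_grid q -> off_grid l x ->
  nbhs x [set y : space | A y -> (lo q 0 l < y 0 l <= hi q 0 l)%R%:R = I] ->
  ramp1 i q y @[y --> within A (nbhs x)] -->
    (x 0 i - lo q 0 i) * (I * \1_(hbox (del l (lo q)) (del l (hi q))) (del l x)).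
Proof.
move=> gq xl N.
have C : (y 0 i - lo q 0 i) * (I * \1_(hbox (del l (lo q)) (del l (hi q))) (del l x))
    @[y --> within A (nbhs x)] -->
    (x 0 i - lo q 0 i) * (I * \1_(hbox (del l (lo q)) (del l (hi q))) (del l x)).
  apply: cvgMr_tmp; apply: cvgB; last exact: cvg_cst.
  by apply: (@cvg_within_filter _ _ _ _ (nbhsF x)); exact: (@coord_continuous _ _ _ 0 i x).
apply: cvg_trans C; apply: near_eq_cvg; rewrite /within/=.
have := near_section gq xl; apply: filterS2 N => y yI ys Ay.
by rewrite /ramp1 (indic_hbox_del l) ys (yI Ay).
Qed.

(** In a neighborhood of x the position of a point relative to the cell depends
    on the l-th coordinate only, since the other coordinates of x are not on
    the grid. *)
Lemma cvg_ramp1_above i l q x : on_grid q -> off_grid l x ->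
  ramp1 i q y @[y --> within (above l x) (nbhs x)] --> ramp1 i q x + gap1 i l q x.
Proof.
move=> gq xl.
have -> : ramp1 i q x + gap1 i l q x = (x 0 i - lo q 0 i) *
    ((lo q 0 l <= x 0 l < hi q 0 l)%R%:R * \1_(hbox (del l (lo q)) (del l (hi q))) (del l x)).
  rewrite /ramp1 /gap1 (indic_hbox_del l) -mulrDr -mulrDl; congr (_ * (_ * _)).
  have := lo_hi q l.
  have [h1|h1|h1] := ltgtP (lo q 0 l) (x 0 l); have [h2|h2|h2] := ltgtP (x 0 l) (hi q 0 l);
    rewrite /= ?subr0 ?addr0 ?add0r ?sub0r ?subrr ?addrN => h//; exfalso; lra.
apply: cvg_ramp1_side => //.
have N1 : nbhs x [set y : space | x 0 l < y 0 l -> (lo q 0 l < y 0 l) = (lo q 0 l <= x 0 l)].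
  have [h|h] := leP (lo q 0 l) (x 0 l).
    by apply: filterE => y /= xy; rewrite (le_lt_trans h xy).
  have xs : x 0 l != lo q 0 l by rewrite lt_eqF.
  by apply: filterS (coord_cmp xs) => y /= [-> _] _; rewrite ltNge (ltW h).
have N2 : nbhs x [set y : space | x 0 l < y 0 l -> (y 0 l <= hi q 0 l) = (x 0 l < hi q 0 l)].
  have [h|h] := leP (hi q 0 l) (x 0 l).
    by apply: filterE => y /= xy; rewrite leNgt (le_lt_trans h xy).
  have xs : x 0 l != hi q 0 l by rewrite lt_eqF.
  by apply: filterS (coord_cmp xs) => y /= [_ ->] _; rewrite (ltW h).
by apply: filterS2 N1 N2 => y h1 h2 Ay; rewrite /= h1// h2.
Qed.

Lemma cvg_ramp1_below i l q x : on_grid q -> off_grid l x ->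
  ramp1 i q y @[y --> within (below l x) (nbhs x)] --> ramp1 i q x.
Proof.
move=> gq xl; rewrite {2}/ramp1 (indic_hbox_del l); apply: cvg_ramp1_side => //.
have N1 : nbhs x [set y : space | y 0 l < x 0 l -> (lo q 0 l < y 0 l) = (lo q 0 l < x 0 l)].
  have [h|h] := leP (x 0 l) (lo q 0 l).
    by apply: filterE => y /= xy; rewrite ltNge (ltW (lt_le_trans xy h)).
  have xs : x 0 l != lo q 0 l by rewrite gt_eqF.
  by apply: filterS (coord_cmp xs) => y /= [-> _] _; rewrite h.
have N2 : nbhs x [set y : space | y 0 l < x 0 l -> (y 0 l <= hi q 0 l) = (x 0 l <= hi q 0 l)].
  have [h|h] := leP (x 0 l) (hi q 0 l).
    by apply: filterE => y /= xy; rewrite (ltW (lt_le_trans xy h)).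
  have xs : x 0 l != hi q 0 l by rewrite gt_eqF.
  by apply: filterS (coord_cmp xs) => y /= [_ ->] _; rewrite leNgt h.
by apply: filterS2 N1 N2 => y h1 h2 Ay; rewrite /= h1// h2.
Qed.

Definition null_cell : R * corners :=
  (0, exist (fun ab : space * space => forall i, ab.1 0 i <= ab.2 0 i) (0, 0) (fun=> lexx _)).

Definition all_on_grid t := forall k, on_grid (nth null_cell t k).2.

Let all_on_grid_cons p t : all_on_grid (p :: t) -> on_grid p.2 /\ all_on_grid t.
Proof. by move=> h; split; [exact: (h 0%N)|move=> k; exact: (h k.+1)]. Qed.

Lemma gap_off i l t x : all_on_grid t -> (forall m, x 0 l != c l m) -> gap i l t x = 0.
Proof.
move=> gt xl; elim: t gt => [|p t IH] gt; first by rewrite /gap big_nil.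
have [gp {}gt] := all_on_grid_cons gt.
by rewrite /gap big_cons (gap1_off _ gp xl) mulr0 add0r; exact: IH.
Qed.

Lemma cvg_ramp_above i l t x : all_on_grid t -> off_grid l x ->
  ramp i t y @[y --> within (above l x) (nbhs x)] --> ramp i t x + gap i l t x.
Proof.
move=> gt xl; elim: t gt => [|p t IH] gt.
  rewrite /ramp /gap !big_nil addr0; under eq_fun do rewrite big_nil; exact: cvg_cst.
have [gp {}gt] := all_on_grid_cons gt.
rewrite /ramp /gap !big_cons addrACA -mulrDr; under eq_fun do rewrite big_cons.
by apply: cvgD; [apply: cvgMl_tmp; exact: cvg_ramp1_above|exact: IH].
Qed.

Lemma cvg_ramp_below i l t x : all_on_grid t -> off_grid l x ->
  ramp i t y @[y --> within (below l x) (nbhs x)] --> ramp i t x.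
Proof.
move=> gt xl; elim: t gt => [|p t IH] gt.
  rewrite {2}/ramp !big_nil; under eq_fun do rewrite /ramp big_nil; exact: cvg_cst.
have [gp {}gt] := all_on_grid_cons gt.
rewrite {2}/ramp big_cons; under eq_fun do rewrite /ramp big_cons.
by apply: cvgD; [apply: cvgMl_tmp; exact: cvg_ramp1_below|exact: IH].
Qed.

Lemma above_proper l x : ProperFilter (within (above l x) (nbhs x)).
Proof.
apply: Build_ProperFilter_ex => A.
move=> /nbhs_ballP[e /= e0 eA]; exists (x + (e / 2) *: 'e_l); apply: eA.
  split=> // j k; rewrite ord1 /ball/= !mxE opprD addrA subrr sub0r normrN.
  rewrite eqxx/= normrM normr_nat (ger0_norm (ltW (divr_gt0 e0 _)))//.
  by case: (k == l); rewrite ?mulr1 ?mulr0//; lra.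
by rewrite /above/= !mxE !eqxx mulr1 ltrDl divr_gt0.
Qed.

End grids.

(** * Scalar potentials *)

Section ramp_limit.
Context {R : realType} {n : nat}.
Local Notation space := 'rV[R]_n.+1.
Local Notation borel := (g_sigma_algebraType (@open space)).
Local Notation cells := (seq (R * corners (R := R) (n := n.+1))).
Local Notation L := (leb R n.+1).
Local Notation H := (hausdorff R n.+1 n).
Local Notation lebT := (caratheodory_type (@lebesgue_outer R n.+1)).
Local Notation hausT := (caratheodory_type (@hausdorff_outer R n.+1 n)).
Implicit Types (x y : space) (l : 'I_n.+1).
Variables (c : 'I_n.+1 -> nat -> R) (i : 'I_n.+1) (f : space -> R) (t : nat -> cells) (F : R).

(** The conclusion of ramp_sequence, together with a grid that contains the
    corners of all the cells. *)
Record ramp_decomposition : Prop := {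
  decomposition_mass_ge0 : 0 <= F;
  decomposition_integrable : L.-integrable setT (EFin \o f);
  decomposition_step : forall J,
    (\int[L]_x `|f x - step (join t J) x|%:E <= (F * 2^-1 ^+ J)%:E)%E;
  decomposition_ramp : forall j x, `|ramp i (t j) x| <= 2^-1 ^+ j;
  decomposition_ramp_mean : forall j,
    (\int[L]_x `|ramp i (t j) x|%:E <= (F * 2^-1 ^+ j)%:E)%E;
  decomposition_jump : forall j, ramp_jump i (t j) <= 2 * F * 2^-1 ^+ j;
  decomposition_grid : forall j, all_on_grid c (t j) }.

Hypothesis dec : ramp_decomposition.

Let F0 := decomposition_mass_ge0 dec.

Definition potential x : R := limn (fun J => \sum_(0 <= j < J) ramp i (t j) x).

(** The gaps describe the jumps outside of the ridge only; cutting them off on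
    the ridge, a null set, makes their sum converge everywhere. *)
Definition clean_gap l j x : R := \1_(~` ridge c) x * gap i l (t j) x.

Definition potential_gap l x : R := limn (fun J => \sum_(0 <= j < J) clean_gap l j x).

Let ramp_dom x j : `|ramp i (t j) x| <= 1 * 2^-1 ^+ j.
Proof. by rewrite mul1r; exact: decomposition_ramp. Qed.

(** A gap is a difference of limits of the ramp, hence inherits its uniform
    bound. *)
Let gap_dom l x j : off_grid c l x -> `|gap i l (t j) x| <= 2 * 2^-1 ^+ j.
Proof.
move=> xl; have FF := above_proper l x.
have C := @cvg_norm _ _ _ _ (@filter_filter _ _ FF) _ _ (cvg_ramp_above (decomposition_grid dec j) xl (i := i)).
have : `|ramp i (t j) x + gap i l (t j) x| <= 2^-1 ^+ j.
  apply: (@cvgr_to_le _ _ FF _ _ _ _ C).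
  by apply: (@nearW _ _ _ FF) => y; exact: decomposition_ramp.
have := decomposition_ramp dec j x.
move=> h1 h2; have := ler_normB (ramp i (t j) x + gap i l (t j) x) (ramp i (t j) x).
by rewrite addrAC subrr add0r; lra.
Qed.

Let clean_gap_dom l x j : `|clean_gap l j x| <= 2 * 2^-1 ^+ j.
Proof.
rewrite /clean_gap indicE; case: (boolP (x \in _)) => [|_]; last first.
  by rewrite mul0r normr0 mulr_ge0// exprn_ge0.
rewrite inE mul1r => /off_ridge[l0 xl]; have [->|ll0] := eqVneq l l0.
  exact: gap_dom.
by rewrite (gap_off _ (decomposition_grid dec j) (fun m => xl l m ll0)) normr0 mulr_ge0// exprn_ge0.
Qed.

Let potentialP x : (fun J => \sum_(0 <= j < J) ramp i (t j) x) @ \oo --> potential x /\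
  forall J, `|potential x - ramp i (join t J) x| <= 2 * 2^-1 ^+ J.
Proof.
have [cv tl] := geometric_domination ler01 (ramp_dom x); split=> // J.
by rewrite ramp_join; have := tl J; rewrite mulr1.
Qed.

Let potential_gapP l x :
  (fun J => \sum_(0 <= j < J) clean_gap l j x) @ \oo --> potential_gap l x.
Proof. by have [] := geometric_domination (ler0n R 2) (clean_gap_dom l x). Qed.

Lemma potential_gap_eq0 l x : (forall m, x 0 l != c l m) -> potential_gap l x = 0.
Proof.
move=> xl; apply: (lim_near_cst (@norm_hausdorff _ _)); apply: nearW => J.
rewrite big1// => j _; rewrite /clean_gap.
by rewrite (gap_off _ (decomposition_grid dec j) xl) mulr0.
Qed.

Let potential_gap_join l x : ~ ridge c x ->
  (fun J => gap i l (join t J) x) @ \oo --> potential_gap l x.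
Proof.
move=> xr; under eq_fun do rewrite gap_join.
rewrite (_ : (fun J => _) = (fun J => \sum_(0 <= j < J) clean_gap l j x)); first exact: potential_gapP.
apply/funext => J; apply: eq_bigr => j _.
by rewrite /clean_gap indicE mem_set// mul1r.
Qed.

Let join_on_grid J : all_on_grid c (join t J).
Proof.
elim: J => [|J IH]; first by move=> k; have := decomposition_grid dec 0 (size (t 0%N)); rewrite nth_nil nth_default.
by move=> k; rewrite nth_cat; case: ifP => _; [exact: IH|exact: decomposition_grid].
Qed.

(** The partial sums have one-sided limits and converge uniformly. *)
Lemma potential_above l x e : ~ ridge c x -> off_grid c l x -> 0 < e ->
  nbhs x [set y : space | x 0 l < y 0 l -> `|potential y - (potential x + potential_gap l x)| <= e].
Proof.
move=> xr xl e0; have e5 : 0 < e / 5 by rewrite divr_gt0.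
have C1 := @potential_gap_join l x xr.
have [J1 _ hJ1] : \forall J \near \oo, `|potential_gap l x - gap i l (join t J) x| <= e / 5.
  by move/cvgrPdist_le : C1; apply.
have [J2 _ hJ2] : \forall J \near \oo, 2 * 2^-1 ^+ J <= e / 5.
  have C : (fun J => 2 * 2^-1 ^+ J : R) @ \oo --> (2 * 0 : R).
    by apply: cvgMl_tmp; apply: cvg_expr; rewrite ger0_norm ?invr_ge0// invf_lt1// ltr1n.
  move/cvgrPdist_le : C => /(_ _ e5); apply: filterS => J.
  by rewrite mulr0 sub0r normrN ger0_norm// mulr_ge0// exprn_ge0.
pose J := maxn J1 J2.
have {}hJ1 := hJ1 J (leq_maxl _ _); have {}hJ2 := hJ2 J (leq_maxr _ _).
have := cvg_ramp_above (join_on_grid J) xl (i := i).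
move=> /cvgrPdist_le/(_ _ e5); rewrite /within/=.
apply: (@filterS _ _ (nbhs_filter (x : ('rV[R]_n.+1 : topologicalType)))) => y /= h /h {h}.
have [_ /(_ J)] := potentialP y; have [_ /(_ J)] := potentialP x.
move: hJ1 hJ2; rewrite !ler_norml => /andP[? ?] ? /andP[? ?] /andP[? ?] /andP[? ?].
by apply/andP; split; lra.
Qed.

Lemma potential_below l x e : off_grid c l x -> 0 < e ->
  nbhs x [set y : space | y 0 l < x 0 l -> `|potential y - potential x| <= e].
Proof.
move=> xl e0; have e5 : 0 < e / 5 by rewrite divr_gt0.
have [J _ hJ] : \forall J \near \oo, 2 * 2^-1 ^+ J <= e / 5.
  have C : (fun J => 2 * 2^-1 ^+ J : R) @ \oo --> (2 * 0 : R).
    by apply: cvgMl_tmp; apply: cvg_expr; rewrite ger0_norm ?invr_ge0// invf_lt1// ltr1n.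
  move/cvgrPdist_le : C => /(_ _ e5); apply: filterS => J.
  by rewrite mulr0 sub0r normrN ger0_norm// mulr_ge0// exprn_ge0.
have {}hJ := hJ J (leqnn _).
have := cvg_ramp_below (join_on_grid J) xl (i := i).
move=> /cvgrPdist_le/(_ _ e5); rewrite /within/=.
apply: (@filterS _ _ (nbhs_filter (x : ('rV[R]_n.+1 : topologicalType)))) => y /= h /h {h}.
have [_ /(_ J)] := potentialP y; have [_ /(_ J)] := potentialP x.
move: hJ; rewrite !ler_norml => ? /andP[? ?] /andP[? ?] /andP[? ?].
by apply/andP; split; lra.
Qed.

Lemma potential_mean : measurable_fun (setT : set lebT) potential /\
  forall J, (\int[L]_x `|potential x - ramp i (join t J) x|%:E <= (2 * F * 2^-1 ^+ J)%:E)%E.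
Proof.
have [j|x|j|m tl] := @mean_series _ lebT R L (fun j => ramp i (t j)) potential F F0.
- by apply: measurable_fun_lebesgue; exact: measurable_ramp.
- by have [] := potentialP x.
- exact: decomposition_ramp_mean.
by split=> // J; under eq_integral do rewrite ramp_join; exact: tl.
Qed.

Let measurable_clean_gap l j : measurable_fun (setT : set borel) (clean_gap l j).
Proof.
apply: measurable_funM; last exact: measurable_gap.
by apply: measurable_indic; apply: measurableC; exact: measurable_ridge.
Qed.

Let clean_gap_mean l j : (\int[H]_x `|clean_gap l j x|%:E <= (2 * F * 2^-1 ^+ j)%:E)%E.
Proof.
apply: (@le_trans _ _ (\int[H]_x `|gap i l (t j) x|%:E)%E).
  apply: ge0_subset_le_integral => // x _; rewrite lee_fin//.
  rewrite /clean_gap normrM indicE; case: (_ \in _); rewrite ?normr1 ?mul1r// normr0 mul0r//.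
apply: (@le_trans _ _ (ramp_jump i (t j))%:E); last by rewrite lee_fin decomposition_jump.
apply: le_trans (integral_gap i (t j)).
exact: (le_sum_mean H (fun l x => gap i l (t j) x)).
Qed.

Lemma potential_gap_mean l : measurable_fun (setT : set hausT) (potential_gap l) /\
  forall J, (\int[H]_x `|potential_gap l x - \sum_(0 <= j < J) clean_gap l j x|%:E <=
             (2 * (2 * F) * 2^-1 ^+ J)%:E)%E.
Proof.
have [|j|x|j|m tl] := @mean_series _ hausT R H (clean_gap l) (potential_gap l) (2 * F).
- by rewrite mulr_ge0.
- by apply: measurable_fun_hausdorff; exact: measurable_clean_gap.
- exact: potential_gapP.
- exact: clean_gap_mean.
by split.
Qed.

Lemma integral_potential : (\int[L]_x `|potential x|%:E <= (2 * F)%:E)%E.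
Proof.
have [_ /(_ 0%N)] := potential_mean; rewrite expr0 mulr1; apply: le_trans.
by apply: ge0_subset_le_integral => // x _; rewrite lee_fin// /ramp/= big_nil subr0.
Qed.

Lemma integral_potential_gap l : (\int[H]_x `|potential_gap l x|%:E <= (4 * F)%:E)%E.
Proof.
have [_ /(_ 0%N)] := potential_gap_mean l; rewrite expr0 mulr1 mulrA -natrM; apply: le_trans.
by apply: ge0_subset_le_integral => // x _; rewrite lee_fin// big_nil subr0.
Qed.

Lemma integrable_potential : L.-integrable setT (EFin \o potential).
Proof.
apply/integrableP; split; first by apply/measurable_EFinP; have [] := potential_mean.
exact: le_lt_trans integral_potential (ltry _).
Qed.

Lemma integrable_potential_gap l : H.-integrable setT (EFin \o potential_gap l).
Proof.
apply/integrableP; split; first by apply/measurable_EFinP; have [] := potential_gap_mean l.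
exact: le_lt_trans (integral_potential_gap l) (ltry _).
Qed.

(** The integration by parts for the partial sums passes to the limit, since the
    step functions, the ramps and the gaps all converge in mean. *)
Lemma potential_divergence Om (phi : space -> R) l : test_function Om phi ->
  \int[L]_x ('D_('e_l) phi x * potential x) =
  - ((i == l)%:R * \int[L]_x (phi x * f x) + \int[H]_x (phi x * potential_gap l x)).
Proof.
move=> tphi; have [M M0 phiM] := test_function_bounded [::] tphi.
have [M' M'0 dphiM] := test_function_bounded [:: l] tphi.
have mphi : measurable_fun (setT : set borel) phi.
  by apply: continuous_measurable; exact: (test_function_continuous (s := [::]) tphi).
have mdphi : measurable_fun (setT : set borel) ('D_('e_l) phi).
  by apply: continuous_measurable; exact: (test_function_continuous (s := [:: l]) tphi).
have ml (g : space -> R) : measurable_fun (setT : set borel) g -> measurable_fun (setT : set lebT) g.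
  exact: measurable_fun_lebesgue.
have mh (g : space -> R) : measurable_fun (setT : set borel) g -> measurable_fun (setT : set hausT) g.
  exact: measurable_fun_hausdorff.
have iramp J : L.-integrable setT (EFin \o ramp i (join t J)).
  exact: (@integrable_combination _ lebT R L _ (join t J) (fun p => p.1)
    (fun p => ramp1 i p.2) (fun p => integrable_ramp1 i p.2)).
have istep J : L.-integrable setT (EFin \o step (join t J)).
  exact: (@integrable_combination _ lebT R L _ (join t J) (fun p => p.1)
    (fun p => \1_(hbox (lo p.2) (hi p.2))) (fun p => integrable_indic_hbox p.2)).
have igap J : H.-integrable setT (EFin \o gap i l (join t J)).
  exact: (@integrable_combination _ hausT R H _ (join t J) (fun p => p.1)
    (fun p => gap1 i l p.2) (fun p => integrable_gap1 i l p.2)).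
pose off : space -> R := \1_(~` ridge c).
have moff : measurable_fun (setT : set borel) off.
  by apply: measurable_indic; apply: measurableC; exact: measurable_ridge.
have off1 x : `|off x| <= 1 by rewrite /off indicE; case: (_ \in _); rewrite ?normr1 ?normr0.
have ioff J : H.-integrable setT (EFin \o (fun x => off x * gap i l (join t J) x)).
  exact: (@integrable_boundedM _ hausT R H _ off 1 (igap J) (mh _ moff) off1).
have EA J := @mean_pairing_le _ lebT R L _ _ ('D_('e_l) phi) M' _ integrable_potential (iramp J)
  (ml _ mdphi) dphiM (potential_mean.2 J).
have EB J := @mean_pairing_le _ lebT R L _ _ phi M _ (decomposition_integrable dec) (istep J)
  (ml _ mphi) phiM (decomposition_step dec J).
have gE J : (\int[H]_x `|potential_gap l x - off x * gap i l (join t J) x|%:E <=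
    (2 * (2 * F) * 2^-1 ^+ J)%:E)%E.
  have [_ /(_ J)] := potential_gap_mean l; apply: le_trans.
  apply: ge0_subset_le_integral => // x _; rewrite lee_fin// gap_join mulr_sumr.
  by [].
have EC J := @mean_pairing_le _ hausT R H _ _ phi M _ (integrable_potential_gap l) (ioff J)
  (mh _ mphi) phiM (gE J).
have offE J : \int[H]_x (phi x * (off x * gap i l (join t J) x)) =
    \int[H]_x (phi x * gap i l (join t J) x).
  rewrite /Rintegral; congr fine.
  have m1 : measurable_fun setT (fun x : hausT => (phi x * (off x * gap i l (join t J) x))%:E).
    apply/measurable_EFinP/mh; apply: (measurable_funM mphi); apply: (measurable_funM moff).
    exact: measurable_gap.
  have m2 : measurable_fun setT (fun x : hausT => (phi x * gap i l (join t J) x)%:E).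
    by apply/measurable_EFinP/mh; apply: (measurable_funM mphi); exact: measurable_gap.
  apply: (ae_eq_integral _ _ measurableT m1 m2); exists (ridge c); split.
  - by apply: borel_hausdorff; exact: measurable_ridge.
  - exact: hausdorff_ridge.
  - move=> x /= xE; apply: contrapT => xr; apply: xE => _.
    by rewrite /off indicE mem_set// mul1r.
pose K := M' * (2 * F) + M * F + M * (4 * F).
set A := \int[L]_x _; set B := \int[L]_x (phi x * f x); set C := \int[H]_x _.
have key J : `|A + ((i == l)%:R * B + C)| <= K * 2^-1 ^+ J.
  have := ramp_divergence tphi i l (join t J).
  move: (EA J) (EB J) (EC J); rewrite offE -/A -/B -/C.
  set AJ := \int[L]_x _; set BJ := \int[L]_x (phi x * step _ x); set CJ := \int[H]_x _.
  move=> hA hB hC E.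
  have -> : A + ((i == l)%:R * B + C) = (A - AJ) + ((i == l)%:R * (B - BJ) + (C - CJ)).
    by rewrite E; ring.
  apply: (le_trans (ler_normD _ _)); rewrite /K !mulrDl.
  have : `|(i == l)%:R * (B - BJ) + (C - CJ)| <= `|B - BJ| + `|C - CJ|.
    apply: (le_trans (ler_normD _ _)); rewrite lerD2r normrM normr_nat ler_piMl//.
    by case: (i == l).
  by move: (2^-1 ^+ J) hA hB hC => p hA hB hC; lra.
have : `|A + ((i == l)%:R * B + C)| <= 0.
  have C0 : (fun J => K * 2^-1 ^+ J : R) @ \oo --> (K * 0 : R).
    by apply: cvgMl_tmp; apply: cvg_expr; rewrite ger0_norm ?invr_ge0// invf_lt1// ltr1n.
  rewrite -[leRHS](mulr0 K); apply: (cvgr_to_ge C0); exact: nearW.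
by rewrite normr_le0 => /eqP; lra.
Qed.

End ramp_limit.

(** * Charges with densities *)

Section signed_density.
Context d1 d2 d (T1 : measurableType d1) (T2 : measurableType d2) (T : measurableType d).
Context (R : realType).
Variables (p1 : T1 -> T) (p2 : T2 -> T).
Hypotheses (mp1 : measurable_fun setT p1) (mp2 : measurable_fun setT p2).
Variables (mu1 : {measure set T1 -> \bar R}) (mu2 : {measure set T2 -> \bar R}).
Variables (h1 : T1 -> R) (h2 : T2 -> R).
Hypotheses (ih1 : mu1.-integrable setT (EFin \o h1)) (ih2 : mu2.-integrable setT (EFin \o h2)).

Let fineB (a b : \bar R) : a \is a fin_num -> b \is a fin_num -> fine (a - b) = fine a - fine b.
Proof. by move: a b => [a| |] [b| |]. Qed.

Let integrable_opp d0 (T0 : measurableType d0) (mu : {measure set T0 -> \bar R}) (h : T0 -> R) :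
  mu.-integrable setT (EFin \o h) -> mu.-integrable setT (EFin \o (\- h)).
Proof.
by move=> ih; exact: (integrableN ih).
Qed.

Let Rintegral_pos_neg d0 (T0 : measurableType d0) (mu : {measure set T0 -> \bar R}) (h g : T0 -> R) M :
  mu.-integrable setT (EFin \o h) -> measurable_fun setT g -> (forall x, `|g x| <= M) ->
  \int[mu]_x (g x * h^\+ x) - \int[mu]_x (g x * (\- h)^\+ x) = \int[mu]_x (g x * h x).
Proof.
move=> ih mg gM; rewrite -RintegralB//.
- apply: eq_Rintegral => x _; rewrite -mulrBr; congr (_ * _).
  by rewrite /funrpos /= /Num.max; case: ifPn; case: ifPn => ? ?; lra.
- apply: (@integrable_boundedM _ T0 R mu h^\+ g M) => //.
  by have := integrable_funrpos measurableT ih.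
- apply: (@integrable_boundedM _ T0 R mu (\- h)^\+ g M) => //.
  by have := integrable_funrpos measurableT (integrable_opp ih).
Qed.

(** The positive and negative parts of the densities give two finite measures,
    whose difference is the charge. *)
Lemma signed_density : exists nu : {charge set T -> \bar R},
  (forall B, measurable B -> fine (nu B) =
     \int[mu1]_(x in p1 @^-1` B) h1 x + \int[mu2]_(x in p2 @^-1` B) h2 x) /\
  (forall (phi : T -> R) M, measurable_fun setT phi -> (forall y, `|phi y| <= M) ->
     charge_integral nu setT phi =
     \int[mu1]_x (phi (p1 x) * h1 x) + \int[mu2]_x (phi (p2 x) * h2 x)).
Proof.
pose m1 : {finite_measure set T -> \bar R} := finite_add (density mp1 ih1) (density mp2 ih2).
pose m2 : {finite_measure set T -> \bar R} :=
  finite_add (density mp1 (integrable_opp ih1)) (density mp2 (integrable_opp ih2)).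
pose nu : {charge set T -> \bar R} :=
  cadd (charge_of_finite_measure m1) (copp (charge_of_finite_measure m2)).
have C (phi : T -> R) M : measurable_fun setT phi -> (forall y, `|phi y| <= M) ->
    \int[m1]_y phi y - \int[m2]_y phi y =
     \int[mu1]_x (phi (p1 x) * h1 x) + \int[mu2]_x (phi (p2 x) * h2 x).
  move=> mphi phiM; rewrite !(Rintegral_finite_add _ _ mphi phiM).
  rewrite !(Rintegral_density _ _ mphi phiM).
  rewrite -(Rintegral_pos_neg ih1 (measurableT_comp mphi mp1) (fun x => phiM (p1 x))).
  rewrite -(Rintegral_pos_neg ih2 (measurableT_comp mphi mp2) (fun x => phiM (p2 x))).
  by lra.
exists nu; split=> [B mB|phi M mphi phiM]; last first.
  by rewrite (@charge_integralE _ T R nu m1 m2 _ M)//; exact: C mphi phiM.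
have mi : measurable_fun setT (\1_B : T -> R) by exact: measurable_indic.
have i1 y : `|\1_B y : R| <= 1 by rewrite indicE; case: (_ \in _); rewrite ?normr1 ?normr0.
have -> : fine (nu B) = \int[m1]_y \1_B y - \int[m2]_y \1_B y.
  change (fine (m1 B - m2 B) = \int[m1]_y \1_B y - \int[m2]_y \1_B y).
  by rewrite fineB ?fin_num_measure// /Rintegral !integral_indic// !setIT.
rewrite (C _ _ mi i1); congr (_ + _); rewrite [RHS]Rintegral_mkcond; apply: eq_Rintegral => x _;
  rewrite patchE indicE.
- have -> : (x \in p1 @^-1` B) = (p1 x \in B) by [].
  by case: ifP => _; rewrite ?mul1r ?mul0r.
- have -> : (x \in p2 @^-1` B) = (p2 x \in B) by [].
  by case: ifP => _; rewrite ?mul1r ?mul0r.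
Qed.

End signed_density.

(** * Vector-valued potentials *)

Section family_of_decompositions.
Context {R : realType} {n : nat}.
Local Notation space := 'rV[R]_n.+1.
Local Notation L := (leb R n.+1).

(** The corners of the cells of finitely many sequences are countably many, so
    that a single grid contains them all. *)
Lemma ramp_decompositions (I : finType) (i : I -> 'I_n.+1) (f : I -> space -> R) :
  (forall p, L.-integrable setT (EFin \o f p)) ->
  exists c t, forall p, ramp_decomposition c (i p) (f p) (t p) (fine (\int[L]_x `|f p x|%:E)%E).
Proof.
move=> intf; have /choice[t tP] p := ramp_sequence (i p) (intf p).
pose c l m : R := if unpickle m is Some (p, j, k, b) then
  let q := (nth null_cell (t p j) k).2 in (if b then hi q else lo q) 0 l else 0.
exists c, t => p; have [t1 t2 t3 t4] := tP p; split=> //.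
- exact/fine_ge0/mean_ge0.
- move=> j k l; split; [exists (pickle (p, j, k, false))|exists (pickle (p, j, k, true))];
  by rewrite /c pickleK.
Qed.

End family_of_decompositions.

Section vector_potential.
Context {R : realType} {n : nat} {E : normedVectType R}.
Local Notation space := 'rV[R]_n.+1.
Local Notation borel := (g_sigma_algebraType (@open space)).
Local Notation L := (leb R n.+1).
Local Notation H := (hausdorff R n.+1 n).
Local Notation e := (vbasis {:E}).
Local Notation coordE := (coord (vbasis {:E})).
Implicit Types (x y : space) (l : 'I_n.+1) (k : 'I_(\dim {:E})).

Definition mean_size (g : space -> tensor n E) : R :=
  \sum_k \sum_l fine (\int[L]_x `|coordE k (g x l)|%:E)%E.

(** The map u solves Du = g L + Th H. The fields gap_support and gap_sides let
    Th be recognized as the jump part: it lives on a Lebesgue null set, and up to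
    an H-null set it is the tensor of the difference of two side limits of u with
    the axis that separates the sides. *)
Record jump_potential (g : space -> tensor n E) (u : space -> E) (Th : space -> tensor n E) : Prop := {
  potential_integrable : forall k, L.-integrable setT (fun x => (coordE k (u x))%:E);
  gap_integrable : forall k l, H.-integrable setT (fun x => (coordE k (Th x l))%:E);
  potential_bound : forall k, (\int[L]_x `|coordE k (u x)|%:E <= (2 * mean_size g)%:E)%E;
  gap_bound : forall k l, (\int[H]_x `|coordE k (Th x l)|%:E <= (4 * mean_size g)%:E)%E;
  gap_support : exists Z : set borel, [/\ measurable Z, L Z = 0%E & forall x, ~ Z x -> Th x = 0];
  gap_sides : exists Q : set borel, [/\ measurable Q, H Q = 0%E & forall x, ~ Q x ->
    exists l a, [/\ Th x = tens a 'e_l, side_limit u x 'e_l (u x + a) &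
                    side_limit u x (- 'e_l) (u x)]];
  potential_gradient : forall Om phi k l, test_function Om phi ->
    \int[L]_x ('D_('e_l) phi x * coordE k (u x)) =
    - (\int[L]_x (phi x * coordE k (g x l)) + \int[H]_x (phi x * coordE k (Th x l))) }.

End vector_potential.

Section finite_sums.
Context d (T : measurableType d) (R : realType) (mu : {measure set T -> \bar R}).
Variables (I : finType) (h : I -> T -> R).
Hypothesis ih : forall i, mu.-integrable setT (EFin \o h i).

Let sumE x : \sum_i h i x = \sum_(i <- index_enum I) 1 * h i x.
Proof. by apply: eq_bigr => i _; rewrite mul1r. Qed.

Lemma integrable_finite_sum : mu.-integrable setT (fun x => (\sum_i h i x)%:E).
Proof. by under eq_fun do rewrite sumE; exact: integrable_combination. Qed.

Lemma mean_sum_norm (F : I -> R) : (forall i, (\int[mu]_x `|h i x|%:E <= (F i)%:E)%E) ->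
  (\int[mu]_x (\sum_i `|h i x|)%:E <= (\sum_i F i)%:E)%E.
Proof.
move=> hF.
have mh i : measurable_fun setT (fun x => `|h i x|%:E).
  by apply/measurable_EFinP; apply: measurableT_comp => //; case/integrableP : (ih i) => /measurable_EFinP.
under eq_integral do rewrite -sumEFin.
rewrite (ge0_integral_sum mu measurableT mh) => [|i x _]; last by rewrite lee_fin.
by rewrite -sumEFin; apply: lee_sum => i _; exact: hF.
Qed.

Lemma mean_finite_sum (F : I -> R) : (forall i, (\int[mu]_x `|h i x|%:E <= (F i)%:E)%E) ->
  (\int[mu]_x `|\sum_i h i x|%:E <= (\sum_i F i)%:E)%E.
Proof.
move=> /mean_sum_norm; apply: le_trans; apply: ge0_subset_le_integral => // x _.
  by rewrite lee_fin sumr_ge0.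
by rewrite lee_fin; exact: ler_norm_sum.
Qed.

Lemma Rintegral_finite_sum (phi : T -> R) (M : R) : measurable_fun setT phi ->
  (forall x, `|phi x| <= M) ->
  \int[mu]_x (phi x * \sum_i h i x) = \sum_i \int[mu]_x (phi x * h i x).
Proof.
move=> mphi phiM.
transitivity (\int[mu]_x (phi x * \sum_(i <- index_enum I) 1 * h i x)).
  by apply: eq_Rintegral => x _; rewrite sumE.
by rewrite (Rintegral_pairing _ _ ih mphi phiM); apply: eq_bigr => i _; rewrite mul1r.
Qed.

End finite_sums.

Section vector_potential_exists.
Context {R : realType} {n : nat} {E : normedVectType R}.
Local Notation space := 'rV[R]_n.+1.
Local Notation borel := (g_sigma_algebraType (@open space)).
Local Notation L := (leb R n.+1).
Local Notation H := (hausdorff R n.+1 n).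
Local Notation lebT := (caratheodory_type (@lebesgue_outer R n.+1)).
Local Notation hausT := (caratheodory_type (@hausdorff_outer R n.+1 n)).
Local Notation e := (vbasis {:E}).
Local Notation coordE := (coord (vbasis {:E})).
Implicit Types (x y : space) (l : 'I_n.+1) (k : 'I_(\dim {:E})).

Lemma coord_of_coords (W : vectType R) (a : 'I_(\dim {:W}) -> R)
    (k : 'I_(\dim {:W})) :
  coord (vbasis {:W}) k (\sum_k a k *: (vbasis {:W})`_k) = a k.
Proof. by rewrite coord_sum_free// (basis_free (vbasisP _)). Qed.

Let hyperplanes (c : 'I_n.+1 -> nat -> R) : set borel :=
  \bigcup_m \bigcup_l [set x : space | x 0 l = c l m].

Let measurable_hyperplanes c : measurable (hyperplanes c).
Proof.
apply: bigcupT_measurable => m; apply: fin_bigcup_measurable => // l _.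
exact: measurable_hyperplane.
Qed.

Let lebesgue_hyperplanes c : L (hyperplanes c) = 0%E.
Proof.
apply: outer_null_bigcup => m.
rewrite (_ : \bigcup_l _ = \bigcup_(k : nat) \bigcup_(l in [set l : 'I_n.+1 | nat_of_ord l = k])
  [set x : space | x 0 l = c l m]).
  apply: outer_null_bigcup => k; have [kn|kn] := ltnP k n.+1.
    apply: (outer_null_sub _ (lebesgue_outer_hyperplane (Ordinal kn) (c (Ordinal kn) m))).
    by move=> x [l /= lk]; rewrite (_ : l = Ordinal kn)//; exact: val_inj.
  rewrite (_ : \bigcup_(l in _) _ = set0); first exact: outer_measure0.
  by apply/seteqP; split=> // x [l /= lk]; move: kn; rewrite -lk leqNgt ltn_ord.
by apply/seteqP; split=> [x [l _ xl]|x [k _ [l _ xl]]]; [exists (nat_of_ord l) => //; exists l|exists l].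
Qed.

Let nbhs_half_ball x (S : set space) : nbhs x S ->
  exists2 r : R, 0 < r & forall y, enorm (y - x) < r -> S y.
Proof.
move=> /nbhs_ballP[r /= r0 rS]; exists r => // y yx; apply: rS; split=> // i j.
rewrite ord1 /ball/= -normrN opprB; apply: le_lt_trans yx.
by have := coord_le_enorm (y - x) j; rewrite !mxE.
Qed.

Let dot_e (z : space) l : dot z 'e_l = z 0 l.
Proof.
rewrite /dot (bigD1 l)//= big1 => [|j jl]; last by rewrite mxE (negPf jl) andbF mulr0.
by rewrite !mxE !eqxx mulr1 addr0.
Qed.

(** The coordinate of g along the k-th basis vector and the i-th axis yields a
    scalar potential; the sums of these potentials over i are the coordinates
    of u. *)
Lemma jump_potential_exists (g : space -> tensor n E) :
  (forall k l, L.-integrable setT (fun x => (coordE k (g x l))%:E)) ->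
  exists u Th, jump_potential g u Th.
Proof.
move=> ig.
have [c [t dec]] := @ramp_decompositions R n ('I_(\dim {:E}) * 'I_n.+1)%type (fun p => p.2)
  (fun p x => coordE p.1 (g x p.2)) (fun p => ig p.1 p.2).
pose pot k i : space -> R := potential i (t (k, i)).
pose gap k i l : space -> R := potential_gap c i (t (k, i)) l.
have ipot k i : L.-integrable setT (EFin \o pot k i) by exact: integrable_potential (dec (k, i)).
have igap k i l : H.-integrable setT (EFin \o gap k i l) by exact: (integrable_potential_gap (dec (k, i))).
pose u x : E := \sum_k (\sum_i pot k i x) *: e`_k.
pose a l x : E := \sum_k (\sum_i gap k i l x) *: e`_k.
pose Th x : tensor n E := [ffun l => a l x].
have uE k x : coordE k (u x) = \sum_i pot k i x by rewrite coord_of_coords.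
have ThE k l x : coordE k (Th x l) = \sum_i gap k i l x by rewrite ffunE coord_of_coords.
pose F k i := fine (\int[L]_x `|coordE k (g x i)|%:E)%E.
have F0 k i : 0 <= F k i by exact/fine_ge0/mean_ge0.
have sumF k : \sum_i F k i <= mean_size g.
  by rewrite /mean_size (bigD1 k)//= lerDl sumr_ge0// => k' _; apply: sumr_ge0 => i _; exact: F0.
exists u, Th; split.
- by move=> k; under eq_fun do rewrite uE; exact: (integrable_finite_sum (ipot k)).
- by move=> k l; under eq_fun do rewrite ThE; exact: (integrable_finite_sum (fun i => igap k i l)).
- move=> k; apply: (@le_trans _ _ (\sum_i 2 * F k i)%:E); last by rewrite lee_fin -mulr_sumr ler_wpM2l.
  under eq_integral do rewrite uE.
  by apply: (mean_finite_sum (ipot k)) => i; exact: integral_potential (dec (k, i)).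
- move=> k l; apply: (@le_trans _ _ (\sum_i 4 * F k i)%:E); last by rewrite lee_fin -mulr_sumr ler_wpM2l.
  under eq_integral do rewrite ThE.
  by apply: (mean_finite_sum (fun i => igap k i l)) => i; exact: integral_potential_gap (dec (k, i)) l.
- exists (hyperplanes c); split=> [||x xZ]; [by []|exact: lebesgue_hyperplanes|]; apply/ffunP => l; rewrite !ffunE /a big1// => k _.
  rewrite big1 ?scale0r// => i _; apply: (potential_gap_eq0 (dec (k, i))) => m.
  by apply/eqP => xl; apply: xZ; exists m => //; exists l.
- exists (ridge c); split; [exact: measurable_ridge|exact: hausdorff_ridge|move=> x xr].
  have [l xl] := off_ridge xr; exists l, (a l x).
  pose W := \sum_(k < \dim {:E}) \sum_(i < n.+1) `|e`_k|.
  have W0 : 0 <= W by apply: sumr_ge0 => k _; exact: sumr_ge0.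
  have norm_vec (b : 'I_(\dim {:E}) -> 'I_n.+1 -> R) (s : R) : (forall k i, `|b k i| <= s) ->
      `|\sum_k (\sum_i b k i) *: e`_k| <= s * W.
    move=> bs; apply: (le_trans (ler_norm_sum _ _ _)); rewrite /W mulr_sumr; apply: ler_sum => k _.
    rewrite normrZ mulr_sumr -mulr_suml; apply: ler_wpM2r => //.
    by apply: (le_trans (ler_norm_sum _ _ _)); apply: ler_sum.
  have sp (r : R) : 0 < r -> 0 < r / (W + 1) by move=> r0; rewrite divr_gt0// ltr_wpDl.
  have sW (r : R) : 0 < r -> r / (W + 1) * W <= r.
    move=> r0; rewrite mulrAC -mulrA ler_piMr ?(ltW r0)// ler_pdivrMr ?mul1r ?lerDl//.
    by rewrite ltr_wpDl.
  have FN : Filter (nbhs x) by exact: (nbhs_filter (x : ('rV[R]_n.+1 : topologicalType))).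
  split.
  + apply/ffunP => j; rewrite !ffunE !mxE eqxx/=; have [->|jl] := eqVneq j l; first by rewrite scale1r.
    rewrite scale0r /a big1// => k _; rewrite big1 ?scale0r// => i _.
    by apply: (potential_gap_eq0 (dec (k, i))) => m; exact: xl.
  + move=> r r0.
    have N : nbhs x [set y : space | forall k i, x 0 l < y 0 l ->
        `|pot k i y - (pot k i x + gap k i l x)| <= r / (W + 1)].
      apply: (@filter_forall _ _ _ _ FN) => k; apply: (@filter_forall _ _ _ _ FN) => i.
      exact: (potential_above (dec (k, i)) xr xl (sp _ r0)).
    have [s s0 sN] := nbhs_half_ball N; exists s => // y [ys]; rewrite dot_e !mxE subr_gt0 => yl.
    rewrite /u /a -big_split -sumrB/=.
    rewrite (eq_bigr (fun k => (\sum_i (pot k i y - (pot k i x + gap k i l x))) *: e`_k)) => [|k _].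
      by apply: le_trans (sW _ r0); apply: norm_vec => k i; exact: (sN y ys).
    by rewrite -scalerDl -scalerBl -big_split -sumrB.
  + move=> r r0.
    have N : nbhs x [set y : space | forall k i, y 0 l < x 0 l ->
        `|pot k i y - pot k i x| <= r / (W + 1)].
      apply: (@filter_forall _ _ _ _ FN) => k; apply: (@filter_forall _ _ _ _ FN) => i.
      exact: (potential_below (dec (k, i)) xl (sp _ r0)).
    have [s s0 sN] := nbhs_half_ball N; exists s => // y [ys].
    rewrite dotNr dot_e !mxE oppr_gt0 subr_lt0 => yl.
    rewrite /u -sumrB.
    rewrite (eq_bigr (fun k => (\sum_i (pot k i y - pot k i x)) *: e`_k)) => [|k _].
      by apply: le_trans (sW _ r0); apply: norm_vec => k i; exact: (sN y ys).
    by rewrite -scalerBl -sumrB.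
- move=> Om phi k l tphi.
  have [M M0 phiM] := test_function_bounded [::] tphi.
  have [M' M'0 dphiM] := test_function_bounded [:: l] tphi.
  have mphi : measurable_fun (setT : set borel) phi.
    by apply: continuous_measurable; exact: (test_function_continuous (s := [::]) tphi).
  have mdphi : measurable_fun (setT : set borel) ('D_('e_l) phi).
    by apply: continuous_measurable; exact: (test_function_continuous (s := [:: l]) tphi).
  transitivity (\int[L]_x ('D_('e_l) phi x * \sum_i pot k i x)).
    by apply: eq_Rintegral => x _; rewrite uE.
  rewrite (@Rintegral_finite_sum _ lebT R L _ (pot k) (ipot k) ('D_('e_l) phi) M'
    (measurable_fun_lebesgue mdphi) dphiM).
  under eq_bigr do rewrite (potential_divergence (dec (k, _)) l tphi).
  rewrite sumrN big_split/=; congr (- (_ + _)).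
    by rewrite (bigD1 l)//= eqxx mul1r big1 ?addr0// => i /negPf ->; rewrite mul0r.
  rewrite -(@Rintegral_finite_sum _ hausT R H _ (fun i => gap k i l) (fun i => igap k i l) phi M
    (measurable_fun_hausdorff mphi) phiM).
  by apply: eq_Rintegral => x _; rewrite ThE.
Qed.

End vector_potential_exists.

(** * Finite-dimensional spaces and tensors *)

Section finite_dimension.
Context {R : realType}.

Lemma coord_vbasisE (W : vectType R) (v : W) :
  v = \sum_k coord (vbasis {:W}) k v *: (vbasis {:W})`_k.
Proof. exact: (coord_vbasis (memvf v)). Qed.

Let combination_continuous (W : normedModType R) m (b : 'I_m -> W) :
  continuous (fun a : 'rV[R]_m => `|\sum_k a 0 k *: b k|).
Proof.
move=> a; have FF : Filter (nbhs (a : ('rV[R]_m : topologicalType))) by exact: nbhs_filter.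
apply/(@cvgrPdist_le _ _ _ _ FF) => r r0.
pose B := \sum_k `|b k|.
have B0 : 0 < B + 1 by rewrite ltr_wpDl// sumr_ge0.
have : nbhs a (ball (a : 'rV[R]_m) (r / (B + 1))) by apply: nbhsx_ballx; rewrite divr_gt0.
apply: filterS => a' [_ aa'].
apply: (le_trans (ler_dist_dist _ _)); rewrite -sumrB.
apply: (le_trans (ler_norm_sum _ _ _)).
apply: (@le_trans _ _ (r / (B + 1) * B)).
  rewrite /B mulr_sumr; apply: ler_sum => k _; rewrite -scalerBl normrZ ler_wpM2r//.
  exact/ltW/(aa' 0 k).
by rewrite mulrAC -mulrA ler_piMr ?(ltW r0)// ler_pdivrMr// mul1r lerDl.
Qed.

(** The norm of the combinations of a basis has a positive minimum on the unit
    sphere of the coefficients, which is compact. *)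
Lemma coord_le_norm (W : normedVectType R) :
  exists2 K, 0 <= K & forall (v : W) k, `|coord (vbasis {:W}) k v| <= K * `|v|.
Proof.
set m := \dim {:W}; pose h (a : 'rV[R]_m) : R := `|\sum_k a 0 k *: (vbasis {:W})`_k|.
have [m0|m0] := posnP m.
  by exists 0 => // v k; have km : (0 < m)%N := leq_ltn_trans (leq0n k) (ltn_ord k); rewrite m0 in km.
pose S := [set a : 'rV[R]_m | enorm a = 1].
have cS : compact S.
  apply: (@subclosed_compact _ _ [set a : 'rV[R]_m | forall i, `[(-1), 1]%classic (a ord0 i)]).
  - have -> : S = (fun a : 'rV[R]_m => enorm (a - 0)) @^-1` [set 1].
      by apply/seteqP; split=> a; rewrite /S /= subr0.
    apply: preimage_closed; last exact: closed_eq.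
    by move=> a _; exact: (@enorm_continuous R m 0 a).
  - by apply: (@rV_compact R m (fun=> `[(-1), 1]%classic)) => i; exact: segment_compact.
  - move=> a a1 i /=; rewrite in_itv /= -ler_norml -a1; exact: coord_le_enorm.
have S0 : S !=set0.
  exists (delta_mx 0 (Ordinal m0)); rewrite /S /= /enorm /dot (bigD1 (Ordinal m0))//= big1.
    by rewrite !mxE !eqxx mulr1 addr0 sqrtr1.
  by move=> j /negPf jm; rewrite !mxE jm andbF mulr0.
have [a aS amin] := @EVT_min_rV R m h S S0 cS (continuous_subspaceT (@combination_continuous W m _)).
have ha : 0 < h a.
  rewrite /h normr_gt0; apply/eqP => a0.
  have : a = 0.
    apply/rowP => k; rewrite mxE -[LHS](@coord_sum_free _ _ _ (vbasis {:W}) (fun k => a 0 k) k).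
      by rewrite a0 linear0.
    exact: (basis_free (vbasisP _)).
  move=> a00; move: aS; rewrite inE /S /= a00 => /eqP.
  by rewrite /enorm /dot big1 ?sqrtr0 1?eq_sym ?oner_eq0// => i _; rewrite mxE mul0r.
exists (h a)^-1; first by rewrite invr_ge0 ltW.
move=> v k; pose x : 'rV[R]_m := \row_k coord (vbasis {:W}) k v.
have hx : h x = `|v|.
  rewrite [in RHS](coord_vbasisE v) /h; congr `|_|; apply: eq_bigr => j _; by rewrite mxE.
have xk : `|coord (vbasis {:W}) k v| <= enorm x by have := coord_le_enorm x k; rewrite mxE.
apply: (le_trans xk); rewrite mulrC ler_pdivlMr// -hx.
have [x0|x0] := eqVneq (enorm x) 0; first by rewrite x0 mul0r /h.
have xp : 0 < enorm x by rewrite lt_neqAle eq_sym x0 enorm_ge0.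
have : (enorm x)^-1 *: x \in S.
  by rewrite inE /S /= enormZ ger0_norm ?invr_ge0 ?enorm_ge0// mulVf.
move/amin; rewrite -(ler_pM2l xp) => /le_trans; apply.
rewrite /h -[X in X * _](ger0_norm (ltW xp)) -normrZ scaler_sumr.
under eq_bigr do rewrite mxE scalerA mulrA mulfV// mul1r.
by [].
Qed.

Lemma hom_bounded (W1 W2 : normedVectType R) (h : 'Hom(W1, W2)) :
  exists2 K, 0 <= K & forall v, `|h v| <= K * `|v|.
Proof.
have [K K0 hK] := @coord_le_norm W1.
exists (K * \sum_(k < \dim {:W1}) `|h (vbasis {:W1})`_k|); first by rewrite mulr_ge0// sumr_ge0.
move=> v; rewrite {1}(coord_vbasisE v) linear_sum; apply: (le_trans (ler_norm_sum _ _ _)).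
rewrite mulrAC mulr_sumr; apply: ler_sum => k _.
by rewrite linearZ normrZ ler_wpM2r.
Qed.

(** The subspace is the kernel of a bounded linear map, a projection. *)
Lemma subspace_closed (W : normedVectType R) (U : {vspace W}) : closed [set v : W | v \in U].
Proof.
pose P : 'End(W) := (\1 - projv U)%VF.
have PU v : v \in U -> P v = 0.
  by move=> vU; rewrite /P add_lfunE opp_lfunE id_lfunE projv_id// subrr.
have [K K0 PK] := hom_bounded P.
move=> v vU; rewrite /= -(subrK (projv U v) v).
have -> : v - projv U v = P v by rewrite /P add_lfunE opp_lfunE id_lfunE.
suff -> : P v = 0 by rewrite add0r memv_proj.
apply/eqP; rewrite -normr_eq0 eq_le normr_ge0 andbT; apply/ler_addgt0Pr => r r0.
have : nbhs v (ball v (r / (K + 1))) by apply: nbhsx_ballx; rewrite divr_gt0// ltr_wpDl.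
move=> /vU[w [/= wU]]; rewrite -ball_normE /= => vw.
rewrite add0r -(subr0 (P v)) -(PU _ wU) -linearB/=.
apply: (le_trans (PK _)); apply: (@le_trans _ _ (K * (r / (K + 1)))).
  by rewrite ler_wpM2l// ltW.
by rewrite mulrCA ler_piMr ?(ltW r0)// ler_pdivrMr ?mul1r ?lerDl// ltr_wpDl.
Qed.

End finite_dimension.

Section tensors.
Context {R : realType} {n : nat} {E F : normedVectType R}.
Local Notation space := 'rV[R]_n.+1.
Local Notation e := (vbasis {:E}).
Local Notation coordE := (coord (vbasis {:E})).
Implicit Types (t : tensor n E) (l : 'I_n.+1).

Lemma tensor_expansion t : t = \sum_k \sum_l coordE k (t l) *: tens e`_k 'e_l.
Proof.
apply/ffunP => j; rewrite sum_ffunE {1}(coord_vbasisE (t j)); apply: eq_bigr => k _.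
rewrite sum_ffunE (bigD1 j)//= big1 ?addr0 => [|l /negPf lj]; rewrite !ffunE !mxE.
  by rewrite !eqxx scale1r.
by rewrite eq_sym lj andbF scale0r scaler0.
Qed.

Lemma norm_tensor_le (p : tensor n E -> R) : is_norm p ->
  exists2 K, 0 <= K & forall t, p t <= K * \sum_k \sum_l `|coordE k (t l)|.
Proof.
move=> [_ pZ pD].
have p0 : p 0 = 0 by rewrite -(scale0r (0 : tensor n E)) pZ normr0 mul0r.
have p_ge0 t : 0 <= p t.
  have := pD t (- t); rewrite addrN p0 -scaleN1r pZ normrN normr1 mul1r; lra.
have pS (I : finType) (s : I -> tensor n E) : p (\sum_i s i) <= \sum_i p (s i).
  elim/big_ind2 : _ => [|x a y b xa yb|//]; first by rewrite p0.
  by apply: (le_trans (pD _ _)); exact: lerD.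
exists (\sum_(k < \dim {:E}) \sum_(l < n.+1) p (tens e`_k 'e_l)); first by apply: sumr_ge0 => k _; exact: sumr_ge0.
move=> t; rewrite {1}(tensor_expansion t); apply: (le_trans (pS _ _)).
rewrite mulr_sumr; apply: ler_sum => k _; apply: (le_trans (pS _ _)).
rewrite mulr_sumr; apply: ler_sum => l _; rewrite pZ mulrC ler_wpM2r//.
rewrite (bigD1 k)//= (bigD1 l)//= -addrA lerDl addr_ge0//; first exact: sumr_ge0.
by apply: sumr_ge0 => k' _; exact: sumr_ge0.
Qed.

Variable A : 'I_n.+1 -> 'Hom(E, F).

(** The operator as a linear map of the gradient. *)
Definition tensor_op t : F := \sum_i A i (t i).

Let tensor_op_linear : linear tensor_op.
Proof.
move=> a t t'; rewrite /tensor_op scaler_sumr -big_split; apply: eq_bigr => i _.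
by rewrite !ffunE linearP.
Qed.

HB.instance Definition _ := GRing.isLinear.Build R (tensor n E) F _ tensor_op tensor_op_linear.

Lemma tensor_op_tens a (xi : space) : tensor_op (tens a xi) = symbol A xi a.
Proof. by rewrite /tensor_op /symbol; apply: eq_bigr => i _; rewrite ffunE linearZ. Qed.

(** The operator takes its values on smooth maps in the image of tensor_op, and
    this image is closed because it is finite-dimensional, so that a linear right
    inverse on it is defined on the essential range. *)
Lemma essential_range_lift : exists G : {linear F -> tensor n E},
  forall (Om : set space) y, essential_range A Om y -> tensor_op (G y) = y.
Proof.
pose T := linfun tensor_op; exists (T^-1)%VF => Om y /closureS yT.
have : y \in limg T.
  apply: (@subspace_closed _ F (limg T)); apply: yT => _ [x [u [_ _ ->]]] /=.
  rewrite (_ : diff_op A u x = T [ffun i => 'D_('e_i) u x]) ?memv_img ?memvf//.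
  by rewrite lfunE /= /tensor_op; apply: eq_bigr => i _; rewrite ffunE.
by move/limg_lfunVK; rewrite lfunE.
Qed.

End tensors.

(** * Integrals up to null sets *)

Section almost_everywhere.
Context d (T : measurableType d) (R : realType) (mu : {measure set T -> \bar R}).
Implicit Types (D N : set T) (f g : T -> \bar R).

Lemma ae_eq_integrable D N f g : measure_is_complete mu -> measurable D ->
  measurable N -> mu N = 0%E -> (forall x, D x -> ~ N x -> f x = g x) ->
  mu.-integrable D g -> mu.-integrable D f /\ (\int[mu]_(x in D) f x = \int[mu]_(x in D) g x)%E.
Proof.
move=> cmu mD mN N0 fg ig; have [mg _] := integrableP _ _ _ ig.
have aefg : ae_eq mu D g f.
  exists N; split=> // x /= xfg; apply: contrapT => xN; apply: xfg => Dx.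
  by rewrite fg.
have mf : measurable_fun D f := ae_measurable_fun cmu aefg mg.
have E : (\int[mu]_(x in D) f x = \int[mu]_(x in D) g x)%E.
  exact/esym/(ae_eq_integral _ _ mD mg mf aefg).
split=> //; apply/integrableP; split=> //.
have [_] := integrableP _ _ _ ig; congr (_ < _)%E.
apply: (ae_eq_integral _ _ mD).
- exact: measurableT_comp.
- exact: measurableT_comp.
- by apply: filterS aefg => x /[apply] ->.
Qed.

(** The larger function can be raised to infinity on the exceptional set, which
    makes the inequality hold everywhere. *)
Lemma ae_le_integral D N f g : measurable N -> mu N = 0%E -> measurable_fun setT g ->
  (forall x, D x -> (0 <= f x)%E) -> (forall x, (0 <= g x)%E) ->
  (forall x, D x -> ~ N x -> (f x <= g x)%E) ->
  (\int[mu]_(x in D) f x <= \int[mu]_x g x)%E.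
Proof.
move=> mN N0 mg f0 g0 fg; pose h x : \bar R := if x \in N then +oo%E else g x.
have mh : measurable_fun setT h.
  apply: (measurable_fun_ifT (measurable_fun_bool true _)) => //.
  rewrite setTI (_ : _ @^-1` _ = N)//.
  by apply/seteqP; split=> x /= xN; [exact: set_mem xN|exact: mem_set].
have <- : (\int[mu]_x h x = \int[mu]_x g x)%E.
  apply: (ae_eq_integral _ _ measurableT mh mg); exists N; split=> // x /= xE.
  by apply: contrapT => xN; apply: xE => _; rewrite /h memNset.
apply: ge0_subset_le_integral => // x; rewrite /h; case: ifPn => // xN.
  by rewrite leey.
by move=> Dx; apply: fg => // Nx; move: xN; rewrite mem_set.
Qed.

Lemma ge0_integral_scale_le (h : T -> R) (a b : R) : 0 <= a -> measurable_fun setT h ->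
  (forall x, 0 <= h x) -> (\int[mu]_x (h x)%:E <= b%:E)%E ->
  (\int[mu]_x (a * h x)%:E <= (a * b)%:E)%E.
Proof.
move=> a0 mh h0 hb; under eq_integral do rewrite EFinM.
rewrite ge0_integralZl//; last 2 first.
- exact/measurable_EFinP.
- by move=> x _; rewrite lee_fin.
by rewrite EFinM lee_wpmul2l.
Qed.

End almost_everywhere.

Section tensor_functionals.
Context {R : realType} {n : nat} {E : normedVectType R}.
Local Notation e := (vbasis {:E}).
Local Notation coordE := (coord (vbasis {:E})).
Local Notation index := ('I_(\dim {:E}) * 'I_n.+1)%type.
Variable lam : {linear tensor n E -> R^o}.

Lemma tensor_functional (t : tensor n E) :
  lam t = \sum_(p : index) lam (tens e`_p.1 'e_p.2) * coordE p.1 (t p.2).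
Proof.
rewrite {1}(tensor_expansion t) pair_bigA linear_sum /=; apply: eq_bigr => p _.
by rewrite linearZ /= mulrC.
Qed.

Context d (T : measurableType d) (mu : {measure set T -> \bar R}) (w : T -> tensor n E).
Hypothesis iw : forall k l, mu.-integrable setT (fun x => (coordE k (w x l))%:E).

Lemma integrable_tensor_functional : mu.-integrable setT (fun x => (lam (w x))%:E).
Proof.
under eq_fun do rewrite tensor_functional.
exact: (integrable_combination (index_enum index) (fun p => lam (tens e`_p.1 'e_p.2))
  (fun p : index => iw p.1 p.2)).
Qed.

Lemma Rintegral_tensor_functional (phi : T -> R) M : measurable_fun setT phi ->
  (forall x, `|phi x| <= M) -> \int[mu]_x (phi x * lam (w x)) =
  \sum_(p : index) lam (tens e`_p.1 'e_p.2) * \int[mu]_x (phi x * coordE p.1 (w x p.2)).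
Proof.
move=> mphi phiM; under eq_Rintegral do rewrite tensor_functional.
exact: (Rintegral_pairing (index_enum index) (fun p => lam (tens e`_p.1 'e_p.2))
  (fun p : index => iw p.1 p.2) mphi phiM).
Qed.

End tensor_functionals.

(** * The jump set of a potential *)

Section jump_of_potential.
Context {R : realType} {n : nat} {E : normedVectType R}.
Local Notation space := 'rV[R]_n.+1.
Local Notation borel := (g_sigma_algebraType (@open space)).
Local Notation L := (leb R n.+1).
Local Notation H := (hausdorff R n.+1 n).
Local Notation lebT := (caratheodory_type (@lebesgue_outer R n.+1)).
Local Notation hausT := (caratheodory_type (@hausdorff_outer R n.+1 n)).
Local Notation e := (vbasis {:E}).
Local Notation coordE := (coord (vbasis {:E})).
Local Notation index := ('I_(\dim {:E}) * 'I_n.+1)%type.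
Variables (Om : set space) (g : space -> tensor n E) (u : space -> E) (Th : space -> tensor n E).
Hypotheses (oOm : open Om) (pot : jump_potential g u Th).
Hypothesis ig : forall k l, L.-integrable setT (fun x => (coordE k (g x l))%:E).
Local Notation J := (jump_set Om u).
Local Notation jump_tensor x := (tens (jump u x) (normal u x)).

(** Outside of the null set where two directions of the grid meet, the side
    limits determine the jump triples up to orientation, and the tensor product
    of the jump with the normal does not depend on the orientation. *)
Lemma jump_set_gap : exists Q : set borel, [/\ measurable Q, H Q = 0%E &
  forall x, ~ Q x -> [/\ J x <-> Om x /\ Th x <> 0, J x -> jump_tensor x = Th x &
    J x -> exists l, `|jump u x| = `|Th x l|]].
Proof.
have [Q [mQ Q0 sides]] := gap_sides pot; exists Q; split=> // x /sides[l [a [ThE up um]]].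
have [peq pneq] := jump_triple_sides (enorm_e l) up um.
have [a0|a0] := eqVneq a 0.
  have Th0 : Th x = 0 by rewrite ThE a0; apply/ffunP => j; rewrite !ffunE scaler0.
  have nJ : ~ J x by case=> _ [t]; apply: peq; rewrite a0 addr0.
  by split=> //; split=> // -[].
have Thl : Th x l = a by rewrite ThE ffunE !mxE !eqxx scale1r.
have [|tr dat] := pneq.
  by move/eqP; rewrite -subr_eq0 addrAC subrr add0r (negPf a0).
have tE (b : E) (nu : space) : tens (- b) (- nu) = tens b nu.
  by apply/ffunP => j; rewrite !ffunE mxE scaleNr scalerN opprK.
split.
- split=> [[Ox _]|[Ox _]]; split=> //; last by exists (u x + a, u x, 'e_l).
  by move=> Th0; move: a0; rewrite -Thl Th0 ffunE eqxx.
- move=> _; rewrite ThE /jump /normal; case: dat => ->/=.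
    by rewrite addrAC subrr add0r.
  by rewrite -(tE a); congr tens; rewrite opprD addrA subrr add0r.
- move=> _; exists l; rewrite Thl /jump; case: dat => -> /=.
    by rewrite addrAC subrr add0r.
  by rewrite opprD addrA subrr add0r normrN.
Qed.

Let mOm : measurable (Om : set borel).
Proof. exact: sub_sigma_algebra. Qed.

Let measurable_gap_coord k l : measurable_fun (setT : set hausT) (fun x => coordE k (Th x l)).
Proof. by apply/measurable_EFinP; case/integrableP : (gap_integrable pot k l). Qed.

(** Up to a null set the jump set is the set where the gaps do not vanish. *)
Lemma measurable_jump_set : measurable (J : set hausT).
Proof.
have [Q [mQ Q0 JP]] := jump_set_gap.
have mG : measurable ([set x | Th x <> 0] : set hausT).
  rewrite (_ : [set x | _] = \big[setU/set0]_(p : index) [set x : hausT | coordE p.1 (Th x p.2) != 0]).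
    apply: bigsetU_measurable => p _.
    rewrite (_ : [set x | _] = (fun x : hausT => coordE p.1 (Th x p.2)) @^-1` (~` [set 0])).
      rewrite -[X in measurable X]setTI; apply: measurable_gap_coord => //.
      by apply: measurableC; exact: (@measurable_set1 R (0 : R)).
    by apply/seteqP; split=> x /= /eqP.
  apply/seteqP; split=> x /=.
    move=> Th0; rewrite -bigcup_seq /=; apply: contrapT => xh; apply: Th0.
    rewrite (tensor_expansion (Th x)) big1// => k _; rewrite big1// => l _.
    have [->|c0] := eqVneq (coordE k (Th x l)) 0; first by rewrite scale0r.
    by exfalso; apply: xh; exists (k, l) => //=; rewrite mem_index_enum.
  rewrite -bigcup_seq => -[p _ /= /eqP h] Th0; apply: h.
  by rewrite Th0 ffunE linear0.
have -> : J = (((Om `&` [set x | Th x <> 0]) `\` Q) `|` (J `&` Q) : set hausT).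
  apply/seteqP; split=> x.
    move=> Jx; have [Qx|Qx] := pselect (Q x); [by right|left; split=> //].
    by have [h _ _] := JP x Qx; exact/h.
  by move=> [[h Qx]|[]//]; have [h' _ _] := JP x Qx; exact/h'.
apply: measurableU; last first.
  by apply: outer_null_measurable; apply: outer_null_sub Q0 => x [].
apply: measurableD; last exact: borel_hausdorff.
by apply: measurableI => //; exact: borel_hausdorff.
Qed.

(** The arbitrary choices in the definitions of the jump and of the normal make
    their measurability unclear; up to a null set they can be replaced with the
    gaps, which are measurable. *)
Lemma integral_jump (B : set hausT) (h h' : space -> R) : measurable B ->
  H.-integrable setT (EFin \o h') ->
  (forall x, J x -> jump_tensor x = Th x -> h x = h' x) -> (forall x, Th x = 0 -> h' x = 0) ->
  H.-integrable (B `&` J) (EFin \o h) /\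
  \int[H]_(x in B `&` J) h x = \int[H]_(x in B `&` Om) h' x.
Proof.
move=> mB ih' hh' h'0.
have mJ := measurable_jump_set; have mBJ : measurable (B `&` J : set hausT) by exact: measurableI.
have mO : measurable (B `&` Om : set hausT).
  by apply: measurableI => //; exact: borel_hausdorff.
have [Q [mQ Q0 JP]] := jump_set_gap.
have mQ' : measurable (Q : set hausT) by exact: borel_hausdorff.
have cH : measure_is_complete H by exact: measure_is_complete_caratheodory.
have [i1 E1] := @ae_eq_integrable _ hausT R H (B `&` J) Q (EFin \o h) (EFin \o h') cH mBJ mQ' Q0
  (fun x => fun '(conj _ Jx) Qx => congr1 EFin (hh' x Jx (let: And3 _ p _ := JP x Qx in p Jx)))
  (integrableS measurableT mBJ (@subsetT _ _) ih').
split=> //; rewrite /Rintegral; congr fine; apply: (etrans E1).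
rewrite integral_mkcond [RHS]integral_mkcond.
have iO : H.-integrable setT ((EFin \o h') \_ (B `&` Om)).
  apply: (iffLR (@integrable_mkcond _ hausT R H _ (EFin \o h') mO)); exact: (integrableS measurableT mO (@subsetT _ _) ih').
have eO x : setT x -> ~ Q x -> ((EFin \o h') \_ (B `&` J)) x = ((EFin \o h') \_ (B `&` Om)) x.
  move=> _ /JP[JT _ _]; rewrite !patchE; case: ifPn => [|/negP xJ]; rewrite in_setI.
    by move=> /andP[xB /set_mem/JT[Ox _]]; rewrite in_setI xB mem_set.
  case: ifPn => // /andP[xB /set_mem Ox].
  have [Th0|Th0] := pselect (Th x = 0); first by rewrite /= h'0.
  by exfalso; apply: xJ; rewrite in_setI xB /=; apply/mem_set/JT.
by have [_] := @ae_eq_integrable _ hausT R H setT Q _ _ cH measurableT mQ' Q0 eO iO.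
Qed.

Lemma potential_gradient_functional (lam : {linear tensor n E -> R^o}) phi : test_function Om phi ->
  \int[L]_(x in Om) lam (tens (u x) (\row_i 'D_('e_i) phi x)) =
  - (\int[L]_x (phi x * lam (g x)) + \int[H]_x (phi x * lam (Th x))).
Proof.
move=> tphi; have [M M0 phiM] := test_function_bounded [::] tphi.
have mphi : measurable_fun (setT : set borel) phi.
  by apply: continuous_measurable; exact: (test_function_continuous (s := [::]) tphi).
have mD l : measurable_fun (setT : set borel) ('D_('e_l) phi).
  by apply: continuous_measurable; exact: (test_function_continuous (s := [:: l]) tphi).
have D0 l x : ~ Om x -> 'D_('e_l) phi x = 0.
  by move=> nOm; apply: (@partials_eq0 _ _ phi [:: l] x) => xS; apply: nOm; have [_] := tphi; apply.
pose c (p : index) := lam (tens e`_p.1 'e_p.2).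
transitivity (\int[L]_x (1 * \sum_(p <- index_enum index) c p * ('D_('e_p.2) phi x * coordE p.1 (u x)))).
  rewrite Rintegral_mkcond; apply: eq_Rintegral => x _; rewrite mul1r patchE.
  case: ifPn => [_|/negP xOm].
    rewrite tensor_functional; apply: eq_bigr => p _.
    by rewrite ffunE mxE linearZ.
  by rewrite big1// => p _; rewrite D0 ?mul0r ?mulr0// => Ox; apply: xOm; rewrite inE.
have iD (p : index) : L.-integrable setT (EFin \o (fun x => 'D_('e_p.2) phi x * coordE p.1 (u x))).
  have [M' M'0 dphiM] := test_function_bounded [:: p.2] tphi.
  exact: (@integrable_boundedM _ lebT R L (fun x => coordE p.1 (u x)) ('D_('e_p.2) phi) M'
    (potential_integrable pot p.1) (measurable_fun_lebesgue (mD p.2)) dphiM).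
have c1 (x : lebT) : `|(fun=> 1) x : R| <= 1 by rewrite normr1.
have m1 : measurable_fun (setT : set lebT) (fun=> 1 : R) by exact: measurable_cst.
rewrite (@Rintegral_pairing _ lebT R L _ (index_enum index) c _ (fun=> 1) 1 iD m1 c1).
rewrite (@Rintegral_tensor_functional R n E lam _ lebT L g ig phi M (measurable_fun_lebesgue mphi) phiM).
rewrite (@Rintegral_tensor_functional R n E lam _ hausT H Th (gap_integrable pot) phi M
  (measurable_fun_hausdorff mphi) phiM).
rewrite -big_split -sumrN; apply: eq_bigr => p _ /=.
rewrite -mulrDr -mulrN; congr (_ * _).
by under eq_Rintegral do rewrite mul1r; rewrite (potential_gradient pot p.1 p.2 tphi).
Qed.

End jump_of_potential.

(** * The gradient of a potential *)

Section borel_determination.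
Context {R : realType} {n : nat}.
Local Notation space := 'rV[R]_n.+1.
Local Notation borel := (g_sigma_algebraType (@open space)).
Local Notation L := (leb R n.+1).
Local Notation lebT := (caratheodory_type (@lebesgue_outer R n.+1)).

(** The gradient measure is given on Borel sets only, while almost everywhere
    equality is tested on the sets measurable for the completed measure; the two
    classes agree up to null sets. *)
Lemma borel_integrals_ae_eq (D : set borel) (f g : space -> R) : measurable D ->
  L.-integrable D (EFin \o f) -> L.-integrable D (EFin \o g) ->
  (forall B : set borel, measurable B -> B `<=` D ->
     \int[L]_(x in B) f x = \int[L]_(x in B) g x) ->
  exists N : set lebT, [/\ measurable N, L N = 0%E & forall x, D x -> ~ N x -> f x = g x].
Proof.
move=> mD jf jg fg.
have mD' : measurable (D : set lebT) by exact: measurable_lebesgue.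
have mg : measurable_fun (D : set lebT) (EFin \o g) by case/integrableP : jg.
have key (A : set lebT) : A `<=` D -> measurable A ->
    (\int[L]_(x in A) (EFin \o f) x = \int[L]_(x in A) (EFin \o g) x)%E.
  move=> AD mA; have [B [mB BA AB0]] := borel_kernel mA.
  have mB' : measurable (B : set lebT) by exact: measurable_lebesgue.
  have BE (h : space -> R) : L.-integrable D (EFin \o h) ->
      (\int[L]_(x in A) (EFin \o h) x = \int[L]_(x in B) (EFin \o h) x)%E.
    move=> jh; have hA : L.-integrable A (EFin \o h) by exact: (integrableS mD' mA AD jh).
    rewrite [LHS]integral_mkcond [RHS]integral_mkcond.
    have cL : measure_is_complete L by exact: measure_is_complete_caratheodory.
    have hA' := iffLR (@integrable_mkcond _ lebT R L _ (EFin \o h) mA) hA.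
    have mAB : measurable (A `\` B : set lebT) by exact: measurableD.
    have hE x : setT x -> ~ (A `\` B) x -> ((EFin \o h) \_ B) x = ((EFin \o h) \_ A) x.
      move=> _ xAB; rewrite !patchE; case: ifPn => [/set_mem/BA xA|/negP xB].
        by rewrite mem_set.
      case: ifPn => // /set_mem xA; exfalso; apply: xAB; split=> // Bx.
      by apply: xB; exact: mem_set.
    by have [_ ->] := @ae_eq_integrable _ lebT R L setT (A `\` B) _ _ cL measurableT mAB AB0 hE hA'.
  rewrite (BE f jf) (BE g jg).
  have BD : B `<=` D by move=> x /BA/AD.
  have fin (h : space -> R) : L.-integrable D (EFin \o h) ->
      (\int[L]_(x in B) (EFin \o h) x)%E \is a fin_num.
    by move=> jh; apply: (integrable_fin_num mB'); exact: (integrableS mD' mB' BD jh).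
  by rewrite -(fineK (fin f jf)) -(fineK (fin g jg)); congr EFin; exact: fg.
have [N [mN N0 DN]] := @integral_ae_eq _ lebT R L D mD' (EFin \o g) (EFin \o f) jf mg key.
exists N; split=> // x Dx xN; apply: contrapT => h; apply/xN/DN => /= /(_ Dx).
by move=> E0; apply: h; exact: EFin_inj E0.
Qed.

End borel_determination.

Section gradient_of_potential.
Context {R : realType} {n : nat} {E : normedVectType R}.
Local Notation space := 'rV[R]_n.+1.
Local Notation borel := (g_sigma_algebraType (@open space)).
Local Notation L := (leb R n.+1).
Local Notation H := (hausdorff R n.+1 n).
Local Notation lebT := (caratheodory_type (@lebesgue_outer R n.+1)).
Local Notation hausT := (caratheodory_type (@hausdorff_outer R n.+1 n)).
Local Notation e := (vbasis {:E}).
Local Notation coordE := (coord (vbasis {:E})).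
Local Notation coordT := (coord (vbasis {:tensor n E})).
Variables (Om : set space) (g : space -> tensor n E) (u : space -> E) (Th : space -> tensor n E).
Hypotheses (oOm : open Om) (pot : jump_potential g u Th).
Hypothesis ig : forall k l, L.-integrable setT (fun x => (coordE k (g x l))%:E).
Local Notation J := (jump_set Om u).

Let mOm : measurable (Om : set borel).
Proof. exact: sub_sigma_algebra. Qed.

Let mOmL : measurable (Om : set lebT).
Proof. exact: measurable_lebesgue. Qed.

Let ic i : L.-integrable setT (fun x => (coordT i (g x))%:E).
Proof. exact: (integrable_tensor_functional (coordT i) ig). Qed.

Let iTh i : H.-integrable setT (fun x => (coordT i (Th x))%:E).
Proof. exact: (integrable_tensor_functional (coordT i) (gap_integrable pot)). Qed.

(** The coordinates of Du are the charges with densities the coordinates of g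
    and Th. *)
Lemma gradient_charge : exists2 Du : vmeasure (tensor n E) borel, is_distr_gradient Om u Du &
  forall (B : set borel) i, measurable B ->
    fine (Du i B) = \int[L]_(x in B) coordT i (g x) + \int[H]_(x in B) coordT i (Th x).
Proof.
have idL : measurable_fun (setT : set lebT) (id : lebT -> borel).
  by apply: measurable_fun_lebesgue; exact: measurable_id.
have idH : measurable_fun (setT : set hausT) (id : hausT -> borel).
  by apply: measurable_fun_hausdorff; exact: measurable_id.
have /choice[Du DuP] i := @signed_density _ _ _ lebT hausT borel R id id idL idH L H
  (fun x => coordT i (g x)) (fun x => coordT i (Th x)) (ic i) (iTh i).
exists Du => [phi tphi|B i mB]; last by have [->] := DuP i.
have [M M0 phiM] := test_function_bounded [::] tphi.
have mphi : measurable_fun (setT : set borel) phi.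
  by apply: continuous_measurable; exact: (test_function_continuous (s := [::]) tphi).
rewrite /vmeasure_integral /vintegral -sumrN; apply: eq_bigr => i _; rewrite -scaleNr; congr (_ *: _).
rewrite (charge_integral_setT _ oOm) => [|x]; last exact: test_function_eq0 tphi.
rewrite ((DuP i).2 phi M mphi phiM).
by rewrite (potential_gradient_functional pot ig (coordT i) tphi) opprK.
Qed.

Lemma distr_gradient_unique (Du1 Du2 : vmeasure (tensor n E) borel) :
  is_distr_gradient Om u Du1 -> is_distr_gradient Om u Du2 ->
  forall (B : set borel) i, measurable B -> B `<=` Om -> Du1 i B = Du2 i B.
Proof.
move=> g1 g2 B i mB BOm; apply: (test_function_charge_unique oOm _ mB BOm) => phi tphi.
have := congr1 (coordT i) (etrans (g1 phi tphi) (esym (g2 phi tphi))).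
by rewrite /vmeasure_integral !coord_of_coords.
Qed.

Let density_of_g : exists Du, is_distr_gradient Om u Du /\ is_ac_density Om Du g.
Proof.
have [Du gDu DuE] := gradient_charge; exists Du; split=> //; split.
  by move=> i; exact: (integrableS measurableT mOmL (@subsetT _ _) (ic i)).
have [Z [mZ Z0 ThZ]] := gap_support pot; exists Z; split=> // B mB BOm.
rewrite /vmeasure_of /vintegral; apply: eq_bigr => i _; rewrite DuE//.
rewrite [X in _ + X](_ : _ = 0) ?addr0// Rintegral_mkcond /Rintegral integral0_eq// => x _.
rewrite patchE; case: ifPn => // /set_mem/BOm[_ /ThZ ->].
by rewrite linear0.
Qed.

(** The approximate gradient is chosen among the densities of the absolutely
    continuous parts of all the measures representing Du; test functions
    determine these measures on Om, hence the densities up to null sets. *)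
Lemma nabla_ae : exists N : set lebT, [/\ measurable N, L N = 0%E &
  forall x, Om x -> ~ N x -> nabla Om u x = g x].
Proof.
have [Du [gDu [_ [Z [mZ Z0 DuE]]]]] := density_of_g.
have : [set g' | exists Du, is_distr_gradient Om u Du /\ is_ac_density Om Du g'] (nabla Om u).
  apply: xgetPex; exists g; exact: density_of_g.
move=> [Du' [gDu' [inab [Z' [mZ' Z'0 DuE']]]]].
pose D : set borel := Om `\` (Z `|` Z').
have mD : measurable D by apply: measurableD => //; exact: measurableU.
have DOm : D `<=` Om by move=> x [].
have mD' : measurable (D : set lebT) by exact: measurable_lebesgue.
have /choice[N NP] i : exists N : set lebT, [/\ measurable N, L N = 0%E &
    forall x, D x -> ~ N x -> coordT i (nabla Om u x) = coordT i (g x)].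
  apply: (borel_integrals_ae_eq mD).
  - exact: (integrableS mOmL mD' DOm (inab i)).
  - exact: (integrableS measurableT mD' (@subsetT _ _) (ic i)).
  - move=> B mB BD.
    have BZ : B `<=` Om `\` Z by move=> x /BD[Ox xZ]; split=> // Zx; apply: xZ; left.
    have BZ' : B `<=` Om `\` Z' by move=> x /BD[Ox xZ]; split=> // Zx; apply: xZ; right.
    have BOm : B `<=` Om by move=> x /BD[].
    have := DuE B mB BZ; have := DuE' B mB BZ'.
    have -> : vmeasure_of Du' B = vmeasure_of Du B.
      by apply: eq_bigr => j _; rewrite (distr_gradient_unique gDu' gDu).
    by move=> -> /(congr1 (coordT i)); rewrite /vintegral !coord_of_coords.
have mZL : measurable (Z : set lebT) by exact: measurable_lebesgue.
have mZL' : measurable (Z' : set lebT) by exact: measurable_lebesgue.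
pose S : set lebT := \bigcup_(k : nat) (if insub k is Some i then N i else set0).
have S0 : L S = 0%E.
  apply: outer_null_bigcup => k; case: insub => [i|]; last exact: outer_measure0.
  by have [] := NP i.
have ZS0 : L (Z `|` Z' `|` S) = 0%E.
  by apply: outer_null_setU => //; exact: outer_null_setU.
exists (Z `|` Z' `|` S); split=> //; first exact: outer_null_measurable.
move=> x Ox xN; rewrite (coord_vbasisE (nabla Om u x)) [RHS]coord_vbasisE.
apply: eq_bigr => i _; congr (_ *: _); have [_ _ ->//] := NP i.
  by split=> // h; apply: xN; left.
by move=> Nx; apply: xN; right; exists (nat_of_ord i) => //; rewrite valK.
Qed.

(** The absolutely continuous part of Du has density g, which is the
    approximate gradient, and the remaining part is Th H, concentrated on the
    jump set. *)
Lemma potential_SBV : SBV Om u.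
Proof.
have [Du gDu DuE] := gradient_charge.
have [N [mN N0 NE]] := nabla_ae.
have iJ (B : set hausT) i : measurable B ->
    H.-integrable (B `&` J) (fun x => (coordT i (tens (jump u x) (normal u x)))%:E) /\
    \int[H]_(x in B `&` J) coordT i (tens (jump u x) (normal u x)) =
    \int[H]_(x in B `&` Om) coordT i (Th x).
  move=> mB; apply: (integral_jump oOm pot mB (iTh i)) => [x _ ->//|x ->].
  by rewrite linear0.
split.
  split; last by exists Du.
  by move=> k; exact: (integrableS measurableT mOmL (@subsetT _ _) (potential_integrable pot k)).
exists Du; split=> //.
  by move=> i; have [+ _] := iJ setT i measurableT; rewrite setTI.
move=> B mB BOm; rewrite /vmeasure_of /vintegral -big_split; apply: eq_bigr => i _ /=.
rewrite -scalerDl; congr (_ *: _); rewrite DuE//.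
have mBL : measurable (B : set lebT) by exact: measurable_lebesgue.
have [_ ->] := iJ B i (measurable_hausdorff n mB).
rewrite (setIidl BOm); congr (_ + _).
have cL : measure_is_complete L by exact: measure_is_complete_caratheodory.
have [_ E1] := @ae_eq_integrable _ lebT R L B N (fun x => (coordT i (nabla Om u x))%:E)
  (fun x => (coordT i (g x))%:E) cL mBL mN N0
  (fun x Bx Nx => congr1 (fun t => (coordT i t)%:E) (NE x (BOm x Bx) Nx))
  (integrableS measurableT mBL (@subsetT _ _) (ic i)).
by rewrite /Rintegral E1.
Qed.

End gradient_of_potential.

(** * Lifting densities to tensors *)

Section lifting.
Context {R : realType} {n : nat} {E F : normedVectType R}.
Local Notation space := 'rV[R]_n.+1.
Local Notation L := (leb R n.+1).
Local Notation lebT := (caratheodory_type (@lebesgue_outer R n.+1)).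
Local Notation coordE := (coord (vbasis {:E})).
Local Notation coordF := (coord (vbasis {:F})).
Variable G : {linear F -> tensor n E}.

(** Extended by 0 outside of Om, so that the potential can be constructed on
    the whole space. *)
Definition lift_density (Om : set space) (f : space -> F) x : tensor n E :=
  if x \in Om then G (f x) else 0.

Let coefficient k l (j : 'I_(\dim {:F})) : R := coordE k (G (vbasis {:F})`_j l).

Let coord_lift k l y : coordE k (G y l) = \sum_j coefficient k l j * coordF j y.
Proof.
rewrite {1}(coord_vbasisE y) linear_sum sum_ffunE linear_sum; apply: eq_bigr => j _.
by rewrite linearZ ffunE linearZ /= mulrC.
Qed.

Lemma lift_density_integrable (Om : set space) (f : space -> F) : open Om ->
  vintegrable L Om f ->
  forall k l, L.-integrable setT (fun x => (coordE k (lift_density Om f x l))%:E).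
Proof.
move=> oOm fint k l.
have mOm : measurable (Om : set lebT) by apply: measurable_lebesgue; exact: sub_sigma_algebra.
pose h j (x : space) : R := if x \in Om then coordF j (f x) else 0.
have ih j : L.-integrable setT (EFin \o h j).
  have := iffLR (@integrable_mkcond _ lebT R L _ (fun x => (coordF j (f x))%:E) mOm) (fint j).
  by congr (is_true (_.-integrable _ _)); apply/funext => x; rewrite patchE /h /=; case: ifP.
have -> : (fun x => (coordE k (lift_density Om f x l))%:E) =
    EFin \o (fun x => \sum_(j <- index_enum 'I_(\dim {:F})) coefficient k l j * h j x).
  apply/funext => x; congr EFin; rewrite /lift_density /h; case: ifP => _.
    exact: coord_lift.
  by rewrite ffunE linear0 big1// => j _; rewrite mulr0.
exact: (@integrable_combination _ lebT R L).
Qed.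

(** The coordinates of the lift are bounded linear functions of f. *)
Lemma lift_density_mean : exists2 K : R, 0 < K & forall (Om : set space) (f : space -> F),
  open Om -> vintegrable L Om f ->
  ((mean_size (lift_density Om f))%:E <= K%:E * \int[L]_(x in Om) `|f x|%:E)%E.
Proof.
have [K0 K00 coordK] := @coord_le_norm R F.
pose c := K0 * (\sum_(k < \dim {:E}) \sum_(l < n.+1) \sum_(j < \dim {:F}) `|coefficient k l j|) + 1.
have c0 : 0 < c.
  rewrite ltr_wpDl// mulr_ge0//; apply: sumr_ge0 => k _; apply: sumr_ge0 => l _; exact: sumr_ge0.
have Gc y k l : `|coordE k (G y l)| <= c * `|y|.
  rewrite coord_lift; apply: (le_trans (ler_norm_sum _ _ _)).
  apply: (@le_trans _ _ (\sum_(j < \dim {:F}) `|coefficient k l j| * (K0 * `|y|))).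
    by apply: ler_sum => j _; rewrite normrM ler_wpM2l.
  rewrite -mulr_suml mulrA ler_wpM2r// mulrC /c ler_wpDr// ler_wpM2l//.
  rewrite (bigD1 k)//= (bigD1 l)//= -addrA lerDl addr_ge0//.
    by apply: sumr_ge0 => l' _; exact: sumr_ge0.
  by apply: sumr_ge0 => k' _; apply: sumr_ge0 => l' _; exact: sumr_ge0.
pose K := \sum_(k < \dim {:E}) \sum_(l < n.+1) c + 1.
have Kp : 0 < K by rewrite ltr_wpDl//; apply: sumr_ge0 => k _; apply: sumr_ge0 => l _; exact: ltW.
exists K => // Om f oOm fint; set I := (\int[L]_(x in Om) `|f x|%:E)%E.
have ig := lift_density_integrable oOm fint.
have I0 : (0 <= I)%E by apply: integral_ge0 => x _; rewrite lee_fin.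
have gI k l : (\int[L]_x `|coordE k (lift_density Om f x l)|%:E <= c%:E * I)%E.
  have mg : measurable_fun (setT : set lebT) (fun x => coordE k (lift_density Om f x l)).
    by apply/measurable_EFinP; case/integrableP : (ig k l).
  have -> : (\int[L]_x `|coordE k (lift_density Om f x l)|%:E =
      c%:E * \int[L]_x `|c^-1 * coordE k (lift_density Om f x l)|%:E)%E.
    rewrite (@integral_normZ _ lebT R L _ _ mg) muleA -EFinM ger0_norm ?invr_ge0 ?(ltW c0)//.
    by rewrite mulfV ?gt_eqF// mul1e.
  rewrite lee_pmul2l//; rewrite /I [leRHS]integral_mkcond.
  apply: ge0_subset_le_integral => // x _; rewrite ?patchE /lift_density; case: ifPn => // _.
    by rewrite lee_fin normrM (ger0_norm (ltW _)) ?invr_gt0// mulrC ler_pdivrMr// mulrC.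
  by rewrite ffunE linear0 mulr0 normr0.
have [[r Ir]|Ir] : (exists r, I = r%:E) \/ I = +oo%E.
- by move: I0; case: I {gI} => [r| |] //; [left; exists r|right].
- rewrite Ir -EFinM lee_fin; move: gI I0; rewrite {}Ir lee_fin => gI r0.
  apply: (@le_trans _ _ (\sum_(k < \dim {:E}) \sum_(l < n.+1) c * r)).
    apply: ler_sum => k _; apply: ler_sum => l _; rewrite -lee_fin fineK ?gI//.
    rewrite ge0_fin_numE; last exact: mean_ge0.
    by apply: le_lt_trans (gI k l) _; rewrite -EFinM ltry.
  apply: (@le_trans _ _ ((\sum_(k < \dim {:E}) \sum_(l < n.+1) c) * r)).
    by rewrite mulr_suml; apply: ler_sum => k _; rewrite mulr_suml.
  by rewrite ler_wpM2r// lerDl.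
- by rewrite Ir mulry gtr0_sg// mul1e leey.
Qed.

End lifting.

(** * Conclusion *)

Section total_size.
Context {R : realType} {n : nat} {E : normedVectType R}.
Local Notation space := 'rV[R]_n.+1.
Local Notation L := (leb R n.+1).
Local Notation H := (hausdorff R n.+1 n).
Local Notation lebT := (caratheodory_type (@lebesgue_outer R n.+1)).
Local Notation hausT := (caratheodory_type (@hausdorff_outer R n.+1 n)).
Local Notation e := (vbasis {:E}).
Local Notation coordE := (coord (vbasis {:E})).
Local Notation index := ('I_(\dim {:E}) * 'I_n.+1)%type.

Lemma norm_le_coords (v : E) : `|v| <= (\sum_(k < \dim {:E}) `|e`_k|) * \sum_k `|coordE k v|.
Proof.
rewrite {1}(coord_vbasisE v); apply: (le_trans (ler_norm_sum _ _ _)).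
rewrite mulr_sumr; apply: ler_sum => k _; rewrite normrZ mulrC ler_wpM2r//.
by rewrite (bigD1 k)//= lerDl; exact: sumr_ge0.
Qed.

(** All norms on the finite-dimensional spaces are bounded by the sums of the
    absolute values of the coordinates, whose means are controlled. *)
Lemma potential_total_size (tnorm : tensor n E -> R) : is_norm tnorm ->
  exists2 C : R, 0 <= C & forall (Om : set space) (g : space -> tensor n E) (u : space -> E) Th,
  open Om -> (forall k l, L.-integrable setT (fun x => (coordE k (g x l))%:E)) ->
  jump_potential g u Th ->
  (\int[L]_(x in Om) (`|u x| + tnorm (nabla Om u x))%:E +
   \int[H]_(x in jump_set Om u) `|jump u x|%:E <= (C * mean_size g)%:E)%E.
Proof.
move=> tnormN; have [K K0 tK] := norm_tensor_le tnormN.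
have t0 t : 0 <= tnorm t.
  have [_ tZ tD] := tnormN.
  have : tnorm (t - t) <= tnorm t + tnorm (- t) by exact: tD.
  by rewrite subrr -(scale0r 0) tZ normr0 mul0r -scaleN1r tZ normrN normr1 mul1r; lra.
pose W : R := \sum_(k < \dim {:E}) `|e`_k|.
have W0 : 0 <= W by exact: sumr_ge0.
pose d : R := (\dim {:E})%:R; pose N : R := #|{: index}|%:R.
exists (W * (d * 2) + K + W * (N * 4)) => [|Om g u Th oOm ig pot].
  by rewrite !addr_ge0// ?mulr_ge0.
set m := mean_size g.
have pairE (t : tensor n E) : \sum_k \sum_l `|coordE k (t l)| = \sum_(p : index) `|coordE p.1 (t p.2)|.
  by rewrite pair_bigA.
pose su x := \sum_k `|coordE k (u x)|.
pose sg x := \sum_(p : index) `|coordE p.1 (g x p.2)|.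
pose sT x := \sum_(p : index) `|coordE p.1 (Th x p.2)|.
have msum d0 (T : measurableType d0) (mu : {measure set T -> \bar R}) (I : finType) (h : I -> T -> R) :
    (forall i, mu.-integrable setT (EFin \o h i)) ->
    measurable_fun setT (fun x => \sum_i `|h i x|).
  move=> ih; apply: measurable_sum => i; apply: measurableT_comp => //.
  by apply/measurable_EFinP; case/integrableP : (ih i).
have msu : measurable_fun (setT : set lebT) su by exact: (msum _ lebT L _ _ (potential_integrable pot)).
have msg : measurable_fun (setT : set lebT) sg.
  exact: (msum _ lebT L index (fun p x => coordE p.1 (g x p.2)) (fun p => ig p.1 p.2)).
have msT : measurable_fun (setT : set hausT) sT.
  exact: (msum _ hausT H index (fun p x => coordE p.1 (Th x p.2)) (fun p => gap_integrable pot p.1 p.2)).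
have Isu : (\int[L]_x (su x)%:E <= (d * (2 * m))%:E)%E.
  apply: le_trans (@mean_sum_norm _ lebT R L _ _ (potential_integrable pot) (fun=> 2 * m)
    (potential_bound pot)) _.
  by rewrite lee_fin sumr_const card_ord -[leLHS]mulr_natl.
have Isg : (\int[L]_x (sg x)%:E <= m%:E)%E.
  apply: le_trans (@mean_sum_norm _ lebT R L index (fun p x => coordE p.1 (g x p.2))
    (fun p => ig p.1 p.2) (fun p => fine (\int[L]_x `|coordE p.1 (g x p.2)|%:E)%E) _) _.
    move=> p; rewrite fineK// ge0_fin_numE; last exact: mean_ge0.
    by case/integrableP : (ig p.1 p.2).
  by rewrite /m /mean_size pair_bigA.
have IsT : (\int[H]_x (sT x)%:E <= (N * (4 * m))%:E)%E.
  apply: le_trans (@mean_sum_norm _ hausT R H index (fun p x => coordE p.1 (Th x p.2))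
    (fun p => gap_integrable pot p.1 p.2) (fun=> 4 * m) (fun p => gap_bound pot p.1 p.2)) _.
  by rewrite lee_fin sumr_const -[leLHS]mulr_natl.
have s0 x : [/\ 0 <= su x, 0 <= sg x & 0 <= sT x] by split; exact: sumr_ge0.
have su0 x : 0 <= su x by have [] := s0 x.
have sg0 x : 0 <= sg x by have [] := s0 x.
have sT0 x : 0 <= sT x by have [] := s0 x.
have [Z [mZ Z0 ZE]] := nabla_ae oOm pot ig.
have I1 : (\int[L]_(x in Om) (`|u x| + tnorm (nabla Om u x))%:E <= (W * (d * (2 * m)) + K * m)%:E)%E.
  apply: (@le_trans _ _ (\int[L]_x (W * su x + K * sg x)%:E)%E).
    apply: (@ae_le_integral _ lebT R L Om Z _ _ mZ Z0).
    - by apply/measurable_EFinP; apply: measurable_funD; apply: measurable_funM => //; exact: measurable_cst.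
    - by move=> x _; rewrite lee_fin addr_ge0.
    - by move=> x; rewrite lee_fin addr_ge0// mulr_ge0.
    - move=> x Ox Zx; rewrite lee_fin lerD//; first exact: norm_le_coords.
      by rewrite ZE// /sg -pairE; exact: tK.
  rewrite (@ge0_integral_combination _ lebT R L)//.
  rewrite EFinD; apply: leeD.
    by rewrite EFinM; apply: lee_pmul => //; apply: integral_ge0 => x _; rewrite lee_fin.
  by rewrite EFinM; apply: lee_pmul => //; apply: integral_ge0 => x _; rewrite lee_fin.
have [Q [mQ Q0 JP]] := jump_set_gap Om pot.
have mQ' : measurable (Q : set hausT) by exact: borel_hausdorff.
have I2 : (\int[H]_(x in jump_set Om u) `|jump u x|%:E <= (W * (N * (4 * m)))%:E)%E.
  apply: (@le_trans _ _ (\int[H]_x (W * sT x)%:E)%E).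
    apply: (@ae_le_integral _ hausT R H (jump_set Om u) Q _ _ mQ' Q0).
    - by apply/measurable_EFinP; apply: measurable_funM => //; exact: measurable_cst.
    - by move=> x _; rewrite lee_fin.
    - by move=> x; rewrite lee_fin mulr_ge0.
    - move=> x Jx Qx; rewrite lee_fin; have [_ _ /(_ Jx)[l ->]] := JP x Qx.
      apply: (le_trans (norm_le_coords _)); rewrite ler_wpM2l// /sT -pairE; apply: ler_sum => k _.
      by rewrite (bigD1 l)//= lerDl; exact: sumr_ge0.
  exact: (@ge0_integral_scale_le _ hausT R H sT W _ W0 msT sT0 IsT).
apply: (le_trans (leeD I1 I2)); rewrite -EFinD lee_fin.
by rewrite !mulrDl; lra.
Qed.

End total_size.

Section operator_of_potential.
Context {R : realType} {n : nat} {E F : normedVectType R}.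
Local Notation space := 'rV[R]_n.+1.
Local Notation borel := (g_sigma_algebraType (@open space)).
Local Notation L := (leb R n.+1).
Local Notation H := (hausdorff R n.+1 n).
Local Notation hausT := (caratheodory_type (@hausdorff_outer R n.+1 n)).
Variable A : 'I_n.+1 -> 'Hom(E, F).

(** The equation for the gradient composed with the linear map tensor_op, which
    turns the tensor of a jump and a normal into the symbol. *)
Lemma potential_distr_op (Om : set space) (f : space -> F) (g : space -> tensor n E)
    (u : space -> E) (Th : space -> tensor n E) :
  open Om -> jump_potential g u Th ->
  (forall k l, L.-integrable setT (fun x => (coord (vbasis {:E}) k (g x l))%:E)) ->
  (forall x, Om x -> tensor_op A (g x) = f x) -> (forall x, ~ Om x -> g x = 0) ->
  forall phi, test_function Om phi ->
  distr_op A Om u phi = vintegral L Om (fun x => phi x *: f x) +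
    vintegral H (jump_set Om u) (fun x => phi x *: symbol A (normal u x) (jump u x)).
Proof.
move=> oOm pot ig gf g0 phi tphi.
have [M M0 phiM] := test_function_bounded [::] tphi.
have mphi : measurable_fun (setT : set borel) phi.
  by apply: continuous_measurable; exact: (test_function_continuous (s := [::]) tphi).
rewrite /distr_op /vintegral -sumrN -big_split; apply: eq_bigr => j _ /=.
rewrite -scaleNr -scalerDl; congr (_ *: _).
pose lam : {linear tensor n E -> R^o} := coord (vbasis {:F}) j \o tensor_op A.
have iT := @integrable_tensor_functional R n E lam _ hausT H Th (gap_integrable pot).
have ipT := @integrable_boundedM _ hausT R H (fun x => lam (Th x)) phi M iT
  (measurable_fun_hausdorff mphi) phiM.
have [x _ <-|x Th0|_] := integral_jump oOm pot (h := fun x =>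
    coord (vbasis {:F}) j (phi x *: symbol A (normal u x) (jump u x))) (@measurableT _ hausT) ipT.
- by rewrite linearZ /= tensor_op_tens.
- by rewrite Th0 linear0 mulr0.
rewrite !setTI => ->.
have -> : \int[L]_(x in Om) coord (vbasis {:F}) j (\sum_i 'D_'e_i phi x *: A i (u x)) =
    \int[L]_(x in Om) lam (tens (u x) (\row_i 'D_('e_i) phi x)).
  apply: eq_Rintegral => x _.
  change (lam (tens (u x) (\row_i 'D_('e_i) phi x))) with
    (coord (vbasis {:F}) j (tensor_op A (tens (u x) (\row_i 'D_('e_i) phi x)))).
  rewrite tensor_op_tens; congr (coord _ _ _).
  by apply: eq_bigr => i _; rewrite mxE.
rewrite (potential_gradient_functional pot ig lam tphi) opprK; congr (_ + _);
  rewrite [RHS]Rintegral_mkcond; apply: eq_Rintegral => x _; rewrite patchE; case: ifPn => // xOm.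
- by rewrite linearZ -gf//; exact: set_mem.
- by rewrite g0 ?linear0 ?mulr0// => Ox; rewrite mem_set in xOm.
- by rewrite (test_function_eq0 tphi) ?mul0r// => Ox; rewrite mem_set in xOm.
Qed.

End operator_of_potential.

Theorem theorem1 (R : realType) (n : nat) (E F : normedVectType R)
    (tnorm : tensor n E -> R) (tnorm_norm : is_norm tnorm)
    (A : 'I_n.+1 -> 'Hom(E, F)) :
  exists C : R,
  forall (Om : set 'rV[R]_n.+1) (f : 'rV[R]_n.+1 -> F),
  open Om ->
  (forall x, Om x -> essential_range A Om (f x)) ->
  vintegrable (leb R n.+1) Om f ->
  exists u : 'rV[R]_n.+1 -> E,
  [/\ SBV Om u,
      forall phi, test_function Om phi ->
        distr_op A Om u phi =
        vintegral (leb R n.+1) Om (fun x => phi x *: f x) +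
        vintegral (hausdorff R n.+1 n) (jump_set Om u)
          (fun x => phi x *: symbol A (normal u x) (jump u x)) &
      (\int[leb R n.+1]_(x in Om) (`|u x| + tnorm (nabla Om u x))%:E +
       \int[hausdorff R n.+1 n]_(x in jump_set Om u) `|jump u x|%:E
       <= C%:E * \int[leb R n.+1]_(x in Om) `|f x|%:E)%E].
Proof.
have [G GP] := essential_range_lift A.
have [K K0 GK] := lift_density_mean G.
have [C C0 sizeC] := potential_total_size tnorm_norm.
exists (C * K) => Om f oOm fA fint.
have ig := lift_density_integrable G oOm fint.
have [u [Th pot]] := jump_potential_exists ig.
exists u; split.
- exact: (potential_SBV oOm pot ig).
- apply: (potential_distr_op oOm pot ig) => x Ox; rewrite /lift_density.
    by rewrite mem_set// (GP Om)//; exact: fA.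
  by rewrite memNset.
- apply: (le_trans (sizeC Om _ u Th oOm ig pot)).
  rewrite EFinM EFinM -muleA; apply: lee_wpmul2l; first by rewrite lee_fin.
  exact: GK.
Qed.
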